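(* Let $\mathfrak{g}$ be a semi-simple finite-dimensional complex Lie algebra with a fixed triangular decomposition $\mathfrak{g}=\mathfrak{n}_-\oplus\mathfrak{h}\oplus\mathfrak{n}_+$, let $U=U(\mathfrak{g})$, and let $\mathscr{W}$ be the category of Whittaker modules for $\mathfrak{g}$. Then $$\mathrm{gl.dim}(\mathscr{W})=\mathrm{gl.dim}(U\text{-}\mathrm{Mod})=\dim\mathfrak{g}.$$
   Context: Whittaker modules. Let $Z(\mathfrak{g})$ be the center of $U(\mathfrak{g})$ and $R=Z(\mathfrak{g})U(\mathfrak{n}_+)\subset U(\mathfrak{g})$. The category $\mathscr{W}$ of Whittaker modules is the full subcategory of the category of finitely generated $U(\mathfrak{g})$-modules consisting of all modules $M$ on which the action of $R$ is locally finite, i.e. $\dim(Rv)<\infty$ for all $v\in M$. $U\text{-}\mathrm{Mod}$ is the category of all $U$-modules. Global dimension. For an Abelian category $\mathcal{A}$, $\mathrm{Ext}^d_{\mathcal{A}}(M,N)$ denotes the Yoneda extension group ($\mathrm{Ext}^0_{\mathcal{A}}=\mathrm{Hom}_{\mathcal{A}}$; for $d\geq 1$, equivalence classes of exact sequences $0\to N\to X_1\to\dots\to X_d\to M\to 0$ in $\mathcal{A}$ modulo the equivalence relation generated by morphisms of such sequences which are identities on $N$ and $M$). The projective dimension of $M\in\mathcal{A}$ is the maximal $d$ such that there is $N\in\mathcal{A}$ with $\mathrm{Ext}^d_{\mathcal{A}}(M,N)\neq0$, and $\infty$ if no such maximal $d$ exists. The global dimension $\mathrm{gl.dim}(\mathcal{A})$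 is the supremum of the projective dimensions of all objects of $\mathcal{A}$. *)

(* Defs.v *)
From HB Require Import structures.
From Stdlib Require Import Relation_Operators.
From mathcomp Require Import all_boot all_order all_algebra.
From mathcomp Require Import boolp classical_sets reals.
From mathcomp Require Import constructive_ereal ereal complex.

Set Implicit Arguments.
Unset Strict Implicit.
Unset Printing Implicit Defensive.

Import GRing.Theory.
Local Open Scope ring_scope.

HB.mixin Record Vector_isLie (K : fieldType) g of Vector K g := {
  lie : g -> g -> g;
  lie_linearl : forall y, linear (lie^~ y);
  lie_linearr : forall x, linear (lie x);
  lie_alt : forall x, lie x x = 0;
  lie_jacobi : forall x y z,
    lie x (lie y z) + lie y (lie z x) + lie z (lie x y) = 0
}.

#[short(type="lieAlgType")]
HB.structure Definition LieAlgebra (K : fieldType) :=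
  {g of Vector K g & Vector_isLie K g}.

Section LieTheory.
Variables (K : fieldType) (g : lieAlgType K).
Implicit Types I V W h : {vspace g}.

Definition ad (x : g) : 'End(g) := linfun (lie x).

HB.instance Definition _ (x : g) :=
  GRing.isLinear.Build K g g *:%R (lie x) (lie_linearr x).

Lemma adE x y : ad x y = lie x y.
Proof. exact: lfunE. Qed.

Definition lie_prodv V W : {vspace g} :=
  <<[seq lie v w | v <- vbasis V, w <- vbasis W]>>%VS.

Definition lie_ideal I : Prop := forall x y, y \in I -> lie x y \in I.

Definition lie_solvable V : Prop :=
  exists n, iter n (fun W => lie_prodv W W) V = 0%VS.

Definition lie_nilpotent V : Prop :=
  exists n, iter n (lie_prodv V) V = 0%VS.

(* The zero Lie algebra is semisimple. *)
Definition semisimple : Prop :=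
  forall I, lie_ideal I -> lie_solvable I -> I = 0%VS.

Definition cartan_subalgebra h : Prop :=
  [/\ (lie_prodv h h <= h)%VS, lie_nilpotent h
    & forall x, (forall y, y \in h -> lie x y \in h) -> x \in h].

Section Roots.
Variable h : {vspace g}.
Notation weight := 'Hom(subvs_of h, K^o).

Definition root_space (a : weight) : {vspace g} :=
  (\bigcap_(e <- vbasis {: subvs_of h})
      passmx.leigenspace (ad (vsval e)) (a e))%VS.

Lemma root_spaceP (a : weight) x :
  reflect (forall y : subvs_of h, lie (vsval y) x = (a y : K) *: x)
          (x \in root_space a).
Proof.
have mem_eig f c : (x \in passmx.leigenspace f c) = (f x == c *: x).
  by rewrite memv_ker !lfunE /= !lfunE /= !lfunE /= lfunE /= subr_eq0.
apply: (iffP idP) => [xa y | xa]; last first.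
  rewrite /root_space; elim/big_rec: _ => [|e V _ xV]; first exact: memvf.
  by rewrite memv_cap xV mem_eig adE xa eqxx.
have xe e : e \in tval (vbasis {: subvs_of h}) ->
    lie (vsval e) x = (a e : K) *: x.
  move: xa; rewrite /root_space; move: {y}(tval _) => s.
  elim: s => [|d s IHs]; first by rewrite in_nil.
  rewrite big_cons memv_cap mem_eig adE inE => /andP[/eqP xd /IHs xs].
  by case/orP=> [/eqP->|/xs].
rewrite {1}(coord_vbasis (memvf y)).
rewrite [in RHS](coord_vbasis (memvf y)) !linear_sum /=.
have -> (F : 'I_(\dim {: subvs_of h}) -> g) :
    lie (\sum_i F i) x = \sum_i lie (F i) x.
  elim/big_rec2: _ => [|i y1 y2 _ <-].
    by have := lie_linearl x (-1) 0 0; rewrite scaler0 add0r scaleN1r addNr.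
  by have := lie_linearl x 1 (F i) y2; rewrite !scale1r.
rewrite scaler_suml; apply: eq_bigr => i _.
rewrite !linearZ /= -scalerA -xe ?mem_nth ?size_tuple //.
have := lie_linearl x (coord (vbasis {: subvs_of h}) i y)
  (vsval (vbasis {: subvs_of h})`_i) 0.
by have := lie_linearl x (-1) 0 0;
  rewrite !scaler0 !add0r scaleN1r addNr => ->; rewrite !addr0.
Qed.

Definition is_root (a : weight) : bool := (a != 0) && (root_space a != 0%VS).

(* [pos] lists the positive roots for some base of the root system:
   equivalently, it is a closed set of roots containing exactly one root out
   of each pair of opposite ones. *)
Definition positive_system (pos : seq weight) : Prop :=
  [/\ {subset pos <= is_root},
      forall a, is_root a -> (a \in pos) (+) (- a \in pos)
    & forall a b, a \in pos -> b \in pos -> is_root (a + b) -> a + b \in pos].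

End Roots.

Definition triangular_decomposition (nm h np : {vspace g}) : Prop :=
  [/\ cartan_subalgebra h,
      exists pos : seq 'Hom(subvs_of h, K^o),
        [/\ positive_system pos,
            np = (\sum_(a <- pos) root_space a)%VS
          & nm = (\sum_(a <- pos) root_space (- a))%VS],
      (nm + h + np)%VS = fullv
    & directv (nm + h + np)].

End LieTheory.

(* U(g) is presented as the algebra of all formal noncommutative polynomial
   expressions in the elements of g, modulo the smallest congruence which makes
   it an associative unital K-algebra in which g embeds linearly with
   x y - y x = [x, y]. Its universal property is [env_univ] below. *)

Inductive env_term (K : fieldType) (g : lieAlgType K) : Type :=
| EnvScalar of K
| EnvGen of g
| EnvAdd of env_term g & env_term g
| EnvMul of env_term g & env_term g.

Arguments EnvScalar {K g} _.
Arguments EnvGen {K g} _.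

Inductive env_rel (K : fieldType) (g : lieAlgType K) :
    env_term g -> env_term g -> Prop :=
| env_refl s : env_rel s s
| env_sym s t : env_rel s t -> env_rel t s
| env_trans s t u : env_rel s t -> env_rel t u -> env_rel s u
| env_congD s s' t t' : env_rel s s' -> env_rel t t' ->
    env_rel (EnvAdd s t) (EnvAdd s' t')
| env_congM s s' t t' : env_rel s s' -> env_rel t t' ->
    env_rel (EnvMul s t) (EnvMul s' t')
| env_addA s t u : env_rel (EnvAdd s (EnvAdd t u)) (EnvAdd (EnvAdd s t) u)
| env_addC s t : env_rel (EnvAdd s t) (EnvAdd t s)
| env_add0 s : env_rel (EnvAdd (EnvScalar 0) s) s
| env_mulA s t u : env_rel (EnvMul s (EnvMul t u)) (EnvMul (EnvMul s t) u)
| env_mulDl s t u :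
    env_rel (EnvMul (EnvAdd s t) u) (EnvAdd (EnvMul s u) (EnvMul t u))
| env_mulDr s t u :
    env_rel (EnvMul s (EnvAdd t u)) (EnvAdd (EnvMul s t) (EnvMul s u))
| env_mul0 s : env_rel (EnvMul (EnvScalar 0) s) (EnvScalar 0)
| env_mul1 s : env_rel (EnvMul (EnvScalar 1) s) s
| env_scalarC c s : env_rel (EnvMul (EnvScalar c) s) (EnvMul s (EnvScalar c))
| env_scalarD c d :
    env_rel (EnvAdd (EnvScalar c) (EnvScalar d)) (EnvScalar (c + d))
| env_scalarM c d :
    env_rel (EnvMul (EnvScalar c) (EnvScalar d)) (EnvScalar (c * d))
| env_genD x y : env_rel (EnvAdd (EnvGen x) (EnvGen y)) (EnvGen (x + y))
| env_genZ c x : env_rel (EnvMul (EnvScalar c) (EnvGen x)) (EnvGen (c *: x))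
| env_genL x y : env_rel (EnvMul (EnvGen x) (EnvGen y))
    (EnvAdd (EnvMul (EnvGen y) (EnvGen x)) (EnvGen (lie x y))).

HB.instance Definition _ (K : fieldType) (g : lieAlgType K) :=
  gen_eqMixin (env_term g).
HB.instance Definition _ (K : fieldType) (g : lieAlgType K) :=
  gen_choiceMixin (env_term g).

Section EnvelopingAlgebra.
Variables (K : fieldType) (g : lieAlgType K).
Local Open Scope quotient_scope.

Definition env_relb (s t : env_term g) : bool := `[< env_rel s t >].

Lemma env_relb_refl : reflexive env_relb.
Proof. by move=> s; apply/asboolP; exact: env_refl. Qed.
Lemma env_relb_sym : symmetric env_relb.
Proof. by move=> s t; apply/asboolP/asboolP; exact: env_sym. Qed.
Lemma env_relb_trans : transitive env_relb.
Proof.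
by move=> t s u /asboolP st /asboolP tu; apply/asboolP; exact: env_trans tu.
Qed.

Canonical env_equiv :=
  EquivRel env_relb env_relb_refl env_relb_sym env_relb_trans.

Definition envalg : Type := {eq_quot env_equiv}.
HB.instance Definition _ := EqQuotient.on envalg.
HB.instance Definition _ := Choice.on envalg.

Definition env_pi (s : env_term g) : envalg := \pi_envalg s.

Lemma envW (P : envalg -> Type) : (forall s, P (env_pi s)) -> forall u, P u.
Proof. by move=> Ps u; rewrite -[u]reprK; exact: Ps. Qed.

Lemma env_piP (s t : env_term g) : env_pi s = env_pi t <-> env_rel s t.
Proof. by split=> [/eqmodP/asboolP|st] //; apply/eqmodP/asboolP. Qed.

Definition envadd (u v : envalg) : envalg := env_pi (EnvAdd (repr u) (repr v)).
Definition envmul (u v : envalg) : envalg := env_pi (EnvMul (repr u) (repr v)).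
Definition envscale (c : K) (u : envalg) : envalg :=
  env_pi (EnvMul (EnvScalar c) (repr u)).

Lemma env_repr_pi s : env_rel (repr (env_pi s)) s.
Proof. by apply/env_piP; rewrite /env_pi reprK. Qed.

Lemma envaddE s t : envadd (env_pi s) (env_pi t) = env_pi (EnvAdd s t).
Proof. by apply/env_piP; apply: env_congD; exact: env_repr_pi. Qed.
Lemma envmulE s t : envmul (env_pi s) (env_pi t) = env_pi (EnvMul s t).
Proof. by apply/env_piP; apply: env_congM; exact: env_repr_pi. Qed.
Lemma envscaleE c s : envscale c (env_pi s) = env_pi (EnvMul (EnvScalar c) s).
Proof.
by apply/env_piP; apply: env_congM; [exact: env_refl | exact: env_repr_pi].
Qed.

Let envE := (envaddE, envmulE, envscaleE).

Fact envaddA : associative envadd.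
Proof.
elim/envW=> s; elim/envW=> t; elim/envW=> u.
by rewrite !envE; apply/env_piP; exact: env_addA.
Qed.
Fact envaddC : commutative envadd.
Proof.
elim/envW=> s; elim/envW=> t.
by rewrite !envE; apply/env_piP; exact: env_addC.
Qed.
Fact envadd0 : left_id (env_pi (EnvScalar 0)) envadd.
Proof. by elim/envW=> s; rewrite !envE; apply/env_piP; exact: env_add0. Qed.
Fact envmulDl : left_distributive envmul envadd.
Proof.
elim/envW=> s; elim/envW=> t; elim/envW=> u.
by rewrite !envE; apply/env_piP; exact: env_mulDl.
Qed.
Fact envmulDr : right_distributive envmul envadd.
Proof.
elim/envW=> s; elim/envW=> t; elim/envW=> u.
by rewrite !envE; apply/env_piP; exact: env_mulDr.
Qed.
Fact envmulA : associative envmul.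
Proof.
elim/envW=> s; elim/envW=> t; elim/envW=> u.
by rewrite !envE; apply/env_piP; exact: env_mulA.
Qed.
Fact envmul1 : left_id (env_pi (EnvScalar 1)) envmul.
Proof. by elim/envW=> s; rewrite !envE; apply/env_piP; exact: env_mul1. Qed.
Fact envmulr1 : right_id (env_pi (EnvScalar 1)) envmul.
Proof.
elim/envW=> s; rewrite !envE; apply/env_piP.
by apply: env_trans (env_mul1 _); apply/env_sym/env_scalarC.
Qed.
Fact envscale_mul c u : envscale c u = envmul (env_pi (EnvScalar c)) u.
Proof. by elim/envW: u => s; rewrite !envE. Qed.
Fact envscalarD c d :
  env_pi (EnvScalar (c + d)) =
    envadd (env_pi (EnvScalar c)) (env_pi (EnvScalar d)).
Proof. by rewrite !envE; apply/esym/env_piP; exact: env_scalarD. Qed.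
Fact envscalarM c d :
  env_pi (EnvScalar (c * d)) =
    envmul (env_pi (EnvScalar c)) (env_pi (EnvScalar d)).
Proof. by rewrite !envE; apply/esym/env_piP; exact: env_scalarM. Qed.
Fact envaddN : left_inverse (env_pi (EnvScalar 0)) (envscale (-1)) envadd.
Proof.
move=> u; rewrite envscale_mul -{2}[u]envmul1 -envmulDl -envscalarD addNr.
by elim/envW: u => s; rewrite !envE; apply/env_piP; exact: env_mul0.
Qed.

HB.instance Definition _ :=
  GRing.isZmodule.Build envalg envaddA envaddC envadd0 envaddN.

(* The augmentation, which shows that U(g) is not the zero ring. *)
Fixpoint env_aug (s : env_term g) : K :=
  match s with
  | EnvScalar c => c
  | EnvGen _ => 0
  | EnvAdd s t => env_aug s + env_aug t
  | EnvMul s t => env_aug s * env_aug t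
  end.

Lemma env_aug_rel s t : env_rel s t -> env_aug s = env_aug t.
Proof.
elim=> //= {s t};
  first [ by move=> s t u _ -> _ -> | by move=> s s' t t' _ -> _ ->
        | move=> *; rewrite ?addr0 ?mulr0 ?add0r ?mul0r ?mul1r //].
- by rewrite addrA.
- by rewrite addrC.
- by rewrite mulrA.
- by rewrite mulrDl.
- by rewrite mulrDr.
- by rewrite mulrC.
Qed.

Fact env_one_neq0 : env_pi (EnvScalar 1) != 0.
Proof. by apply/eqP => /env_piP/env_aug_rel/eqP/=; rewrite oner_eq0. Qed.

HB.instance Definition _ := GRing.Zmodule_isNzRing.Build envalg
  envmulA envmul1 envmulr1 envmulDl envmulDr env_one_neq0.

Fact envscaleA c d u : envscale c (envscale d u) = envscale (c * d) u.
Proof. by rewrite !envscale_mul envscalarM envmulA. Qed.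
Fact envscale1 : left_id 1 envscale.
Proof. by move=> u; rewrite envscale_mul envmul1. Qed.
Fact envscaleDr : right_distributive envscale +%R.
Proof. by move=> c u v; rewrite !envscale_mul envmulDr. Qed.
Fact envscaleDl u : {morph envscale^~ u : c d / c + d}.
Proof. by move=> c d; rewrite !envscale_mul envscalarD envmulDl. Qed.

HB.instance Definition _ := GRing.Zmodule_isLmodule.Build K envalg
  envscaleA envscale1 envscaleDr envscaleDl.

Fact envscaleAl (c : K) (u v : envalg) : c *: (u * v) = (c *: u) * v.
Proof. by rewrite /GRing.scale /= !envscale_mul [LHS]envmulA. Qed.

HB.instance Definition _ := GRing.Lmodule_isLalgebra.Build K envalg envscaleAl.

Fact envscaleAr (c : K) (u v : envalg) : c *: (u * v) = u * (c *: v).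
Proof.
have cC w : envmul (env_pi (EnvScalar c)) w = envmul w (env_pi (EnvScalar c)).
  by elim/envW: w => s; rewrite !envE; apply/env_piP; exact: env_scalarC.
rewrite /GRing.scale /= !envscale_mul.
by rewrite [LHS]envmulA cC; apply/esym; rewrite [LHS]envmulA.
Qed.

HB.instance Definition _ := GRing.Lalgebra_isAlgebra.Build K envalg envscaleAr.

Lemma env_piD s t : env_pi (EnvAdd s t) = env_pi s + env_pi t.
Proof. exact/esym/envaddE. Qed.
Lemma env_piM s t : env_pi (EnvMul s t) = env_pi s * env_pi t.
Proof. exact/esym/envmulE. Qed.
Lemma env_pi_scalar c : env_pi (EnvScalar c) = c%:A.
Proof.
transitivity (envscale c (env_pi (EnvScalar 1))) => //.
by rewrite envscale_mul -envscalarM mulr1.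
Qed.

Definition env_inj (x : g) : envalg := env_pi (EnvGen x).

Lemma env_inj_linear : linear env_inj.
Proof.
move=> c x y; rewrite -mulr_algl -env_pi_scalar -env_piM -env_piD.
apply/esym/env_piP; apply: env_trans (env_genD _ _).
exact: env_congD (env_genZ _ _) (env_refl _).
Qed.

HB.instance Definition _ :=
  GRing.isLinear.Build K g envalg *:%R env_inj env_inj_linear.

Lemma env_inj_lie x y :
  env_inj (lie x y) = env_inj x * env_inj y - env_inj y * env_inj x.
Proof.
apply/esym/eqP; rewrite subr_eq addrC -!env_piM -env_piD.
by apply/eqP/env_piP; exact: env_genL.
Qed.

End EnvelopingAlgebra.

Section UniversalProperty.
Variables (K : fieldType) (g : lieAlgType K) (A : algType K).
Variable f : {linear g -> A}.
Hypothesis f_lie : forall x y, f (lie x y) = f x * f y - f y * f x.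

Fixpoint env_eval (s : env_term g) : A :=
  match s with
  | EnvScalar c => c%:A
  | EnvGen x => f x
  | EnvAdd s t => env_eval s + env_eval t
  | EnvMul s t => env_eval s * env_eval t
  end.

Lemma env_eval_rel s t : env_rel s t -> env_eval s = env_eval t.
Proof.
elim=> //= {s t}; try by move=> *; congruence.
- by move=> s t u; rewrite addrA.
- by move=> s t; rewrite addrC.
- by move=> s; rewrite scale0r add0r.
- by move=> s t u; rewrite mulrA.
- by move=> s t u; rewrite mulrDl.
- by move=> s t u; rewrite mulrDr.
- by move=> s; rewrite scale0r mul0r.
- by move=> s; rewrite scale1r mul1r.
- by move=> c s; rewrite mulr_algl mulr_algr.
- by move=> c d; rewrite scalerDl.
- by move=> c d; rewrite mulr_algl scalerA.
- by move=> x y; rewrite linearD.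
- by move=> c x; rewrite mulr_algl linearZ.
- by move=> x y; rewrite f_lie addrC subrK.
Qed.

Lemma env_univ :
  exists! F : envalg g -> A,
    [/\ linear F, monoid_morphism F & forall x, F (env_inj x) = f x].
Proof.
pose F (u : envalg g) := env_eval (repr u).
have FE s : F (env_pi s) = env_eval s.
  exact/env_eval_rel/env_repr_pi.
exists F; split.
  split=> [c u v | | x]; last by rewrite FE.
  - elim/envW: u => s; elim/envW: v => t.
    by rewrite -mulr_algl -env_pi_scalar -env_piM -env_piD !FE /= mulr_algl.
  - split=> [|u v]; first by rewrite [LHS]FE /= scale1r.
    by elim/envW: u => s; elim/envW: v => t; rewrite -env_piM !FE.
move=> G [Glin [G1 GM] Gf]; apply/funext; elim/envW=> s; rewrite FE.
have G0 : G 0 = 0.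
  by have := Glin (-1) 0 0; rewrite scaler0 addr0 scaleN1r addNr.
elim: s => [c | x | s IHs t IHt | s IHs t IHt] /=.
- by rewrite env_pi_scalar -G1; have := Glin c 1 0; rewrite G0 !addr0.
- by rewrite -Gf.
- rewrite env_piD IHs IHt.
  by have := Glin 1 (env_pi s) (env_pi t); rewrite !scale1r.
- by rewrite env_piM GM IHs IHt.
Qed.

End UniversalProperty.

Section Whittaker.
Variables (K : fieldType) (g : lieAlgType K).
Local Notation U := (envalg g).

Definition env_center (z : U) : Prop := forall u, z * u = u * z.

(* U(n), identified with its image in U(g): the unital subalgebra generated by
   n. *)
Inductive env_sub (n : {vspace g}) : U -> Prop :=
| env_sub_scalar c : env_sub n c%:A
| env_sub_gen x : x \in n -> env_sub n (env_inj x)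
| env_subD u v : env_sub n u -> env_sub n v -> env_sub n (u + v)
| env_subM u v : env_sub n u -> env_sub n v -> env_sub n (u * v).

(* Z(g)U(n), i.e. the span of the products z u. *)
Definition whittaker_ring (n : {vspace g}) (r : U) : Prop :=
  exists (k : nat) (z u : 'I_k -> U),
    [/\ forall i, env_center (z i), forall i, env_sub n (u i)
      & r = \sum_i z i * u i].

(* For a K-subspace V of M, where K acts through K -> U(g). *)
Definition finite_dim (M : lmodType U) (V : M -> Prop) : Prop :=
  exists (k : nat) (b : 'I_k -> M),
    (forall i, V (b i)) /\
    forall v, V v -> exists a : 'I_k -> K, v = \sum_i (a i)%:A *: b i.

Definition finitely_generated (S : nzRingType) (M : lmodType S) : Prop :=
  exists (k : nat) (b : 'I_k -> M),
    forall v, exists a : 'I_k -> S, v = \sum_i a i *: b i.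

Definition whittaker (np : {vspace g}) (M : lmodType U) : Prop :=
  finitely_generated M /\
  forall v : M,
    finite_dim (fun w => exists2 r, whittaker_ring np r & w = r *: v).

End Whittaker.

(* An abelian category is given as a full subcategory C of the category of left
   S-modules. It is meant to be stable under kernels, cokernels and finite
   direct sums, so that a sequence of objects of C is exact in C iff it is
   exact as a sequence of modules. This holds for Whittaker modules because
   U(g) is noetherian. *)

Section GlobalDimension.
Variables (S : nzRingType) (C : lmodType S -> Prop).

(* [chain M N] : sequences N -> X_1 -> ... -> X_d -> M with d >= 0. *)
Inductive chain (M : lmodType S) (N : lmodType S) : Type :=
| ChainLast of {linear N -> M}
| ChainStep (X : lmodType S) of {linear N -> X} & chain M X.

Fixpoint chain_length (M N : lmodType S) (c : chain M N) : nat :=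
  match c with
  | ChainLast _ => 0
  | ChainStep _ _ c' => (chain_length c').+1
  end.

Fixpoint chain_in (M N : lmodType S) (c : chain M N) : Prop :=
  match c with
  | ChainLast _ => True
  | ChainStep X _ c' => C X /\ chain_in c'
  end.

Definition chain_head_ker (M N : lmodType S) (c : chain M N) (x : N) : Prop :=
  match c with
  | ChainLast f => f x = 0
  | ChainStep _ f _ => f x = 0
  end.

(* Exactness of N -> X_1 -> ... -> X_d -> M -> 0. *)
Fixpoint chain_right_exact (M N : lmodType S) (c : chain M N) : Prop :=
  match c with
  | ChainLast f => forall y, exists x, f x = y
  | ChainStep X f c' =>
      (forall y : X, chain_head_ker c' y <-> exists x, f x = y) /\
      chain_right_exact c'
  end.

Definition chain_exact (M N : lmodType S) (c : chain M N) : Prop :=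
  (forall x : N, chain_head_ker c x -> x = 0) /\ chain_right_exact c.

(* Commutative ladders between two sequences of the same length, given by phi at
   the source and by the identity at M. *)
Fixpoint chain_mor (M N N' : lmodType S) (phi : N -> N')
    (c : chain M N) (c' : chain M N') {struct c} : Prop :=
  match c, c' with
  | ChainLast f, ChainLast f' => forall x, f' (phi x) = f x
  | ChainStep X f c1, ChainStep X' f' c1' =>
      exists psi : {linear X -> X'},
        (forall x, f' (phi x) = psi (f x)) /\ chain_mor psi c1 c1'
  | _, _ => False
  end.

Record yoneda_seq (d : nat) (M N : lmodType S) := YonedaSeq {
  yoneda_chain :> chain M N;
  _ : chain_length yoneda_chain = d;
  _ : chain_in yoneda_chain;
  _ : chain_exact yoneda_chain
}.

Definition yoneda_mor d (M N : lmodType S) (e e' : yoneda_seq d M N) : Prop :=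
  chain_mor (fun x : N => x) e e'.

Definition yoneda_equiv d (M N : lmodType S) :
    yoneda_seq d M N -> yoneda_seq d M N -> Prop :=
  clos_refl_sym_trans _ (@yoneda_mor d M N).

(* Ext^d_C(M, N) <> 0. For d >= 1 a group is nonzero iff it has two distinct
   elements, so that its addition (the Baer sum) need not be mentioned. *)
Definition Ext_neq0 (d : nat) (M N : lmodType S) : Prop :=
  match d with
  | 0 => exists (f : {linear M -> N}) (x : M), f x <> 0
  | _.+1 => exists e e' : yoneda_seq d M N, ~ yoneda_equiv e e'
  end.

(* The supremum of a nonempty set of integers in \bar R is its maximum, or +oo
   if there is none. For M = 0 all Ext groups vanish and one gets -oo, the usual
   convention, which does not affect the global dimension. *)
Definition pdim (R : realType) (M : lmodType S) : \bar R :=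
  ereal_sup [set e | exists (d : nat) (N : lmodType S),
    [/\ C N, Ext_neq0 d M N & e = d%:R%:E]].

Definition gldim (R : realType) : \bar R :=
  ereal_sup [set e | exists M : lmodType S, C M /\ e = pdim R M].

End GlobalDimension.

Definition all_modules (S : nzRingType) (M : lmodType S) : Prop := True.

(* Main.v *)
From Stdlib Require Import Relation_Operators.
From HB Require Import structures.
Require Import Defs.
From mathcomp Require Import all_boot all_order all_algebra.
From mathcomp Require Import boolp classical_sets functions reals constructive_ereal ereal complex.

Set Implicit Arguments.
Unset Strict Implicit.
Unset Printing Implicit Defensive.

Import Order.TTheory GRing.Theory Num.Theory.
Local Open Scope ring_scope.

(** Write U for U(g) and D for dim g. For a U-module N, the K-linear maps from U to N form a
    U-module [cind] under right translation; they behave as N-valued formal functions on the formal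
    group of g. The alternating forms on g with values in them, with the Chevalley-Eilenberg
    differential [ced], are a formal de Rham complex of U-modules that starts at N. It is exact by a
    Poincare lemma ([ce_exact]), its terms are injective because they are coinduced from vector
    spaces ([form_inj]), and it vanishes above degree D ([form_top]). So it computes Ext.

    Since Ext is defined by exact sequences, the dictionary is explicit. Extending the embedding of
    N along a sequence from N to M yields a cocycle from M to the k-forms, whose class modulo
    coboundaries depends only on the Yoneda class ([yoneda_equiv_ext]). Every cocycle comes from a
    sequence ([chain_build]), and two sequences with the same cocycle map to a common third one
    ([chain_cospan]). Hence Ext vanishes above degree D ([ext_vanish]). In degree D, take for M the
    trivial module and for N the line on which g acts by the trace of ad. The invariant volume form
    is a cocycle. If it were a coboundary, it would be the differential of an invariant (D-1)-form;
    such a form is the contraction of the volume with some x, so its differential is a Lie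
    derivative of the volume, and the twist by the trace makes this zero ([vol_not_exact],
    [ext_dim]).

    For Whittaker modules the argument runs in two stages. The first works in the larger class [nlf]
    of finitely generated modules with locally finite action of n_+, and with the subcomplex of
    locally finite forms. The key point is that this subcomplex is still exact ([nLF_ce_exact]): a
    locally finite form splits into generalized weight vectors for characters of n_+, and
    [gam_exact] climbs a flag of ideals of n_+, using that e - c is onto on the relevant functions
    by formal integration along e ([frob], [tw_flow]). The second stage replaces the terms of a
    sequence in [nlf] by Whittaker quotients ([chain_push]). This rests on an Artin-Rees property of
    the center ([whittaker_AR]), which follows from noetherianity of U ([env_noetherian]) and from
    the finite generation of ideals of the center ([center_ideal_fg]). The latter is Hilbert's
    argument with a Reynolds operator ([reynolds]), a polynomial in the Casimir element acting on U
    by commutators.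

    Semisimplicity enters through the nondegenerate Killing form ([killing_nondeg]), which provides
    the Casimir element and, through the adjoint representation, coordinates on the formal group
    ([coords]). *)

Definition lin_pack (S : pzRingType) (A B : lmodType S) (f : A -> B)
  (Hf : linear f) : {linear A -> B} :=
  HB.pack f (GRing.isLinear.Build S A B *:%R f Hf).

Lemma pairD (A B : zmodType) (x x' : A) (y y' : B) :
  (x + x', y + y') = (x, y) + (x', y').
Proof. by []. Qed.

Lemma pairZ (S : pzRingType) (A B : lmodType S) a (x : A) (y : B) :
  (a *: x, a *: y) = a *: (x, y).
Proof. by []. Qed.

(** * Submodules, quotients, spans and noetherian modules *)

Section Submodules.
Variable S : nzRingType.
Implicit Types M : lmodType S.

Definition submod M (P : M -> Prop) : Prop :=
  P 0 /\ forall a x y, P x -> P y -> P (a *: x + y).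

Section SubmodTheory.
Variables (M : lmodType S) (P : M -> Prop) (HP : submod P).
Lemma submod0 : P 0. Proof. by case: HP. Qed.
Lemma submodD x y : P x -> P y -> P (x + y).
Proof. by case: HP => _ H Px Py; rewrite -[x]scale1r; exact: H. Qed.
Lemma submodZ a x : P x -> P (a *: x).
Proof. by case: HP => P0 H Px; rewrite -[_ *: _]addr0; exact: H. Qed.
Lemma submodN x : P x -> P (- x).
Proof. by move=> Px; rewrite -scaleN1r; exact: submodZ. Qed.
Lemma submodB x y : P x -> P y -> P (x - y).
Proof. by move=> Px Py; apply: submodD => //; exact: submodN. Qed.
Lemma submod_sum I (r : seq I) (Q : pred I) (F : I -> M) :
  (forall i, Q i -> P (F i)) -> P (\sum_(i <- r | Q i) F i).
Proof. by move=> PF; elim/big_ind: _ => //; [exact: submod0|exact: submodD]. Qed.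

Record submodT (H : submod P) := SubmodT { smval : M; _ : `[< P smval >] }.

HB.instance Definition _ (H : submod P) := [isSub for @smval H].
HB.instance Definition _ (H : submod P) := gen_eqMixin (submodT H).
HB.instance Definition _ (H : submod P) := gen_choiceMixin (submodT H).

Local Notation sT := (submodT HP).
Lemma smvalP (x : sT) : P (smval x).
Proof. by case: x => x /= /asboolP. Qed.
Lemma smval_inj : injective (@smval HP). Proof. exact: val_inj. Qed.
Definition smk x (Px : P x) : sT := SubmodT HP (asboolT Px).

Let sm0 := smk submod0.
Let smadd (x y : sT) := smk (submodD (smvalP x) (smvalP y)).
Let smopp (x : sT) := smk (submodN (smvalP x)).
Let smscale a (x : sT) := smk (submodZ a (smvalP x)).

Fact smaddA : associative smadd.
Proof. by move=> x y z; apply: smval_inj; rewrite /= addrA. Qed.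
Fact smaddC : commutative smadd.
Proof. by move=> x y; apply: smval_inj; rewrite /= addrC. Qed.
Fact smadd0 : left_id sm0 smadd.
Proof. by move=> x; apply: smval_inj; rewrite /= add0r. Qed.
Fact smaddN : left_inverse sm0 smopp smadd.
Proof. by move=> x; apply: smval_inj; rewrite /= addNr. Qed.
HB.instance Definition _ :=
  GRing.isZmodule.Build sT smaddA smaddC smadd0 smaddN.
Fact smscaleA a b x : smscale a (smscale b x) = smscale (a * b) x.
Proof. by apply: smval_inj; rewrite /= scalerA. Qed.
Fact smscale1 : left_id 1 smscale.
Proof. by move=> x; apply: smval_inj; rewrite /= scale1r. Qed.
Fact smscaleDr : right_distributive smscale +%R.
Proof. by move=> a x y; apply: smval_inj; rewrite /= scalerDr. Qed.
Fact smscaleDl x : {morph smscale^~ x : a b / a + b}.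
Proof. by move=> a b; apply: smval_inj; rewrite /= scalerDl. Qed.
HB.instance Definition _ := GRing.Zmodule_isLmodule.Build S sT
  smscaleA smscale1 smscaleDr smscaleDl.
Fact smval_linear : linear (@smval HP). Proof. by []. Qed.
HB.instance Definition _ :=
  GRing.isLinear.Build S sT M *:%R (@smval HP) smval_linear.
End SubmodTheory.
Arguments submodT {M P} H.
Arguments smval {M P H} _.

Lemma submod_ker M M' (f : {linear M -> M'}) : submod (fun x => f x = 0).
Proof.
split=> [|a x y fx fy]; first exact: linear0.
by rewrite linearP fx fy scaler0 addr0.
Qed.

Lemma submod_im M M' (f : {linear M -> M'}) : submod (fun y => exists x, f x = y).
Proof.
split=> [|a _ _ [x <-] [y <-]]; first by exists 0; exact: linear0.
by exists (a *: x + y); rewrite linearP.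
Qed.

Lemma submodI M (P Q : M -> Prop) :
  submod P -> submod Q -> submod (fun x => P x /\ Q x).
Proof.
by move=> [P0 HP] [Q0 HQ]; split=> // a x y [Px Qx] [Py Qy]; split; auto.
Qed.

Lemma submod_pre M M' (f : {linear M -> M'}) P :
  submod P -> submod (fun x => P (f x)).
Proof.
move=> HP; split=> [|a x y Px Py]; first by rewrite linear0; exact: submod0.
by rewrite linearP; apply: submodD => //; exact: submodZ.
Qed.

Lemma submod_true M : submod (fun _ : M => True).
Proof. by split. Qed.

Lemma lin_corestr M M' (P : M' -> Prop) (HP : submod P) (f : {linear M -> M'}) :
  (forall x, P (f x)) ->
  exists q : {linear M -> submodT HP}, forall x, smval (q x) = f x.
Proof.
move=> Pf; have H : linear (fun x => smk HP (Pf x) : submodT HP).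
  by move=> a x y; apply: smval_inj; rewrite /= linearP.
by exists (lin_pack H).
Qed.

Lemma lin_image M M' (f : {linear M -> M'}) :
  exists (Y : lmodType S) (q : {linear M -> Y}) (r : {linear Y -> M'}),
    [/\ forall y, exists x, q x = y, forall y, r y = 0 -> y = 0
      & forall x, r (q x) = f x].
Proof.
pose HP := submod_im f.
have [|q qE] := @lin_corestr _ _ _ HP f; first by move=> x; exists x.
exists (submodT HP), q, (@smval _ _ HP); split => //.
  move=> y; case: (smvalP y) => x xE; exists x.
  by apply: smval_inj; rewrite qE.
by move=> y y0; apply: smval_inj; rewrite y0.
Qed.

Section Quotient.
Variables (M : lmodType S) (L : M -> Prop) (HL : submod L).

Fact qrep_ex x : exists y, L (x - y).
Proof. by exists x; rewrite subrr; exact: submod0. Qed.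
Definition qrep (x : M) : M := projT1 (cid (qrep_ex x)).
Lemma qrepP x : L (x - qrep x).
Proof. by rewrite /qrep; case: cid. Qed.
Lemma qrepE x y : L (x - y) -> qrep x = qrep y.
Proof.
move=> Lxy; rewrite /qrep; move: (qrep_ex x) (qrep_ex y).
(* Congruent elements define the same predicate, hence the same choice. *)
suff -> : (fun z => L (x - z)) = (fun z => L (y - z)).
  by move=> e1 e2; rewrite (Prop_irrelevance e1 e2).
apply/funext => z; apply/propext; split => Lz.
  have -> : y - z = (x - z) - (x - y) by rewrite opprB [RHS]addrC addrA subrK.
  exact: submodB.
have -> : x - z = (x - y) + (y - z) by rewrite addrA subrK.
exact: submodD.
Qed.
Lemma qrepK x : qrep (qrep x) = qrep x.
Proof. by apply: qrepE; rewrite -opprB; apply: submodN => //; exact: qrepP. Qed.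

(** The quotient lives on the chosen representatives, the fixed points of [qrep]; operations are
    those of M followed by [qpi]. *)
Record quotM (H : submod L) := QuotM { qval : M; _ : qrep qval == qval }.
HB.instance Definition _ (H : submod L) := [isSub for @qval H].
HB.instance Definition _ (H : submod L) := gen_eqMixin (quotM H).
HB.instance Definition _ (H : submod L) := gen_choiceMixin (quotM H).
Local Notation qT := (quotM HL).
Definition qpi x : qT := QuotM HL (introT eqP (qrepK x)).
Lemma qpiE x y : L (x - y) -> qpi x = qpi y.
Proof. by move=> Lxy; apply: val_inj => /=; exact: qrepE. Qed.
Lemma qpiK q : qpi (qval q) = q.
Proof. by case: q => x xE; apply: val_inj => /=; exact/eqP. Qed.
Lemma qpi_eq x y : qpi x = qpi y -> L (x - y).
Proof.
move=> /(congr1 (@qval HL))/= e.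
have -> : x - y = (x - qrep x) - (y - qrep y) by rewrite e opprB addrA subrK.
by apply: submodB => //; exact: qrepP.
Qed.

Let q0 := qpi 0.
Let qadd (x y : qT) := qpi (qval x + qval y).
Let qopp (x : qT) := qpi (- qval x).
Let qscale a (x : qT) := qpi (a *: qval x).
Let qaddE x y : qadd (qpi x) (qpi y) = qpi (x + y).
Proof.
apply: qpiE; rewrite -opprB; apply: submodN => //; rewrite opprD addrACA.
by apply: submodD => //; exact: qrepP.
Qed.
Let qoppE x : qopp (qpi x) = qpi (- x).
Proof. by apply: qpiE; rewrite opprK addrC; exact: qrepP. Qed.
Let qscaleE a x : qscale a (qpi x) = qpi (a *: x).
Proof.
apply: qpiE; rewrite -scalerBr -opprB scalerN; apply: submodN => //.
by apply: submodZ => //; exact: qrepP.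
Qed.
Let qW (P : qT -> Type) : (forall x, P (qpi x)) -> forall q, P q.
Proof. by move=> H q; rewrite -[q]qpiK; exact: H. Qed.
Fact qaddA : associative qadd.
Proof. by elim/qW=> x; elim/qW=> y; elim/qW=> z; rewrite !qaddE addrA. Qed.
Fact qaddC : commutative qadd.
Proof. by elim/qW=> x; elim/qW=> y; rewrite !qaddE addrC. Qed.
Fact qadd0 : left_id q0 qadd.
Proof. by elim/qW=> x; rewrite /q0 qaddE add0r. Qed.
Fact qaddN : left_inverse q0 qopp qadd.
Proof. by elim/qW=> x; rewrite qoppE qaddE addNr. Qed.
HB.instance Definition _ :=
  GRing.isZmodule.Build qT qaddA qaddC qadd0 qaddN.
Fact qscaleA a b x : qscale a (qscale b x) = qscale (a * b) x.
Proof. by elim/qW: x => x; rewrite !qscaleE scalerA. Qed.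
Fact qscale1 : left_id 1 qscale.
Proof. by elim/qW=> x; rewrite qscaleE scale1r. Qed.
Fact qscaleDr : right_distributive qscale +%R.
Proof.
move=> a; elim/qW=> x; elim/qW=> y.
by rewrite [_ + _]qaddE !qscaleE [RHS]qaddE scalerDr.
Qed.
Fact qscaleDl x : {morph qscale^~ x : a b / a + b}.
Proof. by elim/qW: x => x a b; rewrite !qscaleE [RHS]qaddE scalerDl. Qed.
HB.instance Definition _ := GRing.Zmodule_isLmodule.Build S qT
  qscaleA qscale1 qscaleDr qscaleDl.
Fact qpi_linear : linear qpi.
Proof. by move=> a x y; rewrite [a *: qpi x]qscaleE [RHS]qaddE. Qed.
HB.instance Definition _ :=
  GRing.isLinear.Build S M qT *:%R qpi qpi_linear.
Lemma qpi_eq0 x : qpi x = 0 <-> L x.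
Proof.
split=> [/qpi_eq|Lx]; first by rewrite subr0.
by apply: qpiE; rewrite subr0.
Qed.
Lemma qpi_surj q : exists x, qpi x = q.
Proof. by exists (qval q); exact: qpiK. Qed.
End Quotient.

(** Recursion on the list of generators suits the inductions below, which split off one generator at
    a time. *)
Fixpoint lspan M (l : seq M) (v : M) : Prop :=
  if l is x :: l' then exists a, lspan l' (v - a *: x) else v = 0.

Lemma lspan_submod M (l : seq M) : submod (lspan l).
Proof.
elim: l => [|x l [IH0 IH]] /=.
  by split=> // a x y -> ->; rewrite scaler0 addr0.
split; first by exists 0; rewrite scale0r subr0.
move=> a u v [b Hb] [c Hc]; exists (a * b + c).
have -> : a *: u + v - (a * b + c) *: x = a *: (u - b *: x) + (v - c *: x).
  by rewrite scalerBr scalerDl scalerA opprD addrACA.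
exact: IH.
Qed.

Lemma lspan_mem M (l : seq M) x : x \in l -> lspan l x.
Proof.
elim: l => //= y l IH; rewrite inE => /orP[/eqP->|/IH H].
  by exists 1; rewrite scale1r subrr; exact: submod0 (lspan_submod _).
by exists 0; rewrite scale0r subr0.
Qed.

Lemma lspan_min M (P : M -> Prop) (l : seq M) v :
  submod P -> (forall x, x \in l -> P x) -> lspan l v -> P v.
Proof.
move=> HP; elim: l v => [|x l IH] v Pl /=; first by move=> ->; exact: submod0.
move=> [a /IH H]; rewrite -[v](subrK (a *: x)); apply: submodD => //.
  by apply: H => y yl; apply: Pl; rewrite inE yl orbT.
by apply: submodZ => //; apply: Pl; rewrite mem_head.
Qed.

Lemma lspan_sub M (l l' : seq M) v :
  (forall x, x \in l -> lspan l' x) -> lspan l v -> lspan l' v.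
Proof. by apply: lspan_min; exact: lspan_submod. Qed.

Lemma lspan_map M M' (f : {linear M -> M'}) l v :
  lspan l v -> lspan (map f l) (f v).
Proof.
elim: l v => [|x l IH] v /=; first by move=> ->; exact: linear0.
by move=> [a /IH H]; exists a; rewrite -linearZ -linearB.
Qed.

Lemma lspan_map_inv M M' (f : {linear M -> M'}) l w :
  lspan (map f l) w -> exists2 v, lspan l v & w = f v.
Proof.
elim: l w => [|x l IH] w /=; first by move=> ->; exists 0; rewrite ?linear0.
move=> [a /IH[v Hv E]]; exists (v + a *: x); first by exists a; rewrite addrK.
by rewrite linearD linearZ /= -E subrK.
Qed.

Lemma lspan_sum M I (r : seq I) (b : I -> M) (a : I -> S) :
  lspan (map b r) (\sum_(i <- r) a i *: b i).
Proof.
elim: r => [|i r IH] /=; first by rewrite big_nil.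
by exists (a i); rewrite big_cons addrC addKr.
Qed.

Lemma lspan_sumP M (I : eqType) (r : seq I) (b : I -> M) v : uniq r ->
  lspan (map b r) v -> exists a : I -> S, v = \sum_(i <- r) a i *: b i.
Proof.
elim: r v => [|i r IH] v /=.
  by move=> _ ->; exists (fun=> 0); rewrite big_nil.
move=> /andP[ir ur] [c /(IH _ ur)[a E]].
exists (fun j => if j == i then c else a j); rewrite big_cons eqxx.
rewrite -[v](subrK (c *: b i)) E addrC; congr (_ + _).
by apply: eq_big_seq => j jr; case: eqP jr => // ->; rewrite (negbTE ir).
Qed.

Lemma lspan_ordP M k (b : 'I_k -> M) v :
  lspan (map b (enum 'I_k)) v <-> exists a : 'I_k -> S, v = \sum_i a i *: b i.
Proof.
split=> [/lspan_sumP|[a ->]].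
  by case=> [|a ->]; [exact: enum_uniq|exists a; rewrite big_enum].
by rewrite -big_enum /=; exact: lspan_sum.
Qed.

Lemma map_enum_tnth M (l : seq M) :
  map (tnth (in_tuple l)) (enum 'I_(size l)) = l.
Proof. exact: (map_tnth_enum (in_tuple l)). Qed.

Lemma fgP M : finitely_generated M <-> exists l : seq M, forall v, lspan l v.
Proof.
split=> [[k [b Hb]]|[l Hl]].
  by exists (map b (enum 'I_k)) => v; apply/lspan_ordP; exact: Hb.
exists (size l), (tnth (in_tuple l)) => v; apply/lspan_ordP.
by rewrite map_enum_tnth.
Qed.

Definition noeth M : Prop := forall P : M -> Prop, submod P ->
  exists l : seq M, (forall x, x \in l -> P x) /\ (forall v, P v -> lspan l v).

(** Induction on the generators: the coefficients of x in elements of P modulo the span of l form a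
    left ideal. Finitely many elements [lv] of P realize its generators, and what remains of P lies
    in the span of l. *)
Lemma noeth_gen M (P : M -> Prop) (l : seq M) : noeth S^o -> submod P ->
  (forall v, P v -> lspan l v) ->
  exists l' : seq M, (forall x, x \in l' -> P x) /\ (forall v, P v -> lspan l' v).
Proof.
move=> NS; elim: l P => [|x l IH] P HP Pl.
  by exists [::]; split=> // v /Pl.
have [l1 [l1P l1E]] : exists l' : seq M, (forall x, x \in l' -> P x /\ lspan l x)
    /\ (forall v, P v /\ lspan l v -> lspan l' v).
  by apply: IH => [|v []//]; apply: submodI => //; exact: lspan_submod.
pose I := fun a : S^o => exists v, P v /\ lspan l (v - (a : S) *: x).
have HI : submod I.
  split; first by exists 0; split; [exact: submod0|rewrite scale0r subr0; exact: submod0 (lspan_submod _)].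
  move=> c a b [u [Pu Hu]] [v [Pv Hv]]; exists (c *: u + v); split.
    by case: HP => _; exact.
  rewrite [c *: a + b]/(c * a + b) scalerDl -scalerA opprD addrACA -scalerBr.
  by case: (lspan_submod l) => _; exact.
have [la [laP laE]] := NS I HI.
have [lv [lvP lvE]] : exists lv : seq M, (forall x, x \in lv -> P x) /\
   (forall a : S^o, lspan la a -> exists v, [/\ P v, lspan lv v & lspan l (v - (a : S) *: x)]).
  elim: la laP {laE} => [|a la IHa] laP.
    exists [::]; split=> // a /= ->; exists 0; split=> //; first exact: submod0.
    by rewrite scale0r subr0; exact: submod0 (lspan_submod _).
  have [|lv [lvP lvE]] := IHa; first by move=> b bl; apply: laP; rewrite inE bl orbT.
  have [u [Pu Hu]] := laP a (mem_head _ _).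
  exists (u :: lv); split=> [y|b [c /lvE[v [Pv Hv Hl]]]].
    by rewrite inE => /orP[/eqP->|/lvP].
  exists (v + c *: u); split.
  - by apply: submodD => //; exact: submodZ.
  - by exists c; rewrite addrK.
  - have -> : v + c *: u - (b : S) *: x =
       c *: (u - (a : S) *: x) + (v - (b - c *: a : S^o) *: x).
      rewrite [c *: a]/(c * a) scalerBl scalerBr scalerA opprB.
      by rewrite [RHS]addrC -[RHS]addrA [X in _ = _ + X]addrC subrKA addrA.
    by case: (lspan_submod l) => _; exact.
exists (lv ++ l1); split=> [y|v Pv].
  by rewrite mem_cat => /orP[/lvP|/l1P[]].
have [a Ha] := Pl v Pv.
have [|u [Pu Hu Hl]] := lvE a; first by apply: laE; exists v.
rewrite -[v](subrK u); apply: submodD; first exact: lspan_submod.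
  apply: lspan_sub (l1E (v - u) _) => [y yl|].
    by apply: lspan_mem; rewrite mem_cat yl orbT.
  split; first exact: submodB.
  have -> : v - u = (v - a *: x) - (u - a *: x) by rewrite opprB addrA subrK.
  by apply: submodB => //; exact: lspan_submod.
by apply: lspan_sub Hu => y yl; apply: lspan_mem; rewrite mem_cat yl.
Qed.

Lemma noeth_fg M : noeth S^o -> finitely_generated M -> noeth M.
Proof. by move=> NS /fgP[l Hl] P HP; exact: noeth_gen. Qed.

Lemma fg_surj M M' (f : {linear M -> M'}) : (forall y, exists x, f x = y) ->
  finitely_generated M -> finitely_generated M'.
Proof.
move=> fs /fgP[l Hl]; apply/fgP; exists (map f l) => y.
by have [x <-] := fs y; exact: lspan_map.
Qed.

Lemma fg_submodT M (P : M -> Prop) (HP : submod P) (l : seq M) :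
  (forall x, x \in l -> P x) -> (forall v, P v -> lspan l v) ->
  finitely_generated (submodT HP).
Proof.
move=> lP Pl; apply/fgP.
have [l' l'E] : exists l' : seq (submodT HP), map (@smval _ _ HP) l' = l.
  elim: l lP {Pl} => [|x l IH] lP; first by exists [::].
  have [|l' l'E] := IH; first by move=> y yl; apply: lP; rewrite inE yl orbT.
  by exists (smk HP (lP x (mem_head _ _)) :: l'); rewrite /= l'E.
exists l' => v; have := Pl _ (smvalP v); rewrite -l'E.
by case/lspan_map_inv => w Hw /smval_inj ->.
Qed.

Lemma fg_prod M M' : finitely_generated M -> finitely_generated M' ->
  finitely_generated (M * M')%type.
Proof.
move=> /fgP[l Hl] /fgP[l' Hl']; apply/fgP.
have H1 : linear (fun x : M => (x, 0 : M')).
  by move=> a x y; rewrite -pairZ -pairD scaler0 addr0.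
have H2 : linear (fun x : M' => (0 : M, x)).
  by move=> a x y; rewrite -pairZ -pairD scaler0 addr0.
exists (map (lin_pack H1) l ++ map (lin_pack H2) l') => -[x y].
have -> : (x, y) = lin_pack H1 x + lin_pack H2 y.
  by rewrite /= -pairD addr0 add0r.
apply: submodD; first exact: lspan_submod.
  by apply: lspan_sub (lspan_map (lin_pack H1) (Hl x)) => z zl;
    apply: lspan_mem; rewrite mem_cat zl.
by apply: lspan_sub (lspan_map (lin_pack H2) (Hl' y)) => z zl;
  apply: lspan_mem; rewrite mem_cat zl orbT.
Qed.

End Submodules.
Arguments submodT {S M P} H.
Arguments smval {S M P H} _.

(** * Extension of linear maps over a field *)

Section LinearExtension.
Variables (K : fieldType) (A X V : lmodType K).
Local Open Scope classical_set_scope.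

(** Zorn's lemma on the graphs of partial linear maps: a maximal graph is total, since any vector
    outside of its domain could be sent to 0. *)
Lemma klin_extend (i : {linear A -> X}) (f : {linear A -> V}) :
  (forall a, i a = 0 -> f a = 0) ->
  exists F : {linear X -> V}, forall a, F (i a) = f a.
Proof.
move=> ker.
pose P (D : set (X * V)) := (forall a, D (i a, f a)) /\
  (forall c p q, D p -> D q -> D (c *: p + q)) /\
  (forall v, D (0, v) -> v = 0).
pose D0 := [set p : X * V | exists a, p = (i a, f a)].
have PD0 : P D0.
  split; first by move=> a; exists a.
  split=> [c _ _ [a ->] [b ->]|v [a [/esym/ker fa ->]]]; last by [].
  by exists (c *: a + b); rewrite !linearP.
have [D [[PDi [PDl PDf]] Dmax]] : exists D, P D /\ forall B, D `<` B -> ~ P B.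
  (* Adding [D0] makes the predicate hold of the union of the empty chain too. *)
  pose P' (D : set (X * V)) := P (D `|` D0).
  have D0P D : P D -> D `|` D0 = D.
    by move=> [Hi _]; apply/setUidPl => _ [a ->]; exact: Hi.
  have [|D [PD Dmax]] := @Zorn_bigcup _ P'.
    move=> F FP Ftot; rewrite /P'.
    have [->|/set0P[D1 FD1]] := eqVneq F set0.
      by rewrite bigcup_set0 set0U.
    have -> : \bigcup_(Y in F) Y `|` D0 = \bigcup_(Y in F) (Y `|` D0).
      apply/seteqP; split=> [p [[Y FY Yp]|Dp]|p [Y FY [Yp|Dp]]].
      - by exists Y => //; left.
      - by exists D1 => //; right.
      - by left; exists Y.
      - by right.
    split; first by move=> a; exists D1 => //; right; exists a.
    split=> [c p q [Y FY Yp] [Z FZ Zq]|v [Y FY /(proj2 (proj2 (FP _ FY)))//]].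
    have [YZ|ZY] := Ftot Y Z FY FZ.
      exists Z => //; apply: (proj1 (proj2 (FP _ FZ))) => //.
      by case: Yp => [/YZ|]; [left|right].
    exists Y => //; apply: (proj1 (proj2 (FP _ FY))) => //.
    by case: Zq => [/ZY|]; [left|right].
  exists (D `|` D0); split=> // B [DB BD] PB; apply: (Dmax B).
    split=> [p Dp|BD']; first by apply: DB; left.
    by apply: BD => p /BD'; left.
  by rewrite /P' D0P.
have D00 : D 0 by have := PDi 0; rewrite !linear0.
have Dtot x : exists v, D (x, v).
  apply: contrapT => nx; apply: (Dmax [set p | exists c q, D q /\ p = c *: (x, 0) + q]).
    split=> [p Dp|sub]; first by exists 0, p; rewrite scale0r add0r.
    apply: nx; exists 0; apply: sub; exists 1, 0; split=> //.
    by rewrite scale1r addr0.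
  split; first by move=> a; exists 0, (i a, f a); rewrite scale0r add0r.
  split=> [c _ _ [a [p [Dp ->]]] [b [q [Dq ->]]]|v [c [[y w] [Dy]]]].
    exists (c * a + b), (c *: p + q); split; first exact: PDl.
    by rewrite scalerDr scalerA scalerDl addrACA.
  rewrite -pairZ -pairD scaler0 add0r => -[/esym/eqP ye ->].
  have [c0|c0] := eqVneq c 0.
    by move: ye; rewrite c0 scale0r add0r => /eqP y0; apply: PDf; rewrite -y0.
  exfalso; apply: nx; exists (- c^-1 *: w).
  have -> : (x, - c^-1 *: w) = - c^-1 *: (y, w) + 0.
    rewrite addr0 -pairZ; congr (_, _); move: ye; rewrite addrC addr_eq0 => /eqP->.
    by rewrite scalerN scaleNr opprK scalerA mulVf // scale1r.
  exact: PDl.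
have Duniq x v w : D (x, v) -> D (x, w) -> v = w.
  move=> Dv Dw; apply/eqP; rewrite -subr_eq0; apply/eqP/PDf.
  have := PDl (-1) _ _ Dw Dv.
  by rewrite -pairZ -pairD !scaleN1r addNr addrC.
pose F x := projT1 (cid (Dtot x)).
have FP x : D (x, F x) by rewrite /F; case: cid.
have Flin : linear F.
  move=> c x y; apply: (Duniq (c *: x + y)); first exact: FP.
  by have := PDl c _ _ (FP x) (FP y); rewrite -pairZ -pairD.
by exists (lin_pack Flin) => a /=; apply: (Duniq (i a)).
Qed.

End LinearExtension.

(** * Yoneda sequences and cocycles of a coresolution *)

Section Chains.
Variable S : nzRingType.
Implicit Types M N X Y : lmodType S.

Lemma submod_head_ker M N (c : chain M N) : submod (chain_head_ker c).
Proof. by case: c => [f|X f c]; exact: submod_ker. Qed.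

Lemma chain_mor_head M N N' (phi : {linear N -> N'}) (c : chain M N)
    (c' : chain M N') x :
  chain_mor phi c c' -> chain_head_ker c x -> chain_head_ker c' (phi x).
Proof.
case: c => [f|X f c]; case: c' => [f'|X' f' c'] //=; first by move=> ->.
by move=> [psi [-> _]] ->; rewrite linear0.
Qed.

Lemma chain_mor_length M N N' (phi : N -> N') (c : chain M N)
    (c' : chain M N') : chain_mor phi c c' -> chain_length c = chain_length c'.
Proof.
elim: c N' c' phi => [{}N f|{}N X f c IH] N' [f'|X' f' c'] phi //=.
by move=> [psi [_ /IH ->]].
Qed.
End Chains.

(* A coresolution 0 -> N -> G 0 -> G 1 -> ... of N, whose terms are submodules
   of one module T stable under d, and which is injective relatively to the
   objects of B. *)
Section Coresolution.
Variables (S : nzRingType) (T N : lmodType S) (d : {linear T -> T}).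
Variables (iota : {linear N -> T}) (G : nat -> T -> Prop).
Variable B : lmodType S -> Prop.
Implicit Types M X Y Z A : lmodType S.
Hypothesis G_submod : forall k, submod (G k).
Hypothesis dG : forall k t, G k t -> G k.+1 (d t).
Hypothesis dd : forall k t, G k t -> d (d t) = 0.
Hypothesis iotaG : forall n, G 0 (iota n).
Hypothesis d_iota : forall n, d (iota n) = 0.
Hypothesis iota_inj : forall n, iota n = 0 -> n = 0.
Hypothesis G_exact0 : forall t, G 0 t -> d t = 0 -> exists n, t = iota n.
Hypothesis G_exact : forall k t, G k.+1 t -> d t = 0 ->
  exists2 s, G k s & d s = t.
Hypothesis G_inj : forall k (A X : lmodType S) (i : {linear A -> X})
    (f : {linear A -> T}), B X -> (forall a, G k (f a)) ->
  (forall a, i a = 0 -> f a = 0) ->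
  exists F : {linear X -> T}, (forall x, G k (F x)) /\ forall a, F (i a) = f a.

(** f is extended to the next term by [f1], then [d \o f1] is extended in turn, and so on; m is the
    cocycle obtained at M. With f = [iota] this is the cocycle attached to an exact sequence from N
    to M. *)
Fixpoint chain_ext (M X : lmodType S) (c : chain M X) (k : nat)
    (f : {linear X -> T}) (m : {linear M -> T}) : Prop :=
  match c with
  | ChainLast g => fun f => forall x, m (g x) = f x
  | ChainStep Y g c' => fun f => exists f1 : {linear Y -> T},
      [/\ forall y, G k (f1 y), forall x, f1 (g x) = f x
        & chain_ext c' k.+1 (d \o f1) m]
  end f.

Lemma chain_ext_eqf M X (c : chain M X) k (f f' : {linear X -> T}) m :
  f =1 f' -> chain_ext c k f m -> chain_ext c k f' m.
Proof.
case: c => [g|Y g c] ff' /=; first by move=> H x; rewrite -ff'.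
by move=> [f1 [H1 H2 H3]]; exists f1; split=> // x; rewrite -ff'.
Qed.

(** Relative injectivity gives each extension. The map [d \o f1] vanishes on the image of X because
    d f = 0, and by exactness this image is the kernel of the next map. *)
Lemma chain_ext_exists M X (c : chain M X) k (f : {linear X -> T}) :
  B M -> chain_in B c -> chain_right_exact c -> (forall x, G k (f x)) ->
  (forall x, d (f x) = 0) -> (forall x, chain_head_ker c x -> f x = 0) ->
  exists m, chain_ext c k f m.
Proof.
move=> BM; elim: c k f => [{}X g|{}X Y g c IH] k f /=.
  move=> _ _ Gf _ kf; have [m [_ mE]] := G_inj BM Gf kf.
  by exists m.
move=> [BY Bc] [ex rex] Gf df kf; have [f1 [Gf1 f1E]] := G_inj BY Gf kf.
have [m Hm] : exists m, chain_ext c k.+1 (d \o f1) m.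
  apply: IH => // y /=; [exact: dG|exact: dd (Gf1 y)|].
  by move=> /ex[x <-] /=; rewrite f1E.
by exists m, f1.
Qed.

Lemma chain_ext_deg M X (c : chain M X) k (f : {linear X -> T}) m :
  chain_right_exact c -> (forall x, G k (f x)) -> (forall x, d (f x) = 0) ->
  chain_ext c k f m -> forall y, G (k + chain_length c) (m y) /\ d (m y) = 0.
Proof.
elim: c k f => [{}X g|{}X Y g c IH] k f /=.
  by move=> gs Gf df mE y; have [x <-] := gs y; rewrite mE addn0.
move=> [ex rex] Gf df [f1 [Gf1 f1E H]] y; rewrite addnS -addSn.
apply: IH H _ => // z /=; [exact: dG|exact: dd (Gf1 z)].
Qed.

Lemma chain_ext_nat M X X' (phi : {linear X -> X'}) (c : chain M X)
    (c' : chain M X') k f m :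
  chain_mor phi c c' -> chain_ext c' k f m -> chain_ext c k (f \o phi) m.
Proof.
elim: c X' phi c' k f => [{}X g|{}X Y g c IH] X' phi [g'|Y' g' c'] k f //=.
  by move=> gE fE x; rewrite -gE fE.
move=> [psi [gE mor]] [f1 [Gf1 f1E H]]; exists (f1 \o psi); split => [y|x|] /=.
- exact: Gf1.
- by rewrite -gE f1E.
- by apply: chain_ext_eqf (IH _ psi _ _ _ mor H) => y.
Qed.

(** The usual comparison: u extends to some e on Y, and f1 - f1' - d e vanishes on the image of X,
    so it plays the part of u one term further. *)
Lemma chain_ext_unique M X (c : chain M X) k (f f' u : {linear X -> T}) m m' :
  B M -> chain_in B c -> chain_right_exact c ->
  chain_ext c k.+1 f m -> chain_ext c k.+1 f' m' ->
  (forall x, G k (u x)) -> (forall x, f x - f' x = d (u x)) ->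
  (forall x, chain_head_ker c x -> u x = 0) ->
  exists h : {linear M -> T}, (forall y, G (k + chain_length c) (h y)) /\
    forall y, m y - m' y = d (h y).
Proof.
move=> BM; elim: c k f f' u => [{}X g|{}X Y g c IH] k f f' u /=.
  move=> _ gs mE m'E Gu du ku; have [h [Gh hE]] := G_inj BM Gu ku.
  exists h; split=> [y|y]; first by rewrite addn0.
  by have [x <-] := gs y; rewrite mE m'E hE.
move=> [BY Bc] [ex rex] [f1 [Gf1 f1E H]] [f1' [Gf1' f1E' H']] Gu du ku.
have [e [Ge eE]] := G_inj BY Gu ku.
pose u1 : {linear Y -> T} := (f1 \- f1') \- (d \o e).
have := IH k.+1 (d \o f1) (d \o f1') u1 Bc rex H H'.
rewrite addSn -addnS; apply.
- by move=> y /=; apply: submodB => //; [exact: submodB|exact: dG].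
- by move=> y /=; rewrite !linearB /= (dd (Ge y)) subr0.
- by move=> y /ex[x <-] /=; rewrite f1E f1E' eE du subrr.
Qed.

Lemma chain_ext_unique0 M (c : chain M N) k m m' :
  B M -> chain_in B c -> chain_exact c -> chain_length c = k.+1 ->
  chain_ext c 0 iota m -> chain_ext c 0 iota m' ->
  exists h : {linear M -> T}, (forall y, G k (h y)) /\
    forall y, m y - m' y = d (h y).
Proof.
case: c => // Y g c BM [BY Bc] [_ [ex rex]] [<-].
move=> [f1 [Gf1 f1E H]] [f1' [Gf1' f1E' H']].
apply: (chain_ext_unique (u := f1 \- f1') BM Bc rex H H') => y /=.
- exact: submodB.
- by rewrite linearB.
- by move=> hy; have [x <-] := (ex y).1 hy; rewrite f1E f1E' subrr.
Qed.

(** The class of the cocycle modulo coboundaries is an invariant of the Yoneda class: a morphism of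
    sequences transports an extension without changing m, and homotopies are negated and added along
    a zigzag. *)
Lemma yoneda_equiv_ext (C : lmodType S -> Prop) k M
    (E E' : yoneda_seq C k.+1 M N) m m' :
  (forall X, C X -> B X) -> B M -> yoneda_equiv E E' ->
  chain_ext E 0 iota m -> chain_ext E' 0 iota m' ->
  exists h : {linear M -> T}, (forall y, G k (h y)) /\
    forall y, m y - m' y = d (h y).
Proof.
move=> CB BM; have inB (X : lmodType S) (c : chain M X) : chain_in C c -> chain_in B c.
  by elim: c => //= {}X Y _ c IH [/CB ? /IH].
have uniq (e : yoneda_seq C k.+1 M N) p p' : chain_ext e 0 iota p ->
    chain_ext e 0 iota p' -> exists h : {linear M -> T},
    (forall y, G k (h y)) /\ forall y, p y - p' y = d (h y).
  case: e => c lc ic ec /=; exact: chain_ext_unique0 (inB _ _ ic) ec lc.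
move=> EE'; elim: EE' m m' => {E E'} [E E' mor|E|E E' _ IH|E1 E2 E3 _ IH _ IH'] m m'.
- move=> Hm Hm'; apply: (uniq E) => //.
  have := @chain_ext_nat _ _ _ idfun E E' 0 iota m' mor Hm'.
  exact: chain_ext_eqf.
- exact: uniq.
- move=> Hm Hm'; have [h [Gh hE]] := IH _ _ Hm' Hm; exists (\- h); split=> y /=.
    exact: submodN.
  by rewrite linearN /= -hE opprB.
move=> Hm Hm'.
have [m2 Hm2] : exists m2, chain_ext E2 0 iota m2.
  case: (E2) => c _ ic [ker ex] /=; have Bc := inB _ _ ic.
  by apply: chain_ext_exists => // x /ker ->; exact: linear0.
have [h [Gh hE]] := IH _ _ Hm Hm2; have [h' [Gh' hE']] := IH' _ _ Hm2 Hm'.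
exists (h \+ h'); split=> y /=; first exact: submodD.
by rewrite linearD /= -hE -hE' addrA subrK.
Qed.

Section Building.
Hypothesis B_prod : forall X Y, B X -> B Y -> B (X * Y)%type.
(** One step of the pull-back of the coresolution. Y sits inside the pairs (t, y) with d t = j y and
    y in Q; it must map onto Q and receive the given object A, while belonging to B. *)
Hypothesis B_build : forall k (Y1 A : lmodType S) (j : {linear Y1 -> T})
    (alpha : {linear A -> T}) (beta : {linear A -> Y1}) (Q : Y1 -> Prop),
  B Y1 -> B A -> submod Q -> (forall y, G k.+1 (j y)) ->
  (forall y, Q y -> d (j y) = 0) ->
  (forall a, [/\ G k (alpha a), d (alpha a) = j (beta a) & Q (beta a)]) ->
  exists (Y : lmodType S) (t : {linear Y -> T}) (p : {linear Y -> Y1})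
      (q : {linear A -> Y}),
    [/\ B Y, forall y, [/\ G k (t y), d (t y) = j (p y) & Q (p y)],
        forall a, t (q a) = alpha a /\ p (q a) = beta a,
        forall y, Q y -> exists z, p z = y
      & forall z, t z = 0 -> p z = 0 -> z = 0].

(** The common target is built from M backwards, each term by [B_build] over the next one, with A =
    X * X' so that it receives both sequences. As (t, p) is jointly injective, t is injective on the
    kernel of the first map, which will give exactness at the left end. *)
Lemma chain_cospan_aux M X (c : chain M X) (X' : lmodType S) (c' : chain M X')
    k (a : {linear X -> T}) (a' : {linear X' -> T}) m :
  B M -> B X -> B X' -> chain_in B c -> chain_in B c' ->
  chain_right_exact c -> chain_right_exact c' ->
  chain_length c = chain_length c' ->
  (forall x, G k (a x)) -> (forall x, G k (a' x)) ->
  chain_ext c k.+1 (d \o a) m -> chain_ext c' k.+1 (d \o a') m ->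
  exists (Y : lmodType S) (c2 : chain M Y) (t : {linear Y -> T})
      (q : {linear X -> Y}) (q' : {linear X' -> Y}),
    [/\ [/\ B Y, chain_in B c2, chain_right_exact c2 &
            chain_length c2 = chain_length c],
        [/\ forall y, G k (t y),
        forall y, chain_head_ker c2 y -> d (t y) = 0 &
        forall y, chain_head_ker c2 y -> t y = 0 -> y = 0],
        (forall x, t (q x) = a x) /\ (forall x, t (q' x) = a' x)
      & chain_mor q c c2 /\ chain_mor q' c' c2].
Proof.
move=> BM; elim: c X' c' k a a' => [{}X g|{}X X1 g c IH] X' [g'|X1' g' c'] k a a' //=.
  move=> BX BX' _ _ gs gs' _ Ga Ga' mE mE'.
  have al : linear (fun x : X * X' => a x.1 + a' x.2).
    by move=> b x y; rewrite !linearP scalerDr addrACA.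
  have be : linear (fun x : X * X' => g x.1 + g' x.2).
    by move=> b x y; rewrite !linearP scalerDr addrACA.
  have Gm y : G k.+1 (m y) by have [x <-] := gs y; rewrite mE; exact: dG.
  have dm y : d (m y) = 0 by have [x <-] := gs y; rewrite mE; exact: dd (Ga x).
  have [||Y [t [p [q [BY tp qE ps pi]]]]] := @B_build k M (X * X')%type m (lin_pack al)
     (lin_pack be) (fun=> True) BM (B_prod BX BX') (submod_true _) Gm.
  - by [].
  - move=> x /=; split=> //; first by apply: submodD.
    by rewrite !linearD /= mE mE'.
  have q1 : linear (fun x : X => q (x, 0)).
    by move=> b x y; rewrite -linearP -pairZ -pairD scaler0 addr0.
  have q2 : linear (fun x : X' => q (0, x)).
    by move=> b x y; rewrite -linearP -pairZ -pairD scaler0 addr0.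
  exists Y, (ChainLast p), t, (lin_pack q1), (lin_pack q2).
  split; split => //=.
  - by move=> y; exact: ps.
  - by move=> y; case: (tp y).
  - by move=> y py; case: (tp y) => _ -> _; rewrite py linear0.
  - by move=> y py ty; exact: pi.
  - by move=> x; case: (qE (x, 0)) => -> _; rewrite /= linear0 addr0.
  - by move=> x; case: (qE (0, x)) => -> _; rewrite /= linear0 add0r.
  - by move=> x; case: (qE (x, 0)) => _ ->; rewrite /= linear0 addr0.
  - by move=> x; case: (qE (0, x)) => _ ->; rewrite /= linear0 add0r.
move=> BX BX' [BX1 Bc] [BX1' Bc'] [ex rex] [ex' rex'] [len] Ga Ga'.
move=> [f1 [Gf1 f1E H]] [f1' [Gf1' f1E' H']].
have [Y1 [c2 [j [q1 [q1' [[BY1 Bc2 rex2 len2] [Gj dj ji] [jq jq'] [mor mor']]]]]]] :=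
  IH _ c' k.+1 f1 f1' BX1 BX1' Bc Bc' rex rex' len Gf1 Gf1' H H'.
have al : linear (fun x : X * X' => a x.1 + a' x.2).
  by move=> b x y; rewrite !linearP scalerDr addrACA.
have be : linear (fun x : X * X' => q1 (g x.1) + q1' (g' x.2)).
  by move=> b x y; rewrite !linearP scalerDr addrACA.
have [|Y [t [p [q [BY tp qE ps pi]]]]] := @B_build k Y1 (X * X')%type j (lin_pack al)
   (lin_pack be) (chain_head_ker c2) BY1 (B_prod BX BX') (submod_head_ker _) Gj dj.
  move=> x /=; split; first by apply: submodD.
    by rewrite !linearD /= jq jq' f1E f1E'.
  apply: submodD; first exact: submod_head_ker.
    by apply: chain_mor_head mor _; apply/ex; exists x.1.
  by apply: chain_mor_head mor' _; apply/ex'; exists x.2.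
have ql : linear (fun x : X => q (x, 0)).
  by move=> b x y; rewrite -linearP -pairZ -pairD scaler0 addr0.
have qr : linear (fun x : X' => q (0, x)).
  by move=> b x y; rewrite -linearP -pairZ -pairD scaler0 addr0.
exists Y, (ChainStep p c2), t, (lin_pack ql), (lin_pack qr).
split; split => //=.
- split=> // y; split=> [/ps//|[z <-]]; by case: (tp z).
- by rewrite len2.
- by move=> y; case: (tp y).
- by move=> y py; case: (tp y) => _ -> _; rewrite py linear0.
- by move=> y py ty; exact: pi.
- by move=> x; case: (qE (x, 0)) => -> _; rewrite /= linear0 addr0.
- by move=> x; case: (qE (0, x)) => -> _; rewrite /= linear0 add0r.
- exists q1; split=> // x.
  by case: (qE (x, 0)) => _ ->; rewrite /= !linear0 addr0.
- exists q1'; split=> // x.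
  by case: (qE (0, x)) => _ ->; rewrite /= !linear0 add0r.
Qed.

Lemma chain_cospan M (c c' : chain M N) m :
  B M -> chain_in B c -> chain_in B c' -> chain_exact c -> chain_exact c' ->
  chain_length c = chain_length c' -> (0 < chain_length c)%N ->
  chain_ext c 0 iota m -> chain_ext c' 0 iota m ->
  exists c2 : chain M N, [/\ chain_in B c2, chain_exact c2,
    chain_length c2 = chain_length c, chain_mor (fun x => x) c c2
    & chain_mor (fun x => x) c' c2].
Proof.
move=> BM; case: c => // X g c; case: c' => // X' g' c' [BX Bc] [BX' Bc'].
move=> [_ [ex rex]] [_ [ex' rex']] [len] _.
move=> [f1 [Gf1 f1E H]] [f1' [Gf1' f1E' H']].
have [Y [c2 [t [q [q' [[BY Bc2 rex2 len2] [Gt dt ti] [tq tq'] [mor mor']]]]]]] :=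
  chain_cospan_aux BM BX BX' Bc Bc' rex rex' len Gf1 Gf1' H H'.
have hk n : chain_head_ker c2 (q (g n)).
  by apply: chain_mor_head mor _; apply/ex; exists n.
have hk' n : chain_head_ker c2 (q' (g' n)).
  by apply: chain_mor_head mor' _; apply/ex'; exists n.
exists (ChainStep (q \o g) c2); split=> //=.
- split=> /= [n qgn|]; first by apply: iota_inj; rewrite -f1E -tq qgn linear0.
  split=> // y; split=> [ky|[n <-]]; last exact: hk.
  (* On the kernel t takes values in 0-cocycles, that is in N, and it is injective there. *)
  have [n nE] := G_exact0 (Gt y) (dt y ky); exists n; apply/eqP.
  rewrite -subr_eq0; apply/eqP/ti; last by rewrite linearB tq f1E nE subrr.
  by apply: submodB => //; exact: submod_head_ker.
- by rewrite len2.
- by exists q.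
- exists q'; split=> // n; apply/eqP; rewrite -subr_eq0; apply/eqP/ti.
    by apply: submodB => //; exact: submod_head_ker.
  by rewrite linearB tq tq' f1E f1E' subrr.
Qed.

(** The coresolution is pulled back along m. Only the leftmost term has to receive A through alpha;
    the others receive it through the zero map. *)
Lemma chain_build_aux M k L (m : {linear M -> T}) (A : lmodType S)
    (alpha : {linear A -> T}) : B M -> B A ->
  (forall y, G (k + L).+1 (m y)) -> (forall y, d (m y) = 0) ->
  (forall x, G k (alpha x)) -> (forall x, d (alpha x) = 0) ->
  exists (Y : lmodType S) (c : chain M Y) (t : {linear Y -> T})
      (q : {linear A -> Y}),
    [/\ [/\ B Y, chain_in B c, chain_right_exact c & chain_length c = L],
        [/\ forall y, G k (t y),
        forall y, chain_head_ker c y -> d (t y) = 0 &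
        forall y, chain_head_ker c y -> t y = 0 -> y = 0],
        forall x, t (q x) = alpha x /\ chain_head_ker c (q x)
      & chain_ext c k.+1 (d \o t) m].
Proof.
move=> BM; elim: L k A alpha => [|L IH] k A alpha BA Gm dm Ga da.
  have [|y _|x|Y [t [p [q [BY tp qE ps pi]]]]] :=
    @B_build k M A m alpha \0 (fun=> True) BM BA (submod_true _).
  - by move=> y; have := Gm y; rewrite addn0.
  - exact: dm.
  - by split=> //; rewrite da linear0.
  exists Y, (ChainLast p), t, q; split=> /=.
  - by split=> // y; exact: ps.
  - split=> [y|y py|]; last exact: (fun y py ty => pi y ty py).
      by case: (tp y).
    by case: (tp y) => _ -> _; rewrite py linear0.
  - by move=> x; case: (qE x).
  - by move=> x; case: (tp x) => _ <-.
have [|x|x|Y1 [c [j [q1 [[BY1 Bc rex len] [Gj dj ji] _ H]]]]] :=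
  IH k.+1 A \0 BA _ dm.
- by move=> y; have := Gm y; rewrite addnS.
- exact: submod0.
- exact: linear0.
have [x|Y [t [p [q [BY tp qE ps pi]]]]] :=
    @B_build k Y1 A j alpha \0 (chain_head_ker c) BY1 BA (submod_head_ker _) Gj dj.
  split=> //; first by rewrite da linear0.
  exact: submod0 (submod_head_ker _).
exists Y, (ChainStep p c), t, q; split=> /=.
- split=> //=; last by rewrite len.
  by split=> // y; split=> [/ps//|[z <-]]; case: (tp z).
- split=> [y|y py|]; last exact: (fun y py ty => pi y ty py).
    by case: (tp y).
  by case: (tp y) => _ -> _; rewrite py linear0.
- by move=> x; case: (qE x).
- by exists j; split=> // x; case: (tp x) => _ <-.
Qed.

Lemma chain_build M L (m : {linear M -> T}) : B M -> B N ->
  (forall y, G L.+1 (m y)) -> (forall y, d (m y) = 0) ->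
  exists c : chain M N, [/\ chain_in B c, chain_exact c, chain_length c = L.+1
    & chain_ext c 0 iota m].
Proof.
move=> BM BN Gm dm.
have [Y [c [t [q [[BY Bc rex len] [Gt dt ti] qE H]]]]] :=
  @chain_build_aux M 0 L m N iota BM BN Gm dm iotaG d_iota.
exists (ChainStep q c); split=> //=.
- split=> /= [n qn|]; first by apply: iota_inj; case: (qE n) => <- _; rewrite qn linear0.
  split=> // y; split=> [ky|[n <-]]; last by case: (qE n).
  have [n nE] := G_exact0 (Gt y) (dt y ky); exists n; apply/eqP.
  case: (qE n) => tq kq.
  rewrite -subr_eq0; apply/eqP/ti; last by rewrite linearB tq nE subrr.
  by apply: submodB => //; exact: submod_head_ker.
- by rewrite len.
- by exists t; split=> // n; case: (qE n).
Qed.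
End Building.

End Coresolution.

(* Replacing the terms of an exact sequence of objects of B by quotients in the
   smaller class W. *)
Section Push.
Variables (S : nzRingType) (B W : lmodType S -> Prop).
Implicit Types M N X Y Z A : lmodType S.
Hypothesis W_image : forall X Z (f : {linear X -> Z}), W Z ->
  exists (Y : lmodType S) (q : {linear X -> Y}) (r : {linear Y -> Z}),
    [/\ W Y, forall y, exists x, q x = y, forall y, r y = 0 -> y = 0
      & forall x, r (q x) = f x].
Hypothesis W_prod : forall X Y, W X -> W Y -> W (X * Y)%type.
Hypothesis W_AR : forall (X X1 Z : lmodType S) (f : {linear X -> X1})
    (phi : {linear X -> Z}), B X1 -> W Z ->
  exists (Y1 : lmodType S) (pi1 : {linear X1 -> Y1}), W Y1 /\
    forall x, pi1 (f x) = 0 -> exists x0, phi x0 = phi x /\ f x0 = 0.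

(** The map [pi0] to Z is prescribed, and the new term is the image of X in the product of Z and the
    new next term. That next term is built from the map [pi1] given by [W_AR], so that an element
    which becomes zero there can be replaced by a kernel element with the same image in Z. This is
    what preserves exactness. *)
Lemma chain_push_aux M X (c : chain M X) (Z : lmodType S) (pi0 : {linear X -> Z}) :
  W M -> W Z -> chain_in B c -> chain_right_exact c ->
  exists (Y : lmodType S) (q : {linear X -> Y}) (r : {linear Y -> Z})
      (c' : chain M Y),
    [/\ [/\ W Y, chain_in W c', chain_right_exact c' & chain_length c' = chain_length c],
        (forall y, exists x, q x = y) /\ (forall x, r (q x) = pi0 x),
        chain_mor q c c'
      & forall y, chain_head_ker c' y -> exists2 x, chain_head_ker c x & q x = y].
Proof.
move=> WM; elim: c Z pi0 => [{}X f|{}X X1 f c IH] Z pi0 WZ /=.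
  move=> _ fs; have th : linear (fun x => (pi0 x, f x)).
    by move=> a x y; rewrite !linearP pairD pairZ.
  have [Y [q [r [WY qs ri rq]]]] := W_image (lin_pack th) (W_prod WZ WM).
  have rq1 x : (r (q x)).1 = pi0 x by rewrite rq.
  have rq2 x : (r (q x)).2 = f x by rewrite rq.
  exists Y, q, (fst \o r), (ChainLast (snd \o r)); split=> //=.
  - by split=> // y; have [x <-] := fs y; exists (q x); exact: rq2.
  - move=> y; have [x <-] := qs y; exists x => //.
    by rewrite -rq2.
move=> [BX1 Bc] [ex rex].
have [Y1 [pi1 [WY1 pi1E]]] := W_AR f pi0 BX1 WZ.
have [Y1' [q1 [r1 [c' [[WY1' Wc' rex' len'] [q1s rq1] mor kE]]]]] := IH _ pi1 WY1 Bc rex.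
have th : linear (fun x => (pi0 x, q1 (f x))).
  by move=> a x y; rewrite !linearP pairD pairZ.
have [Y [q [r [WY qs ri rq]]]] := W_image (lin_pack th) (W_prod WZ WY1').
have rqa x : (r (q x)).1 = pi0 x by rewrite rq.
have rqb x : (r (q x)).2 = q1 (f x) by rewrite rq.
exists Y, q, (fst \o r), (ChainStep (snd \o r) c'); split=> //=.
- split=> //; last by rewrite len'.
  split=> // y; split=> [/kE[x /ex[x0 <-] <-]|[z <-]].
    by exists (q x0); exact: rqb.
  have [x <-] := qs z; rewrite [X in chain_head_ker _ X]rqb.
  by apply: chain_mor_head mor _; apply/ex; exists x.
- by exists q1; split=> // x; exact: rqb.
(* [r1] recovers pi1 (f x) from the vanishing q1 (f x); [pi1E] then gives x0 in the kernel of f with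
   the same image as x in Y. *)
move=> y; have [x <-] := qs y; rewrite [X in X = 0 -> _]rqb => q1f.
have [|x0 [x0E fx0]] := pi1E x; first by rewrite -rq1 q1f linear0.
exists x0 => //; apply/eqP; rewrite -subr_eq0; apply/eqP/ri.
by rewrite linearB !rq /= x0E fx0 q1f linear0 subrr.
Qed.

(** [W_AR] for the identity of N yields a map from the first term to an object of W on which N stays
    embedded; the rest follows that map. *)
Lemma chain_push M N (c : chain M N) : W M -> W N -> chain_in B c ->
  chain_exact c -> (0 < chain_length c)%N ->
  exists c' : chain M N, [/\ chain_in W c', chain_exact c',
    chain_length c' = chain_length c & chain_mor (fun x => x) c c'].
Proof.
move=> WM WN; case: c => // X g c [BX Bc] [gi [ex rex]] _.
have [Z [pi0 [WZ pi0E]]] := W_AR g idfun BX WN.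
have [Y [q [r [c' [[WY Wc' rex' len'] [qs rq] mor kE]]]]] := chain_push_aux pi0 WM WZ Bc rex.
exists (ChainStep (q \o g) c'); split=> //=.
- split=> /= [n qgn|].
    have [|n0 [/= <- gn0]] := pi0E n; first by rewrite -rq qgn linear0.
    exact: gi.
  split=> // y; split=> [/kE[x /ex[x0 <-] <-]|[n <-]]; first by exists x0.
  by apply: chain_mor_head mor _; apply/ex; exists n.
- by rewrite len'.
- by exists q.
Qed.
End Push.

(** * Linear maps on the enveloping algebra as functions on words *)

Section Words.
Variables (K : fieldType) (g : lieAlgType K).
Local Notation U := (envalg g).
Implicit Types (x y : g) (w : seq g).

Definition word w : U := \prod_(x <- w) env_inj x.

Lemma word_nil : word [::] = 1. Proof. exact: big_nil. Qed.
Lemma word_cons x w : word (x :: w) = env_inj x * word w.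
Proof. exact: big_cons. Qed.
Lemma word_cat w w' : word (w ++ w') = word w * word w'.
Proof. exact: big_cat. Qed.
Lemma word1 x : word [:: x] = env_inj x. Proof. exact: big_seq1. Qed.
Lemma word_rcons x w : word (rcons w x) = word w * env_inj x.
Proof. by rewrite -cats1 word_cat word1. Qed.

Lemma env_alg_ind (P : U -> Prop) :
  (forall c : K, P c%:A) -> (forall x, P (env_inj x)) ->
  (forall u v, P u -> P v -> P (u + v)) ->
  (forall u v, P u -> P v -> P (u * v)) -> forall u, P u.
Proof.
move=> PS PG PD PM; elim/envW; elim=> [c|x|s IHs t IHt|s IHs t IHt].
- by rewrite env_pi_scalar.
- exact: PG.
- by rewrite env_piD; exact: PD.
- by rewrite env_piM; exact: PM.
Qed.

Inductive word_span : U -> Prop :=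
| word_span0 : word_span 0
| word_spanD c w u : word_span u -> word_span (c *: word w + u).

Lemma env_word_ind (P : U -> Prop) : P 0 ->
  (forall (c : K) w u, P u -> P (c *: word w + u)) -> forall u, P u.
Proof.
move=> P0 PD u; suff : word_span u by elim=> // c w v _; exact: PD.
have sD u1 u2 : word_span u1 -> word_span u2 -> word_span (u1 + u2).
  by elim=> [|c w v _ IH] H2; rewrite ?add0r // -addrA; apply: word_spanD; exact: IH.
have sM c w u1 : word_span u1 -> word_span (c *: word w * u1).
  elim=> [|c' w' v _ IH]; first by rewrite mulr0; exact: word_span0.
  rewrite mulrDr; apply: sD => //.
  rewrite -scalerAl -scalerAr -word_cat scalerA -[_ *: _]addr0.
  exact/word_spanD/word_span0.
elim/env_alg_ind: u => [c|x|u v|u v].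
- by rewrite -word_nil -[_ *: _]addr0; exact/word_spanD/word_span0.
- by rewrite -word1 -[word _]scale1r -[_ *: _]addr0; exact/word_spanD/word_span0.
- exact: sD.
- elim=> [|c w u' _ IH] H2; first by rewrite mul0r; exact: word_span0.
  by rewrite mulrDl; apply: sD; [exact: sM|exact: IH].
Qed.

Section Functionals.
Variable V : lmodType K.
Implicit Types a b : seq g -> V.

(** The functions on words that satisfy the relations of U. By [envfun_word] and [envfun_lift] they
    are the linear maps from U to V. *)
Definition envfun a : Prop :=
  (forall w1 w2 c x y, a (w1 ++ (c *: x + y) :: w2) =
     c *: a (w1 ++ x :: w2) + a (w1 ++ y :: w2)) /\
  (forall w1 w2 x y, a (w1 ++ [:: x, y & w2]) - a (w1 ++ [:: y, x & w2]) =
     a (w1 ++ lie x y :: w2)).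

Lemma envfun_word (phi : U -> V) : linear phi -> envfun (phi \o word).
Proof.
move=> lin; split=> [w1 w2 c x y|w1 w2 x y] /=.
  by rewrite -lin !word_cat !word_cons linearP mulrDl mulrDr -scalerAl -scalerAr.
have H := linearB (lin_pack lin); rewrite /= in H; rewrite -H; congr (phi _).
by rewrite !word_cat !word_cons env_inj_lie mulrBl mulrBr !mulrA.
Qed.

Lemma envfun_sum a I (r : seq I) (c : I -> K) (e : I -> g) w : envfun a ->
  a ((\sum_(i <- r) c i *: e i) :: w) = \sum_(i <- r) c i *: a (e i :: w).
Proof.
move=> [Ha _]; have a0 : a (0 :: w) = 0.
  have := Ha [::] w (-1) 0 0; rewrite /= scaler0 addr0 scaleN1r => E.
  by rewrite E addNr.
elim: r => [|i r IH]; first by rewrite !big_nil.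
by rewrite !big_cons (Ha [::]) /= IH.
Qed.

(** The action of terms by right translation: a generator x turns a into the function w -> a (w
    x). *)
Fixpoint term_act (t : env_term g) a : seq g -> V :=
  match t with
  | EnvScalar c => fun w => c *: a w
  | EnvGen x => fun w => a (rcons w x)
  | EnvAdd s t => fun w => term_act s a w + term_act t a w
  | EnvMul s t => term_act s (term_act t a)
  end.

Lemma term_actP t c a b w : term_act t (fun w => c *: a w + b w) w =
  c *: term_act t a w + term_act t b w.
Proof.
elim: t a b w => [e|x|s IHs t IHt|s IHs t IHt] a b w //=.
- by rewrite scalerDr !scalerA mulrC.
- by rewrite IHs IHt scalerDr addrACA.
- rewrite -IHs; congr (term_act s _ _).
  by apply/funext => v; exact: IHt.
Qed.

Lemma envfun_term t a : envfun a -> envfun (term_act t a).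
Proof.
elim: t a => [c|z|s IHs t IHt|s IHs t IHt] a Ha /=; last by apply: IHs; apply: IHt.
- case: Ha => [H1 H2]; split=> [w1 w2 e x y|w1 w2 x y].
    by rewrite H1 scalerDr !scalerA mulrC.
  by rewrite -H2 scalerBr.
- case: Ha => [H1 H2]; split=> [w1 w2 e x y|w1 w2 x y];
    by rewrite !rcons_cat /= ?H1 // -H2.
- case: (IHs a Ha) => [H1 H2]; case: (IHt a Ha) => [H3 H4].
  split=> [w1 w2 e x y|w1 w2 x y].
    by rewrite H1 H3 scalerDr addrACA.
  by rewrite -H2 -H4 opprD addrACA.
Qed.

Lemma term_act_rel s t : env_rel s t ->
  forall a, envfun a -> term_act s a = term_act t a.
Proof.
have actD u a b : term_act u (fun w => a w + b w) =
    fun w => term_act u a w + term_act u b w.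
  apply/funext => w; have := term_actP u 1 a b w; rewrite scale1r => <-.
  by congr (term_act u _ _); apply/funext => v; rewrite scale1r.
have actZ u c a : term_act u (fun w => c *: a w) = fun w => c *: term_act u a w.
  apply/funext => w; have := term_actP u c a (fun=> 0) w.
  have -> : term_act u (fun=> 0) w = 0.
    transitivity (-1 *: term_act u (fun=> 0) w + term_act u (fun=> 0) w).
      rewrite -term_actP; congr (term_act u _ _).
      by apply/funext => v; rewrite scaler0 addr0.
    by rewrite scaleN1r addNr.
  by rewrite addr0 => <-; congr (term_act u _ _); apply/funext => v; rewrite addr0.
elim=> {s t} //=.
- by move=> s t _ IH a Ha; rewrite IH.
- by move=> s t u _ IH _ IH' a Ha; rewrite IH ?IH'.
- by move=> s s' t t' _ IH _ IH' a Ha; rewrite IH ?IH'.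
- move=> s s' t t' _ IH _ IH' a Ha; rewrite IH' // IH //; exact: envfun_term.
- by move=> s t u a _; apply/funext => w; rewrite addrA.
- by move=> s t a _; apply/funext => w; rewrite addrC.
- by move=> s a _; apply/funext => w; rewrite scale0r add0r.
- by move=> s a _; apply/funext => w; rewrite !scale0r.
- by move=> s a _; apply/funext => w; rewrite scale1r.
- by move=> c d a _; apply/funext => w; rewrite scalerDl.
- by move=> c d a _; apply/funext => w; rewrite scalerA.
- move=> x y a [H1 _]; apply/funext => w; rewrite -!cats1.
  by have := H1 w [::] 1 x y; rewrite !scale1r.
- move=> c x a [H1 _]; apply/funext => w; rewrite -!cats1.
  have H0 : a (w ++ [:: 0]) = 0.
    have := H1 w [::] (-1) 0 0; rewrite scaler0 addr0 scaleN1r => E.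
    by rewrite E addNr.
  by have := H1 w [::] c x 0; rewrite !addr0 H0 addr0.
- move=> x y a [_ H2]; apply/funext => w; rewrite -!cats1 -!catA /=.
  by rewrite -H2 addrCA subrr addr0.
Qed.

(** On functions that satisfy the relations, right translation by terms is compatible with
    [env_rel]; hence evaluating the translate at the empty word is well defined on U. *)
Lemma envfun_lift a : envfun a ->
  exists phi : {linear U -> V}, forall w, phi (word w) = a w.
Proof.
move=> Ha; pose phi (u : U) := term_act (repr u) a [::].
have phiE t : phi (env_pi t) = term_act t a [::].
  by rewrite /phi (term_act_rel (env_repr_pi t)).
have lin : linear phi.
  move=> c u v; elim/envW: u => s; elim/envW: v => t.
  by rewrite -mulr_algl -env_pi_scalar -env_piM -env_piD !phiE /=.
exists (lin_pack lin) => w /=.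
pose wt := foldr (fun x t => EnvMul (EnvGen x) t) (EnvScalar 1) : seq g -> env_term g.
have -> : word w = env_pi (wt w).
  elim: w => [|x w IH] /=; first by rewrite word_nil env_pi_scalar scale1r.
  by rewrite word_cons IH env_piM.
rewrite phiE; have H v : term_act (wt w) a v = a (v ++ w).
  elim: w v => [|x w IH] v /=; first by rewrite scale1r cats0.
  by rewrite IH cat_rcons.
by rewrite H.
Qed.
End Functionals.

(* The coinduced module Hom_K(U(g), V), on which U(g) acts through right
   multiplication on U(g). *)
Section Coinduced.
Variable V : lmodType K.

Record cind := Cind { cfun :> U -> V; _ : `[< linear cfun >] }.
HB.instance Definition _ := gen_eqMixin cind.
HB.instance Definition _ := gen_choiceMixin cind.

Lemma cind_linear (f : cind) : linear f.
Proof. by case: f => f /= /asboolP. Qed.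
HB.instance Definition _ (f : cind) :=
  GRing.isLinear.Build K U V *:%R (cfun f) (cind_linear f).
Definition mkcind (f : U -> V) (H : linear f) : cind := Cind (asboolT H).

Lemma cind_addr (f : cind) u v : f (u + v) = f u + f v.
Proof. exact: linearD. Qed.
Lemma cind_scaler (f : cind) (c : K) u : f (c *: u) = c *: f u.
Proof. exact: linearZ. Qed.

Lemma cindP (f h : cind) : (forall u, f u = h u) -> f = h.
Proof.
case: f h => [f Hf] [h Hh] /= /funext E; move: Hf Hh; rewrite E => Hf Hh.
by rewrite (bool_irrelevance Hf Hh).
Qed.

Lemma cind_wordP (f h : cind) : (forall w, f (word w) = h (word w)) -> f = h.
Proof.
move=> E; apply: cindP => u; elim/env_word_ind: u => [|c w u IH].
  by rewrite !linear0.
by rewrite !linearP /= E IH.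
Qed.

Fact cind0_subproof : linear (fun _ : U => 0 : V).
Proof. by move=> c u v; rewrite scaler0 addr0. Qed.
Fact cindD_subproof (f h : cind) : linear (fun u => f u + h u).
Proof. by move=> c u v; rewrite !linearP scalerDr addrACA. Qed.
Fact cindN_subproof (f : cind) : linear (fun u => - f u).
Proof. by move=> c u v; rewrite linearP opprD scalerN. Qed.
Fact cindZ_subproof (r : U) (f : cind) : linear (fun u => f (u * r)).
Proof. by move=> c u v; rewrite mulrDl -scalerAl linearP. Qed.
Let c0 := mkcind cind0_subproof.
Let cadd f h := mkcind (cindD_subproof f h).
Let copp f := mkcind (cindN_subproof f).
Let cscale r f := mkcind (cindZ_subproof r f).
Fact caddA : associative cadd.
Proof. by move=> f h k; apply: cindP => u; rewrite /= addrA. Qed.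
Fact caddC : commutative cadd.
Proof. by move=> f h; apply: cindP => u; rewrite /= addrC. Qed.
Fact cadd0 : left_id c0 cadd.
Proof. by move=> f; apply: cindP => u; rewrite /= add0r. Qed.
Fact caddN : left_inverse c0 copp cadd.
Proof. by move=> f; apply: cindP => u; rewrite /= addNr. Qed.
HB.instance Definition _ := GRing.isZmodule.Build cind caddA caddC cadd0 caddN.
Fact cscaleA r s f : cscale r (cscale s f) = cscale (r * s) f.
Proof. by apply: cindP => u; rewrite /= mulrA. Qed.
Fact cscale1 : left_id 1 cscale.
Proof. by move=> f; apply: cindP => u; rewrite /= mulr1. Qed.
Fact cscaleDr : right_distributive cscale +%R.
Proof. by move=> r f h; apply: cindP => u. Qed.
Fact cscaleDl f : {morph cscale^~ f : r s / r + s}.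
Proof. by move=> r s; apply: cindP => u; rewrite /= mulrDr linearD. Qed.
HB.instance Definition _ := GRing.Zmodule_isLmodule.Build U cind
  cscaleA cscale1 cscaleDr cscaleDl.

Lemma cind0E u : (0 : cind) u = 0. Proof. by []. Qed.
Lemma cindDE (f h : cind) u : (f + h) u = f u + h u. Proof. by []. Qed.
Lemma cindNE (f : cind) u : (- f) u = - f u. Proof. by []. Qed.
Lemma cindZE r (f : cind) u : (r *: f) u = f (u * r). Proof. by []. Qed.
Lemma cindKE (c : K) (f : cind) u : (c%:A *: f) u = c *: f u.
Proof. by rewrite cindZE -scalerAr mulr1 linearZ. Qed.
Lemma cind_sumE I (r : seq I) (P : pred I) (F : I -> cind) u :
  (\sum_(i <- r | P i) F i) u = \sum_(i <- r | P i) F i u.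
Proof. by elim/big_rec2: _ => // i y1 y2 _ <-. Qed.

Definition cind_of (a : seq g -> V) (Ha : envfun a) : cind :=
  mkcind (linearP (projT1 (cid (envfun_lift Ha)))).
Lemma cind_ofE a (Ha : envfun a) w : cind_of Ha (word w) = a w.
Proof. by rewrite /cind_of /=; case: cid => /= phi ->. Qed.
Lemma cind_envfun (f : cind) : envfun (fun w => f (word w)).
Proof. exact: envfun_word (@cind_linear f). Qed.

Definition cleft x (f : cind) : cind.
refine (@mkcind (fun u => f (env_inj x * u)) _).
abstract (by move=> c u v; rewrite mulrDr -scalerAr linearP).
Defined.
Lemma cleftE x f u : cleft x f u = f (env_inj x * u). Proof. by []. Qed.

(* [cfil m f] : f vanishes on the filtration step U_(m-1). *)
Definition cfil m (f : cind) : Prop := forall w, (size w < m)%N -> f (word w) = 0.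

Lemma cfil0 f : cfil 0 f. Proof. by []. Qed.
Lemma cfil_zero m : cfil m 0. Proof. by []. Qed.
Lemma cfilD m f h : cfil m f -> cfil m h -> cfil m (f + h).
Proof. by move=> Hf Hh w sw; rewrite cindDE Hf ?Hh ?addr0. Qed.
Lemma cfilN m f : cfil m f -> cfil m (- f).
Proof. by move=> Hf w sw; rewrite cindNE Hf ?oppr0. Qed.
Lemma cfilB m f h : cfil m f -> cfil m h -> cfil m (f - h).
Proof. by move=> Hf Hh; apply: cfilD => //; exact: cfilN. Qed.
Lemma cfilK m c f : cfil m f -> cfil m (c%:A *: f).
Proof. by move=> Hf w sw; rewrite cindKE Hf ?scaler0. Qed.
Lemma cfil_sum m I (r : seq I) (P : pred I) (F : I -> cind) :
  (forall i, P i -> cfil m (F i)) -> cfil m (\sum_(i <- r | P i) F i).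
Proof. by move=> H; elim/big_ind: _ => //; exact: cfilD. Qed.
Lemma cfil_leq m n f : (n <= m)%N -> cfil m f -> cfil n f.
Proof. by move=> nm Hf w sw; apply: Hf; exact: leq_trans nm. Qed.
Lemma cfil_gen m x f : cfil m.+1 f -> cfil m (env_inj x *: f).
Proof. by move=> Hf w sw; rewrite cindZE -word_rcons; apply: Hf; rewrite size_rcons. Qed.
Lemma cfil_left m x f : cfil m.+1 f -> cfil m (cleft x f).
Proof. by move=> Hf w sw; rewrite cleftE -word_cons; exact: Hf. Qed.
Lemma cfil_eq0 f : (forall m, cfil m f) -> f = 0.
Proof. by move=> Hf; apply: cind_wordP => w; rewrite (Hf (size w).+1). Qed.

(* Completeness for the filtration. *)
Lemma cfil_complete (a : nat -> cind) :
  (forall n, cfil n.+1 (a n.+1 - a n)) -> exists f, forall n, cfil n.+1 (f - a n).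
Proof.
move=> Ha; have stab n k w : (size w <= n)%N -> a (k + n)%N (word w) = a n (word w).
  elim: k => // k IH sw; rewrite addSn -IH //.
  have := Ha (k + n)%N w; rewrite cindDE cindNE => H; apply/eqP.
  by rewrite -subr_eq0 H // ltnS (leq_trans sw) // leq_addl.
have stab' m n w : (size w <= n)%N -> (n <= m)%N -> a m (word w) = a n (word w).
  by move=> sw nm; rewrite -(subnK nm) stab.
have Hl : envfun (fun w => a (size w) (word w)).
  split=> [w1 w2 c x y|w1 w2 x y]; rewrite !size_cat /=.
    by case: (cind_envfun (a (size w1 + (size w2).+1)%N)) => H _; rewrite H.
  case: (cind_envfun (a (size w1 + (size w2).+2)%N)) => _ H; rewrite H.
  by apply: stab'; rewrite ?size_cat /= ?leq_add2l.
exists (cind_of Hl) => n w; rewrite ltnS => sw.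
by rewrite cindDE cindNE cind_ofE (stab' n (size w) w) // subrr.
Qed.

(** The sum of a series whose j-th term has order at least j, characterized by its partial sums; the
    default 0 never occurs for such series. *)
Definition cseries (b : nat -> cind) : cind :=
  xget 0 (fun f => forall n, cfil n (f - \sum_(j < n) b j)).

Lemma cseriesP b : (forall j, cfil j (b j)) ->
  forall n, cfil n (cseries b - \sum_(j < n) b j).
Proof.
move=> Hb; rewrite /cseries; case: xgetP => [f _ //|].
have [n|f Hf] := @cfil_complete (fun n => \sum_(j < n.+1) b j).
  by rewrite /= [X in cfil _ (X - _)]big_ord_recr /= addrAC subrr add0r.
move=> /(_ f)[] // [|n]; first by [].
exact: Hf.
Qed.

Lemma cseries_unique b f : (forall j, cfil j (b j)) ->
  (forall n, cfil n (f - \sum_(j < n) b j)) -> cseries b = f.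
Proof.
move=> Hb Hf; apply/eqP; rewrite -subr_eq0; apply/eqP/cfil_eq0 => n.
have -> : cseries b - f = (cseries b - \sum_(j < n) b j) - (f - \sum_(j < n) b j).
  by rewrite opprB addrA subrK.
by apply: cfilB => //; exact: cseriesP.
Qed.
End Coinduced.

(** * Products of formal functions on the group *)

Section Convolution.
Variable V : lmodType K.
Implicit Types (f h : seq g -> K^o) (p q : seq g -> V).

(* Convolution along the unshuffling coproduct of words, under which the
   generators of g are primitive. *)
Fixpoint lconv (W : lmodType K) (f : seq g -> K^o) (p : seq g -> W) w : W :=
  if w is x :: w' then lconv (fun v => f (x :: v)) p w' + lconv f (fun v => p (x :: v)) w'
  else (f [::] : K) *: p [::].

Lemma lconvDr f c p q w : lconv f (fun v => c *: p v + q v) w =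
  c *: lconv f p w + lconv f q w.
Proof.
elim: w f p q => [|x w IH] f p q /=; first by rewrite scalerDr !scalerA mulrC.
by rewrite !IH scalerDr addrACA.
Qed.
Lemma lconvDl f h (c : K) p w : lconv (fun v => c *: f v + h v) p w =
  c *: lconv f p w + lconv h p w.
Proof.
elim: w f h p => [|x w IH] f h p /=; first by rewrite scalerDl scalerA.
by rewrite !IH scalerDr addrACA.
Qed.

Lemma lconv_vanish f p a b w : (forall v, (size v < a)%N -> f v = 0) ->
  (forall v, (size v < b)%N -> p v = 0) -> (size w < a + b)%N -> lconv f p w = 0.
Proof.
elim: w f p a b => [|x w IH] f p a b Hf Hp /=; last first.
  have Hf' v : (size v < a.-1)%N -> f (x :: v) = 0.
    by move=> sv; apply: Hf; case: a sv.
  have Hp' v : (size v < b.-1)%N -> p (x :: v) = 0.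
    by move=> sv; apply: Hp; case: b sv.
  move=> sw; rewrite (IH _ _ a.-1 b) ?(IH _ _ a b.-1) ?addr0 //.
    by case: b {Hp Hp'} sw => [|b]; rewrite ?addn0 ?addnS ?ltnS //; exact: ltnW.
  by case: a {Hf Hf'} sw => [|a]; rewrite ?addSn ?ltnS //; exact: ltnW.
  by case: a Hf => [|a] Hf ?; [rewrite Hp ?scaler0|rewrite Hf ?scale0r].
Qed.

(** An unshuffling that gives a letter to f leaves p a word shorter than w, where p vanishes. *)
Lemma lconv_head f p w : (forall v, (size v < size w)%N -> p v = 0) ->
  lconv f p w = (f [::] : K) *: p w.
Proof.
elim: w f p => [//|x w IH] f p Hp /=.
rewrite (lconv_vanish (a := 0) (b := (size w).+1)) // add0r IH // => v sv.
exact: Hp.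
Qed.

Lemma lconv_comm f h p w : lconv f (lconv h p) w = lconv h (lconv f p) w.
Proof.
elim: w f h p => [|x w IH] f h p /=; first by rewrite !scalerA mulrC.
have E f' h' p' : lconv f' (fun v => lconv (fun v => h' (x :: v)) p' v +
    lconv h' (fun v => p' (x :: v)) v) w = lconv f' (lconv (fun v => h' (x :: v)) p') w
    + lconv f' (lconv h' (fun v => p' (x :: v))) w.
  rewrite -[X in X + _]scale1r -lconvDr; congr (lconv f' _ w).
  by apply/funext => v; rewrite scale1r.
rewrite !E (IH (fun v => f (x :: v)) h p) (IH f (fun v => h (x :: v)) p).
by rewrite (IH f h) addrCA.
Qed.

Lemma lconvA f h p w : lconv (lconv f h) p w = lconv f (lconv h p) w.
Proof.
elim: w f h p => [|x w IH] f h p /=; first by rewrite scalerA.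
rewrite -!IH.
have -> : lconv (fun v => lconv (fun v => f (x :: v)) h v + lconv f (fun v => h (x :: v)) v) p w
  = lconv (lconv (fun v => f (x :: v)) h) p w + lconv (lconv f (fun v => h (x :: v))) p w.
  rewrite -[X in X + _]scale1r -lconvDl; congr (lconv _ p w).
  by apply/funext => v; rewrite scale1r.
rewrite -addrA; congr (_ + _); rewrite !IH.
rewrite -[X in X + _]scale1r -lconvDr; congr (lconv f _ w).
by apply/funext => v; rewrite scale1r.
Qed.

Lemma lconv_rcons f p w x : lconv f p (rcons w x) =
  lconv (fun v => f (rcons v x)) p w + lconv f (fun v => p (rcons v x)) w.
Proof. by elim: w f p => [|y w IH] f p //=; rewrite !IH addrACA. Qed.

Lemma lconv1 p w : lconv (fun v => (v == [::])%:R) p w = p w.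
Proof.
elim: w p => [|x w IH] p /=; first by rewrite scale1r.
rewrite IH (@lconv_vanish _ _ (size w).+1 0) ?add0r //.
by rewrite addn0.
Qed.

(** Because letters are primitive, the mixed terms of x y - y x cancel, so the coproduct respects
    the relations; the prefix [w1] is handled by induction. *)
Lemma lconv_envfun f p : envfun f -> envfun p -> envfun (lconv f p).
Proof.
have cons_fun (W : lmodType K) (a : seq g -> W) x :
    envfun a -> envfun (fun v => a (x :: v)).
  by move=> [H1 H2]; split=> w1 w2 *; [exact: (H1 (x :: w1))|exact: (H2 (x :: w1))].
move=> Hf Hp; split=> [w1|w1]; last first.
  elim: w1 f p Hf Hp => [|z w1 IH] f p Hf Hp w2 x y; last first.
    by rewrite /= opprD addrACA !IH //; exact: cons_fun.
  rewrite /=.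
  case: (Hf) => _ /(_ [::] _ x y)/= Ef; case: (Hp) => _ /(_ [::] _ x y)/= Ep.
  have -> : (fun v => f (lie x y :: v)) =
      (fun v => (-1) *: f [:: y, x & v] + f [:: x, y & v]).
    by apply/funext => v; rewrite -Ef scaleN1r addrC.
  have -> : (fun v => p (lie x y :: v)) =
      (fun v => (-1) *: p [:: y, x & v] + p [:: x, y & v]).
    by apply/funext => v; rewrite -Ep scaleN1r addrC.
  rewrite lconvDl lconvDr !scaleN1r.
  apply/eqP; rewrite subr_eq (addrC (- lconv _ _ _)) (addrC (- lconv f _ _)); apply/eqP.
  rewrite addrACA [RHS]addrACA; congr (_ + _); first by rewrite subrKA.
  by rewrite [X in _ = _ + X]addrC subrKA addrC.
elim: w1 f p Hf Hp => [|z w1 IH] f p Hf Hp w2 c x y; last first.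
  rewrite /= (IH (fun v => f (z :: v)) p (cons_fun _ _ _ Hf) Hp).
  by rewrite (IH f _ Hf (cons_fun _ _ _ Hp)) scalerDr addrACA.
case: (Hf) => /(_ [::] _ c x y)/= Ef _; case: (Hp) => /(_ [::] _ c x y)/= Ep _.
have -> : (fun v => f ((c *: x + y) :: v)) = (fun v => c *: f (x :: v) + f (y :: v)).
  by apply/funext => v; exact: Ef.
have -> : (fun v => p ((c *: x + y) :: v)) = (fun v => c *: p (x :: v) + p (y :: v)).
  by apply/funext => v; exact: Ep.
by rewrite lconvDl lconvDr scalerDr addrACA.
Qed.
End Convolution.
End Words.

Lemma zmod_commutator (M : zmodType) (a b c d e f : M) :
  a - b - (c - d) = a - e - (f - d) - (b - f - (e - c)).
Proof.
rewrite !opprB [RHS]addrACA !subrKA.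
by rewrite addrACA [RHS]addrACA [- c + - b]addrC.
Qed.

Section CindConvolution.
Variables (K : fieldType) (g : lieAlgType K) (V : lmodType K).
Implicit Types (f h : cind g K^o) (p q : cind g V) (x : g).

(** Multiplication of W-valued functions by scalar functions. Left and right translations act as
    derivations ([cconv_left], [cconv_gen]), and orders of vanishing add up ([cfil_conv]). *)
Definition cconv (W : lmodType K) f (p : cind g W) : cind g W :=
  cind_of (lconv_envfun (cind_envfun f) (cind_envfun p)).

Lemma cconvE (W : lmodType K) f (p : cind g W) w : cconv f p (word w) =
  lconv (fun v => f (word v)) (fun v => p (word v)) w.
Proof. exact: cind_ofE. Qed.

Lemma cconvPr f (c : K) p q : cconv f (c%:A *: p + q) = c%:A *: cconv f p + cconv f q.
Proof.
apply: cind_wordP => w; rewrite cindDE cindKE !cconvE -lconvDr.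
by congr (lconv _ _ w); apply/funext => v; rewrite cindDE cindKE.
Qed.
Lemma cconvPl f h (c : K) p : cconv (c%:A *: f + h) p = c%:A *: cconv f p + cconv h p.
Proof.
apply: cind_wordP => w; rewrite cindDE cindKE !cconvE -lconvDl.
by congr (lconv _ _ w); apply/funext => v; rewrite cindDE cindKE.
Qed.
Lemma cconvDr f p q : cconv f (p + q) = cconv f p + cconv f q.
Proof. by have := cconvPr f 1 p q; rewrite !scale1r. Qed.
Lemma cconv0r f : cconv f (0 : cind g V) = 0.
Proof.
by apply: (addrI (cconv f 0)); rewrite -cconvDr !addr0.
Qed.
Lemma cconvKr f (c : K) p : cconv f (c%:A *: p) = c%:A *: cconv f p.
Proof. by have := cconvPr f c p 0; rewrite cconv0r !addr0. Qed.
Lemma cconvNr f p : cconv f (- p) = - cconv f p.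
Proof. by apply: (addrI (cconv f p)); rewrite -cconvDr !subrr cconv0r. Qed.
Lemma cconvBr f p q : cconv f (p - q) = cconv f p - cconv f q.
Proof. by rewrite cconvDr cconvNr. Qed.
Lemma cconvDl f h p : cconv (f + h) p = cconv f p + cconv h p.
Proof. by have := cconvPl f h 1 p; rewrite !scale1r. Qed.
Lemma cconv0l p : cconv 0 p = 0.
Proof. by apply: (addrI (cconv 0 p)); rewrite -cconvDl !addr0. Qed.
Lemma cconvNl f p : cconv (- f) p = - cconv f p.
Proof. by apply: (addrI (cconv f p)); rewrite -cconvDl !subrr cconv0l. Qed.

Lemma cconv_left x f p : cleft x (cconv f p) = cconv (cleft x f) p + cconv f (cleft x p).
Proof.
apply: cind_wordP => w; rewrite cindDE cleftE -word_cons !cconvE /=.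
by congr (_ + _); [congr (lconv _ _ w)|congr (lconv _ _ w)];
  apply/funext => v; rewrite word_cons.
Qed.
Lemma cconv_gen x f p : env_inj x *: cconv f p =
  cconv (env_inj x *: f) p + cconv f (env_inj x *: p).
Proof.
apply: cind_wordP => w; rewrite cindDE cindZE -word_rcons !cconvE lconv_rcons.
by congr (_ + _); [congr (lconv _ _ w)|congr (lconv _ _ w)];
  apply/funext => v; rewrite word_rcons.
Qed.
Lemma cconv_comm f h p : cconv f (cconv h p) = cconv h (cconv f p).
Proof.
apply: cind_wordP => w; rewrite !cconvE.
have E a b : (fun v => cconv a (b : cind g V) (word v)) = lconv (fun v => a (word v)) (fun v => b (word v)).
  by apply/funext => v; exact: cconvE.
by rewrite !E lconv_comm.
Qed.
Lemma cconvA f h p : cconv (cconv f h) p = cconv f (cconv h p).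
Proof.
apply: cind_wordP => w; rewrite !cconvE.
have E (W : lmodType K) a (b : cind g W) : (fun v => cconv a b (word v)) = lconv (fun v => a (word v)) (fun v => b (word v)).
  by apply/funext => v; exact: cconvE.
by rewrite !E lconvA.
Qed.
Lemma cfil_conv a b f p : cfil a f -> cfil b p -> cfil (a + b) (cconv f p).
Proof.
move=> Hf Hp w sw; rewrite cconvE; exact: (lconv_vanish Hf Hp sw).
Qed.

Fact eps_envfun : envfun (g := g) (fun w => (w == [::])%:R : K^o).
Proof.
by split=> [[|? ?] w2 c x y|[|? ?] w2 x y]; rewrite /= ?scaler0 ?addr0 ?subrr.
Qed.
Definition ceps : cind g K^o := cind_of eps_envfun.
Lemma cepsE w : ceps (word w) = (w == [::])%:R. Proof. exact: cind_ofE. Qed.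
Lemma cconv1 p : cconv ceps p = p.
Proof.
apply: cind_wordP => w; rewrite cconvE -[RHS](lconv1 (fun v => p (word v))).
by congr (lconv _ _ w); apply/funext => v; exact: cepsE.
Qed.
Lemma ceps_gen x : env_inj x *: ceps = 0.
Proof.
by apply: cind_wordP => w; rewrite cindZE -word_rcons cepsE; case: w.
Qed.
Lemma ceps_left x : cleft x ceps = 0.
Proof. by apply: cind_wordP => w; rewrite cleftE -word_cons cepsE. Qed.
End CindConvolution.
Arguments ceps {K g}.

Section KModule.
Variables (K : fieldType) (g : lieAlgType K) (N : lmodType (envalg g)).

(** A copy of N that carries the scalar multiplication by K, since N already carries the one by
    U. *)
Definition kmod : Type := N.
HB.instance Definition _ := GRing.Zmodule.on kmod.
Let kscale (c : K) (n : kmod) : kmod := (c%:A : envalg g) *: (n : N).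
Fact kscaleA a b n : kscale a (kscale b n) = kscale (a * b) n.
Proof. by rewrite /kscale scalerA mulr_algl scalerA. Qed.
Fact kscale1 : left_id 1 kscale.
Proof. by move=> n; rewrite /kscale !scale1r. Qed.
Fact kscaleDr : right_distributive kscale +%R.
Proof. by move=> c m n; exact: scalerDr. Qed.
Fact kscaleDl n : {morph kscale^~ n : a b / a + b}.
Proof. by move=> a b; rewrite /kscale scalerDl; exact: scalerDl. Qed.
HB.instance Definition _ :=
  GRing.Zmodule_isLmodule.Build K kmod kscaleA kscale1 kscaleDr kscaleDl.
Lemma kmodZ (c : K) (n : N) : c *: (n : kmod) = (c%:A : envalg g) *: n.
Proof. by []. Qed.
Lemma kmod_scale0 u (n : kmod) : n = 0 -> (u *: (n : N) : N) = 0 :> kmod.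
Proof. by move=> ->; rewrite [u *: _](scaler0 N u). Qed.
End KModule.

Lemma kmod_linear (K : fieldType) (g : lieAlgType K) (A B : lmodType (envalg g))
  (f : {linear A -> B}) : linear (f : kmod A -> kmod B).
Proof. by move=> c x y; rewrite !kmodZ linearP. Qed.

(** * The Chevalley-Eilenberg complex with coinduced coefficients *)

Section ChevalleyEilenberg.
Variables (K : numClosedFieldType) (g : lieAlgType K) (N : lmodType (envalg g)).
Local Notation U := (envalg g).
Local Notation H := (cind g (kmod N)).
Local Notation T := (seq g -> H).
Implicit Types (x y z : g) (s : seq g) (p q : H) (om : T).

Definition cpost x p : H.
refine (@mkcind K g (kmod N) (fun u => (env_inj x *: (p u : N) : N)) _).
abstract (by move=> c u v; rewrite linearP /= !kmodZ scalerDr !scalerA mulr_algr mulr_algl).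
Defined.
(* [rho] and [Ld] are sealed to keep rewriting from unfolding them. *)
Fact rho_subproof : { f : g -> H -> H | forall x p, f x p = cpost x p - cleft x p }.
Proof. by exists (fun x p => cpost x p - cleft x p). Qed.
Definition rho := sval rho_subproof.

(** [rho] combines the action on N with left translation on U. It commutes with right translation,
    so it is U-linear ([rhoP]), and its invariants are the U-linear maps from U to N. *)
Lemma rhoE x p u : rho x p u = (env_inj x *: (p u : N) : N) - p (env_inj x * u).
Proof. by rewrite /rho (svalP rho_subproof). Qed.
Lemma rhoP x r p q : rho x (r *: p + q) = r *: rho x p + rho x q.
Proof.
apply: cindP => u; rewrite [RHS]cindDE cindZE !rhoE cindDE !cindZE !cindDE cindZE mulrA scalerDr.
by rewrite opprD addrACA.
Qed.
Lemma rho0 x : rho x 0 = 0.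
Proof.
apply: (addrI (rho x 0)); rewrite addr0.
by have := rhoP x 1 0 0; rewrite !scale1r addr0.
Qed.
Lemma rhoB x p q : rho x (p - q) = rho x p - rho x q.
Proof. by rewrite addrC -scaleN1r rhoP scaleN1r addrC. Qed.
Lemma rho_linx (c : K) x y p : rho (c *: x + y) p = c%:A *: rho x p + rho y p.
Proof.
apply: cindP => u; rewrite [RHS]cindDE cindKE !rhoE.
rewrite linearP /= scalerDl mulrDl linearD -scalerAl linearZ /= scalerBr.
by rewrite !kmodZ scalerA mulr_algl opprD addrACA.
Qed.
Lemma rho_lie x y p : rho (lie x y) p = rho x (rho y p) - rho y (rho x p).
Proof.
apply: cindP => u; rewrite [RHS]cindDE [X in _ + X]cindNE !rhoE env_inj_lie scalerBl mulrBl linearB /=.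
rewrite !scalerBr !scalerA !mulrA.
exact: zmod_commutator.
Qed.

(** The action of x on the arguments of om; [Ld x], which combines it with [rho x], is the Lie
    derivative along x. *)
Fixpoint lieact x (om : T) s : H :=
  if s is y :: s' then om (lie x y :: s') + lieact x (fun v => om (y :: v)) s'
  else 0.
Fact Ld_subproof : { f : g -> T -> T |
  forall x om s, f x om s = rho x (om s) - lieact x om s }.
Proof. by exists (fun x om s => rho x (om s) - lieact x om s). Qed.
Definition Ld := sval Ld_subproof.
Lemma LdE x om s : Ld x om s = rho x (om s) - lieact x om s.
Proof. exact: (svalP Ld_subproof). Qed.
(** The differential is defined through Cartan's formula i_x d = L_x - d i_x, by recursion on the
    arguments. *)
Fixpoint ced (om : T) s : H :=
  if s is x :: s' then Ld x om s' - ced (fun v => om (x :: v)) s' else 0.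

Lemma lieactP x r om om' s : lieact x (r *: om + om') s = r *: lieact x om s + lieact x om' s.
Proof.
elim: s om om' => [|y s IH] om om' /=; first by rewrite scaler0 addr0.
have -> : (fun v => (r *: om + om') (y :: v)) =
  r *: (fun v => om (y :: v)) + (fun v => om' (y :: v)) by [].
by rewrite IH scalerDr addrACA.
Qed.
Lemma LdP x r om om' : Ld x (r *: om + om') = r *: Ld x om + Ld x om'.
Proof.
apply/funext => s; rewrite -[RHS]/(r *: Ld x om s + Ld x om' s).
by rewrite !LdE lieactP rhoP opprD addrACA scalerBr.
Qed.
Fact ced_linear : linear (ced : T -> T).
Proof.
move=> r om om'; apply/funext => s.
rewrite -[RHS]/(r *: ced om s + ced om' s).
elim: s om om' => [|x s IH] om om' /=; first by rewrite scaler0 addr0.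
have -> : (fun v => (r *: om + om') (x :: v)) =
  r *: (fun v => om (x :: v)) + (fun v => om' (x :: v)) by [].
rewrite IH LdP -[(_ + _) s]/(r *: Ld x om s + Ld x om' s).
by rewrite scalerBr opprD addrACA.
Qed.
HB.instance Definition _ := GRing.isLinear.Build U T T *:%R ced ced_linear.

Definition multi om : Prop := forall s1 s2 (c : K) x y,
  om (s1 ++ (c *: x + y) :: s2) = c%:A *: om (s1 ++ x :: s2) + om (s1 ++ y :: s2).
Definition alt om : Prop := forall s1 s2 x, om (s1 ++ [:: x, x & s2]) = 0.
(** All degrees share the module T, which is why a k-form is set to zero on lists of other
    lengths. *)
Definition form k om : Prop := [/\ multi om, alt om & forall s, size s != k -> om s = 0].

Lemma multi_cons om x : multi om -> multi (fun s => om (x :: s)).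
Proof. by move=> Hm s1 s2 c y z; exact: (Hm (x :: s1)). Qed.
Lemma alt_cons om x : alt om -> alt (fun s => om (x :: s)).
Proof. by move=> Ha s1 s2 y; exact: (Ha (x :: s1)). Qed.
Lemma form_cons k om x : form k.+1 om -> form k (fun s => om (x :: s)).
Proof.
by move=> [Hm Ha Hs]; split; [exact: multi_cons|exact: alt_cons|move=> s sk; exact: Hs].
Qed.
Lemma multiD om s1 s2 x y : multi om -> om (s1 ++ (x + y) :: s2) =
  om (s1 ++ x :: s2) + om (s1 ++ y :: s2).
Proof. by move=> /(_ s1 s2 1 x y); rewrite !scale1r. Qed.
Lemma multi0 om s1 s2 : multi om -> om (s1 ++ 0 :: s2) = 0.
Proof.
move=> Hm; apply: (addrI (om (s1 ++ 0 :: s2))).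
by rewrite -multiD // !addr0.
Qed.
Lemma multiN om s1 s2 x : multi om -> om (s1 ++ - x :: s2) = - om (s1 ++ x :: s2).
Proof.
move=> Hm; apply: (addrI (om (s1 ++ x :: s2))).
by rewrite -multiD // !subrr multi0.
Qed.
Lemma alt_swap om s1 s2 x y : multi om -> alt om ->
  om (s1 ++ [:: x, y & s2]) = - om (s1 ++ [:: y, x & s2]).
Proof.
move=> Hm Ha; apply/eqP; rewrite -addr_eq0; apply/eqP.
have := Ha s1 s2 (x + y); rewrite multiD // -(cat_rcons x) -(cat_rcons y).
rewrite (multiD (rcons s1 x)) // (multiD (rcons s1 y)) // !cat_rcons !Ha.
by rewrite add0r addr0.
Qed.

Lemma submod_form k : submod (form k).
Proof.
split.
  split=> // s1 s2 c x y; transitivity (c%:A *: (0 : H) + 0) => //.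
  by rewrite scaler0 addr0.
move=> r om om' [Hm Ha Hs] [Hm' Ha' Hs']; split=> [s1 s2 c x y|s1 s2 x|s sk].
- rewrite -[LHS]/(r *: om _ + om' _) -[X in _ = _ *: X + _]/(r *: om _ + om' _).
  rewrite -[X in _ = _ + X]/(r *: om _ + om' _) Hm Hm' !scalerDr !scalerA.
  by rewrite mulr_algl mulr_algr addrACA.
- by rewrite -[LHS]/(r *: om _ + om' _) Ha Ha' scaler0 addr0.
- by rewrite -[LHS]/(r *: om _ + om' _) Hs // Hs' // scaler0 addr0.
Qed.

Lemma Ld_cons x om y s : Ld x om (y :: s) =
  Ld x (fun v => om (y :: v)) s - om (lie x y :: s).
Proof. by rewrite !LdE /= opprD addrA addrAC. Qed.

Lemma lie_addl x x' y : lie (x + x') y = lie x y + lie x' y.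
Proof. by have := lie_linearl y 1 x x'; rewrite !scale1r. Qed.
Lemma lie_zl (c : K) x x' y : lie (c *: x + x') y = c *: lie x y + lie x' y.
Proof. exact: (lie_linearl y c x x'). Qed.
Lemma lie_zr (c : K) x y y' : lie x (c *: y + y') = c *: lie x y + lie x y'.
Proof. exact: (lie_linearr x c y y'). Qed.
Lemma lie_anti x y : lie x y = - lie y x.
Proof.
apply/eqP; rewrite -addr_eq0; apply/eqP; have := lie_alt (x + y).
by rewrite lie_addl !linearD /= !lie_alt add0r addr0 addrC.
Qed.
Lemma lie_jac x y z : lie (lie x y) z = lie x (lie y z) - lie y (lie x z).
Proof.
have := lie_jacobi x y z => /eqP; rewrite addr_eq0 => /eqP E.
by rewrite lie_anti -E [lie z x]lie_anti linearN.
Qed.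

Lemma Ld_lie x y om : multi om -> forall s,
  Ld x (Ld y om) s - Ld y (Ld x om) s = Ld (lie x y) om s.
Proof.
move=> Hm s; elim: s om Hm => [|z s IH] om Hm.
  by rewrite !LdE /= !subr0 rho_lie.
have Hz u := multi_cons u Hm.
have consE u v : (fun w => Ld u om (v :: w)) =
    Ld u (fun w => om (v :: w)) - (fun w => om (lie u v :: w)).
  by apply/funext => w; exact: Ld_cons.
have LB u (a b : T) : Ld u (a - b) = Ld u a - Ld u b.
  by rewrite addrC -scaleN1r LdP scaleN1r addrC.
rewrite !(Ld_cons _ (Ld _ _)) !consE !LB !Ld_cons lie_jac.
rewrite -(IH _ (Hz z)).
have -> : om ((lie x (lie y z) - lie y (lie x z)) :: s) =
    om (lie x (lie y z) :: s) - om (lie y (lie x z) :: s).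
  by have /= -> := multiD [::] s (lie x (lie y z)) (- lie y (lie x z)) Hm;
    have /= -> := multiN [::] s (lie y (lie x z)) Hm.
have bE (a b : T) : (a - b) s = a s - b s by [].
rewrite !bE.
exact/esym/zmod_commutator.
Qed.

Lemma Ld_consE u v om : (fun w => Ld u om (v :: w)) =
  Ld u (fun w => om (v :: w)) - (fun w => om (lie u v :: w)).
Proof. by apply/funext => w; exact: Ld_cons. Qed.

Lemma ced_consE v om : (fun w => ced om (v :: w)) =
  Ld v om - ced (fun w => om (v :: w)).
Proof. by apply/funext. Qed.

Lemma LdB u om om' : Ld u (om - om') = Ld u om - Ld u om'.
Proof. by rewrite addrC -scaleN1r LdP scaleN1r addrC. Qed.

Lemma Ld_ced x om : multi om -> Ld x (ced om) = ced (Ld x om).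
Proof.
move=> Hm; apply/funext => s; elim: s om Hm => [|y s IH] om Hm.
  by rewrite LdE /= subr0 rho0.
have bE (a b : T) : (a - b) s = a s - b s by [].
have cB (a b : T) : ced (a - b) s = ced a s - ced b s by rewrite linearB.
rewrite Ld_cons ced_consE LdB /= -(Ld_lie _ _ Hm) Ld_consE.
rewrite cB bE (IH _ (multi_cons y Hm)).
set a := Ld x (Ld y om) s; set b := Ld y _ s; set c := ced _ s; set d := ced _ s.
rewrite !opprB [d + _]addrC addrA [a - c + _]addrC subrKA.
by rewrite addrAC [RHS]addrA.
Qed.

(** By Cartan's formula i_x d d = (L_x d - d L_x) + d d i_x; the bracket vanishes by [Ld_ced], the
    last term by induction. *)
Lemma ced_ced om : multi om -> ced (ced om) = 0.
Proof.
move=> Hm; apply/funext => s; elim: s om Hm => [//|x s IH] om Hm.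
have cB (a b : T) : ced (a - b) s = ced a s - ced b s by rewrite linearB.
rewrite /= (Ld_ced x Hm) ced_consE cB.
by rewrite (IH _ (multi_cons x Hm)) subr0 subrr.
Qed.

Lemma multi_consP (c : K) x y om : multi om -> (fun s => om ((c *: x + y) :: s)) =
  c%:A *: (fun s => om (x :: s)) + (fun s => om (y :: s)).
Proof. by move=> Hm; apply/funext => s; exact: (Hm [::] s). Qed.

Lemma multi_lieact x om : multi om -> multi (lieact x om).
Proof.
move=> Hm s1; elim: s1 om Hm => [|z s1 IH] om Hm s2 c y y' /=.
  rewrite lie_zr; have /= -> := Hm [::] s2 c (lie x y) (lie x y').
  by rewrite multi_consP // lieactP scalerDr addrACA.
have /= -> := Hm (lie x z :: s1) s2 c y y'.
by rewrite (IH _ (multi_cons z Hm)) scalerDr addrACA.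
Qed.

Lemma lieact_linx (c : K) x y om s : multi om ->
  lieact (c *: x + y) om s = c%:A *: lieact x om s + lieact y om s.
Proof.
elim: s om => [|z s IH] om Hm /=; first by rewrite scaler0 addr0.
rewrite (IH _ (multi_cons z Hm)) lie_zl; have /= -> := Hm [::] s c (lie x z) (lie y z).
by rewrite scalerDr addrACA.
Qed.

Lemma lieact_vanish x om s : (forall v, size v = size s -> om v = 0) ->
  lieact x om s = 0.
Proof.
elim: s om => [//|y s IH] om H /=; rewrite H // add0r; apply: IH => v sv.
by apply: H; rewrite /= sv.
Qed.

Lemma alt_lieact x om : multi om -> alt om -> alt (lieact x om).
Proof.
move=> Hm Ha s1; elim: s1 om Hm Ha => [|z s1 IH] om Hm Ha s2 y /=.
  rewrite lieact_vanish; last by move=> v _; exact: (Ha [::]).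
  rewrite addr0; have /= -> := alt_swap [::] s2 (lie x y) y Hm Ha.
  by rewrite addNr.
have /= -> := Ha (lie x z :: s1) s2 y.
by rewrite add0r (IH _ (multi_cons z Hm) (alt_cons z Ha)).
Qed.

Lemma form_Ld k x om : form k om -> form k (Ld x om).
Proof.
move=> [Hm Ha Hs]; split=> [s1 s2 c y z|s1 s2 y|s sk]; rewrite !LdE.
- rewrite Hm rhoP (multi_lieact x Hm) opprD addrACA.
  by rewrite -scalerBr.
- by rewrite Ha rho0 (alt_lieact x Hm Ha) subr0.
- rewrite Hs // rho0 lieact_vanish ?subr0 // => v sv.
  by apply: Hs; rewrite sv.
Qed.

Lemma Ld_linx (c : K) x y om s : multi om ->
  Ld (c *: x + y) om s = c%:A *: Ld x om s + Ld y om s.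
Proof.
by move=> Hm; rewrite !LdE rho_linx lieact_linx // opprD addrACA -scalerBr.
Qed.

Lemma cedP r om om' s : ced (r *: om + om') s = r *: ced om s + ced om' s.
Proof. by rewrite linearP. Qed.

Lemma form_ced k om : form k om -> form k.+1 (ced om).
Proof.
have opp r p q p' q' : r *: p + q - (r *: p' + q') = r *: (p - p') + (q - q') :> H.
  by rewrite scalerBr opprD addrACA.
move=> Hom; split=> [s1|s1|s].
- elim: s1 k om Hom => [|z s1 IH] k om Hom s2 c x y /=.
    have [Hm _ _] := Hom; rewrite Ld_linx // (multi_consP c x y Hm) cedP.
    exact: opp.
  have [Hm _ _] := form_Ld z Hom; rewrite Hm.
  case: k Hom => [|k] Hom; last by rewrite (IH k) ?opp //; exact: form_cons.
  have Z : (fun v => om (z :: v)) = 0.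
    by apply/funext => v; case: Hom => _ _ ->.
  have C0 s : ced 0 s = 0 by rewrite linear0.
  by rewrite Z !C0 !subr0.
- elim: s1 k om Hom => [|z s1 IH] k om Hom s2 x /=.
    have [Hm Ha _] := Hom.
    have -> : (fun v => om [:: x, x & v]) = 0 by apply/funext => v; exact: (Ha [::]).
    have C0 s : ced 0 s = 0 by rewrite linear0.
    rewrite C0 subr0 Ld_cons lie_alt; have /= -> := multi0 [::] s2 Hm.
    by rewrite subr0 subrr.
  have [_ Ha _] := form_Ld z Hom; rewrite Ha sub0r.
  case: k Hom => [|k] Hom; last by rewrite (IH k) ?oppr0 //; exact: form_cons.
  have -> : (fun v => om (z :: v)) = 0.
    by apply/funext => v; case: Hom => _ _ ->.
  have C0 s : ced 0 s = 0 by rewrite linear0.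
  by rewrite C0 oppr0.
- elim: s k om Hom => [//|x s IH] k om Hom /= sk.
  have [_ _ ->] := form_Ld x Hom; last by [].
  case: k Hom sk => [|k] Hom sk; last by rewrite (IH k) ?subr0 //; exact: form_cons.
  have -> : (fun v => om (x :: v)) = 0.
    by apply/funext => v; case: Hom => _ _ ->.
  have C0 v : ced 0 v = 0 by rewrite linear0.
  by rewrite C0 subr0.
Qed.

Lemma ced_cfil m om s : (forall v, cfil m.+1 (om v)) -> cfil m (ced om s).
Proof.
have rhof x p : cfil m.+1 p -> cfil m (rho x p).
  move=> Hp w sw; rewrite rhoE -word_cons (Hp (x :: w)) // subr0.
  by apply: kmod_scale0; apply: Hp; exact: leqW.
have lief x om' s' : (forall v, cfil m.+1 (om' v)) -> cfil m (lieact x om' s').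
  elim: s' om' => [//|y s' IH] om' Hom /=; apply: cfilD; last exact: IH.
  exact: cfil_leq (Hom _).
elim: s om => [//|x s IH] om Hom /=; apply: cfilB; last exact: IH.
by rewrite LdE; apply: cfilB; [exact: rhof|exact: lief].
Qed.

(* The homotopy h, which contracts along the Euler field of the coordinates f
   of the formal group: on the graded pieces of the filtration, dh + hd is the
   multiplication by minus the total degree. *)
Section Exactness.
Variables (D : nat) (e : 'I_D -> g) (f : 'I_D -> cind g K^o).
Hypothesis f1 : forall i, f i 1 = 0.
Hypothesis fe : forall x, x = \sum_i (f i (env_inj x) : K) *: e i.

Definition cehom (om : T) : T := fun s => \sum_i cconv (f i) (om (e i :: s)).

(** The exterior product with the differential of [f i], where g acts on functions by minus left
    translation; it is the commutator of [ced] with multiplication by [f i] ([ced_conv]). *)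
Fixpoint cedf i (om : T) s : H :=
  if s is x :: s' then - cconv (cleft x (f i)) (om s') - cedf i (fun v => om (x :: v)) s'
  else 0.

Lemma rho_conv x h p : rho x (cconv h p) = cconv h (rho x p) - cconv (cleft x h) p.
Proof.
have -> : rho x p = cpost x p - cleft x p.
  by apply: cindP => u; rewrite rhoE.
have -> : rho x (cconv h p) = cpost x (cconv h p) - cleft x (cconv h p).
  by apply: cindP => u; rewrite rhoE.
rewrite cconv_left cconvBr opprD [X in _ + X]addrC addrA; congr (_ - _ - _).
have th : linear (fun n : kmod N => (env_inj x *: (n : N) : N) : kmod N).
  by move=> c n m; rewrite !kmodZ scalerDr !scalerA mulr_algr mulr_algl.
have L w (a : seq g -> K^o) b : lin_pack th (lconv a b w) = lconv a (fun v => lin_pack th (b v)) w.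
  by elim: w a b => [|y w IH] a b; rewrite /lconv -/lconv ?linearZ // linearD !IH.
apply: cind_wordP => w; rewrite [RHS]cconvE -[LHS]/(lin_pack th _) cconvE.
exact: L.
Qed.

Lemma lieact_conv x h om s : lieact x (fun v => cconv h (om v)) s =
  cconv h (lieact x om s).
Proof.
elim: s om => [|y s IH] om /=; first by rewrite cconv0r.
by rewrite cconvDr (IH (fun v => om (y :: v))).
Qed.

Lemma ced_conv i om s : ced (fun v => cconv (f i) (om v)) s =
  cconv (f i) (ced om s) + cedf i om s.
Proof.
elim: s om => [|x s IH] om /=; first by rewrite cconv0r addr0.
rewrite (IH (fun v => om (x :: v))) !LdE rho_conv lieact_conv !cconvBr.
rewrite !opprD !addrA; congr (_ - _); rewrite -!addrA; congr (_ + _).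
by rewrite addrC -addrA.
Qed.

(** Cartan's formula cancels the terms d i_e, which leaves Lie derivatives and the commutators
    [cedf]. *)
Lemma cehom_homotopy om s : ced (cehom om) s + cehom (ced om) s =
  \sum_i (cconv (f i) (Ld (e i) om s) + cedf i (fun v => om (e i :: v)) s).
Proof.
have -> : cehom om = \sum_i (fun v => cconv (f i) (om (e i :: v))).
  by apply/funext => v; rewrite fct_sumE.
rewrite linear_sum fct_sumE -big_split /=; apply: eq_bigr => i _.
rewrite ced_conv cconvBr [LHS]addrC addrA subrK.
by rewrite addrC.
Qed.

Lemma lconv_lead (h : cind g K^o) p m w : cfil m p -> (size w <= m)%N ->
  cconv h p (word w) = (h 1 : K) *: p (word w).
Proof.
move=> Hp sw; rewrite cconvE lconv_head ?word_nil // => v sv.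
by apply: Hp; exact: leq_trans sw.
Qed.

(** Euler's identity on leading terms. A factor [f i] applied to the first letter x restores x
    through [fe]; otherwise e i is moved past x, and the bracket produced is a shorter word, on
    which everything vanishes. *)
Lemma euler_conv p m w : cfil m p -> (size w <= m)%N ->
  \sum_i cconv (f i) (cleft (e i) p) (word w) = (size w)%:R *: p (word w).
Proof.
move=> Hp sw.
pose b v := p (word v).
have : forall v, (size v < size w)%N -> b v = 0.
  by move=> v sv; apply: Hp; exact: leq_trans sw.
have -> : \sum_i cconv (f i) (cleft (e i) p) (word w) =
    \sum_i lconv (fun v => f i (word v)) (fun v => b (e i :: v)) w.
  apply: eq_bigr => i _; rewrite cconvE; congr (lconv _ _ w).
  by apply/funext => v; rewrite /b word_cons.
have : envfun b := cind_envfun p.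
rewrite -[p (word w)]/(b w); move: b => b {sw Hp}.
elim: w b => [|x w IH] b Hb bv /=.
  by rewrite scale0r big1 // => i _; rewrite word_nil f1 scale0r.
have [_ Hlie] := Hb; rewrite big_split /= mulrS scalerDl scale1r; congr (_ + _).
  rewrite [X in b (X :: w)]fe envfun_sum //; apply: eq_bigr => i _.
  by rewrite lconv_head ?word1 // => v sv; exact: bv.
have Hb' : envfun (fun v => b (x :: v)).
  by case: Hb => [H1 H2]; split=> w1 *; [exact: (H1 (x :: w1))|exact: (H2 (x :: w1))].
rewrite -(IH _ Hb'); last by move=> v sv; exact: bv.
apply: eq_bigr => i _; rewrite -[RHS]addr0.
rewrite -(@lconv_vanish _ _ _ (fun v => f i (word v)) (fun v => b (lie (e i) x :: v)) 1 (size w) w).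
- rewrite -[X in X + _]scale1r -lconvDr; congr (lconv _ _ w); apply/funext => v.
  by rewrite scale1r -(Hlie [::] v) /= addrC subrK.
- by case=> // _; rewrite word_nil f1.
- by move=> v sv; exact: bv.
- by rewrite add1n.
Qed.

Lemma Ld_euler om s m w : (forall v, cfil m (om v)) -> (size w <= m)%N ->
  \sum_i cconv (f i) (Ld (e i) om s) (word w) = - ((size w)%:R *: om s (word w)).
Proof.
move=> Hom sw; have lief x om' s' : (forall v, cfil m (om' v)) -> cfil m (lieact x om' s').
  by elim: s' om' => [//|y s' IH] om' Hom' /=; apply: cfilD => //; exact: IH.
have f1f i : cfil 1 (f i) by case=> // _; rewrite word_nil f1.
rewrite -(euler_conv (Hom s) sw) -sumrN; apply: eq_bigr => i _.
rewrite LdE.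
have -> : rho (e i) (om s) - lieact (e i) om s =
   (cpost (e i) (om s) - lieact (e i) om s) - cleft (e i) (om s).
  rewrite addrAC; congr (_ - _); apply: cindP => u; first by rewrite rhoE.
rewrite cconvBr cindDE cindNE (cfil_conv (f1f i) (b := m)) ?add0r //.
apply: cfilB; last exact: lief.
move=> v sv; rewrite -[LHS]/(env_inj (e i) *: (om s (word v) : N) : N).
by apply: kmod_scale0; exact: Hom.
Qed.

Lemma cedf_euler om s m w : (forall v, cfil m (om v)) -> multi om -> alt om ->
  (size w <= m)%N ->
  \sum_i cedf i (fun v => om (e i :: v)) s (word w) = - ((size s)%:R *: om s (word w)).
Proof.
move=> Hom Hm Ha sw; elim: s om Hom Hm Ha => [|x s IH] om Hom Hm Ha /=.
  by rewrite scale0r oppr0 big1.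
have E i : (- cconv (cleft x (f i)) (om (e i :: s)) -
    cedf i (fun v => om [:: e i, x & v]) s) (word w) =
  - ((f i (env_inj x) : K) *: om (e i :: s) (word w)) + cedf i (fun v => om [:: x, e i & v]) s (word w).
  rewrite cindDE !cindNE (lconv_lead _ (Hom _) sw) cleftE mulr1; congr (_ + _).
  have -> : (fun v => om [:: e i, x & v]) = - (fun v => om [:: x, e i & v]).
    by apply/funext => v; exact: (alt_swap [::]).
  have N1 (a : T) v : cedf i (- a) v = - cedf i a v.
    elim: v a => [|y v IHv] a /=; first by rewrite oppr0.
    rewrite (IHv (fun v => a (y :: v))).
    by rewrite -[(- a) v]/(- a v) cconvNr opprD !opprK.
  by rewrite N1 cindNE opprK.
rewrite (eq_bigr _ (fun i _ => E i)) big_split /= (IH _ _ (multi_cons x Hm) (alt_cons x Ha)) //.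
rewrite sumrN mulrS scalerDl scale1r opprD; congr (- _ - _).
rewrite [X in om (X :: s)]fe.
have -> : \sum_i (f i (env_inj x) : K) *: om (e i :: s) (word w) =
   (\sum_i ((f i (env_inj x) : K)%:A : U) *: om (e i :: s)) (word w).
  by rewrite cind_sumE; apply: eq_bigr => i _; rewrite cindKE.
congr (cfun _ _); elim: (index_enum _) => [|i r IHr].
  by rewrite !big_nil; have /= -> := multi0 [::] s Hm.
by rewrite !big_cons IHr; have /= -> := Hm [::] s.
Qed.

Lemma form_cehom k om : form k.+1 om -> form k (cehom om).
Proof.
move=> [Hm Ha Hs]; split=> [s1 s2 c x y|s1 s2 x|s sk]; rewrite /cehom.
- rewrite scaler_sumr -big_split /=; apply: eq_bigr => i _.
  by have /= -> := Hm (e i :: s1) s2 c x y; rewrite cconvPr.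
- by rewrite big1 // => i _; have /= -> := Ha (e i :: s1) s2 x; rewrite cconv0r.
- by rewrite big1 // => i _; rewrite Hs ?cconv0r.
Qed.

Lemma cehom_cfil m om s : (forall v, cfil m (om v)) -> cfil m.+1 (cehom om s).
Proof.
move=> Hom; apply: cfil_sum => i _; rewrite -add1n; apply: cfil_conv => //.
by case=> // _; rewrite word_nil f1.
Qed.

(** On terms of order m the homotopy formula is multiplication by minus m + k.+1, which is
    invertible in characteristic zero. *)
Lemma ced_cehom_lead k m om s : form k.+1 om -> ced om = 0 ->
  (forall v, cfil m (om v)) ->
  cfil m.+1 (om s + ((m + k.+1)%:R^-1)%:A *: ced (cehom om) s).
Proof.
move=> Hom dom Hf w; rewrite ltnS => sw; rewrite cindDE cindKE.
have Hm : (m + k.+1)%:R != 0 :> K by rewrite pnatr_eq0 addnS.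
have [sk|sk] := eqVneq (size s) k.+1; last first.
  have [_ _ ->] := Hom; rewrite ?add0r //.
  by have [_ _ ->] := form_ced (form_cehom Hom); rewrite ?scaler0.
have -> : ced (cehom om) s = ced (cehom om) s + cehom (ced om) s.
  by rewrite dom /cehom big1 ?addr0 // => i _; rewrite cconv0r.
have [Hmu Ha _] := Hom.
rewrite cehom_homotopy cind_sumE (eq_bigr _ (fun i _ => cindDE _ _ _)) big_split /=.
rewrite (Ld_euler _ Hf sw) (cedf_euler _ Hf Hmu Ha sw) sk.
have [ws|ws] := eqVneq (size w) m.
  rewrite ws -opprD -scalerDl -natrD scalerN scalerA mulVf // scale1r subrr //.
have -> : om s (word w) = 0 by apply: Hf; rewrite ltn_neqAle ws.
by rewrite !scaler0 oppr0 addr0 scaler0 addr0.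
Qed.

(** A formal Poincare lemma by successive approximation: each step removes the leading term of the
    form by a coboundary, and the corrections have increasing order, so that they converge. *)
Theorem ce_exact k om : form k.+1 om -> ced om = 0 ->
  exists2 et, form k et & ced et = om.
Proof.
move=> Hom dom.
pose step m (a : T) : T := a + (((m + k.+1)%:R^-1)%:A : U) *: ced (cehom a).
pose ap := fix ap m := if m is m'.+1 then step m' (ap m') else om.
have apP m : [/\ form k.+1 (ap m), ced (ap m) = 0 & forall v, cfil m (ap m v)].
  elim: m => [|m [IH1 IH2 IH3]]; first by split.
  have F1 := form_ced (form_cehom IH1); split.
  - apply: submodD => //; [exact: submod_form|].
    by apply: submodZ => //; exact: submod_form.
  - rewrite /= /step linearD linearZ /= IH2 ced_ced ?scaler0 ?addr0 //.
    by case: (form_cehom IH1).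
  - by move=> v; exact: ced_cehom_lead.
(* [ap n] is the remainder, of order at least n, and [et n] the primitive found so far: om = ap n +
   ced (et n). *)
pose et n : T := - \sum_(m < n) (((m + k.+1)%:R^-1)%:A : U) *: cehom (ap m).
have etS n : et n.+1 = et n - (((n + k.+1)%:R^-1)%:A : U) *: cehom (ap n).
  by rewrite /et big_ord_recr /= opprD.
have etE n : om = ap n + ced (et n).
  elim: n => [|n IH]; first by rewrite /et big_ord0 oppr0 linear0 addr0.
  by rewrite etS linearB linearZ /= /step addrACA subrr addr0.
have etF n : form k (et n).
  elim: n => [|n IH]; first by rewrite /et big_ord0 oppr0; exact: submod0 (submod_form k).
  rewrite etS; apply: submodB => //; first exact: submod_form.
  by apply: submodZ; [exact: submod_form|apply: form_cehom; case: (apP n)].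
have lim s : exists h, forall n, cfil n.+1 (h - et n s).
  apply: cfil_complete => n; rewrite etS.
  rewrite -[(et n - _) s]/(et n s - _) addrC addrA addNr add0r.
  apply/cfilN/cfilK/cehom_cfil; by case: (apP n).
pose eta s := projT1 (cid (lim s)).
have etaP s n : cfil n.+1 (eta s - et n s) by rewrite /eta; case: cid.
have eta0 s r1 r2 r3 (c : K) : (forall n, et n s = c%:A *: et n r1 + et n r2) ->
    r3 = s -> eta r3 = c%:A *: eta r1 + eta r2.
  move=> E ->; apply/eqP; rewrite -subr_eq0; apply/eqP/cfil_eq0 => n.
  have -> : eta s - (c%:A *: eta r1 + eta r2) = (eta s - et n s) -
     (c%:A *: (eta r1 - et n r1) + (eta r2 - et n r2)).
    by rewrite scalerBr addrACA -opprD -E opprB addrA subrK.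
  apply: cfil_leq (leqnSn n) _; apply: cfilB => //.
  by apply: cfilD => //; exact: cfilK.
have etaz s : (forall n, et n s = 0) -> eta s = 0.
  move=> E; apply: cfil_eq0 => n; apply: cfil_leq (leqnSn n) _.
  by have := etaP s n; rewrite E subr0.
exists eta.
  split=> [s1 s2 c x y|s1 s2 x|s sk].
  - by apply: eta0 (erefl _) => n; case: (etF n) => ->.
  - by apply: etaz => n; case: (etF n) => _ ->.
  - by apply: etaz => n; case: (etF n) => _ _ ->.
(* The limit agrees with [et n] to order n.+1, and [ced] lowers the order by at most one. *)
apply/funext => s; apply/eqP; rewrite -subr_eq0; apply/eqP/cfil_eq0 => n.
have -> : ced eta s - om s = ced (eta - et n) s - ap n s.
  by rewrite linearB [in LHS](etE n) -[(ap n + _) s]/(ap n s + _) opprD addrA addrAC.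
apply: cfilB; last by case: (apP n).
by apply: ced_cfil => v; exact: etaP.
Qed.

End Exactness.

End ChevalleyEilenberg.

(** * The complex as an injective coresolution of N *)

Section CEResolution.
Variables (K : numClosedFieldType) (g : lieAlgType K) (N : lmodType (envalg g)).
Local Notation U := (envalg g).
Local Notation H := (cind g (kmod N)).
Local Notation T := (seq g -> H).

Fact orbit_subproof (n : N) : linear (fun u : U => u *: n : kmod N).
Proof.
by move=> c u v; rewrite kmodZ scalerDl scalerA mulr_algl.
Qed.
Definition orbit_map n : H := mkcind (orbit_subproof n).
Lemma orbit_mapE n u : orbit_map n u = u *: n. Proof. by []. Qed.

Definition ceiota (n : N) : T := fun s => if s is [::] then orbit_map n else 0.
Fact ceiota_linear : linear ceiota.
Proof.
move=> r n n'; apply/funext => -[|x s].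
  apply: cindP => u; rewrite -[RHS]/((r *: orbit_map n + orbit_map n') u).
  by rewrite cindDE cindZE !orbit_mapE scalerDr scalerA.
rewrite -[RHS]/(r *: (0 : H) + 0); by rewrite scaler0 addr0.
Qed.
HB.instance Definition _ := GRing.isLinear.Build U N T *:%R ceiota ceiota_linear.

Lemma form_ceiota (n : N) : form 0 (ceiota n).
Proof.
split=> [s1 s2 c x y|s1 s2 x|[|x s]] //; last by case: s1.
by case: s1 => [|? ?] /=; rewrite scaler0 addr0.
Qed.

Lemma ceiota_inj (n : N) : ceiota n = 0 -> n = 0.
Proof.
by move=> /(congr1 (fun a : T => a [::] 1)); rewrite -[X in X = _]/(1 *: n) scale1r.
Qed.

Lemma ced_ceiota (n : N) : ced (ceiota n) = 0.
Proof.
have lie0 x s : lieact x (ceiota n) s = 0 by case: s => //= y s; rewrite lieact_vanish ?addr0.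
apply/funext => -[//|x s] /=.
have -> : (fun v => ceiota n (x :: v)) = 0 by apply/funext.
have -> : ced (0 : T) s = 0 by rewrite linear0.
rewrite subr0 LdE lie0 subr0; case: s => [|y s]; last exact: rho0.
by apply: cindP => u; rewrite rhoE !orbit_mapE scalerA subrr.
Qed.

(** Closedness says that the map from U to N commutes with g, hence is U-linear and determined by
    its value at 1. *)
Lemma ce_exact0 (om : T) : form 0 om -> ced om = 0 -> exists n, om = ceiota n.
Proof.
move=> [_ _ Hs] dom; exists (om [::] 1); apply/funext => -[|x s]; last exact: Hs.
have E x u : om [::] (env_inj x * u) = env_inj x *: (om [::] u : N).
  have := congr1 (fun a : T => a [:: x] u) dom; rewrite /= LdE /= subr0 subr0 rhoE.
  by move=> /eqP; rewrite subr_eq0 => /eqP.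
have {}E u v : om [::] (u * v) = u *: (om [::] v : N).
  elim/env_alg_ind: u v => [c|x|u1 u2 IH1 IH2|u1 u2 IH1 IH2] v.
  - by rewrite mulr_algl cind_scaler.
  - exact: E.
  - by rewrite mulrDl cind_addr IH1 IH2 scalerDl.
  - by rewrite -mulrA IH1 IH2 scalerA.
by apply: cindP => u; rewrite orbit_mapE -[X in cfun _ X]mulr1 E.
Qed.

(** Frobenius reciprocity: a U-linear map to coinduced forms is determined by its values at 1, and
    these only need to be extended K-linearly. The map q is a K-linear inverse of i up to the kernel
    of i, on which f vanishes. *)
Lemma form_inj k (A X : lmodType U) (i : {linear A -> X}) (f : {linear A -> T}) :
  (forall a, form k (f a)) -> (forall a, i a = 0 -> f a = 0) ->
  exists F : {linear X -> T}, (forall x, form k (F x)) /\ forall a, F (i a) = f a.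
Proof.
move=> Hf ker.
pose iK : {linear kmod A -> kmod X} := lin_pack (kmod_linear i).
pose HP := submod_ker iK.
pose sv : {linear submodT HP -> kmod A} := @smval _ _ _ HP.
have sv_inj z : sv z = 0 -> z = 0 by move=> z0; apply: smval_inj; exact: z0.
have [r rE] := @klin_extend K (submodT HP) (kmod A) (submodT HP) sv idfun sv_inj.
have sgl : linear (fun a : kmod A => a - sv (r a)).
  by move=> c a b; rewrite (linearP r) (linearP sv) opprD addrACA -scalerBr.
have sgk a : iK a = 0 -> lin_pack sgl a = 0.
  by move=> a0 /=; rewrite -[a]/(sv (smk HP a0)) rE subrr.
have [q qE] := klin_extend sgk.
have fqi a : f (q (i a)) = f a.
  rewrite (qE a) linearB [X in _ - X]ker ?subr0 //.
  exact: (smvalP (r a)).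
have Flin x s : linear (fun u : U => f (q (u *: x)) s 1 : kmod N).
  move=> c u v.
  have -> : q ((c *: u + v) *: x) = (c%:A : U) *: (q (u *: x) : A) + q (v *: x).
    have -> : (c *: u + v) *: x = c *: (u *: x : kmod X) + (v *: x : kmod X).
      by rewrite scalerDl kmodZ scalerA mulr_algl.
    by rewrite linearP.
  by rewrite linearP -[LHS]/(((c%:A : U) *: f _ s + f _ s) 1) cindDE cindKE.
pose F x : T := fun s => mkcind (Flin x s).
have FE x s u : F x s u = f (q (u *: x)) s 1 by [].
have lin : linear F.
  move=> a x y; apply/funext => s; apply: cindP => u.
  rewrite -[RHS]/((a *: F x s + F y s) u) cindDE cindZE !FE scalerDr scalerA.
  rewrite -[X in q X]/(((u * a) *: x : kmod X) + (u *: y : kmod X)) linearD.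
  by rewrite -[X in f X]/((q ((u * a) *: x) : A) + (q (u *: y) : A)) linearD.
exists (lin_pack lin); split=> [x|a]; rewrite -[lin_pack lin _]/(F _).
  split=> [s1 s2 c y z|s1 s2 y|s sk]; apply: cindP => u; last first.
  - by rewrite FE; case: (Hf (q (u *: x))) => _ _ ->.
  - by rewrite FE; case: (Hf (q (u *: x))) => _ -> _.
  rewrite [RHS]cindDE cindKE !FE; case: (Hf (q (u *: x))) => Hm _ _.
  by rewrite Hm cindDE cindKE.
apply/funext => s; apply: cindP => u.
by rewrite FE -linearZ fqi linearZ cindZE mul1r.
Qed.

End CEResolution.

(** * Generalized weight vectors for a character *)

Section TwistedAction.
Variables (K : numClosedFieldType) (g : lieAlgType K).
Local Notation U := (envalg g).
Implicit Types (x y : g) (s : {vspace g}) (chi : {linear g -> K^o}).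

Section OneModule.
Variable X : lmodType U.
Implicit Types (v w : X).

(* The action of x - c. *)
Definition tw x (c : K) v : X := env_inj x *: v - (c%:A : U) *: v.

Lemma twP x c (a : K) v w : tw x c ((a%:A : U) *: v + w) =
  (a%:A : U) *: tw x c v + tw x c w.
Proof.
rewrite /tw [in RHS]scalerBr !scalerDr opprD addrACA !scalerA; congr (_ - _ + _).
  by rewrite mulr_algl mulr_algr.
by rewrite !mulr_algl !scalerA mulrC.
Qed.
Lemma twD x c v w : tw x c (v + w) = tw x c v + tw x c w.
Proof. by have := twP x c 1 v w; rewrite !scale1r. Qed.
Lemma tw0 x c : tw x c 0 = 0.
Proof. by rewrite /tw !scaler0 subr0. Qed.
Lemma twK x c (a : K) v : tw x c ((a%:A : U) *: v) = (a%:A : U) *: tw x c v.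
Proof. by have := twP x c a v 0; rewrite tw0 !addr0. Qed.
Lemma twN x c v : tw x c (- v) = - tw x c v.
Proof. by rewrite /tw !scalerN opprB opprK addrC. Qed.
Lemma twB x c v w : tw x c (v - w) = tw x c v - tw x c w.
Proof. by rewrite twD twN. Qed.
Lemma tw_gen x c v : env_inj x *: v = tw x c v + (c%:A : U) *: v.
Proof. by rewrite subrK. Qed.

Lemma tw_linx chi (a : K) x y v : tw (a *: x + y) (chi (a *: x + y)) v =
  (a%:A : U) *: tw x (chi x) v + tw y (chi y) v.
Proof.
rewrite /tw !linearP /= !scalerDl opprD addrACA scalerBr !scalerA.
by congr (_ - _ + _); rewrite ?mulr_algl ?scalerA.
Qed.
Lemma tw_zero chi v : tw 0 (chi 0) v = 0.
Proof. by rewrite /tw !linear0 !scale0r subr0. Qed.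

Lemma tw_lie x y c c' v : tw x c (tw y c' v) =
  tw y c' (tw x c v) + env_inj (lie x y) *: v.
Proof.
rewrite env_inj_lie scalerBl /tw !scalerBr !scalerA !mulr_algl !mulr_algr.
rewrite !scalerA [c * c']mulrC.
set P := _ *: v; set A := _ *: v; set B := _ *: v; set C := _ *: v; set Q := _ *: v.
rewrite [RHS]addrC -[X in _ = _ + X]addrA subrKA !opprB -addrA; congr (_ + _).
by rewrite addrCA [RHS]addrCA; congr (_ + _); rewrite addrC.
Qed.

(** The r-th step of the generalized weight space of weight chi for s. *)
Fixpoint nilp s chi r v : Prop :=
  if r is r'.+1 then forall x, x \in s -> nilp s chi r' (tw x (chi x) v)
  else v = 0.

Lemma nilp0 s chi r : nilp s chi r 0.
Proof. by elim: r => //= r IH x _; rewrite tw0. Qed.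
Lemma nilpP s chi r (a : K) v w :
  nilp s chi r v -> nilp s chi r w -> nilp s chi r ((a%:A : U) *: v + w).
Proof.
elim: r v w => [|r IH] v w /=; first by move=> -> ->; rewrite scaler0 addr0.
by move=> Hv Hw x xs; rewrite twP; apply: IH; [exact: Hv|exact: Hw].
Qed.
Lemma nilpD s chi r v w :
  nilp s chi r v -> nilp s chi r w -> nilp s chi r (v + w).
Proof. by move=> Hv Hw; have := nilpP 1 Hv Hw; rewrite !scale1r. Qed.
Lemma nilpK s chi r (a : K) v : nilp s chi r v -> nilp s chi r ((a%:A : U) *: v).
Proof. by move=> Hv; have := nilpP a Hv (nilp0 s chi r); rewrite addr0. Qed.
Lemma nilpN s chi r v : nilp s chi r v -> nilp s chi r (- v).
Proof. by move=> /(nilpK (-1)); rewrite !scaleN1r. Qed.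
Lemma nilpB s chi r v w :
  nilp s chi r v -> nilp s chi r w -> nilp s chi r (v - w).
Proof. by move=> Hv Hw; apply: nilpD => //; exact: nilpN. Qed.
Lemma nilp_leq s chi r r' v : (r <= r')%N -> nilp s chi r v -> nilp s chi r' v.
Proof.
elim: r r' v => [|r IH] [|r'] v //=; first by move=> _ -> x _; rewrite tw0; exact: nilp0.
by rewrite ltnS => rr' Hv x xs; apply: IH => //; exact: Hv.
Qed.
Lemma nilp_sub s s' chi r v : (s' <= s)%VS -> nilp s chi r v -> nilp s' chi r v.
Proof.
move=> /subvP ss'; elim: r v => [//|r IH] v /= Hv x xs.
by apply: IH; apply: Hv; exact: ss'.
Qed.

(* e normalizes s and chi kills [s, e]. *)
Definition normalizes s chi e : Prop :=
  forall x, x \in s -> lie x e \in s /\ chi (lie x e) = 0.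

Lemma nilp_tw s chi e c r v : normalizes s chi e ->
  nilp s chi r v -> nilp s chi r (tw e c v).
Proof.
move=> ne; elim: r v => [|r IH] v /=; first by move=> ->; rewrite tw0.
move=> Hv x xs; rewrite tw_lie; have [ls chil] := ne x xs.
apply: nilpD; first by apply: IH; exact: Hv.
by rewrite (tw_gen _ (chi (lie x e))) chil scale0r scale0r addr0; have := Hv _ ls; rewrite chil.
Qed.

Lemma nilp_iter s chi e c r j v : normalizes s chi e ->
  nilp s chi r v -> nilp s chi r (iter j (tw e c) v).
Proof. by move=> ne; elim: j => //= j IH Hv; apply: nilp_tw => //; exact: IH. Qed.

(* Generalized eigenspaces of an ad-nilpotent element are stable. *)
Lemma tw_iter_gen e c q x j v : iter q (lie e) x = 0 ->
  iter j (tw e c) v = 0 -> iter (j + q) (tw e c) (env_inj x *: v) = 0.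
Proof.
have z i : iter i (tw e c) 0 = 0 by elim: i => //= i ->; exact: tw0.
have iD i w w' : iter i (tw e c) (w + w') = iter i (tw e c) w + iter i (tw e c) w'.
  by elim: i => //= i ->; exact: twD.
move En : (j + q)%N => n; elim: n j q x v En => [|n IH] j q x v.
  by move=> /eqP; rewrite addn_eq0 => /andP[/eqP-> /eqP->] /= _ ->; rewrite scaler0.
have E : tw e c (env_inj x *: v) = env_inj x *: tw e c v + env_inj (lie e x) *: v.
  rewrite -[env_inj x *: v]subr0 -(scale0r v) -(scale0r (1 : U)) -[_ - _]/(tw x 0 v).
  by rewrite tw_lie /tw scale0r scale0r subr0.
case: j => [|j].
  by move=> _ _ /= ->; rewrite scaler0 -iterS z.
case: q => [|q].
  by move=> _ /= -> _; rewrite linear0 scale0r -iterS z.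
rewrite addSn => -[jq]; rewrite !iterSr => Hx Hv.
rewrite E iD (IH j q.+1) ?(IH j.+1 q) ?addr0 //; last by rewrite iterSr.
  by rewrite addSnnS.
by rewrite iterSr.
Qed.

Lemma tw_iter_tw e c q x d j v : iter q (lie e) x = 0 ->
  iter j (tw e c) v = 0 -> iter (j + q) (tw e c) (tw x d v) = 0.
Proof.
have iD i (a : K) w w' : iter i (tw e c) ((a%:A : U) *: w + w') = (a%:A : U) *: iter i (tw e c) w + iter i (tw e c) w'.
  by elim: i => //= i ->; exact: twP.
move=> Hx Hv; rewrite /tw addrC -scaleNr -scaleNr iD (tw_iter_gen Hx Hv) addr0.
have z i : iter i (tw e c) 0 = 0 by elim: i => //= i ->; exact: tw0.
by rewrite addnC iterD Hv z scaler0.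
Qed.

(** Double induction: e - chi e lowers j and keeps r, because e normalizes s; x - chi x with x in s
    lowers r and raises j by at most q. The bound R is uniform in v. *)
Lemma nilp_extend s s' chi e : normalizes s chi e ->
  (forall y, y \in s' -> exists x (a : K), x \in s /\ y = a *: e + x) ->
  (exists q, forall x, x \in s -> iter q (lie e) x = 0) ->
  forall r j, exists R, forall v, nilp s chi r v -> iter j (tw e (chi e)) v = 0 ->
    nilp s' chi R v.
Proof.
move=> ne Hs' [q Hq]; elim=> [|r IHr] j; first by exists 0%N.
elim: j => [|j [R1 HR1]]; first by exists 0%N.
have [R2 HR2] := IHr (j.+1 + q)%N.
exists (maxn R1 R2).+1 => v Hv Hj y /Hs'[x [a [xs ->]]].
rewrite tw_linx; apply: nilpP.
  apply: nilp_leq (leq_maxl _ _) _; apply: HR1; first exact: nilp_tw.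
  by rewrite -iterSr.
apply: nilp_leq (leq_maxr _ _) _; apply: HR2; first exact: Hv.
by apply: tw_iter_tw => //; exact: Hq.
Qed.
End OneModule.

Lemma tw_lin (X Y : lmodType U) (f : {linear X -> Y}) x c v :
  f (tw x c v) = tw x c (f v).
Proof. by rewrite /tw linearB !linearZ. Qed.
Lemma nilp_lin (X Y : lmodType U) (f : {linear X -> Y}) s chi r v :
  nilp s chi r v -> nilp s chi r (f v).
Proof.
elim: r v => [|r IH] v /=; first by move=> ->; rewrite linear0.
by move=> Hv x xs; rewrite -tw_lin; apply: IH; exact: Hv.
Qed.
End TwistedAction.

(** * Formal integration along an element e *)

Section Flow.
Variables (K : numClosedFieldType) (g : lieAlgType K).
Local Notation U := (envalg g).
Variables (s : {vspace g}) (e : g) (u : cind g K^o).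
Hypothesis u1 : cfil 1 u.
Hypothesis u_inv : forall x, x \in s -> env_inj x *: u = 0.
Hypothesis ue : (env_inj e *: u) 1 = 1.
Hypothesis s_e : forall x, x \in s -> lie x e \in s.

(** w is the derivative of the coordinate u along e. It takes the value 1 at the identity, hence is
    invertible: [winv] is the geometric series in q = 1 - w. *)
Let w := env_inj e *: u.
Let q := ceps - w.
Let winv := cseries (fun j => iter j (cconv q) ceps).

Let w_inv x : x \in s -> env_inj x *: w = 0.
Proof.
move=> xs; rewrite /w scalerA.
have -> : env_inj x * env_inj e = env_inj e * env_inj x + env_inj (lie x e).
  by rewrite env_inj_lie addrC subrK.
by rewrite scalerDl -scalerA !u_inv ?scaler0 ?addr0 // s_e.
Qed.
Let q_inv x : x \in s -> env_inj x *: q = 0.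
Proof. by move=> xs; rewrite scalerBr ceps_gen w_inv // subr0. Qed.
Let q1 : cfil 1 q.
Proof.
case=> // _; rewrite cindDE cindNE cepsE word_nil ue.
exact: subrr.
Qed.
Let qj_fil j : cfil j (iter j (cconv q) ceps).
Proof. by elim: j => //= j IH; rewrite -add1n; exact: cfil_conv. Qed.
Let winvP n : cfil n (winv - \sum_(j < n) iter j (cconv q) ceps).
Proof. exact: cseriesP. Qed.

Let cconv_sumr (V : lmodType K) (f : cind g K^o) n (F : 'I_n -> cind g V) :
  cconv f (\sum_i F i) = \sum_i cconv f (F i).
Proof. by apply: (big_morph _ (cconvDr f) (cconv0r V f)). Qed.

Let w_winv : cconv w winv = ceps.
Proof.
have -> : w = ceps - q by rewrite opprB addrC subrK.
rewrite cconvDl cconvNl cconv1; apply/eqP; rewrite -subr_eq0; apply/eqP/cfil_eq0 => n.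
pose S := \sum_(j < n) iter j (cconv q) ceps.
have E : S - cconv q S - ceps = - iter n (cconv q) ceps.
  rewrite /S cconv_sumr -sumrB.
  rewrite -(big_mkord xpredT (fun j => iter j (cconv q) ceps - cconv q (iter j (cconv q) ceps))).
  rewrite -[LHS]opprK !opprD -sumrN opprK.
  under eq_bigr do rewrite opprB.
  rewrite (telescope_sumr (fun j => iter j (cconv q) ceps)) //=.
  by rewrite opprB addrAC subrr add0r.
have -> : winv - cconv q winv - ceps =
    ((winv - S) - cconv q (winv - S)) + (S - cconv q S - ceps).
  rewrite cconvBr addrA; congr (_ - _).
  by rewrite opprB -[RHS]addrA [_ - _ + (S - _)]addrC !subrKA.
rewrite E; apply: cfilB; last exact: qj_fil.
apply: cfilB; first exact: winvP.
by apply: (cfil_conv (a := 0)) => //; exact: winvP.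
Qed.

Let winv_inv x : x \in s -> env_inj x *: winv = 0.
Proof.
move=> xs; have qi j : env_inj x *: iter j (cconv q) ceps = 0.
  elim: j => [|j IH]; first exact: ceps_gen.
  by rewrite /= cconv_gen q_inv // IH cconv0l cconv0r addr0.
apply: cfil_eq0 => n; rewrite -[_ *: _]subr0.
have <- : env_inj x *: (\sum_(j < n.+1) iter j (cconv q) ceps) = 0.
  by rewrite scaler_sumr big1 // => j _; exact: qi.
by rewrite -scalerBr; apply: cfil_gen; exact: winvP.
Qed.

Section Values.
Variables (V : lmodType K) (c : K).
Implicit Types (p : cind g V) (chi : {linear g -> K^o}).
Local Notation mu := (cconv u).

(** The derivation w^-1 e sends u to 1. Integrating by parts in the coordinate u gives the solution
    of (e - c) F = p as the sum over j of (-1)^j u^(j+1) / (j+1)! times (w^-1 (e - c))^j (w^-1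
    p). *)
Fixpoint flowc p j : cind g V :=
  if j is j'.+1 then - cconv winv (tw e c (flowc p j')) else cconv winv p.
Definition flowt (a : nat -> cind g V) j : cind g V :=
  ((j.+1`!%:R^-1 : K)%:A : U) *: iter j.+1 mu (a j).
Definition flows (a : nat -> cind g V) := cseries (flowt a).
Definition flow p := flows (flowc p).

Let mu_fil m j p : cfil m p -> cfil (j + m) (iter j mu p).
Proof. by move=> Hp; elim: j => //= j IH; rewrite -add1n -addnA; exact: cfil_conv. Qed.
Let flowt_fil m a j : cfil m (a j) -> cfil (j.+1 + m) (flowt a j).
Proof. by move=> Ha; apply: cfilK; exact: mu_fil. Qed.
Let flowt_fil0 a j : cfil j (flowt a j).
Proof. by apply: (@cfil_leq _ _ _ (j.+1 + 0)); [rewrite addn0|exact: flowt_fil]. Qed.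
Lemma flowsP a n : cfil n (flows a - \sum_(j < n) flowt a j).
Proof. exact: cseriesP. Qed.
Let mu_iterP j (b : K) p p' : iter j mu ((b%:A : U) *: p + p') =
  (b%:A : U) *: iter j mu p + iter j mu p'.
Proof. by elim: j => //= j ->; exact: cconvPr. Qed.

Lemma flows_lin (b : K) a1 a2 a3 : (forall j, a3 j = (b%:A : U) *: a1 j + a2 j) ->
  flows a3 = (b%:A : U) *: flows a1 + flows a2.
Proof.
move=> E; apply: cseries_unique => // n.
have -> : \sum_(j < n) flowt a3 j = (b%:A : U) *: (\sum_(j < n) flowt a1 j) + \sum_(j < n) flowt a2 j.
  rewrite scaler_sumr -big_split; apply: eq_bigr => j _.
  by rewrite /flowt E mu_iterP scalerDr !scalerA !mulr_algl !scalerA mulrC.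
by rewrite opprD addrACA -scalerBr; apply: cfilD; [apply: cfilK|]; exact: flowsP.
Qed.

Lemma flowc_lin (b : K) p1 p2 j :
  flowc ((b%:A : U) *: p1 + p2) j = (b%:A : U) *: flowc p1 j + flowc p2 j.
Proof.
by elim: j => [|j IH] /=; rewrite ?IH ?twP cconvPr // opprD scalerN.
Qed.

Lemma flow_lin (b : K) p1 p2 :
  flow ((b%:A : U) *: p1 + p2) = (b%:A : U) *: flow p1 + flow p2.
Proof. by apply: flows_lin => j; exact: flowc_lin. Qed.

(** The sum telescopes: e - c applied to the first n.+1 terms leaves p plus a remainder divisible by
    u^(n+1), hence of order at least n.+1. *)
Lemma tw_flow p : tw e c (flow p) = p.
Proof.
have twmu p' : tw e c (mu p') = cconv w p' + mu (tw e c p').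
  by rewrite /tw cconv_gen cconvBr -cconvKr addrA.
have twmui j p' : tw e c (iter j.+1 mu p') =
    ((j.+1%:R : K)%:A : U) *: iter j mu (cconv w p') + iter j.+1 mu (tw e c p').
  elim: j p' => [|j IH] p'; first by rewrite /= scale1r scale1r twmu.
  rewrite [iter j.+2 _ _]iterS twmu IH cconvDr cconvKr.
  have -> : cconv w (iter j.+1 mu p') = iter j.+1 mu (cconv w p').
    by elim: j.+1 => //= i <-; exact: cconv_comm.
  rewrite addrA; congr (_ + _).
  by rewrite [(j.+2)%:R]mulrS scalerDl scale1r scalerDl scale1r.
have D0 n : \sum_(j < n.+1) tw e c (flowt (flowc p) j) =
    p + ((n.+1`!%:R^-1 : K)%:A : U) *: iter n.+1 mu (tw e c (flowc p n)).
  elim: n => [|n IH].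
    rewrite big_ord1 /flowt twK twmui /= -cconvA w_winv cconv1.
    by rewrite (_ : (0.+1)`! = 1)%N // invr1 !scale1r.
  rewrite big_ord_recr /= IH -addrA; congr (_ + _).
  rewrite /flowt twK twmui scalerDr addrA -[RHS]add0r; congr (_ + _).
  have cf : (n.+2)`!%:R^-1 * n.+2%:R = (n.+1)`!%:R^-1 :> K.
    by rewrite (factS n.+1) natrM invfM mulrAC mulVf ?mul1r // pnatr_eq0.
  rewrite [X in _ + X]scalerA mulr_algl scalerA cf -scalerDr.
  have -> : cconv w (flowc p n.+1) = - tw e c (flowc p n).
    by rewrite /= cconvNr -cconvA w_winv cconv1.
  have -> : iter n.+1 mu (- tw e c (flowc p n)) = - iter n.+1 mu (tw e c (flowc p n)).
    by elim: n.+1 => //= i ->; rewrite cconvNr.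
  by rewrite subrr scaler0.
apply/eqP; rewrite -subr_eq0; apply/eqP/cfil_eq0 => n.
have tw_fil m p' : cfil m.+1 p' -> cfil m (tw e c p').
  move=> Hp; apply: cfilB; first exact: cfil_gen.
  by apply: cfilK; exact: cfil_leq Hp.
have tw_sum I (r : seq I) (F : I -> cind g V) : tw e c (\sum_(i <- r) F i) = \sum_(i <- r) tw e c (F i).
  by apply: (big_morph _ (twD e c) (tw0 _ e c)).
have -> : tw e c (flow p) - p = tw e c (flow p - \sum_(j < n.+1) flowt (flowc p) j) +
   ((n.+1`!%:R^-1 : K)%:A : U) *: iter n.+1 mu (tw e c (flowc p n)).
  by rewrite twB tw_sum D0 opprD addrA subrK.
apply: cfilD; first by apply: tw_fil; exact: flowsP.
by apply: cfilK; apply: (@cfil_leq _ _ _ (n.+1 + 0)); [rewrite addn0|exact: mu_fil].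
Qed.

(** The functions u and [winv] are killed by s, so x - chi x passes through all products and through
    the limit and acts on the coefficients only. *)
Lemma nilp_flow chi r p : normalizes s chi e -> nilp s chi r p -> nilp s chi r (flow p).
Proof.
move=> ne Hp; have twc (f : cind g K^o) x d p' : env_inj x *: f = 0 ->
    tw x d (cconv f p') = cconv f (tw x d p').
  by move=> fi; rewrite /tw cconv_gen fi cconv0l add0r cconvBr cconvKr.
have nc (f : cind g K^o) r' p' : (forall x, x \in s -> env_inj x *: f = 0) ->
    nilp s chi r' p' -> nilp s chi r' (cconv f p').
  move=> fi; elim: r' p' => [|r' IH] p' /=; first by move=> ->; exact: cconv0r.
  by move=> H x xs; rewrite twc ?fi //; apply: IH; exact: H.
have : forall j, nilp s chi r (flowc p j).
  elim=> [|j IH] /=; first exact: nc winv_inv Hp.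
  by apply: nilpN; apply: nc winv_inv _; exact: nilp_tw.
rewrite /flow; move: (flowc p) => a {Hp}; elim: r a => [|r IH] a /= Ha.
  have {}Ha : forall j, a j = 0 by [].
  have := @flows_lin (-1) a a a; rewrite scaleN1r scaleN1r addNr; apply=> j.
  by rewrite Ha scaler0 addr0.
move=> x xs.
have -> : tw x (chi x) (flows a) = flows (fun j => tw x (chi x) (a j)).
  apply/esym/cseries_unique => [//|n].
  have -> : \sum_(j < n) flowt (fun j => tw x (chi x) (a j)) j =
      tw x (chi x) (\sum_(j < n) flowt a j).
    rewrite (big_morph _ (twD x (chi x)) (tw0 _ x (chi x))); apply: eq_bigr => j _.
    rewrite /flowt twK; congr (_ *: _).
    by elim: j.+1 => //= i IHi; rewrite twc ?IHi ?u_inv.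
  rewrite -twB; have Hn := @flowsP a n.+1.
  have -> : flows a - \sum_(j < n) flowt a j =
      (flows a - \sum_(j < n.+1) flowt a j) + flowt a n.
    by rewrite big_ord_recr /= opprD addrA subrK.
  rewrite twD; apply: cfilD.
    rewrite /tw; apply: cfilB; first exact: cfil_gen.
    by apply: cfilK; exact: cfil_leq Hn.
  rewrite /flowt twK; apply: cfilK.
  have -> : tw x (chi x) (iter n.+1 mu (a n)) = iter n.+1 mu (tw x (chi x) (a n)).
    by elim: n.+1 => //= i IHi; rewrite twc ?IHi ?u_inv.
  by apply: (@cfil_leq _ _ _ (n.+1 + 0)); [rewrite addn0|exact: mu_fil].
by apply: IH => j; exact: Ha.
Qed.

Lemma flow_fil p : cfil 1 p -> cfil 2 (flow p).
Proof.
move=> Hp; have -> : flow p = (flow p - \sum_(j < 2) flowt (flowc p) j) +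
   \sum_(j < 2) flowt (flowc p) j by rewrite subrK.
apply: cfilD; first exact: flowsP.
rewrite big_ord_recl big_ord1; apply: cfilD.
  exact: (@flowt_fil 1 (flowc p) 0 (cfil_conv (a := 0) (cfil0 _) Hp)).
exact: (@flowt_fil 0 (flowc p) 1 (cfil0 _)).
Qed.
End Values.
End Flow.

(** If k is the length of l, the first k.+1 vectors v j are dependent. The relation is recorded as
    the coefficients of a polynomial, because the v j will be powers applied to a vector. *)
Lemma lspan_relation (K : fieldType) (V : lmodType K) (l : seq V) (v : nat -> V) :
  (forall j, lspan l (v j)) ->
  exists2 p : {poly K}, p != 0 & \sum_(j < size p) p`_j *: v j = 0.
Proof.
move=> Hv; pose k := size l.
have HA j : exists a : 'I_k -> K, v j = \sum_i a i *: tnth (in_tuple l) i.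
  by apply/lspan_ordP; rewrite map_enum_tnth.
pose A : 'M[K]_(k.+1, k) := \matrix_(j < k.+1, i < k) projT1 (cid (HA j)) i.
have vA (j : 'I_k.+1) : v j = \sum_i A j i *: tnth (in_tuple l) i.
  rewrite [LHS](projT2 (cid (HA j))); apply: eq_bigr => i _.
  by rewrite mxE.
have /rowV0Pn[b bA b0] : kermx A != 0.
  rewrite -mxrank_eq0 mxrank_ker -lt0n subn_gt0 ltnS.
  exact: rank_leq_col.
have {}bA : b *m A = 0 by apply/sub_kermxP.
pose p := \poly_(j < k.+1) (if insub j is Some i then b 0 i else 0).
have pE (j : 'I_k.+1) : p`_j = b 0 j by rewrite coef_poly ltn_ord valK.
exists p.
  apply: contraNneq b0 => p0; apply/eqP/rowP => j.
  by rewrite -pE p0 coef0 mxE.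
have -> : \sum_(j < size p) p`_j *: v j = \sum_(j < k.+1) p`_j *: v j.
  rewrite (big_ord_widen k.+1 (fun j => p`_j *: v j) (size_poly _ _)).
  rewrite big_mkcond /=; apply: eq_bigr => j _.
  by case: ltnP => // /leq_sizeP/(_ _ (leqnn _)) ->; rewrite scale0r.
under eq_bigr do rewrite pE vA scaler_sumr.
rewrite exchange_big big1 // => i _.
under eq_bigr do rewrite scalerA.
rewrite -scaler_suml.
have := congr1 (fun M : 'rV_k => M 0 i) bA; rewrite mxE mxE => ->.
by rewrite scale0r.
Qed.

(** * Primary decomposition for a single operator *)

Section PolyAction.
Variables (K : numClosedFieldType) (g : lieAlgType K).
Local Notation U := (envalg g).
Variable X : lmodType U.
Implicit Types (y : U) (v w : X) (p q : {poly K}).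

Definition pact y p v : X := horner_alg y p *: v.
Lemma pactD y p q v : pact y (p + q) v = pact y p v + pact y q v.
Proof. by rewrite /pact rmorphD scalerDl. Qed.
Lemma pactM y p q v : pact y (p * q) v = pact y p (pact y q v).
Proof. by rewrite /pact rmorphM scalerA. Qed.
Lemma pact1 y v : pact y 1 v = v.
Proof. by rewrite /pact rmorph1 scale1r. Qed.
Lemma pactC y c v : pact y c%:P v = (c%:A : U) *: v.
Proof. by rewrite /pact horner_algC. Qed.
Lemma pactX y v : pact y 'X v = y *: v.
Proof. by rewrite /pact horner_algX. Qed.

Lemma pactv y p c v w : pact y p ((c%:A : U) *: v + w) =
  (c%:A : U) *: pact y p v + pact y p w.
Proof. by rewrite /pact scalerDr !scalerA mulr_algl mulr_algr. Qed.
Lemma pact0 y p : pact y p 0 = 0. Proof. exact: scaler0. Qed.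
Lemma pactE y p v : pact y p v = \sum_(j < size p) ((p`_j)%:A : U) *: (y ^+ j *: v).
Proof.
rewrite -{1}[p]coefK poly_def /pact rmorph_sum scaler_suml.
apply: eq_bigr => j _; rewrite -mul_polyC rmorphM rmorphXn /= horner_algC horner_algX.
by rewrite scalerA.
Qed.

Lemma pact_relation y v (l : seq (kmod X)) :
  (forall j, lspan l (y ^+ j *: v : kmod X)) ->
  exists2 p, p != 0 & pact y p v = 0.
Proof.
move=> /lspan_relation[p p0 pv]; exists p => //.
by rewrite -[RHS]pv pactE.
Qed.

Lemma pact_root y p v lam : p != 0 -> pact y p v = 0 ->
  exists (a : nat) (q : {poly K}), [/\ ~~ root q lam,
    p = q * ('X - lam%:P) ^+ a & q != 0].
Proof.
move=> p0 pv; have [a [q]] := multiplicity_XsubC p lam.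
rewrite p0 => /= qr pE; exists a, q; split=> //.
by apply: contraNneq qr => ->; exact: root0.
Qed.

(** Induction on the degree of p: for a root lam, a Bezout identity between the power of X - lam in
    p and the cofactor q splits v. An entry of [ts] is a polynomial that cuts out a component, with
    its eigenvalue. *)
Lemma pact_primary y p v : p != 0 -> pact y p v = 0 ->
  exists ts : seq ({poly K} * K), v = \sum_(t <- ts) pact y t.1 v /\
    forall t, t \in ts -> exists a, pact y (('X - t.2%:P) ^+ a) (pact y t.1 v) = 0.
Proof.
have [n sn] := ubnP (size p); elim: n p v sn => // n IH p v sn p0 pv.
have [p1|p1] := eqVneq (size p) 1%N.
  move/eqP: p1 => /size_poly1P[c c0 pE]; exists [::]; rewrite big_nil; split=> //.
  move: pv; rewrite pE pactC => cv.
  have -> : v = (c^-1%:A : U) *: ((c%:A : U) *: v).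
    by rewrite scalerA mulr_algl scalerA mulVf // !scale1r.
  by rewrite cv scaler0.
have /closed_rootP[lam rl] : size p != 1%N by [].
have [a [q [qr pE q0]]] := pact_root lam p0 pv.
have a0 : (0 < a)%N.
  by rewrite lt0n; apply: contraNneq qr => a0; move: rl; rewrite pE a0 expr0 mulr1.
have /Bezout_eq1_coprimepP[[A B] /= AB] : coprimep (('X - lam%:P) ^+ a) q.
  by apply: coprimep_expl; rewrite coprimep_sym coprimep_XsubC.
have sq : (size q < n)%N.
  apply: leq_trans (_ : size p <= n)%N => //; rewrite pE size_Mmonic ?monic_exp ?monicXsubC //.
  by rewrite size_exp_XsubC addnS /= -addn1 leq_add2l.
pose v1 := pact y (A * ('X - lam%:P) ^+ a) v.
have v1q : pact y q v1 = 0.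
  by rewrite -pactM mulrCA -pE pactM pv pact0.
have [ts [tsE tsP]] := IH q v1 sq q0 v1q.
have vE : v = pact y (B * q) v + v1.
  by rewrite addrC -pactD AB pact1.
exists ((B * q, lam) :: [seq (t.1 * (A * ('X - lam%:P) ^+ a), t.2) | t <- ts]).
split.
  rewrite big_cons /= {1}vE; congr (_ + _); rewrite big_map {1}tsE.
  by apply: eq_bigr => t _; rewrite pactM.
move=> t; rewrite inE => /orP[/eqP-> /=|/mapP[t' /tsP[b tb] ->]].
  by exists a; rewrite -pactM mulrCA [_ * q]mulrC -pE pactM pv pact0.
by exists b; rewrite /= [pact y (_ * _) v]pactM.
Qed.

(* Fitting decomposition with respect to y. *)
Lemma pact_fitting y p v r : p != 0 -> pact y p v = 0 ->
  exists (a : nat) (q : {poly K}), pact y 'X^a (v - pact y ('X^r * q) v) = 0.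
Proof.
move=> p0 pv; have [a [q [qr pE q0]]] := pact_root 0 p0 pv.
(* As A X^r + B q = 1, the vector v - X^r A v is B q v, which X^a kills because p = q X^a. *)
have /Bezout_eq1_coprimepP[[A B] /= AB] : coprimep (('X - 0%:P) ^+ r) q.
  by apply: coprimep_expl; rewrite coprimep_sym coprimep_XsubC.
rewrite subr0 in AB pE; exists a, A.
have -> : v - pact y ('X^r * A) v = pact y (B * q) v.
  by rewrite -{1}[v](pact1 y) -AB pactD [A * _]mulrC addrAC subrr add0r.
by rewrite -pactM mulrCA [_ * q]mulrC -pE pactM pv pact0.
Qed.
End PolyAction.

(** * Vectors locally finite under a subalgebra *)

Section LocallyFinite.
Variables (K : numClosedFieldType) (g : lieAlgType K).
Local Notation U := (envalg g).
Implicit Types (X Y : lmodType U) (V : {vspace g}).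

Lemma env_sub_poly V y (p : {poly K}) : env_sub V y -> env_sub V (horner_alg y p).
Proof.
move=> Hy; elim/poly_ind: p => [|p c IH].
  by rewrite rmorph0 -(scale0r (1 : U)); exact: env_sub_scalar.
rewrite rmorphD rmorphM /= horner_algX horner_algC.
by apply: env_subD; [exact: env_subM|exact: env_sub_scalar].
Qed.

(* Local finiteness of the action of U(V) at a vector. *)
Definition nLF V X (v : X) : Prop := exists l : seq (kmod X),
  forall u, env_sub V u -> lspan l (u *: v : kmod X).

Lemma kspanD X (l : seq (kmod X)) (a b : X) :
  lspan l (a : kmod X) -> lspan l (b : kmod X) -> lspan l (a + b : kmod X).
Proof. exact: (submodD (lspan_submod l)). Qed.

Lemma kspan_sub X (l : seq (kmod X)) V :
  (forall x w, x \in V -> w \in l -> lspan l (env_inj x *: (w : X) : kmod X)) ->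
  forall u, env_sub V u -> forall w, lspan l w -> lspan l (u *: (w : X) : kmod X).
Proof.
move=> Hl u; elim=> {u} [c|x xV|u v _ IHu _ IHv|u v _ IHu _ IHv] w Hw.
- exact: (submodZ (lspan_submod l) c Hw).
- have lin : linear (fun w : kmod X => env_inj x *: (w : X) : kmod X).
    by move=> c a b; rewrite !kmodZ scalerDr !scalerA mulr_algr mulr_algl.
  have := lspan_map (lin_pack lin) Hw; apply: lspan_min; first exact: lspan_submod.
  by move=> y /mapP[z zl ->]; exact: Hl.
- by rewrite scalerDl; exact: kspanD (IHu _ Hw) (IHv _ Hw).
- by rewrite -scalerA; apply: IHu; exact: IHv.
Qed.

Lemma nLF_stable V X (v : X) (l : seq (kmod X)) : lspan l (v : kmod X) ->
  (forall x w, x \in V -> w \in l -> lspan l (env_inj x *: (w : X) : kmod X)) ->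
  nLF V v.
Proof. by move=> Hv Hl; exists l => u Hu; exact: (kspan_sub Hl Hu Hv). Qed.

Lemma noeth_field (F : fieldType) : noeth F^o.
Proof.
move=> P HP; have [[a [Pa a0]]|H] := pselect (exists a : F^o, P a /\ a != 0).
  exists [:: a]; split=> [x|v _]; first by rewrite inE => /eqP->.
  by exists (v * a^-1); rewrite /= [_ *: a]mulfVK // subrr.
exists [::]; split=> // v Pv /=; apply: contrapT => v0; apply: H; exists v.
by split=> //; exact/eqP.
Qed.

(* A spanning set of U(V)v taken inside of U(V)v. *)
Lemma nLF_span V X (v : X) : nLF V v -> exists us : seq U,
  [/\ forall u, u \in us -> env_sub V u,
      lspan (map (fun u => u *: v : kmod X) us) (v : kmod X)
    & forall u, env_sub V u -> lspan (map (fun u => u *: v : kmod X) us) (u *: v : kmod X)].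
Proof.
move=> [l Hl]; pose P (w : kmod X) := exists2 u, env_sub V u & w = u *: v.
have HP : submod P.
  split.
    exists 0; last by rewrite scale0r.
    by rewrite -(scale0r (1 : U)); exact: env_sub_scalar.
  move=> c _ _ [u Hu ->] [u' Hu' ->]; exists ((c%:A : U) * u + u').
    by apply: env_subD => //; apply: env_subM => //; exact: env_sub_scalar.
  by rewrite scalerDl -scalerA kmodZ.
have [|l' [l'P l'E]] := noeth_gen (@noeth_field K) HP (l := l).
  by move=> _ [u Hu ->]; exact: Hl.
have [us usP usE] : exists2 us : seq U, (forall u, u \in us -> env_sub V u) &
    map (fun u => u *: v : kmod X) us = l'.
  elim: l' l'P {l'E} => [|w l' IH] l'P; first by exists [::].
  have [|us usP usE] := IH; first by move=> z zl; apply: l'P; rewrite inE zl orbT.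
  have [u Hu wE] := l'P w (mem_head _ _).
  exists (u :: us); last by rewrite /= usE wE.
  by move=> z; rewrite inE => /orP[/eqP->|/usP].
exists us; rewrite usE; split=> // [|u Hu]; apply: l'E.
  exists 1; last by rewrite scale1r.
  by rewrite -[1](scale1r (1 : U)); exact: env_sub_scalar.
by exists u.
Qed.

Lemma nLF_lin V X Y (f : {linear X -> Y}) v : nLF V v -> nLF V (f v).
Proof.
move=> [l Hl]; exists (map (lin_pack (kmod_linear f)) l) => u Hu.
by have := lspan_map (lin_pack (kmod_linear f)) (Hl u Hu); rewrite /= linearZ.
Qed.

Lemma nLF_lin_inv V X Y (f : {linear X -> Y}) v :
  (forall x, f x = 0 -> x = 0) -> nLF V (f v) -> nLF V v.
Proof.
move=> fi /nLF_span[us [_ _ usE]].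
exists (map (fun u => u *: v : kmod X) us) => u Hu; have := usE u Hu.
have -> : map (fun u => u *: f v : kmod Y) us =
   map (lin_pack (kmod_linear f)) (map (fun u => u *: v : kmod X) us).
  by rewrite -map_comp; apply: eq_map => z /=; rewrite linearZ.
case/lspan_map_inv => w Hw /= E; have -> : (u *: v : kmod X) = w; last exact: Hw.
apply/eqP; rewrite -subr_eq0; apply/eqP/fi.
by rewrite linearB /= -E linearZ subrr.
Qed.

Lemma nLF0 V X : nLF V (0 : X).
Proof. by exists [::] => u _ /=; rewrite scaler0. Qed.

Lemma nLFD V X (v w : X) : nLF V v -> nLF V w -> nLF V (v + w).
Proof.
move=> [l Hl] [l' Hl']; exists (l ++ l') => u Hu; rewrite scalerDr.
apply: kspanD.
  by apply: lspan_sub (Hl u Hu) => z zl; apply: lspan_mem; rewrite mem_cat zl.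
by apply: lspan_sub (Hl' u Hu) => z zl; apply: lspan_mem; rewrite mem_cat zl orbT.
Qed.

Lemma nLF_subM V X (v : X) u : env_sub V u -> nLF V v -> nLF V (u *: v).
Proof.
by move=> Hu [l Hl]; exists l => u' Hu'; rewrite scalerA; apply: Hl; exact: env_subM.
Qed.

(** If l spans U(V) v, then l together with g l spans a V-stable space, because y b t = b y t +
    [y, b] t. *)
Lemma nLF_gen V X (v : X) x : nLF V v -> nLF V (env_inj x *: v).
Proof.
move=> /nLF_span[us [usV vs usE]]; pose l := map (fun u => u *: v : kmod X) us.
pose B := vbasis {:g}.
pose l' := l ++ flatten [seq [seq (env_inj b *: (w : X) : kmod X) | w <- l] | b <- B].
have ll' w : lspan l w -> lspan l' w.
  by apply: lspan_sub => z zl; apply: lspan_mem; rewrite mem_cat zl.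
have gl y w : lspan l w -> lspan l' (env_inj y *: (w : X) : kmod X).
  move=> Hw; rewrite (coord_vbasis (memvf y)) linear_sum /= scaler_suml.
  elim/big_ind: _ => [|a b Ha Hb|i _]; first exact: submod0 (lspan_submod _).
    exact: kspanD Ha Hb.
  have -> : env_inj (coord B i y *: B`_i) *: (w : X) =
     (coord B i y) *: (env_inj B`_i *: (w : X) : kmod X).
    by rewrite linearZ /= kmodZ scalerA mulr_algl.
  apply: submodZ; first exact: lspan_submod.
  have lin : linear (fun w : kmod X => env_inj B`_i *: (w : X) : kmod X).
    by move=> c a b; rewrite !kmodZ scalerDr !scalerA mulr_algr mulr_algl.
  apply: lspan_sub (lspan_map (lin_pack lin) Hw) => z /mapP[t tl ->].
  apply: lspan_mem; rewrite mem_cat; apply/orP; right; apply/flattenP.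
  exists [seq (env_inj B`_i *: (w : X) : kmod X) | w <- l].
    by apply/mapP; exists B`_i => //; apply: mem_nth; rewrite size_tuple.
  by apply/mapP; exists t.
have lV y w : y \in V -> lspan l w -> lspan l (env_inj y *: (w : X) : kmod X).
  move=> yV; apply: kspan_sub (env_sub_gen yV) w => {}y {}w {}yV /mapP[u uus ->].
  by rewrite scalerA; apply: usE; apply: env_subM; [exact: env_sub_gen|exact: usV].
apply: (@nLF_stable _ _ _ l'); first exact: gl.
move=> y w yV; rewrite mem_cat => /orP[wl|/flattenP[_ /mapP[b _ ->] /mapP[t tl ->]]].
  by apply/ll'/lV => //; exact: lspan_mem.
have -> : env_inj y *: (env_inj b *: (t : X)) =
    env_inj b *: (env_inj y *: (t : X)) + env_inj (lie y b) *: (t : X).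
  by rewrite env_inj_lie scalerBl !scalerA addrC subrK.
apply: kspanD.
  by apply/gl/lV => //; exact: lspan_mem.
by apply/gl/lspan_mem.
Qed.

Lemma nLF_env V X (v : X) u : nLF V v -> nLF V (u *: v).
Proof.
elim/env_alg_ind: u v => [c|x|u1 u2 IH1 IH2|u1 u2 IH1 IH2] v Hv.
- by apply: nLF_subM => //; exact: env_sub_scalar.
- exact: nLF_gen.
- by rewrite scalerDl; apply: nLFD; [exact: IH1|exact: IH2].
- by rewrite -scalerA; apply: IH1; exact: IH2.
Qed.

Lemma submod_nLF V X : submod (@nLF V X).
Proof.
by split=> [|a x y Hx Hy]; [exact: nLF0|apply: nLFD => //; exact: nLF_env].
Qed.
End LocallyFinite.

Lemma vector_dual (F : fieldType) (V : vectType F) (W : {vspace V}) y :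
  y \notin W -> exists f : {linear V -> F^o}, f y = 1 /\ forall x, x \in W -> f x = 0.
Proof.
move=> yW; pose X := in_tuple (y :: vbasis W).
have fX : free X by rewrite /= free_cons (basis_free (vbasisP W)) (span_basis (vbasisP W)) yW.
exists (coord X ord0); split; first by have := coord_free ord0 ord0 fX; rewrite /= => ->.
move=> x xW; rewrite (coord_vbasis xW) linear_sum big1 //= => i _.
rewrite linearZ /=.
have := coord_free (lift ord0 (cast_ord (esym (size_tuple (vbasis W))) i)) ord0 fX.
by rewrite /= => ->; rewrite mulr0.
Qed.

Lemma gen_stable (K : numClosedFieldType) (g : lieAlgType K) (X : lmodType (envalg g)) e c u (v : X) :
  (exists q, forall x, iter q (lie e) x = 0) -> (exists j, iter j (tw e c) v = 0) ->
  exists j, iter j (tw e c) (u *: v) = 0.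
Proof.
move=> [q Hq]; elim/env_alg_ind: u v => [a|x|u1 u2 IH1 IH2|u1 u2 IH1 IH2] v [j Hj].
- exists j; rewrite (_ : iter j _ _ = (a%:A : envalg g) *: iter j (tw e c) v).
    by rewrite Hj scaler0.
  by elim: j {Hj} => //= j ->; rewrite twK.
- by exists (j + q)%N; apply: tw_iter_gen.
- have [j1 H1] := IH1 _ (ex_intro _ j Hj); have [j2 H2] := IH2 _ (ex_intro _ j Hj).
  exists (j1 + j2)%N; rewrite scalerDl.
  have iD i w w' : iter i (tw e c) (w + w') = iter i (tw e c) w + iter i (tw e c) w' :> X.
    by elim: i => //= i ->; exact: twD.
  have z i : iter i (tw e c) 0 = 0 :> X by elim: i => //= i ->; exact: tw0.
  by rewrite iD {1}addnC !iterD H1 H2 !z addr0.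
- by rewrite -scalerA; apply: IH1; apply: IH2; exists j.
Qed.

Lemma twE (K : numClosedFieldType) (g : lieAlgType K) (X : lmodType (envalg g)) e c j (v : X) :
  iter j (tw e c) v = (env_inj e - c%:A) ^+ j *: v.
Proof.
elim: j => [|j IH]; first by rewrite scale1r.
by rewrite iterS IH /tw exprS -scalerA scalerBl.
Qed.

(** * Exactness of the locally finite subcomplex *)

Section NilFlag.
Variables (K : numClosedFieldType) (g : lieAlgType K) (m : nat) (e : nat -> g).
Local Notation U := (envalg g).
Local Notation s k := (<<mkseq e k>>%VS).
Hypothesis flag : forall k x, (k < m)%N -> x \in s m -> lie x (e k) \in s k.
Hypothesis adnil : forall x, x \in s m -> exists q, forall y, iter q (lie x) y = 0.
Hypothesis e_free : free (mkseq e m).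
Hypothesis coords : forall l : {linear g -> K^o},
  exists f : cind g K^o, f 1 = 0 /\ forall x, f (env_inj x) = l x.
Implicit Types (chi : {linear g -> K^o}).

Lemma s_sub k k' : (k <= k')%N -> (s k <= s k')%VS.
Proof.
move=> kk; apply: sub_span => x xe; case: (elimT (nthP 0) xe) => i; rewrite size_mkseq => ik <-; rewrite nth_mkseq //.
by apply: map_f; rewrite mem_iota (leq_trans ik).
Qed.

Lemma s_mem i k : (i < k)%N -> e i \in s k.
Proof. by move=> ik; apply: memv_span; apply: map_f; rewrite mem_iota. Qed.

Lemma s_ind k y : y \in s k.+1 -> exists x (a : K), x \in s k /\ y = a *: e k + x.
Proof.
rewrite mkseqS -cats1 span_cat span_seq1 => /memv_addP[x xs [_ /vlineP[a ->] ->]].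
by exists x, a; split; rewrite // addrC.
Qed.

Lemma s_lie k x y : (k <= m)%N -> x \in s m -> y \in s k -> lie x y \in s k.
Proof.
elim: k y => [|k IH] y km xs; first by rewrite span_nil memv0 => /eqP->; rewrite linear0 mem0v.
move=> /s_ind[z [a [zs ->]]]; rewrite linearP memvD ?memvZ //.
  by apply: (subvP (s_sub (leqnSn k))); exact: flag.
by apply: (subvP (s_sub (leqnSn k))); apply: IH => //; exact: ltnW.
Qed.

Lemma s_lieC k x y : (k <= m)%N -> x \in s m -> y \in s k -> lie y x \in s k.
Proof. by move=> km xs ys; rewrite lie_anti memvN s_lie. Qed.

(** A formal Frobenius theorem: there is a coordinate u constant along s k and transverse to e k.
    One starts from any function with linear part l and corrects it along e 0, ..., e (k-1) with the
    coordinates already found. *)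
Lemma frob k : (k < m)%N -> exists u : cind g K^o, [/\ cfil 1 u,
  forall x, x \in s k -> env_inj x *: u = 0 & (env_inj (e k) *: u) 1 = 1].
Proof.
have [n kn] := ubnP k; elim: n k kn => // n IH k; rewrite ltnS => kn km.
have [l [lk ls]] : exists l : {linear g -> K^o}, l (e k) = 1 /\ forall x, x \in s k -> l x = 0.
  apply: vector_dual; apply: contraTN e_free => ek.
  apply/negP => fm; have : free (mkseq e k.+1).
    have := fm; rewrite -(subnKC km) /mkseq iotaD map_cat; exact: catl_free.
  by rewrite mkseqS (perm_free (Y := e k :: mkseq e k)) ?perm_rcons // free_cons ek.
have {}IH j : (j < k)%N -> exists u : cind g K^o, [/\ cfil 1 u,
  forall x, x \in s j -> env_inj x *: u = 0 & (env_inj (e j) *: u) 1 = 1].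
  by move=> jk; apply: IH; [exact: leq_trans jk kn|exact: ltn_trans km].
suff [h [h1 hk hl]] : exists h : cind g K^o, [/\ cfil 1 h,
   forall x, x \in s k -> env_inj x *: h = 0 & forall x, h (env_inj x) = l x].
  by exists h; split=> //; rewrite cindZE mul1r hl.
(* h is invariant under s j. Subtracting the integral of e_j h along e_j adds invariance under e_j;
   that integral is itself invariant under s j and has order at least 2, so the linear part of h is
   unchanged. *)
have : (k <= k)%N by []; move: {1 3}k => j; elim: j => [|j IHj] jk.
  have [f [f1 fl]] := coords l; exists f; split=> // [|x].
    by move=> [|//] _; rewrite word_nil.
  by rewrite span_nil memv0 => /eqP->; rewrite linear0 scale0r.
have [h [h1 hj hl]] := IHj (ltnW jk); have [u [u1 us ue]] := IH _ jk.
have sj x : x \in s j -> lie x (e j) \in s j.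
  move=> xs; apply: flag; first exact: ltn_trans km.
  by apply: (subvP (s_sub _)) xs; apply: ltnW; exact: ltn_trans km.
have eh : cfil 1 (env_inj (e j) *: h).
  by move=> [|//] _; rewrite word_nil cindZE mul1r hl ls // s_mem.
pose z := (\0)%R : {linear g -> K^o}.
have nz : normalizes (s j) z (e j) by move=> x xs; split; [exact: sj|].
have f2 := flow_fil (e j) u1 0 eh.
have t0 x (w : cind g K^o) : tw x 0 w = env_inj x *: w by rewrite /tw scale0r scale0r subr0.
exists (h - flow (e j) u 0 (env_inj (e j) *: h)); split.
- by apply: cfilB => // w w1; apply: f2; exact: ltnW.
- have H x : x \in s j -> env_inj x *: (h - flow (e j) u 0 (env_inj (e j) *: h)) = 0.
    move=> xs; rewrite scalerBr (hj _ xs) [LHS]sub0r -[X in - X]t0.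
    suff E : nilp (s j) z 1 (env_inj (e j) *: h).
      by apply/eqP; rewrite oppr_eq0; apply/eqP; have H := nilp_flow u1 us ue sj 0 nz E; exact: (H x xs).
    move=> y ys /=; rewrite t0 scalerA.
    have /eqP := env_inj_lie y (e j); rewrite eq_sym subr_eq => /eqP ->.
    by rewrite scalerDl hj ?sj // add0r -scalerA hj // scaler0.
  move=> y /s_ind[x [a [xs ->]]]; rewrite linearP scalerDl H // addr0.
  rewrite [X in X *: _](_ : _ = (a%:A : U) * env_inj (e j)); last by rewrite mulr_algl.
  rewrite -scalerA scalerBr -[X in _ - X]t0 (tw_flow u1 ue).
  by rewrite subrr scaler0.
- move=> x; have := f2 [:: x] isT; rewrite word1 => E.
  by rewrite cindDE cindNE E subr0 hl.
Qed.

Variable (N : lmodType U).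
Local Notation T := (seq g -> cind g (kmod N)).

Definition abchar chi := forall x y, x \in s m -> y \in s m -> chi (lie x y) = 0.

Lemma abchar_normalizes chi k : abchar chi -> (k < m)%N -> normalizes (s k) chi (e k).
Proof.
move=> chiP km x xs; have xm := subvP (s_sub (ltnW km)) x xs.
by split; [exact: flag|apply: chiP => //; exact: s_mem].
Qed.

Lemma nilp_fun k chi r (om : T) : nilp (s k) chi r om <-> forall l, nilp (s k) chi r (om l).
Proof.
elim: r om => [|r IH] om /=; first by split=> [->|H] //; apply/funext.
split=> H; first by move=> l x xs; have /IH := H x xs; exact.
by move=> x xs; apply/IH => l; exact: H.
Qed.

(** Divisibility: each value of the form is integrated along e k in the coordinate of [frob], which
    keeps nilpotency under s k. *)
Lemma gam_div chi k i r (om : T) : abchar chi -> (k < m)%N ->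
  form i om -> nilp (s k) chi r om ->
  exists om' : T, [/\ form i om', nilp (s k) chi r om' & tw (e k) (chi (e k)) om' = om].
Proof.
move=> chiP km [om_m om_a om_s] /nilp_fun om_n; have [u [u1 us ue]] := frob km.
have ne := abchar_normalizes chiP km.
have ske x : x \in s k -> lie x (e k) \in s k by move=> /ne[].
pose F := @flow K g (e k) u (kmod N) (chi (e k)).
have F0 : F 0 = 0.
  have := flow_lin (e k) u1 (chi (e k)) (V := kmod N) (-1) 0 0.
  by rewrite scaler0 addr0 !scaleN1r addNr.
exists (fun l => F (om l)); split.
- split=> [l1 l2 c x y|l1 l2 x|l sl]; first by rewrite om_m; exact: flow_lin.
  - by rewrite om_a F0.
  - by rewrite om_s.
- by apply/nilp_fun => l; exact: nilp_flow.
- by apply/funext => l; exact: tw_flow.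
Qed.

Lemma nilp_inj (X Y : lmodType U) (f : {linear X -> Y}) k chi r v :
  (forall x, f x = 0 -> x = 0) -> nilp (s k) chi r (f v) -> nilp (s k) chi r v.
Proof.
move=> fi; elim: r v => [|r IH] v /=; first exact: fi.
by move=> H x xs; apply: IH; rewrite tw_lin; exact: H.
Qed.

Lemma nilp_pact (X : lmodType U) k x c chi r p (v : X) : normalizes (s k) chi x ->
  nilp (s k) chi r v -> nilp (s k) chi r (pact (env_inj x - c%:A) p v).
Proof.
move=> nx Hv; elim/poly_ind: p => [|p a IH].
  by rewrite /pact rmorph0 scale0r; exact: nilp0.
rewrite pactD mulrC pactM pactX pactC scalerBl; apply: nilpD; last exact: nilpK.
exact: nilp_tw.
Qed.

Lemma s0 x : x \in s 0 -> x = 0.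
Proof. by rewrite span_nil memv0 => /eqP. Qed.

Lemma nilp_step (X : lmodType U) chi k r j (v : X) : abchar chi -> (k < m)%N ->
  nilp (s k) chi r v -> iter j (tw (e k) (chi (e k))) v = 0 ->
  exists R, nilp (s k.+1) chi R v.
Proof.
move=> chiP km; have [q Hq] := adnil (s_mem km).
have [R HR] := nilp_extend X (abchar_normalizes chiP km) (@s_ind k)
   (ex_intro _ q (fun x _ => Hq x)) r j.
by move=> H1 H2; exists R; exact: HR.
Qed.

Hypothesis N_lf : forall n : N, nLF (s m) n.
Variables (D : nat) (b : 'I_D -> g) (f : 'I_D -> cind g K^o).
Hypothesis f1 : forall i, f i 1 = 0.
Hypothesis fb : forall x, x = \sum_i (f i (env_inj x) : K) *: b i.

(** Induction along the flag. A primitive [et0] nilpotent under s k is corrected by a cocycle until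
    a power of y = e_k - chi e_k kills it; [nilp_step] then makes it nilpotent under s k.+1. The
    obstruction is y^r et0, which is closed since y^r om = 0. *)
Lemma gam_exact chi k i r (om : T) : abchar chi -> (k <= m)%N ->
  form i.+1 om -> ced om = 0 -> nilp (s k) chi r om ->
  exists (et : T) r', [/\ form i et, ced et = om & nilp (s k) chi r' et].
Proof.
move=> chiP; elim: k i r om => [|k IH] i r om km om_f om_c om_n.
  have [et et_f et_d] := ce_exact f1 fb om_f om_c.
  by exists et, 1%N; split=> // x /s0-> /=; exact: tw_zero.
have km' := ltnW km; have ne := abchar_normalizes chiP km.
have [et0 [r1 [et_f et_d et_n]]] := IH _ _ _ km' om_f om_c (nilp_sub (s_sub (leqnSn k)) om_n).
pose y := env_inj (e k) - (chi (e k))%:A : U.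
have yr : y ^+ r *: om = 0.
  rewrite -twE; elim: r om om_n {om_f om_c et_d} => [//|r IHr] om' Hn.
  by rewrite iterSr; apply: IHr; apply: (Hn (e k)); exact: s_mem.
have yrc : ced (y ^+ r *: et0 : T) = 0 by rewrite linearZ /= et_d.
have yrf : form i (y ^+ r *: et0 : T) by apply: submodZ => //; exact: submod_form.
have yrn : nilp (s k) chi r1 (y ^+ r *: et0 : T) by rewrite -twE; exact: nilp_iter.
(* In degree 0 the obstruction is an element n of N. As N is locally finite, Fitting's decomposition
   makes n equal to y^r n' up to a vector killed by a power of y. *)
case: i => [|i] in om_f et_f yrf *.
  have [n nE] := ce_exact0 yrf yrc.
  have [l Hl] := N_lf n.
  have yV : env_sub (s m) y.
    apply: env_subD; first by apply: env_sub_gen; exact: s_mem.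
    by rewrite -scaleNr; exact: env_sub_scalar.
  have [|p p0 pn] := @pact_relation _ _ N y n l.
    by move=> j; have := Hl _ (env_sub_poly 'X^j yV); rewrite rmorphXn /= horner_algX; exact.
  have [a [q Hq]] := pact_fitting r p0 pn.
  pose n' := pact y q n.
  have n_n : nilp (s k) chi r1 n.
    by apply: (nilp_inj (@ceiota_inj K g N)); have := yrn; rewrite nE.
  have n'_n : nilp (s k) chi r1 (ceiota n') by apply: nilp_lin; exact: nilp_pact.
  have et1n : nilp (s k) chi r1 (et0 - ceiota n') by exact: nilpB.
  have [|R HR] := @nilp_step _ chi k r1 (a + r) (et0 - ceiota n') chiP km et1n.
    rewrite twE -/y exprD -scalerA scalerBr nE -linearZ -linearB -linearZ /=.
    have := Hq; rewrite pactM /pact !rmorphXn /= !horner_algX -/(pact y q n) => ->.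
    by rewrite linear0.
  exists (et0 - ceiota n'), R; split=> //.
    by apply: submodB => //; [exact: submod_form|exact: form_ceiota].
  by rewrite linearB /= ced_ceiota subr0.
(* In positive degree the obstruction is a coboundary by induction, and its primitive is divisible
   by y^r. *)
have [th [r2 [th_f th_d th_n]]] := IH _ _ _ km' yrf yrc yrn.
have [th' [th'_f th'_n th'E]] : exists th' : T, [/\ form i th', nilp (s k) chi r2 th'
    & y ^+ r *: th' = th].
  elim: (r) th th_f th_n {th_d} => [|j IHj] th th_f th_n.
    by exists th; rewrite scale1r.
  have [t1 [t1f t1n t1E]] := gam_div chiP km th_f th_n.
  have [t2 [t2f t2n t2E]] := IHj _ t1f t1n.
  by exists t2; split=> //; rewrite exprS -scalerA t2E -t1E /tw -scalerBl.
have et1n : nilp (s k) chi (r1 + r2) (et0 - ced th').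
  by apply: nilpB; [apply: nilp_leq et_n; rewrite leq_addr|
    apply: nilp_lin; apply: nilp_leq th'_n; rewrite leq_addl].
have [|R HR] := @nilp_step _ chi k (r1 + r2) r (et0 - ced th') chiP km et1n.
  by rewrite twE -/y scalerBr -th_d -th'E linearZ subrr.
exists (et0 - ced th'), R; split=> //.
  by apply: submodB => //; [exact: submod_form|exact: form_ced].
by rewrite linearB /= et_d ced_ced ?subr0 //; case: th'_f.
Qed.

(** The vector is decomposed under e 0, e 1, ... in turn. Components found earlier stay generalized
    eigenvectors because each ad e_i is nilpotent ([gen_stable]). *)
Lemma nLF_blocks (X : lmodType U) (v : X) : nLF (s m) v ->
  exists ts : seq (U * (nat -> K)), v = \sum_(t <- ts) t.1 *: v /\
    forall t, t \in ts -> env_sub (s m) t.1 /\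
      forall i, (i < m)%N -> exists a, iter a (tw (e i) (t.2 i)) (t.1 *: v) = 0.
Proof.
move=> Hv; suff : forall k, (k <= m)%N ->
  exists ts : seq (U * (nat -> K)), v = \sum_(t <- ts) t.1 *: v /\
    forall t, t \in ts -> env_sub (s m) t.1 /\
      forall i, (i < k)%N -> exists a, iter a (tw (e i) (t.2 i)) (t.1 *: v) = 0 by exact.
elim=> [|k IH] km.
  exists [:: (1, fun=> 0)]; rewrite big_seq1 scale1r; split=> // t.
  rewrite inE => /eqP->; split=> //=; rewrite -(scale1r (1 : U)); exact: env_sub_scalar.
have {IH}[ts [vE tsP]] := IH (ltnW km).
suff H : forall t : U * (nat -> K), (env_sub (s m) t.1 /\
      forall i, (i < k)%N -> exists a, iter a (tw (e i) (t.2 i)) (t.1 *: v) = 0) ->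
   exists ts : seq (U * (nat -> K)), t.1 *: v = \sum_(t <- ts) t.1 *: v /\
    forall t, t \in ts -> env_sub (s m) t.1 /\
      forall i, (i < k.+1)%N -> exists a, iter a (tw (e i) (t.2 i)) (t.1 *: v) = 0.
  have {tsP} : exists ts' : seq (U * (nat -> K)), \sum_(t <- ts) t.1 *: v = \sum_(t <- ts') t.1 *: v /\
    forall t, t \in ts' -> env_sub (s m) t.1 /\
      forall i, (i < k.+1)%N -> exists a, iter a (tw (e i) (t.2 i)) (t.1 *: v) = 0.
    elim: ts tsP {vE} => [|t ts IHt] tsP; first by exists [::].
    have [|ts' [E' P']] := IHt; first by move=> z zt; apply: tsP; rewrite inE zt orbT.
    have [t1 [E1 P1]] := H t (tsP t (mem_head _ _)).
    exists (t1 ++ ts'); rewrite big_cons big_cat E1 E'; split=> // z.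
    by rewrite mem_cat => /orP[/P1|/P'].
  by move=> [ts' [E' P']]; exists ts'; rewrite -E'.
move=> [u0 la] /= [u0s Hu0]; have [l Hl] := nLF_subM u0s Hv.
have ys : env_sub (s m) (env_inj (e k)) by apply: env_sub_gen; exact: s_mem.
have [|p p0 pv] := @pact_relation _ _ X (env_inj (e k)) (u0 *: v) l.
  by move=> j; have := Hl _ (env_sub_poly 'X^j ys); rewrite rmorphXn /= horner_algX; exact.
have [qs [qE qP]] := pact_primary p0 pv.
pose mk (t : {poly K} * K) : U * (nat -> K) :=
  (horner_alg (env_inj (e k)) t.1 * u0, fun i => if i == k then t.2 else la i).
exists (map mk qs); split.
  rewrite big_map {1}qE.
  by apply: eq_bigr => t _ /=; rewrite -scalerA.
move=> t tq; have [q qq ->] := elimT mapP tq.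
split=> /=; first by apply: env_subM => //; exact: env_sub_poly.
move=> i; rewrite ltnS leq_eqVlt => /orP[/eqP->|ik].
  rewrite eqxx; have [a Ha] := qP q qq; exists a; rewrite twE -Ha /pact.
  by rewrite rmorphXn rmorphB /= horner_algX horner_algC -[in LHS](scalerA (horner_alg _ _)).
rewrite ltn_eqF // -scalerA; apply: gen_stable; last exact: Hu0.
by apply: adnil; apply: s_mem; exact: ltn_trans km.
Qed.

Lemma eigvec (X : lmodType U) chi k r (v : X) : v <> 0 -> nilp (s k) chi r v ->
  exists u : U, u *: v <> 0 /\ forall x, x \in s k -> tw x (chi x) (u *: v) = 0.
Proof.
elim: r v => [|r IH] v v0 //= Hv.
have [H|] := pselect (forall x, x \in s k -> tw x (chi x) v = 0).
  by exists 1; rewrite scale1r.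
move=> /existsNP[x /not_implyP[xs xv]].
have [u [u0 uP]] := IH _ xv (Hv x xs).
exists (u * (env_inj x - (chi x)%:A)); rewrite -scalerA.
by rewrite scalerBl.
Qed.

(** The argument of Lie's theorem: with E = e_k - chi e_k, one finds (x - chi x) E^(n+1) w = (n+1)
    chi [x, e_k] E^n w. For the last nonzero E^n w the left side is zero, so chi [x, e_k] = 0 in
    characteristic zero. *)
Lemma char_step (X : lmodType U) chi k (w : X) a : (k < m)%N -> w <> 0 ->
  (forall x, x \in s k -> tw x (chi x) w = 0) -> iter a (tw (e k) (chi (e k))) w = 0 ->
  forall x, x \in s k -> chi (lie x (e k)) = 0.
Proof.
move=> km w0 Hw Ha x0 x0s; set E := tw _ _ in Ha.
pose ad1 (x : g) := lie x (e k).
have adE j x : iter j ad1 x = (-1) ^+ j *: iter j (lie (e k)) x.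
  elim: j => [|j IH]; first by rewrite scale1r.
  by rewrite !iterS IH /ad1 lie_anti linearZ /= exprS mulN1r scaleNr.
have ek : e k \in s m by exact: s_mem.
have ads x : x \in s k -> ad1 x \in s k by move=> xs; apply: flag => //; exact: (subvP (s_sub (ltnW km))).
have adsi j x : x \in s k -> iter j ad1 x \in s k by move=> xs; elim: j => //= j; exact: ads.
apply: contrapT => c0.
have [q Hq] := adnil ek.
have [x [xs xc xn]] : exists x, [/\ x \in s k, chi (ad1 x) <> 0 &
    forall j, chi (iter j.+2 ad1 x) = 0].
  (* The last iterate of x0 under ad e_k whose next bracket is not killed by chi; all further
     brackets are, so the formula for E^n w has no more terms. *)
  pose P n := chi (iter n.+1 ad1 x0) != 0.
  have Pq n : P n -> (n <= q)%N.
    move=> Pn; rewrite leqNgt; apply: contraNN Pn => qn.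
    rewrite adE -(subnK (ltnW qn)) -addSn iterD Hq (_ : iter _ _ 0 = 0).
      by rewrite scaler0 linear0.
    by elim: (_.+1) => //= j ->; rewrite linear0.
  have exP : exists n, P n by exists 0%N; exact/eqP.
  case: (ex_maxnP exP Pq) => n Pn nmax; exists (iter n ad1 x0); split.
  - exact: adsi.
  - by apply/eqP; exact: Pn.
  move=> j; rewrite -iterD addSn; apply/eqP; rewrite -[_ == _]negbK; apply/negP => Hj.
  by have := nmax _ Hj; rewrite addSn ltnNge leq_addl.
have evz y n : y \in s k -> (forall j, chi (iter j.+1 ad1 y) = 0) ->
    tw y (chi y) (iter n E w) = 0.
  elim: n y => [|n IH] y ys Hy; first exact: Hw.
  rewrite iterS tw_lie IH // /E tw0 add0r.
  rewrite (tw_gen _ (chi (ad1 y))) IH ?ads // => [|j]; first by rewrite (Hy 0%N) scale0r scale0r addr0.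
  by rewrite -iterSr; exact: Hy.
have evx n : tw x (chi x) (iter n.+1 E w) = ((n.+1%:R * chi (ad1 x))%:A : U) *: iter n E w.
  elim: n => [|n IH].
    rewrite iterS tw_lie /= Hw // /E tw0 add0r (tw_gen _ (chi (ad1 x))) Hw ?ads //.
    by rewrite add0r mul1r.
  rewrite iterS tw_lie IH twK -iterS (tw_gen _ (chi (ad1 x))) evz ?ads //; last first.
    by move=> j; rewrite -iterSr; exact: xn.
  rewrite add0r -scalerDl -scalerDl; congr ((_ *: _) *: _).
  by rewrite -[X in _ + X]mul1r -mulrDl natr1.
have [p Pp pmin] : exists2 p, iter p.+1 E w = 0 & iter p E w <> 0.
  elim: a Ha => [//|n0 IH] Hn; have [/IH//|] := pselect (iter n0 E w = 0).
  by exists n0.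
have := evx p; rewrite Pp tw0 => /esym H; apply: pmin.
set c := _ * _ in H; have c1 : c != 0 by rewrite mulf_neq0 ?pnatr_eq0 //; apply/eqP.
have := congr1 (fun z => (c^-1%:A : U) *: z) H.
by rewrite scaler0 scalerA mulr_algl scalerA mulVf // !scale1r.
Qed.

(** Induction on r: v together with the finite-dimensional spaces generated by the (e_i - chi e_i) v
    spans a stable space. *)
Lemma nilp_nLF (X : lmodType U) chi r (v : X) : nilp (s m) chi r v -> nLF (s m) v.
Proof.
elim: r v => [|r IH] v /= Hv; first by rewrite Hv; exact: nLF0.
pose ws : seq X := [seq tw (e i) (chi (e i)) v | i <- iota 0 m].
have [l [Hl ls]] : exists l : seq (kmod X), (forall w, w \in ws -> lspan l (w : kmod X)) /\
  forall x w, x \in s m -> w \in l -> lspan l (env_inj x *: (w : X) : kmod X).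
  have : forall w, w \in ws -> nLF (s m) w.
    move=> w wl; case: (elimT mapP wl) => i; rewrite mem_iota /= => im ->.
    by apply: IH; apply: Hv; exact: s_mem.
  elim: ws => [|w ws' IHw] Hws; first by exists [::].
  have [|l [Hl ls]] := IHw; first by move=> z zw; apply: Hws; rewrite inE zw orbT.
  have [us [uV wu uE]] := nLF_span (Hws w (mem_head _ _)).
  set l2 := map _ us in wu uE; exists (l2 ++ l).
  have i1 z : lspan l2 z -> lspan (l2 ++ l) z.
    by apply: lspan_sub => t tl; apply: lspan_mem; rewrite mem_cat tl.
  have i2 z : lspan l z -> lspan (l2 ++ l) z.
    by apply: lspan_sub => t tl; apply: lspan_mem; rewrite mem_cat tl orbT.
  split=> [z|x z xs].
    by rewrite inE => /orP[/eqP->|/Hl/i2 //]; exact: i1.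
  rewrite mem_cat => /orP[zl|zl]; last by apply: i2; exact: ls.
  apply: i1; have [u uu ->] := elimT mapP zl.
  rewrite scalerA; apply: uE; apply: env_subM; [exact: env_sub_gen|exact: uV].
have i2 z : lspan l z -> lspan ((v : kmod X) :: l) z.
  by apply: lspan_sub => t tl; apply: lspan_mem; rewrite inE tl orbT.
have iv : lspan ((v : kmod X) :: l) (v : kmod X) by apply: lspan_mem; rewrite mem_head.
apply: (nLF_stable iv) => x z xs; rewrite inE => /orP[/eqP->|zl]; last by apply: i2; exact: ls.
suff H : lspan l (tw x (chi x) v : kmod X).
  rewrite (tw_gen _ (chi x)); apply: kspanD; first exact: i2.
  exact: (submodZ (lspan_submod _) (chi x) iv).
have : (m <= m)%N by []; move: xs; move: {1 2}m => k; elim: k x => [|k IHk] x.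
  by move=> /s0-> _; rewrite tw_zero; exact: (submod0 (lspan_submod l)).
move=> /s_ind[y [a [ys ->]]] km; rewrite tw_linx; apply: kspanD; last exact: (IHk _ ys (ltnW km)).
have H : lspan l (tw (e k) (chi (e k)) v : kmod X).
  by apply: Hl; apply: map_f; rewrite mem_iota.
exact: (submodZ (lspan_submod l) a H).
Qed.

(** The eigenvalues [la] define chi on the basis e. Along the flag, v generates an eigenvector for s
    k by [eigvec], and [char_step] applied to it shows that chi kills the brackets with e k. *)
Lemma gen_char (X : lmodType U) (la : nat -> K) (v : X) : v <> 0 ->
  (forall i, (i < m)%N -> exists a, iter a (tw (e i) (la i)) v = 0) ->
  exists chi r, abchar chi /\ nilp (s m) chi r v.
Proof.
move=> v0 Hv.
have [chi chiE] : exists chi : {linear g -> K^o}, forall i, (i < m)%N -> chi (e i) = la i.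
  have sz : size (mkseq e m) == m by rewrite size_mkseq.
  pose E := Tuple sz.
  have H : linear (fun x => \sum_(i < m) la i * coord E i x : K^o).
    move=> c x y; rewrite [c *: (\sum_(_ < _) _)]mulr_sumr -big_split; apply: eq_bigr => i _ /=.
    by rewrite linearP mulrDr /= mulrCA.
  exists (lin_pack H) => i im /=; rewrite (bigD1 (Ordinal im)) //= big1 ?addr0.
    have := coord_free (Ordinal im) (Ordinal im) (X := E) e_free.
    by rewrite /= nth_mkseq // eqxx => ->; rewrite mulr1.
  move=> j ji; have := coord_free (Ordinal im) j (X := E) e_free.
  by rewrite /= nth_mkseq // eq_sym (negPf ji) => ->; rewrite mulr0.
suff [r [ab nl]] : exists r, (forall x y, x \in s m -> y \in s m -> chi (lie x y) = 0) /\ nilp (s m) chi r v.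
  by exists chi, r.
suff : forall k, (k <= m)%N -> exists r, (forall x y, x \in s k -> y \in s k -> chi (lie x y) = 0) /\
   nilp (s k) chi r v by exact.
elim=> [|k IH] km.
  by exists 1%N; split=> [x y /s0-> _|x /s0->]; [rewrite lie_anti linear0 oppr0 linear0|exact: tw_zero].
have [r [ab nl]] := IH (ltnW km).
have [u [u0 uP]] := eigvec v0 nl.
have [a0 Ha0] := Hv k km.
have [|a Ha] := @gen_stable _ _ X (e k) (la k) u v (adnil (s_mem km)).
  by exists a0.
have ne : normalizes (s k) chi (e k).
  move=> x xs; split; first by apply: flag => //; exact: (subvP (s_sub (ltnW km))).
  by apply: (char_step km u0 uP (a := a)) => //; rewrite chiE.
have [q Hq] := adnil (s_mem km).
have [R HR] := nilp_extend X ne (@s_ind k) (ex_intro _ q (fun x _ => Hq x)) r a0.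
exists R; split; last by apply: HR => //; rewrite chiE.
move=> x y /s_ind[x' [c [xs ->]]] /s_ind[y' [d [ys ->]]].
rewrite lie_zl !lie_zr lie_alt (lie_anti (e k)) !linearD /= !linearZ /=.
by rewrite linearN /= !(ne _ _).2 // ab // linear0 oppr0 !scaler0 !addr0.
Qed.

(** Each block t.1 *: om is still closed, since [ced] is U-linear, and belongs to one character of
    the subalgebra; the primitives given by [gam_exact] are added up. *)
Lemma nLF_ce_exact i (om : T) : form i.+1 om -> ced om = 0 -> nLF (s m) om ->
  exists et : T, [/\ form i et, nLF (s m) et & ced et = om].
Proof.
move=> om_f om_c om_n; have [ts [omE tsP]] := nLF_blocks om_n.
rewrite omE; elim: ts tsP {omE} => [|t ts IH] tsP.
  exists 0; rewrite big_nil; split; [exact: submod0 (submod_form _ _)|exact: nLF0|exact: linear0].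
have [|et [et_f et_n et_c]] := IH; first by move=> z zt; apply: tsP; rewrite inE zt orbT.
have [_ Ht] := tsP t (mem_head _ _); rewrite big_cons.
have [->|t0] := pselect (t.1 *: om = 0); first by exists et; rewrite add0r.
have [chi [r [ab nl]]] := gen_char t0 Ht.
have [||et1 [r' [f1' c1 n1]]] := gam_exact (i := i) ab (leqnn m) _ _ nl.
- by apply: submodZ => //; exact: submod_form.
- by rewrite linearZ /= om_c scaler0.
exists (et1 + et); split; last by rewrite linearD /= c1 et_c.
  by apply: submodD => //; exact: submod_form.
by apply: nLFD => //; exact: nilp_nLF n1.
Qed.
End NilFlag.

(** * Modules from representations, and Engel's theorem *)

Section RepMod.
Variables (K : fieldType) (g : lieAlgType K).
Local Notation U := (envalg g).

Record lierep (V : lmodType K) := LieRep {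
  rep_fun :> g -> V -> V;
  rep_linr : forall x, linear (rep_fun x);
  rep_linl : forall c x y v, rep_fun (c *: x + y) v = c *: rep_fun x v + rep_fun y v;
  rep_lie : forall x y v,
    rep_fun (lie x y) v = rep_fun x (rep_fun y v) - rep_fun y (rep_fun x v) }.

Variables (V : lmodType K) (r : lierep V).

Fixpoint rep_term (s : env_term g) (v : V) : V :=
  match s with
  | EnvScalar c => c *: v
  | EnvGen x => r x v
  | EnvAdd s t => rep_term s v + rep_term t v
  | EnvMul s t => rep_term s (rep_term t v)
  end.

Lemma rep_term_lin s c v w : rep_term s (c *: v + w) = c *: rep_term s v + rep_term s w.
Proof.
elim: s v w => [a|x|s IHs t IHt|s IHs t IHt] v w /=.
- by rewrite scalerDr !scalerA mulrC.
- exact: rep_linr.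
- by rewrite IHs IHt scalerDr addrACA.
- by rewrite IHt IHs.
Qed.

Lemma rep_term_rel s t : env_rel s t -> rep_term s =1 rep_term t.
Proof.
have aD u v w : rep_term u (v + w) = rep_term u v + rep_term u w.
  by have := rep_term_lin u 1 v w; rewrite !scale1r.
have a0 u : rep_term u 0 = 0.
  by have := rep_term_lin u (-1) 0 0; rewrite scaler0 addr0 scaleN1r addNr.
have aZ u c v : rep_term u (c *: v) = c *: rep_term u v.
  by have := rep_term_lin u c v 0; rewrite a0 !addr0.
have r0 v : r 0 v = 0.
  by have := rep_linl r (-1) 0 0 v; rewrite scaler0 addr0 scaleN1r addNr.
elim=> //= {s t}.
- by move=> s t _ E v; rewrite E.
- by move=> s t u _ E1 _ E2 v; rewrite E1 E2.
- by move=> s s' t t' _ E1 _ E2 v; rewrite E1 E2.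
- by move=> s s' t t' _ E1 _ E2 v; rewrite E2 E1.
- by move=> s t u v; rewrite addrA.
- by move=> s t v; rewrite addrC.
- by move=> s v; rewrite scale0r add0r.
- by move=> s t u v; rewrite aD.
- by move=> s v; rewrite !scale0r.
- by move=> s v; rewrite scale1r.
- by move=> c s v; rewrite aZ.
- by move=> c d v; rewrite scalerDl.
- by move=> c d v; rewrite scalerA.
- by move=> x y v; have := rep_linl r 1 x y v; rewrite !scale1r.
- by move=> c x v; have := rep_linl r c x 0 v; rewrite r0 !addr0.
- by move=> x y v; rewrite rep_lie addrC subrK.
Qed.

Definition repmod (_ : lierep V) : Type := V.
HB.instance Definition _ := GRing.Zmodule.on (repmod r).
Definition rep_act (u : U) (v : repmod r) : repmod r := rep_term (repr u) v.
Lemma rep_actE s (v : repmod r) : rep_act (env_pi s) v = rep_term s v.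
Proof. exact: rep_term_rel (env_repr_pi s) v. Qed.

Fact rep_actA a b v : rep_act a (rep_act b v) = rep_act (a * b) v.
Proof. by elim/envW: a => s; elim/envW: b => t; rewrite -env_piM !rep_actE. Qed.
Fact rep_act1 : left_id 1 rep_act.
Proof. by move=> v; rewrite -(scale1r (1 : U)) -env_pi_scalar rep_actE /= scale1r. Qed.
Fact rep_actDr : right_distributive rep_act +%R.
Proof.
move=> u v w; elim/envW: u => s; rewrite !rep_actE.
by have := rep_term_lin s 1 v w; rewrite !scale1r.
Qed.
Fact rep_actDl v : {morph rep_act^~ v : a b / a + b}.
Proof. by move=> a b; elim/envW: a => s; elim/envW: b => t; rewrite -env_piD !rep_actE. Qed.
HB.instance Definition _ := GRing.Zmodule_isLmodule.Build U (repmod r)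
  rep_actA rep_act1 rep_actDr rep_actDl.

Lemma repmod_gen x (v : repmod r) : env_inj x *: v = r x v.
Proof. exact: rep_actE. Qed.
Lemma repmod_scalar c (v : repmod r) : (c%:A : U) *: v = (c *: (v : V) : V).
Proof. by rewrite -env_pi_scalar; exact: rep_actE. Qed.
End RepMod.

Section EngelJacobson.
Variables (K : numClosedFieldType) (g : lieAlgType K).

Lemma adrep_subproof x y v :
  lie (lie x y) v = lie x (lie y v) - lie y (lie x v) :> g.
Proof. exact: lie_jac. Qed.
Definition adrep : lierep g g :=
  LieRep (@lie_linearr K g) (fun c x y v => lie_zl c x y v) adrep_subproof.
Definition admod := repmod adrep.
Definition zchar : {linear g -> K^o} := \0%R.

Lemma admod_gen x (v : admod) : env_inj x *: v = lie x (v : g).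
Proof. exact: repmod_gen. Qed.
Lemma admod_tw x c (v : admod) : c = 0 -> tw x c v = lie x (v : g).
Proof. by move=> ->; rewrite /tw scale0r scale0r subr0 admod_gen. Qed.

(* Jacobson's form of Engel's theorem, for sets closed under the bracket. *)
Lemma engel_jacobson (S : g -> Prop) :
  (forall x y, S x -> S y -> S (lie x y)) ->
  (forall x, S x -> exists q, forall y, iter q (lie x) y = 0) ->
  exists (l : seq g) r, [/\ forall x, x \in l -> S x, forall x, S x -> x \in <<l>>%VS &
    forall v : admod, nilp <<l>>%VS zchar r v].
Proof.
move=> SS Snil.
suff H n l r : (\dim {:g} - \dim <<l>>%VS <= n)%N -> (forall x, x \in l -> S x) ->
    (forall v : admod, nilp <<l>>%VS zchar r v) ->
  exists (l : seq g) r, [/\ forall x, x \in l -> S x, forall x, S x -> x \in <<l>>%VS &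
    forall v : admod, nilp <<l>>%VS zchar r v].
  apply: (H _ [::] 1%N (leqnn _)) => // v x; rewrite span_nil memv0 => /eqP-> /=.
  exact: (tw_zero zchar v).
elim: n l r => [|n IH] l r ln lS lnil.
  exists l, r; split=> // x _; suff -> : <<l>>%VS = fullv by exact: memvf.
  by apply/eqP; rewrite eqEdim subvf -subn_eq0 -leqn0.
have [H|/existsNP[x0 /not_implyP[x0S x0l]]] := pselect (forall x, S x -> x \in <<l>>%VS).
  by exists l, r.
(* As l acts nilpotently on g, repeated brackets of x0 with l end up in the span of l; the last one
   outside of it normalizes the span. *)
have [x [xS xl xN]] : exists x, [/\ S x, x \notin <<l>>%VS & forall y, y \in l -> lie y x \in <<l>>%VS].
  move: (lnil x0) x0S x0l; move: {lnil ln} r x0 => r; elim: r => [|r IHr] x0.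
    by move=> /= -> _; rewrite mem0v.
  move=> Hx xS /negP xl; have [H|/existsNP[y /not_implyP[yl /negP yx]]] :=
    pselect (forall y, y \in l -> lie y x0 \in <<l>>%VS); first by exists x0.
  apply: (IHr (lie y x0)); [|by apply: SS => //; exact: lS|exact/negP].
  have yB : y \in <<l>>%VS by rewrite memv_span.
  by have := Hx y yB; rewrite admod_tw.
have {}xN y : y \in <<l>>%VS -> lie y x \in <<l>>%VS.
  suff : (<<l>> <= (linfun (lin_pack (@lie_linearl K g x))) @^-1: <<l>>)%VS.
    by move=> /subvP H yl; have := H y yl; rewrite -memv_preim lfunE.
  by apply/span_subvP => z zl; rewrite -memv_preim lfunE; exact: xN.
have [q Hq] := Snil x xS.
have [|||R HR] := @nilp_extend _ _ admod <<l>>%VS <<x :: l>>%VS zchar x _ _ _ r q.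
- by move=> y yl; split; [exact: xN|].
- rewrite span_cons => y /memv_addP[_ /vlineP[a ->] [z zl ->]].
  by exists z, a.
- by exists q => y _; exact: Hq.
have itw (v : admod) : iter q (tw x (zchar x)) v = 0.
  rewrite -[RHS](Hq v); elim: q {Hq HR} => //= q ->; exact: admod_tw.
apply: (IH (x :: l) R).
- have dl : (\dim <<l>> < \dim <<x :: l>>)%N.
    rewrite span_cons ltn_neqAle dimvS ?addvSr // andbT; apply: contraNneq xl => E.
    have /eqP -> : <<l>>%VS == (<[x]> + <<l>>)%VS by rewrite eqEdim addvSr E /=.
    by apply: (subvP (addvSl _ _)); exact: memv_line.
  by move: ln; rewrite leq_subLR => ln; rewrite leq_subLR (leq_trans ln) // addnS -addSn leq_add2r.
- by move=> y; rewrite inE => /orP[/eqP->|/lS].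
- by move=> v; apply: HR.
Qed.

Lemma nilp_ad B r (x y : g) : (forall v : admod, nilp B zchar r v) -> x \in B ->
  iter r (lie x) y = 0.
Proof.
move=> /(_ y) H xB; elim: r y H => [//|r IH] y /(_ x xB).
by rewrite admod_tw // => /IH; rewrite iterSr.
Qed.
End EngelJacobson.

Lemma lie0l (K : fieldType) (g : lieAlgType K) (y : g) : lie 0 y = 0.
Proof. by have := @lie_linearl K g y (-1) 0 0; rewrite scaler0 addr0 scaleN1r addNr. Qed.
Lemma lieBl (K : numClosedFieldType) (g : lieAlgType K) (x x' y : g) : lie (x - x') y = lie x y - lie x' y.
Proof. by rewrite addrC -scaleN1r lie_zl scaleN1r addrC. Qed.
Lemma lieZl (K : numClosedFieldType) (g : lieAlgType K) (c : K) (x y : g) : lie (c *: x) y = c *: lie x y.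
Proof. by rewrite lie_anti linearZ /= -scalerN -lie_anti. Qed.
Lemma lie_suml (K : numClosedFieldType) (g : lieAlgType K) I r (P : pred I) (F : I -> g) y :
  lie (\sum_(i <- r | P i) F i) y = \sum_(i <- r | P i) lie (F i) y.
Proof. by rewrite lie_anti linear_sum -sumrN; apply: eq_bigr => i _; rewrite -lie_anti. Qed.

Lemma span_ind (F : fieldType) (V : vectType F) (l : seq V) (P : V -> Prop) :
  P 0 -> (forall a x y, P x -> P y -> P (a *: x + y)) -> (forall x, x \in l -> P x) ->
  forall v, v \in <<l>>%VS -> P v.
Proof.
move=> P0 PD Pl v /(coord_span (X := in_tuple l)) ->.
elim/big_ind: _ => [//|x y Hx Hy|i _]; first by rewrite -[x]scale1r; exact: PD.
by rewrite -[_ *: _]addr0; apply: PD => //; apply: Pl; exact: mem_nth.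
Qed.

Lemma lie_prodvP (K : numClosedFieldType) (g : lieAlgType K) (V W X : {vspace g}) :
  (forall x y, x \in V -> y \in W -> lie x y \in X) <-> (lie_prodv V W <= X)%VS.
Proof.
split=> [H|/subvP H x y xV yW].
  apply/span_subvP => z zl; have [[v u] [vV uW ->]] := elimT allpairsP zl.
  by apply: H; exact: vbasis_mem.
apply: H; rewrite (coord_vbasis xV) (coord_vbasis yW) lie_suml; apply: memv_suml => i _.
rewrite lieZl memvZ // linear_sum; apply: memv_suml => j _; rewrite linearZ memvZ //.
by apply: memv_span; apply/allpairsP; exists ((vbasis V)`_i, (vbasis W)`_j);
  split=> //; apply: mem_nth; rewrite size_tuple.
Qed.

Lemma lie_prodv_mem (K : numClosedFieldType) (g : lieAlgType K) (V W : {vspace g}) x y :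
  x \in V -> y \in W -> lie x y \in lie_prodv V W.
Proof. by have /lie_prodvP H := subvv (lie_prodv V W); exact: H. Qed.

Lemma semisimple_center (K : numClosedFieldType) (g : lieAlgType K) (x : g) :
  semisimple g -> (forall y, lie x y = 0) -> x = 0.
Proof.
move=> ss Hx; have := ss <[x]>%VS.
have I : lie_ideal <[x]>%VS.
  by move=> y z /vlineP[c ->]; rewrite linearZ /= lie_anti Hx oppr0 scaler0 mem0v.
have S : lie_solvable <[x]>%VS.
  exists 1%N; apply/eqP; rewrite /= -subv0; apply/lie_prodvP => y z /vlineP[c ->] /vlineP[d ->].
  by rewrite lieZl linearZ /= Hx !scaler0 mem0v.
by move=> /(_ I S) E; apply/eqP; rewrite -memv0 -E memv_line.
Qed.

(** * Weights and trace forms *)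

Section DiagonalRep.
Variables (K : numClosedFieldType) (g : lieAlgType K) (h : {vspace g}).
Hypothesis hC : forall t t', t \in h -> t' \in h -> lie t t' = 0.
Hypothesis hN : forall x, (forall t, t \in h -> lie t x = 0) -> x \in h.

Definition hwt (a : g -> K) x := forall t, t \in h -> lie t x = a t *: x.

Lemma hwt_lie a a' x y : hwt a x -> hwt a' y -> hwt (fun t => a t + a' t) (lie x y).
Proof.
move=> Hx Hy t th; have := lie_jac t x y; rewrite (Hx t th) (Hy t th) lieZl linearZ /= => E.
by rewrite scalerDl E subrK.
Qed.

Lemma hwt_ext a a' x : (forall t, t \in h -> a t = a' t) -> hwt a x -> hwt a' x.
Proof. by move=> E H t th; rewrite -E // H. Qed.

Lemma hwt0 a x : (forall t, t \in h -> a t = 0) -> hwt a x -> x \in h.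
Proof. by move=> E H; apply: hN => t th; rewrite H // E // scale0r. Qed.

Lemma hwt_lie0 a x y : hwt a x -> hwt (fun t => - a t) y -> lie x y \in h.
Proof. by move=> Hx Hy; apply: hwt0 (hwt_lie Hx Hy) => t _; rewrite subrr. Qed.

Section Rep.
Variables (n : nat) (rho : {linear g -> 'M[K]_n}) (mu : 'I_n -> g -> K).
Hypothesis rhoL : forall x y, rho (lie x y) = rho x *m rho y - rho y *m rho x.
Hypothesis rhoD : forall t, t \in h -> rho t = diag_mx (\row_j mu j t).

Definition tform x y : K := \tr (rho x *m rho y).

Lemma tformC x y : tform x y = tform y x.
Proof. exact: mxtrace_mulC. Qed.
Lemma tform_lie x y z : tform (lie x y) z = tform x (lie y z).
Proof.
rewrite /tform !rhoL mulmxBl mulmxBr !linearB /= !mulmxA; congr (_ - _).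
by rewrite -[in LHS]mulmxA [LHS]mxtrace_mulC.
Qed.
Lemma tformZl c x y : tform (c *: x) y = c * tform x y.
Proof. by rewrite /tform linearZ -scalemxAl linearZ. Qed.
Lemma tformDl x x' y : tform (x + x') y = tform x y + tform x' y.
Proof. by rewrite /tform linearD mulmxDl linearD. Qed.
Lemma tform_suml I r (P : pred I) (F : I -> g) y :
  tform (\sum_(i <- r | P i) F i) y = \sum_(i <- r | P i) tform (F i) y.
Proof.
elim/big_rec2: _ => [|i u v _ <-]; last by rewrite tformDl.
by rewrite /tform linear0 mul0mx linear0.
Qed.
Lemma tform_h t t' : t \in h -> t' \in h -> tform t t' = \sum_j mu j t * mu j t'.
Proof.
move=> th th'; rewrite /tform !rhoD // mulmx_diag mxtrace_diag.
by apply: eq_bigr => j _; rewrite !mxE.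
Qed.

Lemma tform_orth a a' x y t : hwt a x -> hwt a' y -> t \in h -> a t + a' t != 0 ->
  tform x y = 0.
Proof.
move=> Hx Hy th aN; apply: (mulfI aN); rewrite mulr0 mulrDl.
have -> : a t * tform x y = tform (lie t x) y by rewrite Hx // tformZl.
have -> : a' t * tform x y = tform x (lie t y) by rewrite (Hy _ th) [RHS]tformC tformZl tformC.
by rewrite -tform_lie lie_anti -scaleN1r tformZl mulN1r addNr.
Qed.

Lemma rho_entry a x i k t : hwt a x -> rho x i k != 0 -> t \in h -> mu i t = mu k t + a t.
Proof.
move=> Hx x0 th; have := congr1 (fun M : 'M_n => M i k) (rhoL t x).
rewrite Hx // linearZ rhoD // mul_diag_mx mul_mx_diag !mxE [_ * mu k t]mulrC -mulrBl => /(mulIf x0) ->.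
by rewrite addrC subrK.
Qed.

(* The trace of [x, y] vanishes on the sum of the weight spaces of an a-string. *)
Lemma string_real a x y j : hwt a x -> hwt (fun t => - a t) y ->
  exists2 q : K, q \is Num.real & mu j (lie x y) = q * a (lie x y).
Proof.
move=> Hx Hy; have th := hwt_lie0 Hx Hy; set t := lie x y in th *.
(* S is the a-string through mu j. Its weight spaces are stable under rho x and rho y, so the
   commutator rho t has trace zero on their sum. *)
pose P i (z : int) := forall t, t \in h -> mu i t = mu j t + z%:~R * a t.
pose S := [pred i | `[< exists z, P i z >]].
have Sx i k : rho x i k != 0 -> (i \in S) = (k \in S).
  move=> /(rho_entry Hx) E; apply/asboolP/asboolP => -[z Hz].
    exists (z - 1) => s sh; have /eqP := E s sh; rewrite Hz // -subr_eq => /eqP <-.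
    by rewrite rmorphB mulrBl mul1r addrA.
  by exists (z + 1) => s sh; rewrite E // Hz // rmorphD mulrDl mul1r addrA.
have Sy i k : rho y i k != 0 -> (i \in S) = (k \in S).
  move=> /(rho_entry Hy) E; apply/asboolP/asboolP => -[z Hz].
    exists (z + 1) => s sh; have /eqP := E s sh; rewrite Hz // -subr_eq opprK => /eqP <-.
    by rewrite rmorphD mulrDl mul1r addrA.
  by exists (z - 1) => s sh; rewrite E // Hz // rmorphB mulrBl mul1r addrA.
have tr0 : \sum_(i in S) mu i t = 0.
  have -> : \sum_(i in S) mu i t = \sum_(i in S) rho t i i.
    by apply: eq_bigr => i _; rewrite rhoD // !mxE eqxx.
  under eq_bigr do rewrite rhoL !mxE.
  rewrite big_split /= sumrN; apply/eqP; rewrite subr_eq0; apply/eqP.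
  have E (X Y : 'M[K]_n) : (forall i k, X i k != 0 -> (i \in S) = (k \in S)) ->
     \sum_(i in S) \sum_k X i k * Y k i = \sum_(i in S) \sum_(k in S) X i k * Y k i.
    move=> HX; apply: eq_bigr => i iS; rewrite [RHS]big_mkcond; apply: eq_bigr => k _.
    by have [->|/HX <-] := eqVneq (X i k) 0; rewrite ?iS // mul0r if_same.
  rewrite E // E // exchange_big; apply: eq_bigr => i _; apply: eq_bigr => k _.
  exact: mulrC.
have jS : j \in S by apply/asboolP; exists 0 => s _; rewrite mul0r addr0.
have zP i : exists z, i \in S -> P i z.
  by have [/asboolP[z Hz]|_] := boolP (i \in S); [exists z|exists 0].
pose z i := projT1 (cid (zP i)).
have zE i : i \in S -> mu i t = mu j t + (z i)%:~R * a t.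
  by move=> iS; apply: (projT2 (cid (zP i)) iS).
have S0 : #|S|%:R != 0 :> K by rewrite pnatr_eq0 -lt0n; apply/card_gt0P; exists j.
exists (- (\sum_(i in S) (z i)%:~R) / #|S|%:R).
  rewrite rpredM ?rpredN ?rpredV ?realn // rpred_sum // => i _; exact: realz.
move: tr0; rewrite (eq_bigr _ zE) big_split /= sumr_const -mulr_suml => /eqP.
rewrite addr_eq0 => /eqP E; apply: (mulIf S0); rewrite mulr_natr E.
by rewrite mulrAC mulfVK // mulNr.
Qed.
End Rep.
End DiagonalRep.

(** * The Killing form and the Casimir element *)

Section Killing.
Variables (K : numClosedFieldType) (g : lieAlgType K) (h : {vspace g}).
Variables (D : nat) (b : 'I_D -> g) (bc : 'I_D -> {linear g -> K^o}) (w : 'I_D -> g -> K).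
Hypothesis ss : semisimple g.
Hypothesis bcK : forall x, x = \sum_i (bc i x : K) *: b i.
Hypothesis bcb : forall i j, bc i (b j) = (i == j)%:R.
Hypothesis wt : forall i, hwt h (w i) (b i).
Hypothesis hC : forall t t', t \in h -> t' \in h -> lie t t' = 0.
Hypothesis hN : forall x, (forall t, t \in h -> lie t x = 0) -> x \in h.

Definition wzero i := forall t, t \in h -> w i t = 0.

Lemma b_neq0 i : b i != 0.
Proof.
apply/eqP => bi; have := bcb i i; rewrite bi linear0 eqxx => /eqP.
by rewrite eq_sym oner_eq0.
Qed.

Lemma bcI x y : (forall i, bc i x = bc i y) -> x = y.
Proof. by move=> E; rewrite (bcK x) (bcK y); apply: eq_bigr => i _; rewrite E. Qed.

Lemma bc_sum (a : 'I_D -> K) i : bc i (\sum_j a j *: b j) = a i.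
Proof.
rewrite linear_sum (bigD1 i) //= linearZ /= bcb eqxx big1 => [|j ji].
  by rewrite addr0 [LHS]mulr1.
by rewrite linearZ /= bcb eq_sym (negPf ji) [LHS]mulr0.
Qed.

Lemma w_lin i t t' c : t \in h -> t' \in h -> w i (c *: t + t') = c * w i t + w i t'.
Proof.
move=> th th'; apply/eqP; rewrite -subr_eq0.
have : (w i (c *: t + t') - (c * w i t + w i t')) *: b i = 0.
  by rewrite scalerBl -wt ?memvD ?memvZ // lie_zl !wt // scalerDl scalerA subrr.
by move/eqP; rewrite scaler_eq0 (negPf (b_neq0 i)) orbF.
Qed.

Lemma h_center t : t \in h -> (forall i, w i t = 0) -> t = 0.
Proof.
move=> th wt0; apply: semisimple_center => // y; rewrite (bcK y) linear_sum big1 // => i _.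
by rewrite linearZ /= wt // wt0 scale0r scaler0.
Qed.

Lemma hwt_coord a x i : hwt h a x -> bc i x != 0 -> forall t, t \in h -> w i t = a t.
Proof.
move=> Hx xi t th; apply: (mulIf xi).
have <- : bc i (lie t x) = a t * bc i x by rewrite Hx // linearZ.
rewrite [in RHS](bcK x) linear_sum -(bc_sum (fun j => w j t * bc j x)); congr (bc i _).
by apply: eq_bigr => j _; rewrite linearZ /= wt // scalerA mulrC.
Qed.

Lemma hwt_neq0 a x : hwt h a x -> x <> 0 -> exists i, forall t, t \in h -> w i t = a t.
Proof.
move=> Hx x0; have [[i xi]|H] := pselect (exists i, bc i x != 0).
  by exists i; exact: hwt_coord xi.
case: x0; apply: bcI => i; rewrite linear0; apply/eqP; apply: contrapT => xi.
by apply: H; exists i; exact/negP.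
Qed.

Definition admx_fun x : 'M[K]_D := \matrix_(k, j) (bc k (lie x (b j)) : K).
Lemma admx_linear : linear admx_fun.
Proof. by move=> c x y; apply/matrixP => k j; rewrite !mxE lie_zl linearP. Qed.
Definition admx : {linear g -> 'M[K]_D} := lin_pack admx_linear.

Lemma admx_lie x y : admx (lie x y) = admx x *m admx y - admx y *m admx x.
Proof.
have E u v k j : (admx u *m admx v) k j = bc k (lie u (lie v (b j))).
  rewrite mxE (bcK (lie v (b j))) linear_sum linear_sum.
  by apply: eq_bigr => i _; rewrite !mxE linearZ linearZ /= mulrC.
by apply/matrixP => k j; rewrite [LHS]mxE lie_jac linearB /= -!E [RHS]mxE [X in _ = _ + X]mxE.
Qed.
Lemma admx_h t : t \in h -> admx t = diag_mx (\row_j w j t).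
Proof.
move=> th; apply/matrixP => k j; rewrite !mxE wt // linearZ /= bcb.
by case: eqVneq => [->|_]; [exact: mulr1|exact: mulr0].
Qed.

Local Notation kf := (tform admx).

Lemma killing_h t : t \in h -> kf t t = \sum_k w k t ^+ 2.
Proof. by move=> th; rewrite (tform_h admx_h). Qed.

(** By [string_real] all weights of t = [x, y] are real multiples of w i t, the multiple for i being
    1. If w i t were nonzero, a sum of real squares containing 1 would vanish; so all weights vanish
    on t, which is then central. *)
Lemma killing_isotropic i x y : hwt h (w i) x -> hwt h (fun t => - w i t) y ->
  kf (lie x y) (lie x y) = 0 -> lie x y = 0.
Proof.
move=> Hx Hy; have th := hwt_lie0 hN Hx Hy.
have st k := string_real hN admx_lie admx_h k Hx Hy.
rewrite killing_h // => k0; apply: h_center => // k; have [q qr ->] := st k.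
suff -> : w i (lie x y) = 0 by rewrite mulr0.
apply: contrapT => /eqP wi.
have : \sum_k (w k (lie x y) / w i (lie x y)) ^+ 2 = 0.
  by under eq_bigr do rewrite expr_div_n; rewrite -mulr_suml k0 mul0r.
move=> /eqP; rewrite psumr_eq0 => [/allP/(_ i (mem_index_enum _))|j _].
  by rewrite divff // expr1n oner_eq0.
have [q' qr' ->] := st j; rewrite mulfK // -realEsqr //.
Qed.

(** Otherwise the iterates of ad x on some b j would have D.+1 distinct weights, while only D
    indices are available. *)
Lemma hwt_adnil a x : hwt h a x -> (exists2 t, t \in h & a t != 0) ->
  exists q, forall y, iter q (lie x) y = 0.
Proof.
move=> Hx [t th at0]; exists D.+1 => y.
have it n c u v : iter n (lie x) (c *: u + v) = c *: iter n (lie x) u + iter n (lie x) v.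
  by elim: n => //= n ->; rewrite linearP.
have it0 n : iter n (lie x) 0 = 0 by elim: n => //= n ->; rewrite linear0.
rewrite (bcK y); elim/big_ind: _ => [|u v Hu Hv|j _]; first exact: it0.
  by have := it D.+1 1 u v; rewrite !scale1r Hu Hv addr0.
have -> : iter D.+1 (lie x) (bc j y *: b j) = bc j y *: iter D.+1 (lie x) (b j).
  by have := it D.+1 (bc j y) (b j) 0; rewrite it0 !addr0.
suff -> : iter D.+1 (lie x) (b j) = 0 by rewrite scaler0.
apply: contrapT => N.
have wn n : hwt h (fun t => n%:R * a t + w j t) (iter n (lie x) (b j)).
  elim: n => [|n IH] /=; first by apply: hwt_ext (wt j) => s _; rewrite mul0r add0r.
  by apply: hwt_ext (hwt_lie Hx IH) => s _; rewrite -natr1 mulrDl mul1r addrA [a s + _]addrC.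
have Nn n : (n <= D.+1)%N -> iter n (lie x) (b j) <> 0.
  by move=> nD; apply: contra_not N => E; rewrite -(subnK nD) iterD E it0.
have H (n : 'I_D.+1) : exists k, w k t = n%:R * a t + w j t.
  have [k Hk] := hwt_neq0 (wn n) (Nn _ (ltnW (ltn_ord n))); exists k; exact: Hk.
pose f n := projT1 (cid (H n)).
have fE n : w (f n) t = n%:R * a t + w j t := projT2 (cid (H n)).
have fi : injective f.
  move=> n n' E; have := fE n; rewrite E fE => /addIr/(mulIf at0)/eqP.
  by rewrite eqr_nat => /eqP/val_inj.
by have := leq_card f fi; rewrite !card_ord ltnn.
Qed.

(** The radical of the Killing form. *)
Definition krad x := forall y, kf x y = 0.

Lemma krad_lie x y : krad x -> krad (lie x y).
Proof. by move=> Hx z; rewrite (tform_lie admx_lie). Qed.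

Lemma kradP c x y : krad x -> krad y -> krad (c *: x + y).
Proof. by move=> Hx Hy z; rewrite tformDl tformZl Hx Hy mulr0 addr0. Qed.

Lemma krad_b x : (forall j, kf x (b j) = 0) -> krad x.
Proof.
move=> H y; rewrite (bcK y) tformC tform_suml big1 // => i _.
by rewrite tformZl tformC H mulr0.
Qed.

Definition wsame i : pred 'I_D := fun k => `[< forall t, t \in h -> w k t = w i t >].
Definition wcomp i x : g := \sum_(k | wsame i k) (bc k x : K) *: b k.

Lemma wcomp_hwt i x : hwt h (w i) (wcomp i x).
Proof.
move=> t th; rewrite linear_sum scaler_sumr; apply: eq_bigr => k /asboolP E.
by rewrite linearZ /= wt // scalerA mulrC -scalerA E.
Qed.

(** All indices of equal weight give the same component, hence the division by their number. *)
Lemma wcomp_sum x : x = \sum_i (#|wsame i|%:R^-1 : K) *: wcomp i x.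
Proof.
rewrite [LHS]bcK; under [RHS]eq_bigr do rewrite scaler_sumr.
rewrite (exchange_big_dep predT) //=; apply: eq_bigr => k _.
have E i : wsame i k -> wsame i =1 wsame k.
  move=> /asboolP ik j; apply/asboolP/asboolP => H t th; first by rewrite H // ik.
  by rewrite H // ik.
have Es i : wsame i k = wsame k i.
  by apply/asboolP/asboolP => H t th; rewrite H.
rewrite (eq_bigr (fun i => (#|wsame k|%:R^-1 : K) *: ((bc k x : K) *: b k))); last first.
  by move=> i ik; rewrite (eq_card (B := wsame k)) // => j; exact: E ik j.
rewrite (eq_bigl (wsame k)) // sumr_const -scaler_nat scalerA mulfV ?scale1r //.
by rewrite pnatr_eq0 -lt0n; apply/card_gt0P; exists k; apply/asboolP.
Qed.

Lemma krad_wcomp i x : krad x -> krad (wcomp i x).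
Proof.
move=> Hx; apply: krad_b => j.
have [H|/existsNP[t /not_implyP[th /eqP tN]]] := pselect (forall t, t \in h -> w i t + w j t = 0).
  rewrite -(Hx (b j)) [in RHS](bcK x) /wcomp !tform_suml big_mkcond /=; apply: eq_bigr => k _.
  case: ifP => // /asboolP /existsNP[t /not_implyP[th /eqP tN]].
  rewrite tformZl (tform_orth admx_lie (wt k) (wt j) th) ?mulr0 //.
  by apply: contraNneq tN => E; apply/eqP; apply: (addIr (w j t)); rewrite H.
exact: (tform_orth admx_lie (wcomp_hwt _ _) (wt j) th).
Qed.

Lemma krad_isotropic i j x y : krad x -> krad y -> hwt h (w i) x -> hwt h (w j) y ->
  (forall t, t \in h -> w i t + w j t = 0) -> lie x y = 0.
Proof.
move=> Hx Hy wx wy ij; apply: (killing_isotropic wx (i := i)).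
  by apply: hwt_ext wy => t th; apply/eqP; rewrite -addr_eq0 addrC ij.
by apply: krad_lie.
Qed.

Definition kradS x := krad x /\
  (x = 0 \/ exists2 i, hwt h (w i) x & exists2 t, t \in h & w i t != 0).

Lemma kradS_lie i j x y : krad x -> krad y -> hwt h (w i) x -> hwt h (w j) y ->
  kradS (lie x y).
Proof.
move=> Hx Hy wx wy; split; first exact: krad_lie.
have [->|l0] := pselect (lie x y = 0); [by left|right].
have [k Hk] := hwt_neq0 (hwt_lie wx wy) l0; exists k.
  by apply: hwt_ext (hwt_lie wx wy) => t th; rewrite Hk.
apply: contrapT => N; apply: l0; apply: (krad_isotropic Hx Hy wx wy) => t th.
by rewrite -Hk //; apply: contrapT => /eqP kt; apply: N; exists t.
Qed.

(** Cartan's criterion through weights. Homogeneous elements of the radical bracket to zero when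
    their weights are opposite, so [kradS] is closed under brackets and consists of ad-nilpotent
    elements. By [engel_jacobson] its span acts nilpotently, and it contains [r, r]; so r is a
    solvable ideal. *)
Lemma killing_nondeg x : krad x -> x = 0.
Proof.
have lin : linear (fun x => \row_j kf x (b j) : 'rV[K]_D).
  by move=> c y z; apply/rowP => j; rewrite !mxE tformDl tformZl.
pose r := lker (linfun (lin_pack lin)).
have rP y : y \in r <-> krad y.
  rewrite memv_ker lfunE /=; split=> [/eqP/rowP E|Hy].
    by apply: krad_b => j; have := E j; rewrite !mxE.
  by apply/eqP/rowP => j; rewrite !mxE Hy.
suff : r = 0%VS by move=> r0 Hx; apply/eqP; rewrite -memv0 -r0; apply/rP.
have krad0 : krad 0 by apply/rP; exact: mem0v.
have [||l [R [lS SB lnil]]] := @engel_jacobson _ g kradS.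
- move=> y z [Hy [->|[i wy _]]] [Hz [->|[j wz _]]].
  + by rewrite linear0; split=> //; left.
  + by rewrite lie0l; split=> //; left.
  + by rewrite linear0; split=> //; left.
  + exact: kradS_lie wy wz.
- move=> y [_ [->|[i wy nz]]]; last exact: hwt_adnil wy nz.
  by exists 1%N => z /=; rewrite lie0l.
apply: ss.
  by move=> y z /rP Hz; apply/rP; rewrite lie_anti -scaleN1r -[_ *: _]addr0; apply: kradP => //; exact: krad_lie.
have rB y z : y \in r -> z \in r -> lie y z \in <<l>>%VS.
  move=> /rP Hy /rP Hz; rewrite (wcomp_sum y) (wcomp_sum z) lie_suml; apply: memv_suml => i _.
  rewrite lieZl memvZ // linear_sum; apply: memv_suml => j _; rewrite linearZ memvZ //.
  by apply: SB; apply: kradS_lie (wcomp_hwt i y) (wcomp_hwt j z); exact: krad_wcomp.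
exists R.+1; apply/eqP; rewrite -subv0.
pose Dr k := iter k (fun W => lie_prodv W W) r.
have Drr k : (Dr k <= r)%VS.
  elim: k => // k IH; apply/lie_prodvP => y z /(subvP IH)/rP Hy _.
  by apply/rP; exact: krad_lie.
have DB k : (Dr k.+1 <= <<l>>)%VS.
  by apply/lie_prodvP => y z /(subvP (Drr k)) Hy /(subvP (Drr k)) Hz; exact: rB.
(* Each bracket with the derived ideal, which lies in the span of l, lowers the nilpotency index by
   one; after R steps nothing is left. *)
suff H k : (k <= R)%N -> forall v : admod g, (v : g) \in Dr k.+1 -> nilp <<l>>%VS (@zchar K g) (R - k) v.
  by apply/subvP => v /(H R (leqnn R)); rewrite subnn => /= ->; exact: mem0v.
elim: k => [|k IH] kR v; first by rewrite subn0 => _; exact: lnil.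
rewrite /Dr iterS -/(Dr k.+1) => Hv.
apply: (span_ind (P := fun v : g => nilp <<l>>%VS (zchar g) (R - k.+1) (v : admod g))) Hv.
- exact: (@nilp0 _ _ (admod g)).
- move=> c x1 y1 Hx Hy.
  have := nilpP c Hx Hy; rewrite (repmod_scalar (r := adrep g)); exact.
move=> _ /allpairsP[[y z] [/= yD zD ->]].
have yB : y \in <<l>>%VS by apply: (subvP (DB k)); exact: vbasis_mem.
have := IH (ltnW kR) z (vbasis_mem zD); rewrite -(subnSK kR) => /= /(_ y yB).
by rewrite admod_tw.
Qed.

Lemma killing_dual : exists bd : 'I_D -> g, forall i j, kf (bd i) (b j) = (i == j)%:R.
Proof.
pose G : 'M[K]_D := \matrix_(i, j) kf (b i) (b j).
have Gu : G \in unitmx.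
  rewrite -row_free_unit -kermx_eq0; apply/eqP/row_matrixP => i; rewrite row0.
  pose a := row i (kermx G); pose x := \sum_j a 0 j *: b j.
  have x0 : x = 0.
    apply: killing_nondeg; apply: krad_b => j.
    have := congr1 (fun M : 'rV_D => M 0 j) (sub_kermxP (row_sub i (kermx G))).
    rewrite !mxE => <-; rewrite tform_suml; apply: eq_bigr => k _.
    by rewrite tformZl !mxE.
  by apply/rowP => j; rewrite [RHS]mxE -[LHS](bc_sum (fun j => a 0 j) j) -/x x0 linear0.
exists (fun i => \sum_k (invmx G) i k *: b k) => i j.
have := congr1 (fun M : 'M_D => M i j) (mulVmx Gu); rewrite !mxE => <-.
by rewrite tform_suml; apply: eq_bigr => k _; rewrite tformZl !mxE.
Qed.
Definition bd := projT1 (cid killing_dual).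
Lemma bdE i j : kf (bd i) (b j) = (i == j)%:R.
Proof. by rewrite /bd; case: cid => /= f. Qed.

Lemma kfI x y : (forall j, kf x (b j) = kf y (b j)) -> x = y.
Proof.
move=> H; apply/eqP; rewrite -subr_eq0; apply/eqP/killing_nondeg/krad_b => j.
by rewrite addrC -scaleN1r tformDl tformZl H mulN1r addNr.
Qed.

Lemma bdK x : x = \sum_i kf x (b i) *: bd i.
Proof.
apply: kfI => j; rewrite tform_suml (bigD1 j) //= big1 => [|i ij].
  by rewrite tformZl bdE eqxx mulr1 addr0.
by rewrite tformZl bdE (negPf ij) mulr0.
Qed.

Lemma bcE x i : bc i x = kf (bd i) x.
Proof.
rewrite [in RHS](bcK x) tformC tform_suml (bigD1 i) //= big1 => [|j ji].
  by rewrite tformZl tformC bdE eqxx mulr1 addr0.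
by rewrite tformZl tformC bdE eq_sym (negPf ji) mulr0.
Qed.

Lemma bd_wt i : hwt h (fun t => - w i t) (bd i).
Proof.
move=> t th; apply: kfI => j; rewrite lie_anti -scaleN1r tformZl (tform_lie admx_lie) wt //.
rewrite tformC !tformZl [in LHS]tformC !bdE.
by have [->|_] := eqVneq i j; rewrite ?mulr1 ?mulr0 ?mulN1r.
Qed.

Definition casimir : envalg g := \sum_i env_inj (b i) * env_inj (bd i).

(** By invariance of the Killing form, the coefficients of [x, b_i] in the basis and those of
    [x, bd_j] in the dual basis are opposite, so the two sums cancel. *)
Lemma casimir_central : env_center casimir.
Proof.
have C x : env_inj x * casimir = casimir * env_inj x.
  apply/eqP; rewrite -subr_eq0 /casimir mulr_sumr mulr_suml -sumrB.
  rewrite (eq_bigr (fun i => env_inj (lie x (b i)) * env_inj (bd i) +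
     env_inj (b i) * env_inj (lie x (bd i)))); last first.
    move=> i _; rewrite !env_inj_lie mulrBl mulrBr !mulrA addrA subrK.
    by [].
  rewrite big_split /=.
  rewrite (eq_bigr (fun i => \sum_j bc j (lie x (b i)) *: (env_inj (b j) * env_inj (bd i)))); last first.
    move=> i _; rewrite [in LHS](bcK (lie x (b i))) linear_sum mulr_suml; apply: eq_bigr => j _.
    by rewrite linearZ /= scalerAl.
  rewrite [X in _ + X](eq_bigr (fun i => \sum_j kf (lie x (bd i)) (b j) *: (env_inj (b i) * env_inj (bd j)))); last first.
    move=> i _; rewrite [in LHS](bdK (lie x (bd i))) linear_sum mulr_sumr; apply: eq_bigr => j _.
    by rewrite linearZ /= scalerAr.
  rewrite exchange_big -big_split big1 //= => i _; rewrite -big_split big1 //= => j _.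
  rewrite -scalerDl bcE [lie x (bd _)]lie_anti -(scaleN1r (lie _ x)) tformZl (tform_lie admx_lie).
  by rewrite mulN1r subrr scale0r.
move=> u; elim/env_alg_ind: u => [c|x|u v IHu IHv|u v IHu IHv].
- by rewrite mulr_algr mulr_algl.
- exact/esym/C.
- by rewrite mulrDr mulrDl IHu IHv.
- by rewrite mulrA IHu -mulrA IHv mulrA.
Qed.

Lemma bd_h i t : t \in h -> kf (lie (b i) (bd i)) t = w i t.
Proof.
move=> th; rewrite (tform_lie admx_lie) lie_anti bd_wt // scaleNr opprK.
by rewrite tformC tformZl bdE eqxx mulr1.
Qed.

Section Star.
Variables (n : nat) (rho : {linear g -> 'M[K]_n}) (mu : 'I_n -> g -> K).
Hypothesis rhoL : forall x y, rho (lie x y) = rho x *m rho y - rho y *m rho x.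
Hypothesis rhoD : forall t, t \in h -> rho t = diag_mx (\row_j mu j t).

Let t_ i := lie (b i) (bd i).
Let c_ i := w i (t_ i).
Let t_h i : t_ i \in h. Proof. exact: hwt_lie0 (wt i) (bd_wt i). Qed.

(** A positivity argument: the trace of the Casimir element is a sum of squares of the real numbers
    mu j (t_ i) with nonnegative coefficients. If it is zero, all weights mu j vanish on h, and then
    every weight vector of nonzero weight acts as zero too. *)
Lemma tr_casimir_eq0 : \sum_i tform rho (b i) (bd i) = 0 -> forall x, rho x = 0.
Proof.
have cE i : c_ i = \sum_k w k (t_ i) ^+ 2 by rewrite -killing_h // bd_h.
have c0 i : c_ i = 0 -> wzero i.
  move=> ci t th; rewrite -bd_h // -/(t_ i).
  suff -> : t_ i = 0 by rewrite -(scale0r (0 : g)) tformZl mul0r.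
  apply: h_center => // k; have [q _] := string_real hN admx_lie admx_h k (wt i) (bd_wt i).
  by rewrite -/(t_ i) -/(c_ i) ci mulr0.
(* c_i is the sum of the squares of the real multiples q k * c_i of itself, so either it is zero or
   its inverse is a sum of real squares. *)
have cr i : 0 <= c_ i.
  have [/c0|/eqP ci] := pselect (c_ i = 0); first by move=> H; rewrite /c_ H.
  have H k : exists q, q \is Num.real /\ w k (t_ i) = q * c_ i.
    by have [q qr E] := string_real hN admx_lie admx_h k (wt i) (bd_wt i); exists q.
  pose q k := projT1 (cid (H k)).
  have [qr qE] : (forall k, q k \is Num.real) /\ (forall k, w k (t_ i) = q k * c_ i).
    by split=> k; have [] := projT2 (cid (H k)).
  have E : c_ i * (\sum_k q k ^+ 2) = 1.
    apply: (mulfI ci); rewrite mulr1 [in RHS]cE mulrA -expr2 mulr_sumr.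
    by apply: eq_bigr => k _; rewrite qE exprMn mulrC.
  have S0 : 0 <= \sum_k q k ^+ 2 by apply: sumr_ge0 => k _; rewrite -realEsqr.
  have := invr_ge0 (\sum_k q k ^+ 2); rewrite S0.
  by rewrite (_ : _^-1 = c_ i) // -[LHS]mul1r -E mulfK //; apply/eqP => S00; move/eqP: E; rewrite S00 mulr0 eq_sym oner_eq0.
have m2 j i : 0 <= mu j (t_ i) ^+ 2.
  have [q qr ->] := string_real hN rhoL rhoD j (wt i) (bd_wt i).
  rewrite -/(t_ i) -/(c_ i) -realEsqr rpredM //; exact: ger0_real.
(* The element of h that represents mu j for the Killing form, see [tmE]. *)
pose tm j := \sum_(i | `[< wzero i >]) mu j (b i) *: bd i.
have bh i : wzero i -> b i \in h by move=> H; apply: hwt0 (wt i).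
have bdh i : wzero i -> bd i \in h.
  by move=> H; apply: hwt0 (bd_wt i) => // t th; rewrite H // oppr0.
have tmh j : tm j \in h by apply: memv_suml => i /asboolP/bdh; exact: memvZ.
have muL j c t t' : t \in h -> t' \in h -> mu j (c *: t + t') = c * mu j t + mu j t'.
  move=> th th'; have := linearP rho c t t'; rewrite !rhoD ?memvD ?memvZ //.
  by move=> /matrixP/(_ j j); rewrite !mxE eqxx.
have mu0 j : mu j 0 = 0.
  by have := muL j (-1) 0 0 (mem0v _) (mem0v _); rewrite scaler0 addr0 mulN1r addNr.
have muS j (P : pred 'I_D) (a : 'I_D -> K) (F : 'I_D -> g) : (forall i, P i -> F i \in h) ->
    mu j (\sum_(i | P i) a i *: F i) = \sum_(i | P i) a i * mu j (F i).
  move=> HF; suff [] : \sum_(i | P i) a i *: F i \in h /\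
     mu j (\sum_(i | P i) a i *: F i) = \sum_(i | P i) a i * mu j (F i) by [].
  elim/big_rec2: _ => [|i u v Pi [vh <-]]; first by rewrite mem0v mu0.
  by rewrite muL ?HF // memvD ?memvZ ?HF.
have tmE j t : t \in h -> kf (tm j) t = mu j t.
  move=> th; rewrite tform_suml.
  have -> : t = \sum_(i | `[< wzero i >]) (bc i t : K) *: b i.
    rewrite [LHS]bcK big_mkcond /= [RHS]big_mkcond; apply: eq_bigr => i _.
    case: ifP => // /asboolP iz; have [->|ti] := eqVneq (bc i t) 0; first by rewrite scale0r.
    case: iz => s sh; apply: (hwt_coord (a := fun=> 0) _ ti sh) => s' sh'.
    by rewrite scale0r hC.
  rewrite muS; last by move=> i /asboolP; exact: bh.
  apply: eq_bigr => i iz; rewrite tformZl mulrC; congr (_ * _).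
  by rewrite -bcE linear_sum (bigD1 i) //= linearZ /= bcb eqxx big1 ?addr0 ?[_ *: _]mulr1 // => k /andP[_ ki];
   rewrite linearZ /= bcb eq_sym (negPf ki) [_ *: _]mulr0.
have tm2 j : \sum_(i | `[< wzero i >]) mu j (b i) * mu j (bd i) = \sum_k mu j (t_ k) ^+ 2.
  rewrite -muS; last by move=> i /asboolP; exact: bdh.
  rewrite -/(tm j) -tmE // killing_h //; apply: eq_bigr => k _.
  by rewrite -bd_h // -/(t_ k) tformC tmE.
have pos i : ~ wzero i -> tform rho (b i) (bd i) = (c_ i)^-1 * \sum_j mu j (t_ i) ^+ 2.
  move=> iz; have ci : c_ i != 0 by apply/eqP => /c0.
  apply: (mulfI ci); rewrite mulrA divff // mul1r.
  have <- : tform rho (t_ i) (t_ i) = \sum_j mu j (t_ i) ^+ 2.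
    by rewrite (tform_h rhoD).
  rewrite {1}/t_ (tform_lie rhoL) lie_anti bd_wt // scaleNr opprK.
  by rewrite [in RHS]tformC tformZl tformC.
have zer i : wzero i -> tform rho (b i) (bd i) = \sum_j mu j (b i) * mu j (bd i).
  by move=> iz; rewrite (tform_h rhoD) ?bh ?bdh.
(* Indices of weight zero contribute the norms of the mu j, the others the terms of [pos]; both sums
   are nonnegative, hence both vanish. *)
rewrite (bigID (fun i => `[< wzero i >])) /= (eq_bigr _ (fun i iz => zer i (asboolW iz))).
rewrite exchange_big (eq_bigr _ (fun j _ => tm2 j)) /= => S0.
have pos' i : ~~ `[< wzero i >] -> 0 <= tform rho (b i) (bd i).
  by move=> /asboolP/pos ->; rewrite mulr_ge0 ?invr_ge0 // sumr_ge0.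
have mu_t j i : mu j (t_ i) = 0.
  have : \sum_j \sum_k mu j (t_ k) ^+ 2 = 0.
    move/eqP: S0; rewrite paddr_eq0 ?sumr_ge0 // => [/andP[/eqP]//|j' _].
    by rewrite sumr_ge0.
  move=> /eqP; rewrite psumr_eq0 => [/allP/(_ j (mem_index_enum _))|j' _]; last by rewrite sumr_ge0.
  rewrite psumr_eq0 // => /allP/(_ i (mem_index_enum _)).
  by rewrite sqrf_eq0 => /eqP.
have tm0 j : tm j = 0.
  by apply: h_center => // k; rewrite -bd_h // -/(t_ k) tformC tmE // mu_t.
have muh j t : t \in h -> mu j t = 0.
  by move=> th; rewrite -tmE // tm0 -(scale0r (0 : g)) tformZl mul0r.
have rhoh t : t \in h -> rho t = 0.
  move=> th; rewrite rhoD //; apply/matrixP => i j; rewrite !mxE muh //.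
  by rewrite mul0rn.
have rhob i : rho (b i) = 0.
  have [/bh/rhoh //|/existsNP[t /not_implyP[th /eqP tN]]] := pselect (wzero i).
  have := rhoL t (b i); rewrite (wt i th) (rhoh t th) mul0mx mulmx0 subrr linearZ /= => /eqP.
  by rewrite scaler_eq0 (negPf tN) => /eqP.
by move=> x; rewrite (bcK x) linear_sum big1 // => i _; rewrite linearZ /= rhob scaler0.
Qed.
End Star.
End Killing.

Lemma nilpotent_mxtrace (F : closedFieldType) n (A : 'M[F]_n) a :
  (forall v : 'rV_n, iter a (mulmxr A) v = 0) -> \tr A = 0.
Proof.
case: n A => [|n] A HA; first by rewrite /mxtrace big_ord0.
have [rs E] := closed_field_poly_normal (char_poly A).
have {}E : char_poly A = \prod_(z <- rs) ('X - z%:P).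
  by rewrite {1}E (monicP (char_poly_monic A)) scale1r.
have rs0 z : z \in rs -> z = 0.
  move=> zr; have : root (char_poly A) z by rewrite E root_prod_XsubC.
  rewrite -eigenvalue_root_char => /eigenvalueP[v vA v0].
  have it j : iter j (mulmxr A) v = z ^+ j *: v.
    elim: j => [|j IH]; first by rewrite scale1r.
    by rewrite iterS IH /= -scalemxAl vA scalerA exprSr.
  move: (HA v); rewrite it => /eqP; rewrite scaler_eq0 (negPf v0) orbF.
  by rewrite expf_eq0 => /andP[_ /eqP].
have := char_poly_trace A isT; have -> : char_poly A = 'X^(n.+1).
  have sz := size_char_poly A; rewrite E size_prod_XsubC in sz; case: sz => sz.
  rewrite E (eq_big_seq (fun=> 'X)) ?big_const_seq ?count_predT ?sz ?iter_mulr_1 //.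
  by move=> z /rs0 ->; rewrite subr0.
by rewrite coefXn /= ltn_eqF // => /esym/eqP; rewrite oppr_eq0 => /eqP.
Qed.

Lemma lspan_tnthP (S : nzRingType) (M : lmodType S) (l : seq M) v :
  lspan l v <-> exists a : 'I_(size l) -> S, v = \sum_i a i *: tnth (in_tuple l) i.
Proof. by have := lspan_ordP (tnth (in_tuple l)) v; rewrite map_enum_tnth. Qed.

Lemma free_sublist (K : fieldType) (V : lmodType K) (l : seq V) : exists l' : seq V,
  [/\ {subset l' <= l}, forall v, lspan l v -> lspan l' v &
   forall a : 'I_(size l') -> K, \sum_i a i *: tnth (in_tuple l') i = 0 -> forall i, a i = 0].
Proof.
elim: l => [|x l [l' [l's l'sp l'f]]].
  by exists [::]; split=> // a _ [].
have [xl|xl] := pselect (lspan l' x).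
  exists l'; split=> // [z /l's|v /= [a /l'sp H]]; first by rewrite inE => ->; rewrite orbT.
  by have /= E := submodD (lspan_submod l') H (submodZ (lspan_submod l') a xl); rewrite subrK in E.
exists (x :: l'); split.
- by move=> z; rewrite !inE => /orP[->//|/l's ->]; rewrite orbT.
- by move=> v /= [a /l'sp H]; exists a.
move=> a; rewrite big_ord_recl => E.
have E2 : \sum_(i < size l') a (lift ord0 i) *: tnth (in_tuple l') i = - (a ord0 *: x).
  apply/eqP; rewrite -addr_eq0 addrC -[X in _ == X]E; apply/eqP; congr (_ + _).
  by apply: eq_bigr => i _; rewrite !(tnth_nth 0).
have a0 : a ord0 = 0.
  apply: contrapT => /eqP a0; apply: xl.
  have -> : x = \sum_(i < size l') (- (a ord0)^-1 * a (lift ord0 i)) *: tnth (in_tuple l') i.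
    under eq_bigr do rewrite -scalerA.
    by rewrite -scaler_sumr E2 scalerN scaleNr opprK scalerA mulVf ?scale1r.
  by apply/lspan_tnthP; eexists.
have := l'f (fun i => a (lift ord0 i)); rewrite E2 a0 scale0r oppr0 => /(_ erefl) H i.
by case: (unliftP ord0 i) => [j ->|->].
Qed.

(** * A Reynolds operator onto the center *)

Section Casimir.
Variables (K : numClosedFieldType) (g : lieAlgType K) (h : {vspace g}).
Variables (D : nat) (b : 'I_D -> g) (bc : 'I_D -> {linear g -> K^o}) (w : 'I_D -> g -> K).
Local Notation U := (envalg g).
Hypothesis ss : semisimple g.
Hypothesis bcK : forall x, x = \sum_i (bc i x : K) *: b i.
Hypothesis bcb : forall i j, bc i (b j) = (i == j)%:R.
Hypothesis wt : forall i, hwt h (w i) (b i).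
Hypothesis hC : forall t t', t \in h -> t' \in h -> lie t t' = 0.
Hypothesis hN : forall x, (forall t, t \in h -> lie t x = 0) -> x \in h.

Let Om : U := casimir ss bcK bcb wt hN.

(** In a basis extracted from l, h acts by diagonal matrices and the Casimir element by a nilpotent
    matrix, hence of trace zero, and [tr_casimir_eq0] applies. *)
Lemma casimir_trivial (X : lmodType U) (l : seq (kmod X)) a :
  (forall v, v \in l -> exists mu : g -> K, forall t, t \in h -> env_inj t *: (v : X) = ((mu t)%:A : U) *: (v : X)) ->
  (forall x v, v \in l -> lspan l (env_inj x *: (v : X) : kmod X)) ->
  (forall v, v \in l -> Om ^+ a *: (v : X) = 0) ->
  forall x v, v \in l -> env_inj x *: (v : X) = 0.
Proof.
move=> lw lst lnil; have [l' [l'l ll' l'f]] := free_sublist l.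
pose n := size l'; pose v (i : 'I_n) : X := tnth (in_tuple l') i.
have vl i : (v i : kmod X) \in l by apply: l'l; exact: mem_tnth.
have span (y : X) : lspan l (y : kmod X) -> exists c : 'I_n -> K, y = \sum_i ((c i)%:A : U) *: v i.
  by move=> /ll'/lspan_tnthP.
have vf (c d : 'I_n -> K) : \sum_i ((c i)%:A : U) *: v i = \sum_i ((d i)%:A : U) *: v i -> forall i, c i = d i.
  move=> E i; apply/eqP; rewrite -subr_eq0; apply/eqP.
  apply: (l'f (fun i => c i - d i)).
  have -> : \sum_i (c i - d i) *: tnth (in_tuple l') i =
     \sum_i ((c i)%:A : U) *: v i - \sum_i ((d i)%:A : U) *: v i.
    by rewrite -sumrB; apply: eq_bigr => j _; rewrite -scalerBl -scalerBl.
  by rewrite E subrr.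
have He x j : exists c : 'I_n -> K, env_inj x *: v j = \sum_i ((c i)%:A : U) *: v i.
  by apply: span; apply: lst.
pose rf x : 'M[K]_n := \matrix_(k, j) projT1 (cid (He x j)) k.
have rE x j : env_inj x *: v j = \sum_k ((rf x k j)%:A : U) *: v k.
  by rewrite [LHS](projT2 (cid (He x j))); apply: eq_bigr => k _; rewrite mxE.
pose comb (c : 'I_n -> K) := \sum_i ((c i)%:A : U) *: v i.
have combD c d : comb c + comb d = comb (fun i => c i + d i).
  by rewrite /comb -big_split; apply: eq_bigr => i _ /=; rewrite -scalerDl -scalerDl.
have combB c d : comb c - comb d = comb (fun i => c i - d i).
  by rewrite /comb -sumrB; apply: eq_bigr => i _ /=; rewrite -scalerBl -scalerBl.
have combZ e c : (e%:A : U) *: comb c = comb (fun i => e * c i).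
  by rewrite /comb scaler_sumr; apply: eq_bigr => i _; rewrite scalerA mulr_algl scalerA.
have rC x c : env_inj x *: comb c = comb (fun k => \sum_j rf x k j * c j).
  rewrite /comb scaler_sumr; under eq_bigr do rewrite scalerA mulr_algr -mulr_algl -scalerA rE scaler_sumr.
  rewrite exchange_big; apply: eq_bigr => k _; rewrite scaler_suml scaler_suml; apply: eq_bigr => j _.
  by rewrite scalerA mulr_algl scalerA mulrC.
have rEc z i : env_inj z *: v i = comb (fun k => rf z k i) by rewrite rE.
have rlin : linear rf.
  move=> c x y; apply/matrixP => k j; rewrite [RHS]mxE [X in _ = X + _]mxE; move: k; apply: vf.
  rewrite -[LHS]rE linearP scalerDl.
  by rewrite -[X in X *: _ + _]mulr_algl -scalerA !rEc combZ combD.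
pose rho : {linear g -> 'M[K]_n} := lin_pack rlin.
have rhoL x y : rho (lie x y) = rho x *m rho y - rho y *m rho x.
  apply/matrixP => k j; move: k; apply: vf; rewrite -[LHS]rE env_inj_lie scalerBl -!scalerA.
  rewrite !rEc !rC combB; apply: eq_bigr => k _; congr ((_ *: _) *: _).
  by rewrite [RHS]mxE [X in _ = _ + X]mxE mxE [in RHS]mxE.
pose mu j t := rf t j j.
have rhoD t : t \in h -> rho t = diag_mx (\row_j mu j t).
  move=> th; apply/matrixP => k j; rewrite [RHS]mxE [X in X *+ _]mxE -mulr_natr /= /mu.
  have [m Hm] := lw _ (vl j).
  have E i : rf t i j = m t * (i == j)%:R.
    move: i; apply: vf; rewrite -[LHS]rE Hm // (bigD1 j) //= eqxx mulr1 big1 ?addr0 // => i ij.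
    by rewrite (negPf ij) mulr0 scale0r scale0r.
  by rewrite E; case: eqVneq => [->|_]; rewrite ?mulr0 // E eqxx !mulr1.
pose bd := bd ss bcK bcb wt hN.
pose C : 'M[K]_n := \sum_i rho (b i) *m rho (bd i).
have OC c : Om *: comb c = comb (fun k => \sum_j C k j * c j).
  rewrite /Om /casimir scaler_suml.
  rewrite (eq_bigr (fun i => comb (fun k => \sum_j (rho (b i) *m rho (bd i)) k j * c j))); last first.
    move=> i _; rewrite -scalerA !rC; apply: eq_bigr => k _; congr ((_ *: _) *: _).
    under eq_bigr do rewrite mulr_sumr.
    rewrite exchange_big; apply: eq_bigr => j _; rewrite mxE mulr_suml; apply: eq_bigr => i' _.
    by rewrite mulrA.
  rewrite /comb exchange_big; apply: eq_bigr => k _; rewrite -scaler_suml -scaler_suml.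
  congr ((_ *: _) *: _); rewrite exchange_big; apply: eq_bigr => j _.
  by rewrite /C summxE mulr_suml.
have tr0 : \tr C = 0.
  rewrite -mxtrace_tr; apply: (@nilpotent_mxtrace _ _ _ a) => r.
  have it j : Om ^+ j *: comb (fun k => r 0 k) = comb (fun k => iter j (mulmxr C^T) r 0 k).
    elim: j => [|j IH]; first by rewrite scale1r.
    rewrite exprS -scalerA IH OC; apply: eq_bigr => k _; congr ((_ *: _) *: _).
    by rewrite /= mxE; apply: eq_bigr => i _; rewrite mxE mulrC.
  apply/rowP => k; rewrite [RHS]mxE; move: k; apply: vf; transitivity (0 : X).
    rewrite -[LHS]/(comb _) -it scaler_sumr big1 // => i _.
    by rewrite scalerA mulr_algr -mulr_algl -scalerA lnil ?scaler0.
  by rewrite big1 // => i _; rewrite scale0r scale0r.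
have rho0 x : rho x = 0.
  apply: (tr_casimir_eq0 (ss := ss) (bcK := bcK) (bcb := bcb) (wt := wt) hC (hN := hN) rhoL rhoD).
  by rewrite -[RHS]tr0 /C raddf_sum.
have lv0 x i : env_inj x *: v i = 0.
  rewrite rE big1 // => k _.
  have -> : rf x k i = 0 by rewrite -[rf x]/(rho x) rho0 mxE.
  by rewrite scale0r scale0r.
move=> x y yl; have [c ->] := span y (lspan_mem yl).
rewrite scaler_sumr big1 // => i _.
by rewrite scalerA mulr_algr -mulr_algl -scalerA lv0 scaler0.
Qed.

Lemma adU_linr (x : g) : linear (fun u : U => env_inj x * u - u * env_inj x).
Proof.
by move=> c u v; rewrite mulrDr mulrDl opprD addrACA scalerBr -scalerAr -scalerAl.
Qed.
Lemma adU_linl c (x y : g) (u : U) : env_inj (c *: x + y) * u - u * env_inj (c *: x + y) =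
  c *: (env_inj x * u - u * env_inj x) + (env_inj y * u - u * env_inj y).
Proof.
by rewrite linearP mulrDr mulrDl opprD addrACA scalerBr -scalerAr -scalerAl.
Qed.
Lemma adU_lie (x y : g) (u : U) : env_inj (lie x y) * u - u * env_inj (lie x y) =
  (env_inj x * (env_inj y * u - u * env_inj y) - (env_inj y * u - u * env_inj y) * env_inj x) -
  (env_inj y * (env_inj x * u - u * env_inj x) - (env_inj x * u - u * env_inj x) * env_inj y).
Proof.
have E (V : zmodType) (p q r s t v : V) :
    p - t - (v - s) = p - q - (r - s) - (t - r - (q - v)).
  by rewrite !opprB [RHS]addrACA !subrKA [LHS]addrACA [RHS]addrACA [- t - v]addrC.
by rewrite env_inj_lie !mulrBl !mulrBr !mulrA; exact: E.
Qed.
Definition adUrep : lierep g U := LieRep adU_linr adU_linl adU_lie.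
Local Notation adU := (repmod adUrep).

Lemma adU_gen x (u : adU) : env_inj x *: u = env_inj x * (u : U) - (u : U) * env_inj x.
Proof. exact: repmod_gen. Qed.

Lemma adU_mul (v : U) (u : adU) (z : U) : env_center z -> v *: ((u : U) * z : adU) = ((v *: u : adU) : U) * z.
Proof.
move=> zC; elim/env_alg_ind: v u => [c|x|v1 v2 IH1 IH2|v1 v2 IH1 IH2] u.
- by rewrite !(repmod_scalar (r := adUrep)) [LHS]scalerAl.
- by rewrite !adU_gen mulrBl -!mulrA zC.
- by rewrite !scalerDl IH1 IH2 -mulrDl.
- by rewrite -!scalerA IH2 IH1.
Qed.

Lemma adU_central (u : adU) : (forall x, env_inj x *: u = 0) -> env_center (u : U).
Proof.
move=> H v; elim/env_alg_ind: v => [c|x|v1 v2 IH1 IH2|v1 v2 IH1 IH2].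
- by rewrite mulr_algr mulr_algl.
- by have /eqP := H x; rewrite adU_gen subr_eq0 => /eqP.
- by rewrite mulrDr mulrDl IH1 IH2.
- by rewrite mulrA IH1 -mulrA IH2 mulrA.
Qed.

Fixpoint lists n : seq (seq 'I_D) :=
  if n is n'.+1 then [::] :: [seq i :: t | i <- enum 'I_D, t <- lists n'] else [:: [::]].

Lemma mem_lists n t : (t \in lists n) = (size t <= n)%N.
Proof.
elim: n t => [|n IH] [|i t] //=; rewrite inE /=; apply/allpairsP/idP.
  by move=> [[j s] /= [_ sl [_ ->]]]; rewrite ltnS -IH.
by rewrite ltnS -IH => tl; exists (i, t); split=> //; rewrite mem_enum.
Qed.

Definition bword (t : seq 'I_D) : U := word (map b t).
(** The degree filtration of U; its steps are finite-dimensional and stable under commutators with g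
    ([bspan_ad]). *)
Definition bspan n (u : U) : Prop := lspan (map bword (lists n)) u.

Lemma bspan_word t n : (size t <= n)%N -> bspan n (bword t).
Proof. by move=> tn; apply: lspan_mem; apply: map_f; rewrite mem_lists. Qed.
Lemma bspan_leq n n' u : (n <= n')%N -> bspan n u -> bspan n' u.
Proof.
move=> nn; apply: lspan_sub => y0 /mapP[t]; rewrite mem_lists => tn ->.
by apply: bspan_word; exact: leq_trans nn.
Qed.
Lemma bspan_mul n n' u v : bspan n u -> bspan n' v -> bspan (n + n') (u * v).
Proof.
move=> Hu Hv; suff H t : (size t <= n)%N -> bspan (n + n') (bword t * v).
  have sub : submod (fun u : U => bspan (n + n') (u * v)).
    split=> [|a x y Hx Hy]; first by rewrite mul0r; exact: submod0 (lspan_submod _).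
    by rewrite mulrDl -scalerAl; case: (lspan_submod (map bword (lists (n + n')))) => _; apply.
  by apply: lspan_min sub _ Hu => y0 /mapP[t]; rewrite mem_lists => tn ->; exact: H.
move=> tn.
have sub : submod (fun v : U => bspan (n + n') (bword t * v)).
  split=> [|a x y Hx Hy]; first by rewrite mulr0; exact: submod0 (lspan_submod _).
  by rewrite mulrDr -scalerAr; case: (lspan_submod (map bword (lists (n + n')))) => _; apply.
apply: lspan_min sub _ Hv => y0 /mapP[t']; rewrite mem_lists => tn' ->.
rewrite /bword -word_cat -map_cat; apply: bspan_word.
by rewrite size_cat leq_add.
Qed.

Lemma bspan_gen x : bspan 1 (env_inj x).
Proof.
rewrite (bcK x) linear_sum; apply: (submod_sum (lspan_submod _)) => i _.
rewrite linearZ; apply: (submodZ (lspan_submod _)).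
by have := @bspan_word [:: i] 1 isT; rewrite /bword /= word1.
Qed.

Lemma bspan_all u : exists n, bspan n u.
Proof.
elim/env_alg_ind: u => [c|x|u v [n Hu] [n' Hv]|u v [n Hu] [n' Hv]].
- exists 0%N; apply: (submodZ (lspan_submod _)).
  by have := @bspan_word [::] 0 isT; rewrite /bword word_nil.
- by exists 1%N; exact: bspan_gen.
- exists (n + n')%N; apply: (submodD (lspan_submod _)).
    by apply: bspan_leq Hu; rewrite leq_addr.
  by apply: bspan_leq Hv; rewrite leq_addl.
- by exists (n + n')%N; exact: bspan_mul.
Qed.

Lemma bspan_ad t x : bspan (size t) (env_inj x * bword t - bword t * env_inj x).
Proof.
elim: t => [|i t IH]; first by rewrite /bword word_nil mulr1 mul1r subrr; exact: submod0 (lspan_submod _).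
have -> : env_inj x * bword (i :: t) - bword (i :: t) * env_inj x =
  env_inj (lie x (b i)) * bword t + env_inj (b i) * (env_inj x * bword t - bword t * env_inj x).
  by rewrite /bword /= word_cons env_inj_lie mulrBl mulrBr !mulrA addrA subrK.
apply: (submodD (lspan_submod _)).
  by apply: (@bspan_mul 1 (size t)); [exact: bspan_gen|exact: bspan_word].
by apply: (@bspan_mul 1 (size t)) IH; exact: bspan_gen.
Qed.

Lemma bword_wt t x : x \in h -> exists m : K,
  env_inj x * bword t - bword t * env_inj x = m *: bword t.
Proof.
move=> xh; elim: t => [|i t [m IH]]; first by exists 0; rewrite /bword word_nil mulr1 mul1r subrr scale0r.
exists (w i x + m).
have -> : env_inj x * bword (i :: t) - bword (i :: t) * env_inj x =
  env_inj (lie x (b i)) * bword t + env_inj (b i) * (env_inj x * bword t - bword t * env_inj x).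
  by rewrite /bword /= word_cons env_inj_lie mulrBl mulrBr !mulrA addrA subrK.
by rewrite IH wt // linearZ /= -scalerAl -scalerAr -scalerDl /bword /= word_cons.
Qed.

(** P is a polynomial in the Casimir element of the adjoint action, projecting a filtration step
    that contains [us] to the part where the Casimir element is nilpotent. By [casimir_trivial] g
    acts trivially on that part, so it is central. Multiplication by central elements commutes with
    the adjoint action, hence with P. *)
Lemma reynolds (us : seq U) : exists P : U -> U,
  [/\ forall u v, P (u + v) = P u + P v,
      forall u z, env_center z -> P (u * z) = P u * z,
      forall z, env_center z -> P z = z & forall u, u \in us -> env_center (P u)].
Proof.
have [n Hn] : exists n, forall u, u \in us -> bspan n u.
  elim: us => [|u us [n IH]]; first by exists 0%N.
  have [n' Hu] := bspan_all u; exists (n' + n)%N => v; rewrite inE => /orP[/eqP->|/IH].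
    by apply: bspan_leq Hu; rewrite leq_addr.
  by apply: bspan_leq; rewrite leq_addl.
pose l : seq (kmod adU) := map bword (lists n).
have lE (u : adU) : lspan l (u : kmod adU) <-> bspan n u.
  have lin : linear (fun u : U => (u : adU) : kmod adU).
    by move=> c x y; rewrite kmodZ (repmod_scalar (r := adUrep)).
  have lin' : linear (fun u : kmod adU => (u : U)).
    by move=> c x y; rewrite kmodZ (repmod_scalar (r := adUrep)).
  rewrite /bspan /l; split=> H.
    by have := lspan_map (lin_pack lin') H; rewrite -map_comp.
  by have := lspan_map (lin_pack lin) H; rewrite -map_comp.
have lst x (v : adU) : lspan l (v : kmod adU) -> lspan l (env_inj x *: v : kmod adU).
  move=> /lE Hv; apply/lE; rewrite adU_gen.
  have sub : submod (fun u : U => bspan n (env_inj x * u - u * env_inj x)).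
    split=> [|c y z Hy Hz]; first by rewrite mulr0 mul0r subrr; exact: submod0 (lspan_submod _).
    by rewrite adU_linr; case: (lspan_submod (map bword (lists n))) => _; apply.
  apply: lspan_min sub _ Hv => y0 /mapP[t]; rewrite mem_lists => tn ->.
  by apply: bspan_leq tn _; exact: bspan_ad.
have Ost u (v : adU) : lspan l (v : kmod adU) -> lspan l (u *: v : kmod adU).
  elim/env_alg_ind: u v => [c|x|u v IHu IHv|u v IHu IHv] y Hy.
  - exact: (submodZ (lspan_submod l) c Hy).
  - exact: lst.
  - by rewrite scalerDl; exact: kspanD (IHu _ Hy) (IHv _ Hy).
  - by rewrite -scalerA; apply: IHu; exact: IHv.
have [p p0 pv] : exists2 p : {poly K}, p != 0 & forall v : adU, v \in l -> pact Om p v = 0.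
  have : forall v, v \in l -> lspan l v by move=> v; exact: lspan_mem.
  move: {1 3}l => l1; elim: l1 => [|v l1 IH] Hl1; first by exists 1; rewrite ?oner_eq0.
  have [|p p0 pv] := IH; first by move=> z zl; apply: Hl1; rewrite inE zl orbT.
  have [|q q0 qv] := @pact_relation _ _ adU Om v l.
    by move=> j; apply: Ost; apply: Hl1; rewrite mem_head.
  exists (p * q); first by rewrite mulf_neq0.
  move=> z; rewrite inE => /orP[/eqP->|zl]; first by rewrite pactM qv pact0.
  by rewrite mulrC pactM pv // pact0.
have [a [q]] := multiplicity_XsubC p 0; rewrite p0 => /= q0 pE.
(* With p = q X^a and q(0) nonzero, X^a pi kills the filtration step, while pi(0) = 1 makes P the
   identity on central elements, which the Casimir element kills. *)
pose pi := q.[0]^-1 *: q.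
have pi0 : pi.[0] = 1 by rewrite hornerZ mulVf.
pose P (u : adU) : adU := pact Om pi u.
have pa (v : adU) : pact Om 'X^a v = Om ^+ a *: v.
  by rewrite /pact rmorphXn /= horner_algX.
have XP v : v \in l -> Om ^+ a *: (P v : adU) = 0.
  move=> vl; rewrite -pa /P -pactM /pi -scalerAr mulrC -[X in q * X](_ : ('X - 0%:P) ^+ a = _).
    by rewrite -pE -mul_polyC pactM pv // pact0.
  by rewrite subr0.
have Pc u v : u *: P v = P (u *: v).
  have OC j : u * Om ^+ j = Om ^+ j * u.
    elim: j => [|j IH]; first by rewrite mulr1 mul1r.
    by rewrite exprS mulrA -(casimir_central ss bcK bcb wt hN u) -!mulrA IH.
  rewrite /P !pactE scaler_sumr; apply: eq_bigr => j _.
  by rewrite !scalerA; congr (_ *: _); rewrite -!mulrA !mulr_algl -scalerAr OC.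
have Plin : linear (P : kmod adU -> kmod adU).
  by move=> c u v; rewrite !kmodZ /P pactv.
have Pl x v : v \in map P l -> env_inj x *: v = 0 :> adU.
  apply: (@casimir_trivial adU (map P l) a).
  - move=> _ /mapP[y /mapP[t tn ->] ->].
    have H s : exists m : K, s \in h -> env_inj s *: (bword t : adU) = (m%:A : U) *: (bword t : adU).
      have [/(bword_wt t)[m E]|_] := boolP (s \in h); last by exists 0.
      by exists m => _; rewrite adU_gen E (repmod_scalar (r := adUrep)).
    exists (fun s => projT1 (cid (H s))) => s sh; rewrite !Pc; congr P.
    exact: (projT2 (cid (H s)) sh).
  - move=> x0 _ /mapP[y yl ->]; rewrite Pc.
    have yl' : lspan l (y : kmod adU) by apply: lspan_mem.
    exact: (lspan_map (lin_pack Plin) (lst x0 y yl')).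
  - by move=> _ /mapP[y yl ->]; exact: XP.
exists P; split.
- by move=> u v; rewrite /P /pact scalerDr.
- by move=> u z zC; rewrite /P /pact adU_mul.
- move=> z zC; have gz x : env_inj x *: (z : adU) = 0 by rewrite adU_gen zC subrr.
  have Oz : Om *: (z : adU) = 0.
    by rewrite /Om /casimir scaler_suml big1 // => i _; rewrite -scalerA gz scaler0.
  rewrite /P -[pi](subrK 1%:P) pactD pactC scale1r scale1r.
  have /factor_theorem[r ->] : root (pi - 1%:P) 0 by rewrite rootE hornerD hornerN hornerC pi0 subrr.
  by rewrite subr0 pactM pactX Oz pact0 add0r.
move=> u /Hn /lE Hu; apply: adU_central => x; rewrite Pc.
have sub : submod (fun v : kmod adU => P (env_inj x *: (v : adU)) = 0).
  split=> [|c v v' Hv Hv']; first by rewrite /P scaler0 pact0.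
  rewrite -Pc in Hv; rewrite -Pc in Hv'; rewrite kmodZ -Pc /P pactv scalerDr scalerA mulr_algr.
  by rewrite -mulr_algl -scalerA Hv Hv' scaler0 addr0.
apply: lspan_min sub _ Hu => v vl; rewrite -Pc; apply: Pl.
by apply: map_f.
Qed.
End Casimir.

(** * Dickson's lemma and noetherianity of the enveloping algebra *)

Lemma dickson (I W : eqType) (c : I -> W -> nat) (l : seq I) (A : W -> Prop) :
  exists ts : seq W, (forall t, t \in ts -> A t) /\
    forall t, A t -> exists2 t', t' \in ts & forall i, i \in l -> (c i t' <= c i t)%N.
Proof.
elim: l A => [|i l IH] A.
  have [[t At]|H] := pselect (exists t, A t); last by exists [::]; split=> // t At; case: H; exists t.
  by exists [:: t]; split=> [s|s _]; [rewrite inE => /eqP->|exists t; rewrite ?mem_head].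
have [ts [tA tsP]] := IH A.
(* The minimal elements for the other coordinates settle every t with c i t at least N; below N, the
   values of coordinate i are treated one by one. *)
have [N HN] : exists N, forall t, t \in ts -> (c i t <= N)%N.
  elim: ts {tA tsP} => [|t ts [N HN]]; first by exists 0%N.
  exists (maxn (c i t) N) => s; rewrite inE => /orP[/eqP->|/HN H]; first exact: leq_maxl.
  by rewrite leq_max H orbT.
suff [ts' [tA' tsP']] : exists ts' : seq W, (forall t, t \in ts' -> A t) /\
    forall t, A t -> (c i t < N)%N -> exists2 t', t' \in ts' & forall j, j \in i :: l -> (c j t' <= c j t)%N.
  exists (ts ++ ts'); split=> [t|t At]; first by rewrite mem_cat => /orP[/tA|/tA'].
  have [tN|Nt] := ltnP (c i t) N.
    by have [t' tt' H] := tsP' t At tN; exists t' => //; rewrite mem_cat tt' orbT.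
  have [t' tt' H] := tsP t At; exists t'; first by rewrite mem_cat tt'.
  move=> j; rewrite inE => /orP[/eqP->|/H //].
  exact: leq_trans (HN _ tt') Nt.
elim: (N) => [|k [ts1 [tA1 tsP1]]]; first by exists [::].
have [ts2 [tA2 tsP2]] := IH (fun t => A t /\ c i t = k).
exists (ts1 ++ ts2); split=> [t|t At].
  by rewrite mem_cat => /orP[/tA1|/tA2[]].
rewrite ltnS leq_eqVlt => /orP[/eqP tk|tk].
  have [t' tt' H] := tsP2 t (conj At tk); exists t'; first by rewrite mem_cat tt' orbT.
  by move=> j; rewrite inE => /orP[/eqP->|/H //]; rewrite tk (tA2 _ tt').2.
by have [t' tt' H] := tsP1 t At tk; exists t' => //; rewrite mem_cat tt'.
Qed.

Fixpoint lexlt (s t : seq nat) : bool :=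
  match s, t with x :: s', y :: t' => (x < y)%N || (x == y) && lexlt s' t' | _, _ => false end.

Lemma lexlt_trans s t u : lexlt s t -> lexlt t u -> lexlt s u.
Proof.
elim: s t u => [|x s IH] [|y t] [|z u] //= /orP[xy|/andP[/eqP-> st]] /orP[yz|/andP[/eqP<- tu]].
- by rewrite (ltn_trans xy yz).
- by rewrite xy.
- by rewrite yz.
- by rewrite eqxx (IH _ _ st tu) orbT.
Qed.

Lemma lexlt_total s t : size s = size t -> [\/ lexlt s t, s = t | lexlt t s].
Proof.
elim: s t => [|x s IH] [|y t] //=; first by constructor 2.
move=> [/IH H]; case: (ltngtP x y) => [_|_|->]; [by constructor 1|by constructor 3|].
by case: H => [->|->|->]; [constructor 1|constructor 2|constructor 3].
Qed.

Lemma lexlt_add (I : Type) (l : seq I) (f f' k : I -> nat) :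
  lexlt (map f l) (map f' l) ->
  lexlt (map (fun i => k i + f i)%N l) (map (fun i => k i + f' i)%N l).
Proof.
elim: l => //= i l IH /orP[H|/andP[/eqP-> /IH ->]]; first by rewrite ltn_add2l H.
by rewrite eqxx orbT.
Qed.

Lemma lexlt_wf n k : size k = n -> Acc (fun s t => size s = size t /\ lexlt s t) k.
Proof.
elim: n k => [|n IH] [|x k] kn; [|discriminate kn|discriminate kn|].
  by apply: Acc_intro => s HR; exfalso; move: HR => [_]; case: s.
have {}kn : size k = n by case: kn.
have [N xN] := ubnP x; elim: N x xN k kn => [|N IHN] x xN k kn; first by rewrite ltn0 in xN.
have Hk := IH k kn; elim: Hk kn => {}k _ IHk kn.
apply: Acc_intro => s0 [E H]; case: s0 E H => [|y s] E H; first by exfalso.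
have {}E : size s = size k by move/eqP: E; rewrite /= eqSS => /eqP.
case/orP: H => [yx|/andP[/eqP-> H]]; last by apply: IHk; [split; [exact: E|exact: H]|rewrite E].
by apply: IHN; [exact: leq_trans yx _|rewrite E].
Qed.

Section Noetherian.
Variables (K : numClosedFieldType) (g : lieAlgType K).
Variables (D : nat) (b : 'I_D -> g) (bc : 'I_D -> {linear g -> K^o}).
Local Notation U := (envalg g).
Hypothesis bcK : forall x, x = \sum_i (bc i x : K) *: b i.
Local Notation bword := (bword b).
Local Notation bspan := (bspan b).
Implicit Types (s t : seq 'I_D) (u v : U).

(** Degree first, then the multiplicities of the letters. Words with equal keys are permutations of
    each other and agree in U up to lower degree ([wlow_perm]). *)
Definition wkey t := size t :: [seq count_mem i t | i <- enum 'I_D].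
Lemma size_wkey t : size (wkey t) = #|'I_D|.+1.
Proof. by rewrite /= size_map -cardE. Qed.
Lemma wkey_cat s t t' : lexlt (wkey t) (wkey t') -> lexlt (wkey (s ++ t)) (wkey (s ++ t')).
Proof.
rewrite /wkey /= !size_cat => /orP[H|/andP[/eqP-> H]]; first by rewrite ltn_add2l H.
rewrite eqxx; apply/orP; right.
have E t1 : [seq count_mem i (s ++ t1) | i <- enum 'I_D] =
    [seq (count_mem i s + count_mem i t1)%N | i <- enum 'I_D].
  by apply: eq_map => i; rewrite count_cat.
by rewrite !E; exact: (lexlt_add (fun i => count_mem i s) H).
Qed.
Lemma wkey_perm s t : wkey s = wkey t -> perm_eq s t.
Proof.
move=> [_ E]; apply/allP => i _ /=; apply/eqP.
by move/eq_in_map: E => /(_ i) -> //; rewrite mem_enum.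
Qed.
Lemma wkey_eq s t : perm_eq s t -> wkey s = wkey t.
Proof.
move=> st; rewrite /wkey (perm_size st); congr cons.
by apply: eq_map => i; exact: (permP st).
Qed.

Definition wlow t u := exists2 ts : seq (seq 'I_D),
  (forall s, s \in ts -> lexlt (wkey s) (wkey t)) & lspan (map bword ts) u.

Lemma wlow_submod t : submod (wlow t : (U : lmodType K) -> Prop).
Proof.
split=> [|a u v [ts1 H1 L1] [ts2 H2 L2]]; first by exists [::].
exists (ts1 ++ ts2); first by move=> s; rewrite mem_cat => /orP[/H1|/H2].
apply: (submodD (lspan_submod _)); first apply: (submodZ (lspan_submod _)).
  by apply: lspan_sub L1 => z /mapP[s sl ->]; apply: lspan_mem; rewrite map_cat mem_cat map_f.
by apply: lspan_sub L2 => z /mapP[s sl ->]; apply: lspan_mem; rewrite map_cat mem_cat; apply/orP; right; exact: map_f.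
Qed.

Lemma wlow_mul s t u : wlow t u -> wlow (s ++ t) (bword s * u).
Proof.
move=> [ts H L]; exists (map (cat s) ts); first by move=> z /mapP[t' tt' ->]; apply: wkey_cat; exact: H.
have lin : linear (fun u : U => bword s * u) by move=> c x y; rewrite mulrDr scalerAr.
have := lspan_map (lin_pack lin) L; rewrite -map_comp -map_comp.
rewrite (eq_map (g := bword \o cat s)) // => z /=.
by rewrite /bword map_cat word_cat.
Qed.

Lemma wlow_key t t' u : wkey t = wkey t' -> wlow t u -> wlow t' u.
Proof. by move=> E [ts H L]; exists ts => // s /H; rewrite E. Qed.

Lemma wlow_bspan n t u : (n < size t)%N -> bspan n u -> wlow t u.
Proof.
move=> nt Hu; exists (lists D n) => // s; rewrite mem_lists => sn.
by rewrite /= (leq_ltn_trans sn nt).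
Qed.

Lemma bword_perm t t' : perm_eq t t' -> bspan (size t).-1 (bword t - bword t').
Proof.
elim: t t' => [|i t IH] t' tt'.
  by rewrite perm_sym in tt'; rewrite (perm_nilP tt') subrr; exact: (submod0 (lspan_submod _)).
have it' : i \in t' by rewrite -(perm_mem tt') mem_head.
case/splitPr: it' tt' => a c tt' /=.
have tac : perm_eq t (a ++ c).
  by move: tt'; rewrite perm_sym perm_catC /= perm_cons perm_catC perm_sym.
have -> : bword (i :: t) - bword (a ++ i :: c) =
   env_inj (b i) * (bword t - bword (a ++ c)) + (env_inj (b i) * bword a - bword a * env_inj (b i)) * bword c.
  by rewrite /bword !map_cat /= !word_cat !word_cons mulrBl mulrBr !mulrA addrA subrK.
apply: (submodD (lspan_submod _)).
  case: t IH tac {tt'} => [|j t] IH tac.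
    have : size (a ++ c) = 0%N by rewrite -(perm_size tac).
    move=> /eqP; rewrite size_cat addn_eq0 => /andP[/nilP-> /nilP->] /=.
    by rewrite subrr mulr0; exists 0; rewrite scale0r subr0.
  exact: (bspan_mul (bspan_gen bcK (b i)) (IH _ tac)).
rewrite (perm_size tac) size_cat; apply: bspan_mul; first exact: bspan_ad.
exact: bspan_word.
Qed.

Lemma wlow_perm t t' : wkey t = wkey t' -> wlow t (bword t - bword t').
Proof.
move=> /wkey_perm tt'; have := bword_perm tt'.
case: t tt' => [|i t] tt'; last by move=> H; apply: wlow_bspan H.
by rewrite perm_sym in tt'; rewrite (perm_nilP tt') subrr => _; exact: (submod0 (wlow_submod _)).
Qed.

Lemma wlow_lead t (ts : seq (seq 'I_D)) u :
  (forall s, s \in ts -> lexlt (wkey s) (wkey t) \/ wkey s = wkey t) ->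
  lspan (map bword ts) u -> exists c : K, wlow t (u - c *: bword t).
Proof.
move=> Hts; apply: (lspan_min (P := fun u : U => exists c : K, wlow t (u - c *: bword t))).
  split=> [|a x y [c Hx] [d Hy]]; first by exists 0; rewrite scale0r subr0; exact: submod0 (wlow_submod _).
  exists (a * c + d); rewrite scalerDl opprD addrACA -scalerA -scalerBr.
  by case: (wlow_submod t) => _; apply.
move=> _ /mapP[s sl ->]; have [H|H] := Hts s sl.
  exists 0; rewrite scale0r subr0; exists [:: s]; first by move=> z; rewrite inE => /eqP->.
  by apply: lspan_mem; rewrite mem_head.
by exists 1; rewrite scale1r; apply: (wlow_key H); exact: wlow_perm.
Qed.

Lemma wkey_max (ts : seq (seq 'I_D)) : ts != [::] ->
  exists2 t, t \in ts & forall s, s \in ts -> lexlt (wkey s) (wkey t) \/ wkey s = wkey t.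
Proof.
elim: ts => // t [|t' ts] IH _; first by exists t; rewrite ?mem_head // => s; rewrite inE => /eqP->; right.
have [//|m mt mP] := IH.
have [H|H|H] : [\/ lexlt (wkey t) (wkey m), wkey t = wkey m | lexlt (wkey m) (wkey t)].
- by apply: lexlt_total; rewrite !size_wkey.
- by exists m; [rewrite inE mt orbT|move=> s; rewrite inE => /orP[/eqP->|/mP //]; left].
- by exists m; [rewrite inE mt orbT|move=> s; rewrite inE => /orP[/eqP->|/mP //]; right].
exists t; first exact: mem_head.
move=> s; rewrite inE => /orP[/eqP->|/mP[Hs|->]]; [by right|left|by left].
exact: lexlt_trans H.
Qed.

(** A Groebner basis argument: by [dickson] finitely many elements of L have leading words that
    divide, as multisets of letters, every leading word of L. Well-founded induction on the key then
    reduces any element of L to zero. *)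
Theorem env_noetherian : noeth (U^o : lmodType U).
Proof.
move=> L HL.
have HK c u : L u -> L (c *: u) by rewrite -mulr_algl => Lu; exact: (submodZ HL).
have [ts [tA tsP]] := dickson (fun i t => count_mem i t) (enum 'I_D)
  (fun t => exists2 u, L u & wlow t (u - bword t)).
have [us usP usE] : exists2 us : seq (seq 'I_D * U), (forall p, p \in us -> L p.2 /\ wlow p.1 (p.2 - bword p.1)) &
   map fst us = ts.
  elim: ts tA {tsP} => [|t ts IH] tA; first by exists [::].
  have [|us H E] := IH; first by move=> z zl; apply: tA; rewrite inE zl orbT.
  have [u Lu Hu] := tA t (mem_head _ _); exists ((t, u) :: us); last by rewrite /= E.
  by move=> p; rewrite inE => /orP[/eqP->|/H].
pose l' : seq U^o := map snd us; exists l'; split=> [x /mapP[p /usP[Lp _] ->] //|].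
suff main t : forall u, L u -> (exists c : K, wlow t (u - c *: bword t)) -> lspan l' u.
  move=> u Lu; have [n Hn] := bspan_all bcK u.
  have [|t _ tm] := @wkey_max (lists D n); first by case: (n).
  by apply: (main t) => //; apply: wlow_lead Hn.
have [k kE] : exists k, k = wkey t by eexists.
have := @lexlt_wf _ k erefl; move=> Hk; elim: Hk t kE => {}k _ IH t kE.
have low u : L u -> wlow t u -> lspan l' u.
  move=> Lu [ts' H Lt]; have [E|/wkey_max[m mt mP]] := eqVneq ts' [::].
    by move: Lt; rewrite E /= => ->; exact: (submod0 (lspan_submod _)).
  apply: (IH (wkey m) _ m erefl) => //; last exact: wlow_lead Lt.
  by rewrite kE !size_wkey; split=> //; exact: H.
move=> u Lu [c Hc]; have [c0|c0] := eqVneq c 0.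
  by apply: low => //; move: Hc; rewrite c0 scale0r subr0.
have [|t' tt' t't] := tsP t.
  exists (c^-1 *: u); first exact: HK.
  have -> : c^-1 *: u - bword t = c^-1 *: (u - c *: bword t).
    by rewrite scalerBr scalerA mulVf // scale1r.
  exact: (submodZ (wlow_submod t)).
have [[t1 u1] pu /= tE] : exists2 p, p \in us & p.1 = t'.
  by move: tt'; rewrite -usE => /mapP[p pu ->]; exists p.
have [/= Lu1 Hu1] := usP _ pu; rewrite tE in Hu1.
have [s st] : exists s, perm_eq t (s ++ t').
  have : forall i, (count_mem i t' <= count_mem i t)%N by move=> i; apply: t't; rewrite mem_enum.
  elim: t' {tt' t't tE Hu1} t {Hc low kE} => [|i t' IHt] t Ht; first by exists t; rewrite cats0.
  have it : i \in t.
    by rewrite -has_pred1 has_count (leq_trans _ (Ht i)) //= eqxx.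
  have [|s sP] := IHt (rem i t).
    move=> j; have := Ht j; rewrite (permP (perm_to_rem it)) /=.
    by rewrite leq_add2l.
  exists s; rewrite (permPl (perm_to_rem it)) perm_sym perm_catC /= perm_cons perm_catC perm_sym.
  exact: sP.
(* Up to the order of the letters, the multiple of u1 has the leading word t, so the first summand
   is lower than t. *)
have uE : u = (u - c *: (bword s * u1)) + (c *: bword s) * u1.
  by rewrite -scalerAl subrK.
rewrite uE; apply: (submodD (lspan_submod _)).
  apply: low.
    by apply: (submodB HL) => //; apply: HK; exact: (submodZ HL).
  have -> : u - c *: (bword s * u1) = (u - c *: bword t) + c *: (bword t - bword (s ++ t'))
     - c *: (bword s * (u1 - bword t')).
    rewrite mulrBr -word_cat -map_cat -/(bword (s ++ t')) !scalerBr addrA subrK opprB addrA.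
    by rewrite subrK.
  apply: (submodB (wlow_submod t)).
    apply: (submodD (wlow_submod t)) => //; apply: (submodZ (wlow_submod t)).
    by apply: wlow_perm; exact: wkey_eq.
  apply: (submodZ (wlow_submod t)); apply: (wlow_key (t := s ++ t')); first exact/esym/wkey_eq.
  exact: wlow_mul.
apply: (submodZ (lspan_submod l')); apply: lspan_mem.
by apply/mapP; exists (t1, u1).
Qed.
End Noetherian.

Lemma vspace_pred (F : fieldType) (V : vectType F) (P : V -> Prop) :
  P 0 -> (forall a x y, P x -> P y -> P (a *: x + y)) ->
  exists W : {vspace V}, forall x, x \in W <-> P x.
Proof.
move=> P0 PD; suff H n (W : {vspace V}) : (\dim {:V} - \dim W <= n)%N -> (forall x, x \in W -> P x) ->
    exists W : {vspace V}, forall x, x \in W <-> P x.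
  apply: (H _ 0%VS (leqnn _)) => x; by rewrite memv0 => /eqP->.
elim: n W => [|n IH] W dW WP.
  have E : W = fullv by apply/eqP; rewrite eqEdim subvf -subn_eq0 -leqn0.
  by exists W => x; split=> [/WP //|_]; rewrite E memvf.
have [H|/existsNP[x /not_implyP[Px /negP xW]]] := pselect (forall x, P x -> x \in W).
  by exists W => x; split=> [/WP|/H].
apply: (IH (<[x]> + W)%VS); last first.
  by move=> y /memv_addP[_ /vlineP[c ->] [z zW ->]]; apply: PD => //; exact: WP.
have dl : (\dim W < \dim (<[x]> + W))%N.
  rewrite ltn_neqAle dimvS ?addvSr // andbT; apply: contraNneq xW => E.
  have /eqP -> : W == (<[x]> + W)%VS by rewrite eqEdim addvSr E /=.
  by apply: (subvP (addvSl _ _)); exact: memv_line.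
by move: dW; rewrite leq_subLR => dW; rewrite leq_subLR (leq_trans dW) // addnS -addSn leq_add2r.
Qed.

(** * Structure of g from its triangular decomposition *)

Section Cartan.
Variables (K : numClosedFieldType) (g : lieAlgType K) (nm h np : {vspace g}).
Hypothesis ss : semisimple g.
Hypothesis tri : triangular_decomposition nm h np.
Local Notation weight := 'Hom(subvs_of h, K^o).
Definition wfun (a : weight) (t : g) : K := a (vsproj h t).

Lemma root_hwt (a : weight) x : x \in root_space a <-> hwt h (wfun a) x.
Proof.
split=> [/root_spaceP H t th|H]; first by have := H (vsproj h t); rewrite vsprojK.
apply/root_spaceP => y; have := H (vsval y) (subvsP y).
by rewrite /wfun vsvalK.
Qed.

Lemma tri_hN x : (forall t, t \in h -> lie t x = 0) -> x \in h.
Proof.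
case: tri => -[_ _ H] _ _ _ Hx; apply: H => y yh.
by rewrite lie_anti Hx // oppr0 mem0v.
Qed.

(* [tri_gen] : g is spanned by h together with vectors of non zero weight. *)
Lemma tri_gen : exists L : seq g, [/\ (h + <<L>>)%VS = fullv &
  forall x, x \in L -> exists a : weight, hwt h (wfun a) x].
Proof.
case: tri => _ [pos [_ npE nmE]] full _.
pose ps := pos ++ [seq - a | a <- pos].
exists (flatten [seq (vbasis (root_space a) : seq g) | a <- ps]); split; last first.
  move=> x /flattenP[s /mapP[a _ ->] xa]; exists a; apply/root_hwt.
  exact: vbasis_mem xa.
apply/eqP; rewrite eqEsubv subvf /= -full.
have sub a : a \in ps -> (root_space a <= <<flatten [seq (vbasis (root_space a) : seq g) | a <- ps]>>)%VS.
  move=> aps; rewrite -{1}(span_basis (vbasisP (root_space a))); apply: sub_span => x xa.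
  by apply/flattenP; exists (vbasis (root_space a) : seq g) => //; apply/mapP; exists a.
have subS (s : seq weight) : {subset s <= ps} -> (\sum_(a <- s) root_space a <=
   <<flatten [seq (vbasis (root_space a) : seq g) | a <- ps]>>)%VS.
  elim: s => [|a s IH] Hs; first by rewrite big_nil sub0v.
  rewrite big_cons subv_add sub ?Hs ?mem_head //= IH // => z zs.
  by apply: Hs; rewrite inE zs orbT.
rewrite !subv_add addvSl andbT; apply/andP; split.
  apply: subv_trans (addvSr _ _); rewrite nmE -(big_map (fun a => - a) predT (@root_space _ g h)).
  by apply: subS => a; rewrite mem_cat orbC => ->.
apply: subv_trans (addvSr _ _); rewrite npE; apply: subS => a.
by rewrite mem_cat => ->.
Qed.

(** A bracket of two elements of h acts on weight vectors by a commutator of scalars, hence by zero.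
    The elements of h that kill all these vectors form an ideal c, solvable because h is nilpotent,
    so c = 0. *)
Lemma tri_hC t t' : t \in h -> t' \in h -> lie t t' = 0.
Proof.
have [L [full LP]] := tri_gen; case: (tri) => -[hh [n hn] _] _ _ _.
have {}hh x y : x \in h -> y \in h -> lie x y \in h by move/lie_prodvP: hh; apply.
pose P x := x \in h /\ forall y, y \in L -> lie x y = 0.
have [||c cP] := @vspace_pred K g P.
- by split; [exact: mem0v|move=> y _; exact: lie0l].
- move=> a x y [xh Hx] [yh Hy]; split; first by rewrite memvD ?memvZ.
  by move=> z zL; rewrite lie_zl Hx // Hy // scaler0 addr0.
have c0 : c = 0%VS.
  apply: ss.
    move=> x y /cP[yh Hy]; apply/cP.
    have : x \in (h + <<L>>)%VS by rewrite full memvf.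
    move=> /memv_addP[u uh [v vL ->]]; rewrite lie_addl.
    have -> : lie v y = 0.
      apply: (span_ind (P := fun v => lie v y = 0)) vL => [|a z z' E E'|z zL].
      - exact: lie0l.
      - by rewrite lie_zl E E' scaler0 addr0.
      - by rewrite lie_anti Hy // oppr0.
    rewrite addr0; split; first exact: hh.
    move=> z zL; rewrite lie_jac Hy // linear0; have [a Ha] := LP z zL.
    by rewrite Ha // linearZ /= Hy // scaler0 subrr.
  exists n; apply/eqP; rewrite -subv0 -hn.
  have H k : (iter k (lie_prodv h) h <= h)%VS.
    by elim: k => //= k IH; apply/lie_prodvP => x y xh /(subvP IH); exact: hh.
  have ch : (c <= h)%VS by apply/subvP => x /cP[].
  elim: n {hn} => [//|k IH] /=; apply/lie_prodvP => x y /(subvP IH)/(subvP (H k)) xh /(subvP IH) yk.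
  exact: lie_prodv_mem.
move=> th th'; apply/eqP; rewrite -memv0 -c0; apply/cP; split; first exact: hh.
move=> y yL; have [a Ha] := LP y yL; rewrite lie_jac (Ha t' th') (Ha t th) linearZ [X in _ - X]linearZ /=.
by rewrite (Ha t th) (Ha t' th') !scalerA mulrC subrr.
Qed.

Lemma cartan_basis : exists (D : nat) (b : 'I_D -> g) (bc : 'I_D -> {linear g -> K^o})
    (w : 'I_D -> g -> K),
  [/\ D = \dim {:g}, forall x, x = \sum_i (bc i x : K) *: b i,
      forall i j, bc i (b j) = (i == j)%:R & forall i, hwt h (w i) (b i)].
Proof.
have [L [full LP]] := tri_gen.
have [l [lL lsp lf]] := free_sublist (vbasis h ++ L : seq g).
have fl : free (in_tuple l).
  apply/freeP => k Hk i; apply: lf => //.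
  by rewrite -[RHS]Hk; apply: eq_bigr => j _; rewrite (tnth_nth 0).
have sp : <<in_tuple l>>%VS = fullv.
  apply/eqP; rewrite eqEsubv subvf /= -full -(span_basis (vbasisP h)) -span_cat; apply/span_subvP => x xl.
  have /lsp/lspan_tnthP[a ->] := lspan_mem xl.
  apply: memv_suml => i _; rewrite memvZ // memv_span //; exact: mem_tnth.
have wP i : exists w, hwt h w (tnth (in_tuple l) i).
  have := lL _ (mem_tnth i (in_tuple l)); rewrite mem_cat => /orP[/vbasis_mem xh|/LP[a Ha]].
    by exists (fun=> 0) => t th; rewrite tri_hC // scale0r.
  by exists (wfun a).
exists (size l), (tnth (in_tuple l)), (fun i => coord (in_tuple l) i : {linear g -> K^o}).
exists (fun i => projT1 (cid (wP i))); split.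
- by rewrite -sp (eqP fl).
- move=> x; have := coord_span (X := in_tuple l) (v := x); rewrite sp memvf => /(_ isT) {1}->.
  by apply: eq_bigr => i _; rewrite (tnth_nth 0).
- move=> i j; rewrite (tnth_nth 0); have := coord_free j i fl; rewrite /= => ->.
  by rewrite eq_sym.
- by move=> i; exact: (projT2 (cid (wP i))).
Qed.

Section Flag.
Variables (D : nat) (b : 'I_D -> g) (bc : 'I_D -> {linear g -> K^o}) (w : 'I_D -> g -> K).
Hypothesis bcK : forall x, x = \sum_i (bc i x : K) *: b i.
Hypothesis bcb : forall i j, bc i (b j) = (i == j)%:R.
Hypothesis wt : forall i, hwt h (w i) (b i).

(** The positive root vectors, with 0, are closed under brackets and ad-nilpotent, so
    [engel_jacobson] applies. A sum of two positive roots is nonzero because opposite roots are not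
    both positive. *)
Lemma np_nil : exists r, (forall v : admod g, nilp np (zchar g) r v) /\
  forall x y, x \in np -> y \in np -> lie x y \in np.
Proof.
case: (tri) => _ [pos [[posr posx posc] npE _]] _ _.
pose S x := x = 0 \/ exists2 a : weight, a \in pos & x \in root_space a.
have SS x y : S x -> S y -> S (lie x y).
  move=> [->|[a ap xa]]; first by rewrite lie0l; left.
  move=> [->|[c cp yc]]; first by rewrite linear0; left.
  have [->|l0] := eqVneq (lie x y) 0; [by left|right; exists (a + c)]; last first.
    apply/root_hwt => t th.
    rewrite (hwt_lie ((root_hwt a x).1 xa) ((root_hwt c y).1 yc) th); congr (_ *: _).
    by rewrite /wfun lfunE.
  have lr : lie x y \in root_space (a + c).
    apply/root_hwt => t th.
    rewrite (hwt_lie ((root_hwt a x).1 xa) ((root_hwt c y).1 yc) th); congr (_ *: _).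
    by rewrite /wfun lfunE.
  apply: posc => //; rewrite /is_root; apply/andP; split; last first.
    by apply: contraNneq l0 => E; move: lr; rewrite E memv0.
  apply/eqP => /eqP; rewrite addrC addr_eq0 => /eqP ca; have := posx a (posr a ap).
  by rewrite ap -ca cp.
have Sn x : S x -> exists q, forall y, iter q (lie x) y = 0.
  move=> [->|[a ap /root_hwt xa]]; first by exists 1%N => y /=; exact: lie0l.
  apply: (hwt_adnil bcK bcb wt xa).
  have /andP[/eqP a0 _] := posr a ap; apply: contrapT => H; apply: a0; apply/lfunP => y.
  rewrite lfunE /=; apply: contrapT => /eqP ay; apply: H; exists (vsval y); first exact: subvsP.
  by rewrite /wfun vsvalK.
have [l [r [lS Sl lnil]]] := engel_jacobson SS Sn.
have E : np = <<l>>%VS.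
  apply/eqP; rewrite eqEsubv; apply/andP; split.
    rewrite npE big_seq; elim/big_rec: _ => [|a V ap VB]; first exact: sub0v.
    rewrite subv_add VB andbT; apply/subvP => x xa.
    by apply: Sl; right; exists a.
  apply/span_subvP => x /lS [->|[a ap xa]]; first exact: mem0v.
  rewrite npE (big_rem a) //=; exact: (subvP (addvSl _ _)) xa.
exists r; rewrite E; split=> // x y xl yl.
apply: (span_ind (P := fun y => lie x y \in <<l>>%VS)) yl => [|c z z' Hz Hz'|z zl].
- by rewrite linear0 mem0v.
- by rewrite lie_zr memvD ?memvZ.
apply: (span_ind (P := fun x => lie x z \in <<l>>%VS)) xl => [|c u u' Hu Hu'|u ul].
- by rewrite lie0l mem0v.
- by rewrite lie_zl memvD ?memvZ.
by apply: Sl; apply: SS; exact: lS.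
Qed.

(** While l does not span n_+, nilpotency of the adjoint action gives a vector of n_+ outside of the
    span whose brackets with n_+ fall into it; it is appended to l. *)
Lemma np_flag : exists (m : nat) (e : nat -> g),
  [/\ <<mkseq e m>>%VS = np, free (mkseq e m),
      forall k x, (k < m)%N -> x \in np -> lie x (e k) \in <<mkseq e k>>%VS
    & forall x, x \in np -> exists q, forall y, iter q (lie x) y = 0].
Proof.
have [r [npn npl]] := np_nil.
suff H n l : (\dim np - size l <= n)%N -> free l -> (<<l>> <= np)%VS ->
    (forall k x, (k < size l)%N -> x \in np -> lie x l`_k \in <<take k l>>%VS) ->
  exists l : seq g, [/\ <<l>>%VS = np, free l &
    forall k x, (k < size l)%N -> x \in np -> lie x l`_k \in <<take k l>>%VS].
  have [|||l [lnp lf lk]] := H _ [::] (leqnn _); rewrite ?nil_free ?span_nil ?sub0v //.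
  exists (size l), (nth 0 l); rewrite mkseq_nth; split=> // [k x kl xn|x xn].
    rewrite (_ : mkseq _ _ = take k l) ?lk // -{2}(mkseq_nth 0 l) /mkseq -map_take take_iota.
    by rewrite (minn_idPl (ltnW kl)).
  by exists r => y; exact: nilp_ad npn xn.
elim: n l => [|n IH] l dl fl lnp lk.
  exists l; split=> //; apply/eqP; rewrite eqEdim lnp /=.
  by move: dl; rewrite leqn0 subn_eq0 => dl; rewrite (eqP fl).
have [E|] := pselect (forall x, x \in np -> x \in <<l>>%VS).
  by exists l; split=> //; apply/eqP; rewrite eqEsubv lnp; apply/subvP.
move=> /existsNP[v0 /not_implyP[v0n /negP v0l]].
have [v [vn vl vP]] : exists v, [/\ v \in np, v \notin <<l>>%VS &
    forall x, x \in np -> lie x v \in <<l>>%VS].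
  move: (npn v0) v0n v0l; elim: r v0 {npn} => [|r' IHr] v0.
    by move=> /= -> _; rewrite mem0v.
  move=> Hv vn vl; have [H|/existsNP[y /not_implyP[yn /negP yv]]] :=
    pselect (forall x, x \in np -> lie x v0 \in <<l>>%VS); first by exists v0.
  apply: (IHr (lie y v0)); [|exact: npl|exact: yv].
  by have := Hv y yn; rewrite admod_tw.
apply: (IH (rcons l v)).
- rewrite size_rcons; move: dl; rewrite !leq_subLR => dl.
  by rewrite (leq_trans dl) // addSnnS.
- by rewrite (perm_free (Y := v :: l)) ?perm_rcons // free_cons vl.
- by rewrite -cats1 span_cat subv_add lnp span_seq1 -memvE.
move=> k x; rewrite size_rcons ltnS leq_eqVlt nth_rcons => /orP[/eqP->|kl] xn.
  by rewrite ltnn eqxx -cats1 take_cat ltnn subnn cats0; exact: vP.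
by rewrite kl -cats1 take_cat kl; exact: lk.
Qed.

(** The adjoint representation supplies the functions u -> tr (ad u ad y). On g this is the Killing
    form against y, so its nondegeneracy realizes any l; a multiple of the counit adjusts the value
    at 1. *)
Lemma coords (l : {linear g -> K^o}) :
  exists f : cind g K^o, f 1 = 0 /\ forall x, f (env_inj x) = l x.
Proof.
pose y := \sum_i (l (b i) : K) *: bd ss bcK bcb wt tri_hN i.
have yE x : tform (admx b bc) x y = l x.
  rewrite tformC tform_suml [in RHS](bcK x) linear_sum; apply: eq_bigr => i _.
  by rewrite tformZl -bcE linearZ mulrC.
pose F (u : envalg g) : K^o := \sum_j bc j (u *: (lie y (b j) : admod g)).
have Flin : linear F.
  move=> c u v; rewrite scaler_sumr -big_split; apply: eq_bigr => j _.
  by rewrite scalerDl -[c *: u]mulr_algl -scalerA (repmod_scalar (r := adrep g)) linearP.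
have FE x : F (env_inj x) = l x.
  rewrite -yE /tform /mxtrace; apply: eq_bigr => j _; rewrite admod_gen mxE.
  rewrite [in LHS](bcK (lie y (b j))) linear_sum linear_sum; apply: eq_bigr => i _.
  by rewrite !mxE !linearZ /= mulrC.
exists (mkcind Flin - ((F 1)%:A : envalg g) *: ceps).
have c1 : @ceps K g 1 = 1 by have := cepsE (g := g) (K := K) [::]; rewrite word_nil.
have cx x : @ceps K g (env_inj x) = 0 by have := cepsE (g := g) (K := K) [:: x]; rewrite word1.
split=> [|x]; rewrite cindDE cindNE cindKE ?c1 ?cx.
  by rewrite [_ *: _]mulr1; exact: subrr.
by rewrite scaler0 subr0; exact: FE.
Qed.
End Flag.
End Cartan.

Lemma lspan_pull (K : numClosedFieldType) (g : lieAlgType K) (X Y : lmodType (envalg g))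
    (f : {linear X -> Y}) (l : seq (kmod Y)) : (forall x, f x = 0 -> x = 0) ->
  exists l' : seq (kmod X), forall x : X, lspan l (f x : kmod Y) -> lspan l' (x : kmod X).
Proof.
move=> fi; pose fk := lin_pack (kmod_linear f).
have HP : submod (fun y : kmod Y => (exists x, fk x = y) /\ lspan l y).
  by apply: submodI; [exact: submod_im|exact: lspan_submod].
have [|l1 [l1P l1E]] := noeth_gen (@noeth_field K) HP (l := l); first by move=> v [].
have [l' l'E] : exists l' : seq (kmod X), map fk l' = l1.
  elim: l1 l1P {l1E} => [|y l1 IH] Hl; first by exists [::].
  have [|l' l'E] := IH; first by move=> z zl; apply: Hl; rewrite inE zl orbT.
  have [[x xE] _] := Hl y (mem_head _ _); exists (x :: l').
  by rewrite /= l'E; congr cons.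
exists l' => x Hx; have : lspan l1 (fk x) by apply: l1E; split=> //; exists x.
rewrite -l'E => /lspan_map_inv[w Hw E]; have -> : (x : kmod X) = w; last exact: Hw.
by apply/eqP; rewrite -subr_eq0; apply/eqP/fi; rewrite linearB /= -[f w]E subrr.
Qed.

(** * Whittaker modules and the larger class of n_+-locally finite modules *)

Section WhittakerClass.
Variables (K : numClosedFieldType) (g : lieAlgType K) (np : {vspace g}).
Local Notation U := (envalg g).
Implicit Types (X Y Z : lmodType U).

Definition zLF X (v : X) : Prop := exists l : seq (kmod X),
  forall z : U, env_center z -> lspan l (z *: v : kmod X).

Lemma zLF_lin X Y (f : {linear X -> Y}) v : zLF v -> zLF (f v).
Proof.
move=> [l Hl]; exists (map (lin_pack (kmod_linear f)) l) => u Hu.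
by have := lspan_map (lin_pack (kmod_linear f)) (Hl u Hu); rewrite /= linearZ.
Qed.
Lemma zLF_lin_inv X Y (f : {linear X -> Y}) v :
  (forall x, f x = 0 -> x = 0) -> zLF (f v) -> zLF v.
Proof.
move=> fi [l Hl]; have [l' Hl'] := lspan_pull l fi; exists l' => z zC.
by apply: Hl'; rewrite linearZ; exact: Hl.
Qed.
Lemma zLFD X (v w : X) : zLF v -> zLF w -> zLF (v + w).
Proof.
move=> [l Hl] [l' Hl']; exists (l ++ l') => u Hu; rewrite scalerDr.
apply: kspanD.
  by apply: lspan_sub (Hl u Hu) => z zl; apply: lspan_mem; rewrite mem_cat zl.
by apply: lspan_sub (Hl' u Hu) => z zl; apply: lspan_mem; rewrite mem_cat zl orbT.
Qed.

Lemma inl_linear X Y : linear (fun x : X => (x, 0 : Y)).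
Proof. by move=> a x y; rewrite -pairZ -pairD scaler0 addr0. Qed.
Lemma inr_linear X Y : linear (fun y : Y => (0 : X, y)).
Proof. by move=> a x y; rewrite -pairZ -pairD scaler0 addr0. Qed.

Lemma pairE X Y (v : X) (w : Y) : (v, w) = lin_pack (@inl_linear X Y) v + lin_pack (@inr_linear X Y) w.
Proof. by rewrite /= -pairD addr0 add0r. Qed.
Lemma zLF_pair X Y (v : X) (w : Y) : zLF v -> zLF w -> zLF (v, w).
Proof. by move=> Hv Hw; rewrite pairE; apply: zLFD; exact: zLF_lin. Qed.
Lemma nLF_pair X Y (v : X) (w : Y) : nLF np v -> nLF np w -> nLF np (v, w).
Proof. by move=> Hv Hw; rewrite pairE; apply: nLFD; exact: nLF_lin. Qed.

Lemma lspan_cover X (l : seq X) : (forall w, w \in l -> zLF w) ->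
  exists L : seq (kmod X), forall z w, env_center z -> w \in l -> lspan L (z *: w : kmod X).
Proof.
elim: l => [|w l IH] Hl; first by exists [::].
have [|L HL] := IH; first by move=> y yl; apply: Hl; rewrite inE yl orbT.
have [L' HL'] := Hl w (mem_head _ _); exists (L' ++ L) => z y zC.
rewrite inE => /orP[/eqP->|yl].
  by apply: lspan_sub (HL' z zC) => t tl; apply: lspan_mem; rewrite mem_cat tl.
by apply: lspan_sub (HL z y zC yl) => t tl; apply: lspan_mem; rewrite mem_cat tl orbT.
Qed.

Definition nlf X : Prop := finitely_generated X /\ forall v : X, nLF np v.

(** U(n_+) v has a finite spanning list, and Z(g) acts locally finitely on each vector of that list,
    which bounds Z(g) U(n_+) v. *)
Lemma whittakerP X : whittaker np X <-> nlf X /\ forall v : X, zLF v.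
Proof.
split=> [[fg H]|[[fg H1] H2]].
  have {}H (v : X) : exists l : seq (kmod X), forall r, whittaker_ring np r -> lspan l (r *: v : kmod X).
    have [k [b [_ Hb]]] := H v; exists (map (b : 'I_k -> kmod X) (enum 'I_k)) => r Hr.
    have [|a aE] := Hb (r *: v); first by exists r.
    by apply/lspan_ordP; exists a; rewrite aE.
  split; first split=> // v.
    have [l Hl] := H v; exists l => u Hu; apply: Hl.
    exists 1%N, (fun=> 1), (fun=> u); split=> // [i v'|]; first by rewrite mul1r mulr1.
    by rewrite big_ord1 mul1r.
  move=> v; have [l Hl] := H v; exists l => z Hz; apply: Hl.
  exists 1%N, (fun=> z), (fun=> 1); split=> // [i|]; last by rewrite big_ord1 mulr1.
  by rewrite -(scale1r (1 : U)); exact: env_sub_scalar.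
split=> // v; have [l Hl] := H1 v.
have [|L HL] := @lspan_cover X l; first by move=> w _; exact: H2.
pose P (w : kmod X) := exists2 r, whittaker_ring np r & w = r *: (v : X).
have HP : submod P.
  split.
    exists 0; last by rewrite scale0r.
    exists 0%N, (fun=> 0), (fun=> 0); split=> [[]//|[]//|].
    by rewrite big_ord0.
  move=> c _ _ [r [k [z [u [zC uS rE]]]] ->] [r' [k' [z' [u' [z'C u'S r'E]]]] ->].
  exists ((c%:A : U) * r + r'); last by rewrite scalerDl -scalerA kmodZ.
  exists (k + k')%N.
  exists (fun i => match fintype.split i with inl j => (c%:A : U) * z j | inr j => z' j end).
  exists (fun i => match fintype.split i with inl j => u j | inr j => u' j end); split.
  - move=> i; case: (fintype.split i) => j; last exact: z'C.
    by move=> y; rewrite -mulrA zC mulr_algl mulrA mulr_algr scalerAl.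
  - by move=> i; case: (fintype.split i) => j; [exact: uS|exact: u'S].
  rewrite big_split_ord /= rE r'E mulr_sumr; congr (_ + _); apply: eq_bigr => i _.
    by rewrite (unsplitK (inl i)) mulrA.
  by rewrite (unsplitK (inr i)).
have PL w : P w -> lspan L w.
  move=> [r [k [z [u [zC uS ->]]]] ->]; rewrite scaler_suml.
  elim/big_rec: _ => [|i y _ Hy]; first exact: (submod0 (lspan_submod L)).
  apply: kspanD => //; rewrite -scalerA.
  have lin : linear (fun w : kmod X => (z i *: (w : X)) : kmod X).
    by move=> c a b; rewrite !kmodZ scalerDr !scalerA mulr_algr mulr_algl.
  apply: lspan_sub (lspan_map (lin_pack lin) (Hl (u i) (uS i))) => y' /mapP[w' wl ->].
  exact: HL.
(* [finite_dim] requires the spanning vectors to lie in the space itself. *)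
have [l' [l'P l'E]] := noeth_gen (@noeth_field K) HP PL.
exists (size l'), (tnth (in_tuple l')); split; first by move=> i; apply: l'P; exact: mem_tnth.
move=> w Hw; have /l'E := Hw; rewrite -{1}[l']map_enum_tnth => /lspan_ordP[a aE].
by exists a.
Qed.

Hypothesis Unoeth : noeth (U^o : lmodType U).

Lemma nlf_prod X Y : nlf X -> nlf Y -> nlf (X * Y)%type.
Proof.
move=> [fX nX] [fY nY]; split; first exact: fg_prod.
by move=> [x y]; exact: nLF_pair.
Qed.

Lemma fg_sub X (P : X -> Prop) (HP : submod P) : finitely_generated X -> finitely_generated (submodT HP).
Proof. by move=> fX; have [l [lP Pl]] := noeth_fg Unoeth fX HP; exact: fg_submodT lP Pl. Qed.

Lemma smval0 X (P : X -> Prop) (HP : submod P) (y : submodT HP) : smval y = 0 -> y = 0.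
Proof. by move=> y0; apply: smval_inj. Qed.

Lemma whittaker_prod X Y : whittaker np X -> whittaker np Y -> whittaker np (X * Y)%type.
Proof.
move=> /whittakerP[nX zX] /whittakerP[nY zY]; apply/whittakerP.
by split; [exact: nlf_prod|move=> [x y]; exact: zLF_pair].
Qed.

Lemma whittaker_image X Z (f : {linear X -> Z}) : whittaker np Z ->
  exists Y (q : {linear X -> Y}) (r : {linear Y -> Z}),
    [/\ whittaker np Y, forall y, exists x, q x = y, forall y, r y = 0 -> y = 0
      & forall x, r (q x) = f x].
Proof.
move=> /whittakerP[[fZ nZ] zZ].
have [|q qE] := @lin_corestr _ _ _ _ (submod_im f) f; first by move=> x; exists x.
exists (submodT (submod_im f)), q, (@smval _ _ _ (submod_im f)); split => //.
- apply/whittakerP; split; first split; first exact: fg_sub.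
    by move=> v; apply: (nLF_lin_inv (@smval0 _ _ _)); exact: nZ.
  by move=> v; apply: (zLF_lin_inv (@smval0 _ _ _)); exact: zZ.
- by move=> y; case: (smvalP y) => x xE; exists x; apply: smval_inj; rewrite qE.
- exact: smval0.
Qed.

Section Build.
Variables (T : lmodType U) (d : {linear T -> T}) (G : nat -> T -> Prop).
Hypothesis G_submod : forall k, submod (G k).
Variables (k : nat) (Y1 A : lmodType U) (j : {linear Y1 -> T})
  (alpha : {linear A -> T}) (beta : {linear A -> Y1}) (Q : Y1 -> Prop).
Hypothesis HQ : submod Q.
Hypothesis QA : forall a, [/\ G k (alpha a), d (alpha a) = j (beta a) & Q (beta a)].
Hypothesis Qlift : forall y, Q y -> exists2 t, G k t & d t = j y.

Definition bpair (p : T * Y1) := [/\ G k p.1, d p.1 = j p.2 & Q p.2].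
Lemma submod_bpair : submod bpair.
Proof.
split; first by split; rewrite ?linear0 //; exact: submod0.
move=> a [t y] [t' y'] [/= Gt dt Qy] [/= Gt' dt' Qy']; split=> /=.
- by apply: submodD => //; exact: submodZ.
- by rewrite !linearP dt dt'.
- by apply: submodD => //; exact: submodZ.
Qed.

Lemma build_from (B : lmodType U -> Prop) (P : T * Y1 -> Prop) (HP : submod P) :
  (forall p, P p -> bpair p) -> (forall a, P (alpha a, beta a)) ->
  (forall y, Q y -> exists t, P (t, y)) -> B (submodT HP) ->
  exists (Y : lmodType U) (t : {linear Y -> T}) (p : {linear Y -> Y1}) (q : {linear A -> Y}),
    [/\ B Y, forall y, [/\ G k (t y), d (t y) = j (p y) & Q (p y)],
        forall a, t (q a) = alpha a /\ p (q a) = beta a,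
        forall y, Q y -> exists z, p z = y
      & forall z, t z = 0 -> p z = 0 -> z = 0].
Proof.
move=> Pb PA PQ BP.
have ablin : linear (fun a => (alpha a, beta a)) by move=> c x y; rewrite !linearP pairD pairZ.
have [|q qE] := @lin_corestr _ _ _ _ HP (lin_pack ablin); first by move=> a; exact: PA.
have tlin : linear (fun y : submodT HP => (smval y).1) by [].
have plin : linear (fun y : submodT HP => (smval y).2) by [].
exists (submodT HP), (lin_pack tlin), (lin_pack plin), q; split=> //=.
- by move=> y; exact: Pb (smvalP y).
- by move=> a; rewrite qE.
- by move=> y /PQ[t Pt]; exists (smk HP Pt).
- by move=> z z1 z2; apply: smval_inj; rewrite [LHS]surjective_pairing z1 z2.
Qed.

Lemma build_all : exists (Y : lmodType U) (t : {linear Y -> T}) (p : {linear Y -> Y1}) (q : {linear A -> Y}),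
    [/\ all_modules Y, forall y, [/\ G k (t y), d (t y) = j (p y) & Q (p y)],
        forall a, t (q a) = alpha a /\ p (q a) = beta a,
        forall y, Q y -> exists z, p z = y
      & forall z, t z = 0 -> p z = 0 -> z = 0].
Proof.
apply: (@build_from _ _ submod_bpair) => // y Qy.
by have [t Gt dt] := Qlift Qy; exists t.
Qed.

(** Inside the full pull-back [bpair] it is enough to take the submodule spanned by the images of
    generators of A and by lifts of generators of Q, finitely many by noetherianity. *)
Lemma build_nlf : (forall t, G k t -> nLF np t) -> nlf Y1 -> nlf A ->
  exists (Y : lmodType U) (t : {linear Y -> T}) (p : {linear Y -> Y1}) (q : {linear A -> Y}),
    [/\ nlf Y, forall y, [/\ G k (t y), d (t y) = j (p y) & Q (p y)],
        forall a, t (q a) = alpha a /\ p (q a) = beta a,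
        forall y, Q y -> exists z, p z = y
      & forall z, t z = 0 -> p z = 0 -> z = 0].
Proof.
move=> Gn [fY1 nY1] [/fgP[la Ha] nA].
have [lq [lqQ Qlq]] := noeth_fg Unoeth fY1 HQ.
have [lp [lpP lpE]] : exists lp : seq (T * Y1), (forall p, p \in lp -> bpair p) /\ map snd lp = lq.
  elim: lq lqQ {Qlq} => [|y lq IH] Hl; first by exists [::].
  have [|lp [H E]] := IH; first by move=> z zl; apply: Hl; rewrite inE zl orbT.
  have Qy := Hl y (mem_head _ _); have [t Gt dt] := Qlift Qy.
  exists ((t, y) :: lp); split; last by rewrite /= E.
  by move=> p; rewrite inE => /orP[/eqP->|/H].
have ablin : linear (fun a => (alpha a, beta a)) by move=> c x y; rewrite !linearP pairD pairZ.
pose l := map (lin_pack ablin) la ++ lp.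
have lb p : p \in l -> bpair p.
  by rewrite mem_cat => /orP[/mapP[a _ ->]|/lpP //]; exact: QA.
have lspb p : lspan l p -> bpair p by apply: lspan_min => //; exact: submod_bpair.
apply: (@build_from _ _ (lspan_submod l)) => //.
- move=> a; apply: (lspan_sub _ (lspan_map (lin_pack ablin) (Ha a))) => z zl.
  by apply: lspan_mem; rewrite mem_cat zl.
- move=> y /Qlq Hy.
  have : lspan (map (lin_pack (@GRing.linearP _ _ _ _ (@snd T Y1))) lp) y by rewrite (_ : map _ _ = lq).
  move=> /lspan_map_inv[[t y'] Ht /= ->]; exists t.
  by apply: lspan_sub Ht => z zl; apply: lspan_mem; rewrite mem_cat zl orbT.
split; first by apply: (fg_submodT _ (@lspan_mem _ _ l)).
move=> v; apply: (nLF_lin_inv (@smval0 _ _ _)).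
have [Gt _ _] := lspb _ (smvalP v).
by have := nLF_pair (Gn _ Gt) (nY1 (smval v).2); rewrite -surjective_pairing.
Qed.
End Build.
End WhittakerClass.

(** * An Artin-Rees property for the center *)

Section ArtinRees.
Variables (K : numClosedFieldType) (g : lieAlgType K) (np : {vspace g}).
Local Notation U := (envalg g).
Implicit Types (X Y Z : lmodType U).
Hypothesis Unoeth : noeth (U^o : lmodType U).
Hypothesis reyn : forall us : seq U, exists P : U -> U,
  [/\ forall u v, P (u + v) = P u + P v,
      forall u z, env_center z -> P (u * z) = P u * z,
      forall z, env_center z -> P z = z & forall u, u \in us -> env_center (P u)].

(** Hilbert's argument: the left ideal of U generated by J is generated by finitely many elements of
    J, and the Reynolds operator makes the coefficients central. *)
Lemma center_ideal_fg (J : U -> Prop) : (forall z, J z -> env_center z) ->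
  exists zs : seq U, (forall z, z \in zs -> J z) /\
    forall z, J z -> exists c : 'I_(size zs) -> U,
      (forall i, env_center (c i)) /\ z = \sum_i c i * tnth (in_tuple zs) i.
Proof.
move=> JZ; pose P (v : U^o) := exists2 l : seq U, (forall z, z \in l -> J z) & lspan (l : seq U^o) v.
have HP : submod P.
  split=> [|a x y [l1 H1 L1] [l2 H2 L2]]; first by exists [::].
  exists (l1 ++ l2); first by move=> z; rewrite mem_cat => /orP[/H1|/H2].
  case: (lspan_submod (l1 ++ l2 : seq U^o)) => _; apply.
    by apply: lspan_sub L1 => z zl; apply: lspan_mem; rewrite mem_cat zl.
  by apply: lspan_sub L2 => z zl; apply: lspan_mem; rewrite mem_cat zl orbT.
have [l [lP Pl]] := Unoeth HP.
have [zs [zsJ zsl]] : exists zs : seq U, (forall z, z \in zs -> J z) /\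
    forall x, x \in l -> lspan (zs : seq U^o) x.
  elim: l lP {Pl} => [|x l IH] lP; first by exists [::].
  have [|zs [H1 H2]] := IH; first by move=> z zl; apply: lP; rewrite inE zl orbT.
  have [l0 H0 L0] := lP x (mem_head _ _); exists (l0 ++ zs); split.
    by move=> z; rewrite mem_cat => /orP[/H0|/H1].
  move=> y; rewrite inE => /orP[/eqP->|/H2 L2].
    by apply: lspan_sub L0 => z zl; apply: lspan_mem; rewrite mem_cat zl.
  by apply: lspan_sub L2 => z zl; apply: lspan_mem; rewrite mem_cat zl orbT.
exists zs; split=> // z Jz.
have : lspan (zs : seq U^o) z.
  apply: lspan_sub zsl _; apply: Pl; exists [:: z]; first by move=> y; rewrite inE => /eqP->.
  by apply: lspan_mem; rewrite mem_head.
move=> /lspan_tnthP[a aE].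
have [R [RD RM RZ Ra]] := reyn [seq a i | i <- enum 'I_(size zs)].
have ziC i : env_center (tnth (in_tuple zs) i) by apply/JZ/zsJ; exact: mem_tnth.
exists (fun i => R (a i)); split; first by move=> i; apply: Ra; apply: map_f; rewrite mem_enum.
rewrite -(RZ z (JZ z Jz)) [in LHS]aE.
have R0 : R 0 = 0 by apply: (addrI (R 0)); rewrite -RD !addr0.
elim/big_rec2: _ => [//|i x y _ <-]; rewrite RD; congr (_ + _).
exact: RM (ziC i).
Qed.

(** Induction on the sum of the exponents: the vectors z_i v have a smaller sum, and Z v is spanned
    by the a v, with a in the span of [lz], and by the Z z_i v. *)
Lemma zLF_nilp X (zs : seq U) (lz : seq U) :
  (forall z, z \in zs -> env_center z) ->
  (forall z, env_center z -> exists (a : U) (c : 'I_(size zs) -> U),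
     [/\ lspan (lz : seq U) a, forall i, env_center (c i)
       & z = a + \sum_i c i * tnth (in_tuple zs) i]) ->
  forall n (e : 'I_(size zs) -> nat) (v : X), (\sum_i e i <= n)%N ->
    (forall i, tnth (in_tuple zs) i ^+ e i *: v = 0) -> zLF v.
Proof.
move=> zsC lzP; pose zi i := tnth (in_tuple zs) i.
have step (v : X) : (forall i, zLF (zi i *: v)) -> zLF v.
  move=> H; have [L HL] : exists L : seq (kmod X), forall i z, env_center z -> lspan L (z *: (zi i *: v) : kmod X).
    have [|L HL] := @lspan_cover _ _ X [seq zi i *: v | i <- enum 'I_(size zs)].
      by move=> w /mapP[i _ ->]; exact: H.
    by exists L => i z zC; apply: HL => //; apply/mapP; exists i; rewrite ?mem_enum.
  have lin : linear (fun a : U => a *: v : kmod X).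
    by move=> c x y; rewrite kmodZ scalerDl -[c *: x]mulr_algl scalerA.
  exists (map (lin_pack lin) lz ++ L) => z /lzP[a [c [Ha cC ->]]]; rewrite scalerDl; apply: kspanD.
    by apply: lspan_sub (lspan_map (lin_pack lin) Ha) => t tl; apply: lspan_mem; rewrite mem_cat tl.
  rewrite scaler_suml; elim/big_rec: _ => [|i y _ Hy]; first exact: (submod0 (lspan_submod _)).
  apply: kspanD => //; rewrite -scalerA; apply: lspan_sub (HL i (c i) (cC i)) => t tl.
  by apply: lspan_mem; rewrite mem_cat tl orbT.
have zLF0 : zLF (0 : X) by exists [::] => z _; rewrite scaler0.
elim=> [|n IH] e v en ev; apply: step => i.
  have -> : v = 0; last by rewrite scaler0.
  have := ev i; have -> : e i = 0%N.
    by apply/eqP; rewrite -leqn0 (leq_trans _ en) // (bigD1 i) //= leq_addr.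
  by rewrite scale1r.
have [e0|e0] := posnP (e i).
  by have := ev i; rewrite e0 scale1r => ->; rewrite scaler0.
apply: (IH (fun j => (e j - (j == i))%N)).
  rewrite -ltnS; apply: leq_trans en.
  rewrite (bigD1 i) //= [X in (_ < X)%N](bigD1 i) //= eqxx -addSn leq_add ?subn1 ?prednK //.
  by apply: leq_sum => j _; exact: leq_subr.
move=> j; rewrite scalerA; have [->|ji] := eqVneq j i.
  by rewrite -exprSr subn1 prednK.
rewrite subn0 -[_ ^+ _ * _](_ : zi i * tnth (in_tuple zs) j ^+ e j = _).
  by rewrite -scalerA ev scaler0.
by apply: zsC; exact: mem_tnth.
Qed.

(** The vectors of l are assembled into one vector v of a product, whose annihilator kills them all;
    [lz] lifts a spanning list of the finite-dimensional space Z v. *)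
Lemma zLF_annihilator Z (l : seq Z) : (forall v, v \in l -> zLF v) ->
  exists lz : seq U, (forall z, z \in lz -> env_center z) /\
    forall z, env_center z -> exists2 a, lspan lz a & forall v, v \in l -> (z - a) *: v = 0.
Proof.
move=> Hl.
have [Q [v [Hv vE]]] : exists (Q : lmodType U) (v : Q), zLF v /\
    forall u, u *: v = 0 -> forall x, x \in l -> u *: x = 0.
  elim: l Hl => [|x l IH] Hl.
    by exists Z, 0; split=> //; exists [::] => z _; rewrite scaler0.
  have [|Q [v [Hv vE]]] := IH; first by move=> z zl; apply: Hl; rewrite inE zl orbT.
  exists (Z * Q)%type, (x, v); split; first by apply: zLF_pair => //; apply: Hl; rewrite mem_head.
  move=> u; rewrite -pairZ => -[ux uv] y; rewrite inE => /orP[/eqP->//|]; exact: vE.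
have [L HL] := Hv; pose P (w : kmod Q) := exists2 z, env_center z & w = z *: v.
have CP (c : K) z z' : env_center z -> env_center z' -> env_center ((c%:A : U) * z + z').
  by move=> zC z'C u; rewrite mulrDl mulrDr z'C -mulrA zC mulr_algl !mulrA mulr_algr scalerAl.
have HP : submod P.
  split; first by exists 0; [move=> u; rewrite mul0r mulr0|rewrite scale0r].
  move=> c _ _ [z zC ->] [z' z'C ->]; exists ((c%:A : U) * z + z'); first exact: CP.
  by rewrite scalerDl -scalerA kmodZ.
have [|l' [l'P l'E]] := noeth_gen (@noeth_field K) HP (l := L).
  by move=> _ [z zC ->]; exact: HL.
have [lz [lzC lzE]] : exists lz : seq U, (forall z, z \in lz -> env_center z) /\
    map (fun z => z *: v : kmod Q) lz = l'.
  elim: l' l'P {l'E} => [|w l' IH] Hl'; first by exists [::].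
  have [|lz [H E]] := IH; first by move=> z zl; apply: Hl'; rewrite inE zl orbT.
  have [z zC zE] := Hl' w (mem_head _ _); exists (z :: lz); split; last by rewrite /= E zE.
  by move=> y; rewrite inE => /orP[/eqP->|/H].
exists lz; split=> // z zC.
have lin : linear (fun a : U => a *: v : kmod Q).
  by move=> c x y; rewrite kmodZ scalerDl -[c *: x]mulr_algl scalerA.
have : lspan (map (lin_pack lin) lz) (z *: v : kmod Q).
  by rewrite (_ : map _ _ = l') //; apply: l'E; exists z.
move=> /lspan_map_inv[a Ha /= E]; exists a => // x xl; apply: vE xl.
by rewrite scalerBl E subrr.
Qed.

(** The submodules of the x with z^k x in L increase with k, so they become stationary. *)
Lemma noeth_ascending X (z : U) (L : X -> Prop) : env_center z -> submod L ->
  finitely_generated X -> exists k, forall x, L (z ^+ k.+1 *: x) -> L (z ^+ k *: x).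
Proof.
move=> zC HL fX; pose P x := exists k, L (z ^+ k *: x).
have zkC k : env_center (z ^+ k).
  elim: k => [|k IH] u; first by rewrite mul1r mulr1.
  by rewrite exprS -mulrA IH mulrA zC mulrA.
have mono k k' x : (k <= k')%N -> L (z ^+ k *: x) -> L (z ^+ k' *: x).
  by move=> /subnKC <- Lx; rewrite addnC exprD -scalerA; exact: submodZ.
have HP : submod P.
  split=> [|a x y [k Lx] [k' Ly]]; first by exists 0%N; rewrite scaler0; exact: submod0.
  exists (k + k')%N; rewrite scalerDr scalerA zkC -scalerA; apply: submodD => //.
    by apply: submodZ => //; apply: mono Lx; rewrite leq_addr.
  by apply: mono Ly; rewrite leq_addl.
have [l [lP Pl]] := noeth_fg Unoeth fX HP.
have [k Hk] : exists k, forall x, x \in l -> L (z ^+ k *: x).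
  elim: l lP {Pl} => [|x l IH] Hl; first by exists 0%N.
  have [|k Hk] := IH; first by move=> y yl; apply: Hl; rewrite inE yl orbT.
  have [k' Lx] := Hl x (mem_head _ _); exists (k' + k)%N => y; rewrite inE => /orP[/eqP->|/Hk].
    by apply: mono Lx; rewrite leq_addr.
  by apply: mono; rewrite leq_addl.
exists k => x Lx; have : P x by exists k.+1.
move=> /Pl; apply: (lspan_min (P := fun x => L (z ^+ k *: x))) => //.
split=> [|a y y' Hy Hy']; first by rewrite scaler0; exact: submod0.
by rewrite scalerDr scalerA zkC -scalerA; apply: submodD => //; exact: submodZ.
Qed.

Lemma max_submod X (P P' : X -> Prop) : submod P -> submod P' -> (forall y, P' y -> P y) ->
  exists L : X -> Prop, [/\ submod L, forall y, L y -> P y -> P' y &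
    forall L' : X -> Prop, submod L' -> (forall y, L y -> L' y) ->
      (forall y, L' y -> P y -> P' y) -> forall y, L' y -> L y].
Proof.
move=> HP HP' PP.
(* F does not ask for 0 in L, so that it holds of the empty union; a maximal L is nonempty
   anyway. *)
pose F (L : set X) := (forall a x y, L x -> L y -> L (a *: x + y)) /\ (forall y, L y -> P y -> P' y).
have [|L [[LD LP] Lmax]] := @Zorn_bigcup _ F.
  move=> C CF Ctot; split=> [a x y [A CA Ax] [B CB By]|y [A CA Ay] Py].
    have [AB|BA] := Ctot A B CA CB.
      by exists B => //; apply: (CF B CB).1 => //; exact: AB.
    by exists A => //; apply: (CF A CA).1 => //; exact: BA.
  exact: (CF A CA).2.
have max (L' : set X) : F L' -> (forall y, L y -> L' y) -> forall y, L' y -> L y.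
  move=> FL' LL' y L'y; apply: contrapT => nLy; apply: (Lmax L') => //; split=> // H.
  by apply: nLy; exact: H.
have L0 : L 0.
  have [[x Lx]|nL] := pselect (exists x, L x); first by rewrite -(addNr x) -scaleN1r; exact: LD.
  apply: (max P'); [|by move=> y Ly; case: nL; exists y|exact: submod0].
  by split=> // a x y; case: HP' => _; apply.
exists L; split=> // L' HL' LL' L'P; apply: max => //; split=> // a x y.
by case: HL' => _; apply.
Qed.

(** Let P be the image of f and P' that of the kernel of phi. The quotient is X1 / L for L maximal
    among the submodules that meet P inside P'. The central elements that kill the relevant part of
    Z form an ideal J of finite codimension; each acts nilpotently on X1 / L, and J is finitely
    generated, so X1 / L is locally finite under the center. *)
Lemma whittaker_AR X X1 Z (f : {linear X -> X1}) (phi : {linear X -> Z}) :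
  nlf np X1 -> whittaker np Z ->
  exists Y1 (pi1 : {linear X1 -> Y1}), whittaker np Y1 /\
    forall x, pi1 (f x) = 0 -> exists x0, phi x0 = phi x /\ f x0 = 0.
Proof.
move=> [fX1 nX1] /whittakerP[_ zZ].
pose P y := exists x, f x = y.
pose P' y := exists2 x, phi x = 0 & f x = y.
have HP : submod P := submod_im f.
have HP' : submod P'.
  split=> [|a _ _ [x px <-] [x' px' <-]]; first by exists 0; rewrite linear0.
  by exists (a *: x + x'); rewrite linearP // px px' scaler0 addr0.
have [l [lP Pl]] := noeth_fg Unoeth fX1 HP.
have [xs xsE] : exists xs : seq X, map f xs = l.
  elim: l lP {Pl} => [|y l IH] Hl; first by exists [::].
  have [|xs E] := IH; first by move=> z zl; apply: Hl; rewrite inE zl orbT.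
  by have [x <-] := Hl y (mem_head _ _); exists (x :: xs); rewrite /= E.
(* J kills phi on lifts of generators of P, so it sends P into P'. *)
pose J z := env_center z /\ forall x, x \in xs -> z *: phi x = 0.
have JP z y : J z -> P y -> P' (z *: y).
  move=> [zC Jz] /Pl; apply: (lspan_min (P := fun y => P' (z *: y))).
    split=> [|a v w Hv Hw]; first by rewrite scaler0; exact: submod0.
    by rewrite scalerDr scalerA zC -scalerA; case: HP' => _; apply.
  move=> v; rewrite -xsE => /mapP[x xxs ->]; exists (z *: x); last by rewrite linearZ.
  by rewrite linearZ; exact: Jz.
have [zs [zsJ zsE]] := @center_ideal_fg J (fun z => @proj1 _ _).
have zsC z : z \in zs -> env_center z by move=> /zsJ[].
have [|lz [lzC lzP]] := @zLF_annihilator Z (map phi xs); first by move=> v _; exact: zZ.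
have spC a : lspan lz a -> env_center a.
  have sub : submod (fun z : U => env_center z).
    split=> [u|c x y Hx Hy u]; first by rewrite mul0r mulr0.
    by rewrite mulrDl mulrDr Hy -scalerAl -scalerAr Hx.
  exact: lspan_min sub lzC.
have [L [HL LP Lmax]] := max_submod HP HP' (fun y => fun '(ex_intro2 x _ E) => ex_intro _ x E).
have P'L y : P' y -> L y.
  move=> P'y; apply: (Lmax (fun y => exists a b, [/\ L a, P' b & y = a + b])).
  - split=> [|c _ _ [a [b [La Pb ->]]] [a' [b' [La' Pb' ->]]]].
      by exists 0, 0; rewrite addr0; split=> //; exact: submod0.
    exists (c *: a + a'), (c *: b + b'); rewrite scalerDr addrACA; split=> //.
      by case: HL => _; apply.
    by case: HP' => _; apply.
  - by move=> a La; exists a, 0; rewrite addr0; split=> //; exact: submod0.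
  - move=> _ [a [b [La Pb ->]]] Pab; apply: submodD => //; apply: LP => //.
    have Pb' : P b by case: Pb => x _ <-; exists x.
    by rewrite -(addrK b a); exact: submodB.
  - by exists 0, y; rewrite add0r; split=> //; exact: submod0.
(* For k as in [noeth_ascending], L + z^k X1 still meets P inside P', because z P lies in L; by
   maximality it equals L. *)
have zL z : J z -> exists k, forall y, L (z ^+ k *: y).
  move=> Jz; have zC := Jz.1; have [k Hk] := noeth_ascending zC HL fX1; exists k => y.
  have zkC : env_center (z ^+ k).
    elim: (k) => [|i IH] u; first by rewrite mul1r mulr1.
    by rewrite exprS -mulrA IH mulrA zC mulrA.
  apply: (Lmax (fun y => exists a x, L a /\ y = a + z ^+ k *: x)).
  - split=> [|c _ _ [a [x [La ->]]] [a' [x' [La' ->]]]].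
      by exists 0, 0; rewrite scaler0 addr0; split=> //; exact: submod0.
    exists (c *: a + a'), (c *: x + x'); split; first by case: HL => _; apply.
    by rewrite scalerDr addrACA scalerDr !scalerA zkC.
  - by move=> a La; exists a, 0; rewrite scaler0 addr0.
  - move=> _ [a [x [La ->]]] Py; apply: LP => //; apply: submodD => //; apply: Hk.
    have := P'L _ (JP z _ Jz Py); rewrite scalerDr scalerA -exprS => H.
    by rewrite -(addKr (z *: a) (_ *: x)) addrC; apply: submodB => //; exact: submodZ.
  - by exists 0, y; rewrite add0r; split=> //; exact: submod0.
exists (quotM HL HL), (qpi HL); split; last first.
  move=> x /qpi_eq0 Lfx; have [|x' px' fx'] := LP _ Lfx; first by exists x.
  by exists (x - x'); rewrite !linearB /= px' fx' subr0 subrr.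
apply/whittakerP; split; first split; first exact: fg_surj (@qpi_surj _ _ _ HL) fX1.
  by move=> v; have [x <-] := qpi_surj v; exact: nLF_lin.
have ke i : exists k, forall y, L (tnth (in_tuple zs) i ^+ k *: y).
  by apply/zL/zsJ; exact: mem_tnth.
pose e i := projT1 (cid (ke i)).
move=> v; apply: (zLF_nilp (lz := lz) zsC _ (e := e) (leqnn _)) => [z zC|i]; last first.
  have [x <-] := qpi_surj v; rewrite -linearZ; apply/qpi_eq0.
  exact: (projT2 (cid (ke i)) x).
have [a Ha Ja] := lzP z zC.
have [|c [cC E]] := zsE (z - a).
  split=> [u|x xxs]; first by rewrite mulrBl mulrBr zC (spC a Ha).
  by apply: Ja; apply: map_f.
by exists a, c; split=> //; rewrite -E addrC subrK.
Qed.
End ArtinRees.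

(** * Alternating forms evaluated on a basis *)

Section BasisForms.
Variables (K : numClosedFieldType) (g : lieAlgType K) (N : lmodType (envalg g)).
Variables (D : nat) (b : 'I_D -> g) (bc : 'I_D -> {linear g -> K^o}).
Hypothesis bcK : forall x, x = \sum_i (bc i x : K) *: b i.
Local Notation U := (envalg g).
Local Notation T := (seq g -> cind g (kmod N)).
Implicit Types (om : T) (s p : seq g) (t : seq 'I_D).

Lemma alt_move om p s1 x s2 : multi om -> alt om ->
  om (p ++ s1 ++ x :: s2) = 0 <-> om (p ++ x :: s1 ++ s2) = 0.
Proof.
move=> Hm Ha; elim: s1 p => [//|y s1 IH] p /=; have := IH (rcons p y); rewrite !cat_rcons => ->.
by rewrite alt_swap //; split=> [/eqP|->]; rewrite ?oppr0 // oppr_eq0 => /eqP.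
Qed.

Lemma alt_perm0 om s s' p : multi om -> alt om -> perm_eq s s' ->
  om (p ++ s) = 0 -> om (p ++ s') = 0.
Proof.
move=> Hm Ha; elim: s s' p => [|x s IH] s' p ss' Hs.
  by rewrite perm_sym in ss'; rewrite (perm_nilP ss').
have xs' : x \in s' by rewrite -(perm_mem ss') mem_head.
case/splitPr: xs' ss' => a c ss'; apply/alt_move => //; rewrite -cat_rcons; apply: IH.
  by move: ss'; rewrite perm_sym perm_catC /= perm_cons perm_catC perm_sym.
by rewrite cat_rcons.
Qed.

Lemma alt_dup0 om s : multi om -> alt om -> ~~ uniq s -> om s = 0.
Proof.
elim: s om => [//|y s IH] om Hm Ha /=; rewrite negb_and negbK => /orP[ys|us].
  apply: (alt_perm0 (p := [::]) (s := [:: y, y & rem y s])) => //.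
  by rewrite perm_cons perm_sym perm_to_rem.
by apply: (IH (fun v => om (y :: v))) => //; [exact: multi_cons|exact: alt_cons].
Qed.

Lemma multi_sum0 om s1 s2 (P : pred 'I_D) (c : 'I_D -> K) : multi om ->
  (forall j, P j -> om (s1 ++ b j :: s2) = 0) -> om (s1 ++ \sum_(j | P j) c j *: b j :: s2) = 0.
Proof.
move=> Hm H; elim/big_rec: _ => [|j x Pj Hx]; first exact: multi0.
by rewrite Hm H // Hx scaler0 addr0.
Qed.

Lemma multi_coord om s1 s2 y i : multi om ->
  (forall j, j != i -> om (s1 ++ b j :: s2) = 0) ->
  om (s1 ++ y :: s2) = ((bc i y : K)%:A : U) *: om (s1 ++ b i :: s2).
Proof.
move=> Hm H; rewrite {1}(bcK y) (bigD1 i) //= Hm (multi_sum0 (fun j => bc j y) Hm) ?addr0 //.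
Qed.

Lemma form_basis om n : multi om -> (forall t, size t = n -> om (map b t) = 0) ->
  forall s, size s = n -> om s = 0.
Proof.
move=> Hm Hb s; elim: s n om Hm Hb => [|x s IH] n om Hm Hb sn.
  by rewrite -sn in Hb; exact: (Hb [::]).
rewrite (bcK x); apply: (multi_sum0 (s1 := [::])) => // j _ /=.
case: n sn Hb => // n [sn] Hb; apply: (IH n (fun v => om (b j :: v))) => //; first exact: multi_cons.
by move=> t tn; apply: (Hb (j :: t)); rewrite /= tn.
Qed.

Lemma form_top k om : (D < k)%N -> form k om -> om = 0.
Proof.
move=> Dk [Hm Ha Hs]; apply/funext => s; have [sk|/eqP sk] := pselect (size s = k); last exact: Hs.
apply: (form_basis Hm _ sk) => t tk; apply: alt_dup0 => //; apply/negP => /map_uniq ut.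
by have := uniq_leq_size ut (s2 := enum 'I_D) (fun x _ => mem_enum _ x); rewrite size_enum_ord tk leqNgt Dk.
Qed.

Local Notation rest i := (map b (rem i (enum 'I_D))).

Lemma form_rem k om : k.+1 = D -> form k om -> (forall i, om (rest i) = 0) -> om = 0.
Proof.
move=> kD [Hm Ha Hs] Hr; apply/funext => s.
have [sk|/eqP sk] := pselect (size s = k); last exact: Hs.
apply: (form_basis Hm _ sk) => t tk; have [ut|ut] := boolP (uniq t); last first.
  by apply: alt_dup0 => //; apply: contra ut; exact: map_uniq.
have [i it] : exists i, i \notin t.
  apply: contrapT => H; suff : (D <= k)%N by rewrite -kD ltnn.
  rewrite -tk -[X in (X <= _)%N](size_enum_ord D); apply: uniq_leq_size (enum_uniq _) _ => j _.
  by apply: contrapT => /negP jt; apply: H; exists j.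
have ur : uniq (rem i (enum 'I_D)) by rewrite rem_uniq // enum_uniq.
have sr : size (rem i (enum 'I_D)) = k by rewrite size_rem ?mem_enum // size_enum_ord -kD.
have [||_ E] := uniq_min_size (s1 := t) (s2 := rem i (enum 'I_D)) ut.
- by move=> j jt; rewrite mem_rem_uniq ?enum_uniq // !inE mem_enum andbT; apply: contraNneq it => <-.
- by rewrite sr tk.
apply: (alt_perm0 (p := [::]) Hm Ha _ (Hr i)).
by apply: perm_map; rewrite perm_sym; exact: uniq_perm.
Qed.

(** When the arguments exhaust the basis, only the b_i-component of [x, b_i] survives alternation,
    so x acts by the trace of ad x. *)
Lemma lieact_basis om x (p s : seq 'I_D) : multi om -> alt om -> perm_eq (p ++ s) (enum 'I_D) ->
  lieact x (fun v => om (map b p ++ v)) (map b s) =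
  \sum_(i <- s) ((bc i (lie x (b i)) : K)%:A : U) *: om (map b (p ++ s)).
Proof.
move=> Hm Ha; elim: s p => [|i s IH] p ps /=; first by rewrite big_nil.
rewrite big_cons; congr (_ + _).
  rewrite map_cat /=; apply: multi_coord => // j ji.
  have jp : j \in p ++ s.
    have : j \in p ++ i :: s by rewrite (perm_mem ps) mem_enum.
    by rewrite !mem_cat inE (negPf ji).
  apply: alt_dup0 => //; apply/negP; rewrite -[b j :: _]/(map b (j :: s)) -map_cat => /map_uniq.
  by rewrite uniq_catC /= mem_cat orbC -mem_cat jp.
have := IH (rcons p i); rewrite cat_rcons ps => /(_ isT) <-.
congr (lieact x _ _); apply/funext => v.
by rewrite map_rcons cat_rcons.
Qed.
End BasisForms.

(** * One-dimensional modules and the invariant volume form *)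

Section Characters.
Variables (K : numClosedFieldType) (g : lieAlgType K).
Local Notation U := (envalg g).

Section OneDim.
Variables (chi : {linear g -> K^o}) (chiL : forall x y, chi (lie x y) = 0).
Lemma chirep_linl c x y (v : K^o) : (chi (c *: x + y) : K) * v = c *: ((chi x : K) * v : K^o) + (chi y : K) * v.
Proof. by rewrite linearP mulrDl; congr (_ + _); exact: (esym (mulrA c (chi x) v)). Qed.
Lemma chirep_linr x : linear (fun v : K^o => (chi x : K) * v : K^o).
Proof. by move=> c u v; rewrite mulrDr; congr (_ + _); exact: mulrCA. Qed.
Lemma chirep_lie x y (v : K^o) : (chi (lie x y) : K) * v = (chi x : K) * ((chi y : K) * v) - (chi y : K) * ((chi x : K) * v).
Proof. by rewrite chiL mul0r mulrCA subrr. Qed.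
Definition chirep : lierep g K^o := LieRep chirep_linr chirep_linl chirep_lie.
Definition chimod : lmodType U := repmod chirep.

Lemma chimod_span (v : kmod chimod) : lspan [:: (1 : K^o) : kmod chimod] v.
Proof.
by exists (v : K); rewrite kmodZ (repmod_scalar (r := chirep)) [_ *: _]mulr1 subrr.
Qed.

Lemma chimod_whittaker np : whittaker np chimod.
Proof.
apply/whittakerP; split; last by move=> v; exists [:: (1 : K^o) : kmod chimod] => z _; exact: chimod_span.
split; last by move=> v; exists [:: (1 : K^o) : kmod chimod] => z _; exact: chimod_span.
apply/fgP; exists [:: (1 : K^o) : chimod] => v.
have [c] := chimod_span v; rewrite kmodZ /= => E.
by exists (c%:A : U).
Qed.
End OneDim.

Lemma inv_eq (V : lmodType K) (f f' : cind g V) : (forall x, env_inj x *: f = 0) ->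
  (forall x, env_inj x *: f' = 0) -> f 1 = f' 1 -> f = f'.
Proof.
move=> Hf Hf' E; apply: cind_wordP => w; case: w / lastP => [|w x]; first by rewrite word_nil.
by rewrite word_rcons -[LHS](cindZE (env_inj x) f) -[RHS](cindZE (env_inj x) f') Hf Hf'.
Qed.

Lemma epsV_linear (V : lmodType K) (c : V) : linear (fun u : U => (@ceps K g u : K) *: c).
Proof. by move=> a u v; rewrite linearP scalerDl scalerA. Qed.
Definition epsV (V : lmodType K) (c : V) : cind g V := mkcind (epsV_linear c).

Lemma ceps1 : @ceps K g 1 = 1. Proof. by have := cepsE (g := g) (K := K) [::]; rewrite word_nil. Qed.
Lemma epsV1 (V : lmodType K) (c : V) : epsV c 1 = c.
Proof. by rewrite -[LHS]/((@ceps K g 1 : K) *: c) ceps1 scale1r. Qed.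
Lemma epsV_inv (V : lmodType K) (c : V) x : env_inj x *: epsV c = 0.
Proof.
apply: cindP => u; rewrite cindZE -[LHS]/((@ceps K g (u * env_inj x) : K) *: c).
by rewrite -[ceps (u * _)](cindZE (env_inj x) ceps) ceps_gen scale0r.
Qed.
End Characters.

Section Volume.
Variables (K : numClosedFieldType) (g : lieAlgType K).
Variables (D : nat) (b : 'I_D -> g) (bc : 'I_D -> {linear g -> K^o}).
Hypothesis bcK : forall x, x = \sum_i (bc i x : K) *: b i.
Hypothesis bcb : forall i j, bc i (b j) = (i == j)%:R.
Local Notation U := (envalg g).
Implicit Types (x : g) (s : seq g).

(** The modular character. Coefficients twisted by it compensate the action of x on the arguments of
    a top form. *)
Definition trad_fun x : K^o := \tr (admx b bc x).
Lemma trad_linear : linear trad_fun.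
Proof. by move=> c x y; rewrite /trad_fun linearP linearD /= linearZ. Qed.
Definition trad : {linear g -> K^o} := lin_pack trad_linear.
Lemma trad_lie x y : trad (lie x y) = 0.
Proof. by rewrite /= /trad_fun (admx_lie bcK) linearB /= mxtrace_mulC subrr. Qed.
Lemma tradE x : trad x = \sum_i (bc i (lie x (b i)) : K).
Proof. by apply: eq_bigr => i _; rewrite mxE. Qed.

Local Notation N := (chimod trad_lie).
Local Notation T := (seq g -> cind g (kmod N)).

Definition volc s : K :=
  if size s == D then \det (\matrix_(i < D, j < D) (bc j (nth 0 s i) : K)) else 0.
Definition vol : T := fun s => epsV g (V := kmod N) (volc s : K^o).

Lemma epsN_lin c (u v : K) : epsV g (V := kmod N) (c * u + v : K^o) =
  (c%:A : U) *: epsV g (V := kmod N) (u : K^o) + epsV g (V := kmod N) (v : K^o).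
Proof.
apply: cindP => y; rewrite [RHS]cindDE cindKE.
rewrite -[LHS]/((@ceps K g y : K) *: ((c *: (u : K^o) + v : K^o) : kmod N)).
rewrite -[X in _ = c *: X + _]/((@ceps K g y : K) *: ((u : K^o) : kmod N)).
rewrite -[X in _ = _ + X]/((@ceps K g y : K) *: ((v : K^o) : kmod N)).
rewrite scalerDr; congr (_ + _).
by rewrite scalerA mulrC -scalerA; congr (_ *: _); rewrite kmodZ (repmod_scalar (r := chirep trad_lie)).
Qed.

Lemma vol_form : form D vol.
Proof.
split=> [s1 s2 c x y|s1 s2 x|s sD]; last first.
- rewrite /vol /volc (negPf sD); apply: inv_eq; [exact: epsV_inv|by move=> x; rewrite scaler0|].
  by rewrite epsV1.
- rewrite /vol; have -> : volc (s1 ++ [:: x, x & s2]) = 0; last first.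
    by apply: inv_eq; [exact: epsV_inv|move=> z; rewrite scaler0|rewrite epsV1].
  rewrite /volc; case: eqP => // /eqP; rewrite size_cat /= => /eqP sD.
  have i1 : (size s1 < D)%N by rewrite -sD addnS ltnS leq_addr.
  have i2 : ((size s1).+1 < D)%N by rewrite -sD !addnS !ltnS leq_addr.
  apply: (@determinant_alternate _ _ _ (Ordinal i1) (Ordinal i2)).
    by apply/eqP => /(congr1 val)/= /eqP; rewrite eqn_leq ltnn andbF.
  by move=> j; rewrite !mxE /= !nth_cat ltnn subnn /= ltnNge leqnSn /= subSnn.
rewrite /vol -epsN_lin; congr (epsV g _); rewrite /volc !size_cat /=.
case: eqP => [sD|]; last by rewrite mulr0 addr0.
have i1 : (size s1 < D)%N by rewrite -sD addnS ltnS leq_addr.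
rewrite -[X in _ = _ + X]mul1r.
apply: (@determinant_multilinear _ _ _ _ _ (Ordinal i1)).
- apply/rowP => j; rewrite !mxE /= !nth_cat ltnn subnn /= linearP mul1r.
  by [].
- apply/matrixP => i j; rewrite !mxE /= !nth_cat; case: ltnP => // h1.
  have : (bump (size s1) i != size s1) by rewrite eq_sym neq_bump.
  by move: h1; rewrite leq_eqVlt eq_sym => /orP[->//|]; rewrite -subn_gt0; case: (_ - _)%N.
- apply/matrixP => i j; rewrite !mxE /= !nth_cat; case: ltnP => // h1.
  have : (bump (size s1) i != size s1) by rewrite eq_sym neq_bump.
  by move: h1; rewrite leq_eqVlt eq_sym => /orP[->//|]; rewrite -subn_gt0; case: (_ - _)%N.
Qed.

Lemma vol_inv x : env_inj x *: vol = 0.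
Proof. by apply/funext => s; exact: epsV_inv. Qed.

Lemma vol_basis : vol (map b (enum 'I_D)) 1 = (1 : K^o).
Proof.
rewrite [LHS]epsV1 /volc size_map size_enum_ord eqxx -[RHS](det1 K D); congr (\det _).
apply/matrixP => i j; rewrite !mxE (nth_map i) ?size_enum_ord // nth_ord_enum bcb.
by rewrite eq_sym.
Qed.

Lemma ced_vol : ced vol = 0.
Proof. by apply: (form_top bcK (k := D.+1)) => //; apply: form_ced; exact: vol_form. Qed.

(** An invariant (D-1)-form is the contraction of the volume with some x. Its differential is L_x
    vol by Cartan's formula, and this is zero: the trace of ad x coming from the coefficients
    cancels the one coming from the arguments. *)
Lemma vol_not_exact k (et : T) : k.+1 = D -> form k et -> (forall x, env_inj x *: et = 0) ->
  ced et <> vol.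
Proof.
move=> kD et_f et_inv et_d; have [vm va vs] := vol_form.
pose re i := map b (rem i (enum 'I_D)).
have e_inv s x : env_inj x *: et s = 0 by have := congr1 (fun f : T => f s) (et_inv x).
have v_inv s x : env_inj x *: vol s = 0 by exact: epsV_inv.
pose kap i : K := vol (b i :: re i) 1.
have kap0 i : kap i != 0.
  apply/eqP => k0; have v0 : vol (b i :: re i) = 0.
    by apply: inv_eq => // z; rewrite scaler0.
  have /(congr1 (fun f : cind g (kmod N) => f 1)) : vol (map b (enum 'I_D)) = 0.
    apply: (alt_perm0 (p := [::]) vm va _ v0).
    by rewrite -[b i :: _]/(map b (i :: _)); apply: perm_map; rewrite perm_sym perm_to_rem ?mem_enum.
  by rewrite vol_basis => /eqP; rewrite oner_eq0.
(* The coordinates of x are read off the values of [et] on the basis with one vector removed. *)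
pose x := \sum_i ((et (re i) 1 : K) / kap i) *: b i.
have cx i : bc i x = (et (re i) 1 : K) / kap i by rewrite (bc_sum bcb).
have etE : et = (fun s => vol (x :: s)).
  apply/eqP; rewrite -subr_eq0; apply/eqP.
  have vf : form k (fun s => vol (x :: s)) by apply: form_cons; rewrite kD; exact: vol_form.
  apply: (form_rem bcK kD); first by apply: submodB => //; exact: submod_form.
  move=> i; rewrite -/(re i) -[LHS]/(et (re i) - vol (x :: re i)).
  have -> : vol (x :: re i) = ((bc i x : K)%:A : U) *: vol (b i :: re i).
    apply: (multi_coord bcK (s1 := [::])) => // j ji; apply: alt_dup0 => //=.
    by rewrite negb_and negbK /re map_f // mem_rem_uniq ?enum_uniq // !inE ji mem_enum.
  apply: inv_eq => [y|y|]; rewrite ?scaler0 //.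
    by rewrite scalerBr e_inv scalerA mulr_algr -mulr_algl -scalerA v_inv scaler0 subr0.
  rewrite cindDE cindNE cindKE cx kmodZ (repmod_scalar (r := chirep trad_lie)).
  by rewrite -[_ *: _]/(_ * kap i) divfK // subrr.
have := congr1 (fun f : T => f (map b (enum 'I_D)) 1) et_d.
rewrite vol_basis etE.
have -> : ced (fun s => vol (x :: s)) = Ld x vol.
  apply/eqP; rewrite -subr_eq0 -oppr_eq0 opprB -ced_consE ced_vol.
  by apply/eqP/funext.
rewrite LdE (lieact_basis bcK x (p := [::]) vm va) // cindDE cindNE rhoE mulr1.
rewrite cat0s -scaler_suml; set bl := map b _.
have -> : vol bl (env_inj x) = 0.
  by rewrite -[env_inj x]mul1r -[LHS]/((env_inj x *: vol bl) 1) v_inv.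
have -> : (\sum_(i <- enum 'I_D) (bc i (lie x (b i)) : K)%:A : U) = (trad x : K)%:A.
  by rewrite tradE big_enum /= scaler_suml.
rewrite cindKE vol_basis subr0 repmod_gen => /eqP.
rewrite [X in X - _]mulr1 kmodZ (repmod_scalar (r := chirep trad_lie)) [X in _ - X]mulr1 subrr.
by rewrite eq_sym oner_eq0.
Qed.
End Volume.

(** * From cocycles to Ext groups and the global dimension *)

Section ChainMorphisms.
Variable S : nzRingType.
Implicit Types M N : lmodType S.

Lemma chain_mor_refl M N (c : chain M N) : chain_mor (fun x => x) c c.
Proof.
by elim: c => [{}N f|{}N X f c IH] //=; exists idfun; split.
Qed.

Lemma chain_mor_comp M N N' N'' (phi : N -> N') (psi : N' -> N'')
    (c : chain M N) (c' : chain M N') (c'' : chain M N'') :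
  chain_mor phi c c' -> chain_mor psi c' c'' -> chain_mor (fun x => psi (phi x)) c c''.
Proof.
elim: c N' N'' phi psi c' c'' => [{}N f|{}N X f c IH] N' N'' phi psi [f'|X' f' c'] [f''|X'' f'' c''] //=.
  by move=> E E' x; rewrite E' E.
move=> [p [E mor]] [p' [E' mor']]; exists (p' \o p); split; last exact: IH mor mor'.
by move=> x /=; rewrite E' E.
Qed.
End ChainMorphisms.

Section ExtDimension.
Variables (K : numClosedFieldType) (g : lieAlgType K).
Local Notation U := (envalg g).
Local Notation T N := (seq g -> cind g (kmod N)).
Variables (D : nat) (b : 'I_D -> g) (bc : 'I_D -> {linear g -> K^o}).
Hypothesis bcK : forall x, x = \sum_i (bc i x : K) *: b i.
Hypothesis bcb : forall i j, bc i (b j) = (i == j)%:R.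
(** C is the category studied, B a larger class in which sequences can be built, and P cuts the
    coresolution out of all forms. All modules correspond to B = C and P trivial; Whittaker modules
    to B = [nlf] and P local finiteness under n_+. *)
Variables (B C : lmodType U -> Prop) (P : forall N : lmodType U, T N -> Prop).
Implicit Types X Y M N : lmodType U.
Hypothesis CB : forall X, C X -> B X.
Hypothesis P_submod : forall N, submod (@P N).
Hypothesis P_lin : forall X N (F : {linear X -> T N}) x, B X -> P (F x).
Hypothesis P_ced : forall N (om : T N), P om -> P (ced om).
Hypothesis P_exact : forall N k (om : T N), B N -> form k.+1 om -> ced om = 0 -> P om ->
  exists et : T N, [/\ form k et, P et & ced et = om].
Hypothesis B_prod : forall X Y, B X -> B Y -> B (X * Y)%type.
Local Notation G := (fun N k (om : T N) => form k om /\ P om).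
Hypothesis B_build : forall N k (Y1 A : lmodType U) (j : {linear Y1 -> T N})
    (alpha : {linear A -> T N}) (beta : {linear A -> Y1}) (Q : Y1 -> Prop),
  B Y1 -> B A -> submod Q ->
  (forall y, Q y -> exists2 t, G N k t & ced t = j y) ->
  (forall a, [/\ G N k (alpha a), ced (alpha a) = j (beta a) & Q (beta a)]) ->
  exists (Y : lmodType U) (t : {linear Y -> T N}) (p : {linear Y -> Y1})
      (q : {linear A -> Y}),
    [/\ B Y, forall y, [/\ G N k (t y), ced (t y) = j (p y) & Q (p y)],
        forall a, t (q a) = alpha a /\ p (q a) = beta a,
        forall y, Q y -> exists z, p z = y
      & forall z, t z = 0 -> p z = 0 -> z = 0].
Hypothesis C_push : forall M N (c : chain M N), C M -> C N -> chain_in B c ->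
  chain_exact c -> (0 < chain_length c)%N ->
  exists c' : chain M N, [/\ chain_in C c', chain_exact c',
    chain_length c' = chain_length c & chain_mor (fun x => x) c c'].
Hypothesis C_chi : forall (chi : {linear g -> K^o}) (chiL : forall x y, chi (lie x y) = 0),
  C (chimod chiL).

Lemma chain_in_sub M N (c : chain M N) : chain_in C c -> chain_in B c.
Proof. by elim: c => //= {}N Y f c IH [/CB ? /IH]. Qed.

Section FixedN.
Variables (N : lmodType U) (CN : C N).
Let iota : {linear N -> T N} := @ceiota K g N.
Let d : {linear T N -> T N} := @ced K g N.

Let G_submod k : submod (G N k).
Proof. by apply: submodI; [exact: submod_form|exact: P_submod]. Qed.
Let dG k t : G N k t -> G N k.+1 (d t).
Proof. by move=> [Ht Pt]; split; [exact: form_ced|exact: P_ced]. Qed.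
Let dd k t : G N k t -> d (d t) = 0.
Proof. by move=> [[Hm _ _] _]; exact: ced_ced. Qed.
Let iotaG n : G N 0 (iota n).
Proof. by split; [exact: form_ceiota|apply: P_lin; exact: CB]. Qed.
Let d_iota n : d (iota n) = 0. Proof. exact: ced_ceiota. Qed.
Let iota_inj n : iota n = 0 -> n = 0. Proof. exact: ceiota_inj. Qed.
Let G_exact0 t : G N 0 t -> d t = 0 -> exists n, t = iota n.
Proof. by move=> [Ht _]; exact: ce_exact0. Qed.
Let G_exact k t : G N k.+1 t -> d t = 0 -> exists2 s, G N k s & d s = t.
Proof. by move=> [Ht Pt] dt; have [et [H1 H2 H3]] := P_exact (CB CN) Ht dt Pt; exists et. Qed.
Let G_inj k (A X : lmodType U) (i : {linear A -> X}) (f : {linear A -> T N}) : B X ->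
  (forall a, G N k (f a)) -> (forall a, i a = 0 -> f a = 0) ->
  exists F : {linear X -> T N}, (forall x, G N k (F x)) /\ forall a, F (i a) = f a.
Proof.
move=> BX Hf ker; have [F [HF FE]] := form_inj (fun a => (Hf a).1) ker.
by exists F; split=> // x; split; [exact: HF|exact: P_lin].
Qed.
Let N_build k (Y1 A : lmodType U) (j : {linear Y1 -> T N})
    (alpha : {linear A -> T N}) (beta : {linear A -> Y1}) (Q : Y1 -> Prop) :
  B Y1 -> B A -> submod Q -> (forall y, G N k.+1 (j y)) ->
  (forall y, Q y -> d (j y) = 0) ->
  (forall a, [/\ G N k (alpha a), d (alpha a) = j (beta a) & Q (beta a)]) ->
  exists (Y : lmodType U) (t : {linear Y -> T N}) (p : {linear Y -> Y1})
      (q : {linear A -> Y}),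
    [/\ B Y, forall y, [/\ G N k (t y), d (t y) = j (p y) & Q (p y)],
        forall a, t (q a) = alpha a /\ p (q a) = beta a,
        forall y, Q y -> exists z, p z = y
      & forall z, t z = 0 -> p z = 0 -> z = 0].
Proof.
move=> BY BA HQ Gj dj Ha; apply: B_build => // y Qy.
by apply: G_exact => //; exact: dj.
Qed.

Let ext_exists M (c : chain M N) : B M -> chain_in B c -> chain_exact c ->
  exists m, chain_ext d (G N) c 0 iota m.
Proof.
move=> BM Bc [ci rex].
by apply: (chain_ext_exists dG dd G_inj BM Bc rex) => // x /ci ->; rewrite linear0.
Qed.

Lemma chain_ext_eqm M X (c : chain M X) k (f : {linear X -> T N})
    (m m' : {linear M -> T N}) : m =1 m' -> chain_ext d (G N) c k f m -> chain_ext d (G N) c k f m'.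
Proof.
move=> mm'; elim: c k f => [{}X h|{}X Y h c IH] k f /=; first by move=> H x; rewrite -mm'.
by move=> [f1 [H1 H2 H3]]; exists f1; split=> //; exact: IH.
Qed.

(** Forms of degree above D vanish, so two sequences have the same cocycle 0. They map to a common
    sequence in B, which is then pushed to C. *)
Lemma ext_vanish M k : C M -> (D < k)%N -> ~ Ext_neq0 C k M N.
Proof.
move=> CM; case: k => // k Dk [e [e']]; apply.
case: e e' => [c lc ic ec] [c' lc' ic' ec'].
have Bc := chain_in_sub ic; have Bc' := chain_in_sub ic'; have BM := CB CM.
have [m Hm] := ext_exists BM Bc ec; have [m' Hm'] := ext_exists BM Bc' ec'.
have m0 y : m y = 0.
  have [[mf _] _] := chain_ext_deg dG dd (proj2 ec) iotaG d_iota Hm y.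
  by apply: (form_top bcK _ mf); rewrite add0n lc.
have m'0 y : m' y = 0.
  have [[mf _] _] := chain_ext_deg dG dd (proj2 ec') iotaG d_iota Hm' y.
  by apply: (form_top bcK _ mf); rewrite add0n lc'.
have {}Hm' : chain_ext d (G N) c' 0 iota m by apply: chain_ext_eqm Hm' => y; rewrite m0 m'0.
have ll : chain_length c = chain_length c' by rewrite lc lc'.
have l0 : (0 < chain_length c)%N by rewrite lc.
have [c2 [Bc2 ec2 lc2 mor mor']] :=
  chain_cospan G_submod dG dd iota_inj G_exact0 B_prod N_build BM Bc Bc' ec ec' ll l0 Hm Hm'.
have [|c3 [ic3 ec3 lc3 mor3]] := C_push CM CN Bc2 ec2; first by rewrite lc2.
have lc3' : chain_length c3 = k.+1 by rewrite lc3 lc2.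
pose e3 := YonedaSeq lc3' ic3 ec3.
apply: (rst_trans _ _ _ e3); first by apply: rst_step; exact: chain_mor_comp mor mor3.
by apply/rst_sym/rst_step; exact: chain_mor_comp mor' mor3.
Qed.

(** A sequence with cocycle m is built in B and pushed to C; the push is a morphism, so the cocycle
    changes only by a coboundary. *)
Let realize M k (m : {linear M -> T N}) : C M -> (forall y, G N k.+1 (m y)) ->
  (forall y, d (m y) = 0) ->
  exists (e : yoneda_seq C k.+1 M N) (m' : {linear M -> T N}) (h : {linear M -> T N}),
    [/\ chain_ext d (G N) e 0 iota m', forall y, G N k (h y) & forall y, m' y - m y = d (h y)].
Proof.
move=> CM Gm dm; have BM := CB CM.
have [c [Bc ec lc Hc]] := chain_build G_submod iotaG d_iota iota_inj G_exact0 N_build BM (CB CN) Gm dm.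
have [|c' [ic' ec' lc' mor]] := C_push CM CN Bc ec; first by rewrite lc.
have lck : chain_length c' = k.+1 by rewrite lc'.
have [m' Hm'] := ext_exists BM (chain_in_sub ic') ec'.
have Hcm' : chain_ext d (G N) c 0 iota m'.
  by apply: chain_ext_eqf (chain_ext_nat (phi := idfun) mor Hm').
have [h [Gh hE]] := chain_ext_unique0 G_submod dG dd G_inj BM Bc ec lc Hcm' Hc.
by exists (YonedaSeq lck ic' ec'), m', h.
Qed.

(** Realize m and 0 by sequences in C; if these were equivalent, m would be a coboundary. *)
Lemma ext_nonzero M k (m : {linear M -> T N}) : C M -> (forall y, G N k.+1 (m y)) ->
  (forall y, d (m y) = 0) ->
  ~ (exists h : {linear M -> T N}, (forall y, G N k (h y)) /\ forall y, m y = d (h y)) ->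
  Ext_neq0 C k.+1 M N.
Proof.
move=> CM Gm dm nh; have [e [m1 [h1 [H1 G1 E1]]]] := realize CM Gm dm.
have [||e' [m2 [h2 [H2 G2 E2]]]] := @realize M k (\0)%R CM.
- by move=> y; exact: submod0 (G_submod _).
- by move=> y; exact: linear0.
exists e, e' => ee'.
have [h3 [G3 E3]] := yoneda_equiv_ext G_submod dG dd iotaG d_iota G_inj CB (CB CM) ee' H1 H2.
apply: nh; exists ((h3 \+ h2) \- h1); split=> y /=.
  by apply: (submodB (G_submod k)) => //; exact: (submodD (G_submod k)).
rewrite linearB linearD /= -E1 -E2 -E3.
by rewrite subr0 subrK opprB addrC subrK.
Qed.
End FixedN.

(** M is the trivial module, N is twisted by the modular character, and the cocycle is c -> c
    vol. *)
Lemma ext_dim : exists M N, [/\ C M, C N & Ext_neq0 C D M N].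
Proof.
pose N : lmodType U := chimod (trad_lie bcK).
have CN : C N by exact: C_chi.
(* If D = 0 the witness is the identity of a nonzero module. *)
have [D0|D0] := posnP D.
  exists N, N; split=> //; rewrite D0; exists idfun, (1 : K^o) => /eqP.
  by rewrite oner_eq0.
have zL (x y : g) : (\0 : {linear g -> K^o})%R (lie x y) = 0 by [].
pose M : lmodType U := chimod zL; exists M, N; split; [exact: C_chi|exact: CN|].
pose v := vol bcK.
have Mgen x (c : M) : env_inj x *: c = 0.
  by rewrite [LHS]repmod_gen; exact: mul0r.
have sw (X : lmodType U) (u : U) c (y : X) : u *: ((c%:A : U) *: y) = (c%:A : U) *: (u *: y).
  by rewrite !scalerA mulr_algr mulr_algl.
have mm (X : lmodType U) c c' (y : X) : (c%:A : U) *: ((c'%:A : U) *: y) = ((c * c')%:A : U) *: y.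
  by rewrite scalerA mulr_algl scalerA.
(* U acts on the invariant form vol by the same scalars as on M, which makes c -> c vol U-linear. *)
have u_v (u : U) : exists c : K, u *: v = (c%:A : U) *: v /\ forall w : M, u *: w = (c%:A : U) *: w.
  elim/env_alg_ind: u => [c|x|u1 u2 [c1 [E1 F1]] [c2 [E2 F2]]|u1 u2 [c1 [E1 F1]] [c2 [E2 F2]]].
  - by exists c.
  - exists 0; rewrite vol_inv !scale0r; split=> // w.
    by rewrite Mgen scale0r.
  - exists (c1 + c2); rewrite !scalerDl E1 E2; split=> // w.
    by rewrite !scalerDl F1 F2.
  - exists (c2 * c1); split=> [|w]; first by rewrite -scalerA E2 sw E1 mm.
    by rewrite -scalerA F2 sw F1 mm.
have mlin : linear (fun c : M => ((c : K)%:A : U) *: v).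
  move=> u x y; have [c [E F]] := u_v u.
  rewrite F (repmod_scalar (r := chirep zL)) -[(_ + _ : M)]/((c * (x : K) + (y : K) : K)).
  rewrite !scalerDl; congr (_ + _).
  by rewrite sw E mm mulrC.
have Pv : P v.
  have := P_lin (lin_pack mlin) (1 : K^o) (CB (C_chi zL)).
  by rewrite /= scale1r scale1r.
have vf : form D v by exact: vol_form.
pose m := lin_pack mlin; have [k E] : exists k, D = k.+1 by exists D.-1; rewrite prednK.
suff : Ext_neq0 C k.+1 M N by rewrite -E.
apply: (ext_nonzero CN (m := m) (C_chi zL)).
- move=> y; split; last exact: P_lin (CB (C_chi zL)).
  by rewrite -E; apply: submodZ => //; exact: submod_form.
- by move=> y; rewrite linearZ /= (ced_vol bcK) scaler0.
move=> [h [Gh hE]]; have [fh _] := Gh (1 : K^o).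
apply: (vol_not_exact bcb (esym E) fh).
  by move=> x; rewrite -linearZ Mgen linear0.
by have := hE (1 : K^o); rewrite /= scale1r scale1r.
Qed.

Lemma gldim_eq (R : realType) : gldim C R = D%:R%:E.
Proof.
apply/eqP; rewrite eq_le; apply/andP; split.
  apply: ge_ereal_sup => _ [M [CM ->]]; apply: ge_ereal_sup => _ [k [N [CN Hk ->]]].
  by rewrite lee_fin ler_nat leqNgt; apply/negP => /(ext_vanish CN CM).
have [M [N [CM CN H]]] := ext_dim.
apply: (@le_trans _ _ (pdim C R M)).
  by apply: ereal_sup_ubound; exists D, N.
by apply: ereal_sup_ubound; exists M.
Qed.
End ExtDimension.

Lemma gldim_semisimple (R : realType) (K : numClosedFieldType) (g : lieAlgType K)
    (nm h np : {vspace g}) : semisimple g -> triangular_decomposition nm h np ->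
  gldim (whittaker np) R = (\dim {:g})%:R%:E /\
  gldim (@all_modules (envalg g)) R = (\dim {:g})%:R%:E.
Proof.
move=> ss tri; have [D [b [bc [w [<- bcK bcb wt]]]]] := cartan_basis ss tri.
have [m [e [npE efree flag adnil]]] := np_flag tri bcK bcb wt.
have Unoeth := env_noetherian bcK.
have reyn := reynolds ss bcK bcb wt (tri_hC ss tri) (tri_hN tri).
have crd := coords ss tri bcK bcb wt.
pose f i := projT1 (cid (crd (bc i))).
have f1 i : f i 1 = 0 := (projT2 (cid (crd (bc i)))).1.
have fb x : x = \sum_i (f i (env_inj x) : K) *: b i.
  rewrite [LHS](bcK x); apply: eq_bigr => i _.
  by have [_ ->] := projT2 (cid (crd (bc i))).
split.
  apply: (gldim_eq bcK bcb (B := nlf np) (P := fun N om => nLF np om)).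
  - by move=> X /whittakerP[].
  - by move=> N; exact: submod_nLF.
  - by move=> X N F x [_ nX]; exact: nLF_lin.
  - by move=> N om; exact: (nLF_lin (@ced K g N)).
  - move=> N k om [_ nN] omf omc; rewrite -npE => omn.
    rewrite -npE in flag adnil nN.
    exact: (nLF_ce_exact flag adnil efree crd nN f1 fb omf omc omn).
  - exact: nlf_prod.
  - move=> N k Y1 A j al be Q nY nA HQ lift Ha.
    apply: (build_nlf Unoeth (G := fun k om => form k om /\ nLF np om) _ HQ Ha lift) => //.
      by move=> k'; apply: submodI; [exact: submod_form|exact: submod_nLF].
    by move=> t [].
  - move=> M N c; apply: chain_push.
    + exact: whittaker_image.
    + exact: whittaker_prod.
    + exact: whittaker_AR.
  - by move=> chi chiL; exact: chimod_whittaker.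
apply: (gldim_eq bcK bcb (B := @all_modules (envalg g)) (P := fun N om => True)) => //.
- by move=> N k om _ omf omc _; have [et H1 H2] := ce_exact f1 fb omf omc; exists et.
- move=> N k Y1 A j al be Q _ _ HQ lift Ha.
  apply: (build_all (G := fun k om => form k om /\ True) _ HQ Ha lift).
  by move=> k'; apply: submodI; [exact: submod_form|exact: submod_true].
- by move=> M N c _ _ Bc ec _; exists c; split=> //; exact: chain_mor_refl.
Qed.

Theorem corollary5 (R : realType) (g : lieAlgType R[i])
    (nm h np : {vspace g})
    (g_semisimple : semisimple g)
    (g_triangular : triangular_decomposition nm h np) :
  gldim (whittaker np) R = gldim (@all_modules (envalg g)) R /\
  gldim (@all_modules (envalg g)) R = (\dim {:g})%:R%:E.
Proof.
by have [-> ->] := @gldim_semisimple R R[i] g nm h np g_semisimple g_triangular.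
Qed.
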